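(* Let $\{\varphi_N:Fl(m_{N,1},\dots,m_{N,k_N},V_N)\hookrightarrow Fl(m_{N+1,1},\dots,m_{N+1,k_{N+1}},V_{N+1})\}_{N\ge1}$ be a chain of strict standard extensions with $\dim V_{N+1}>\dim V_N$, and let $V=\varinjlim V_N$, the basis $E$ of $V$ and the generalized flag $\underline{\mathcal F}$ in $V$ be as constructed from this chain in the context. Then there is an isomorphism of ind-varieties $$\varinjlim Fl(m_{N,1},\dots,m_{N,k_N},V_N)\simeq\mathbf{Fl}(\underline{\mathcal F},E,V).$$ Similarly, in the orthogonal and symplectic cases, i.e. for a chain of standard extensions $\psi_N:FlO(m_{N,1},\dots,m_{N,k_N},V_N)\hookrightarrow FlO(m_{N+1,1},\dots,m_{N+1,k_{N+1}},V_{N+1})$ (with $\dim V_N$ all odd or all even), respectively $\psi_N:FlS(m_{N,1},\dots,m_{N,k_N},V_N)\hookrightarrow FlS(m_{N+1,1},\dots,m_{N+1,k_{N+1}},V_{N+1})$, $N\ge1$, with $\dim V_{N+1}>\dim V_N$, there are isomorphisms of ind-varieties $$\varinjlim FlO(m_{N,1},\dots,m_{N,k_N},V_N)\simeq\mathbf{FlO}(\underline{\mathcal F},E,V),$$ $$\varinjlim FlS(m_{N,1},\dots,m_{N,k_N},V_N)\simeq\mathbf{FlS}(\underline{\mathcal F},E,V).$$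
   Context: Base field $\mathbb{C}$; $\subset$ denotes not necessarily strict inclusion. An ind-variety is a direct limit of algebraic varieties along closed embeddings. FLAG VARIETIES. For finite-dimensional $V$ and $1\le m_1<\dots<m_k<\dim V$, $Fl(m_1,\dots,m_k,V)$ is the variety of flags $(0\subset V_{m_1}\subset\dots\subset V_{m_k}\subset V)$ with $\dim V_{m_i}=m_i$; $(m_1,\dots,m_k)$ is the type of such a flag. If $V$ carries a nondegenerate symmetric form ($\dim V\ge7$), resp. symplectic form, and $m_k\le[\dim V/2]$, then $FlO(m_1,\dots,m_k,V)$, resp. $FlS(m_1,\dots,m_k,V)$, is the variety of such flags with all $V_{m_i}$ isotropic; in the symmetric case with $m_k=\dim V/2$ only flags with $V_{m_k}$ in one fixed connected component of the variety of maximal isotropic subspaces are considered. STRICT STANDARD EXTENSION. An embedding $\varphi$ of $Fl(m_1,\dots,m_k,V)$ into $Fl(n_1,\dots,n_{\tilde k},V')$ (resp. $FlO$ into $FlO$, $FlS$ into $FlS$) is a strict standard extension (called simply a standard extension in the orthogonal and symplectic cases) if there exist a flag of distinct nonzero subspaces $U_1\subset U_2\subset\dots\subset U_{\tilde k}$ of $V'$, the spaces $U_i$ being nondegenerate in the orthogonal and symplectic cases, and linear operators $\varepsilon_i:U_i\to V$, surjective whenever nonzero, with $\varepsilon_{i+1}|_{U_i}=\varepsilon_i$, compatible with the respective forms on $U_i$ and $V$ and having isotropic kernels in the orthogonal and symplectic cases, and such that, for a suitable surjective map $\overline p:\{0,\dots,\tilde k+1\}\to\{0,\dots,k+1\}$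 with $\overline p(i)\le\overline p(j)$ whenever $i<j$, one has $\varphi(V_{m_1}\subset\dots\subset V_{m_k})=(0\subset\varepsilon_1^{-1}(V_{(\overline p(1))})\subset\dots\subset\varepsilon_{\tilde k}^{-1}(V_{(\overline p(\tilde k))})\subset V')$, where $V_{(0)}=0$, $V_{(i)}=V_{m_i}$ for $1\le i\le k$, $V_{(k+1)}=V$. GENERALIZED FLAGS. Let $V$ be a countable-dimensional vector space with basis $E$. A chain of subspaces of $V$ is a set of pairwise distinct subspaces linearly ordered by inclusion. A generalized flag in $V$ is a chain $\mathcal F$ such that (i) each $F\in\mathcal F$ has an immediate successor or an immediate predecessor in $\mathcal F$; (ii) $V\setminus\{0\}=\bigcup_{F'}(F''\setminus F')$, where $F'$ runs over the elements of $\mathcal F$ having an immediate successor and $F''$ is the immediate successor of $F'$. $\mathcal F$ is compatible with $E$ if $F\cap E$ is a basis of $F$ for every $F\in\mathcal F$, and weakly compatible with $E$ if it is compatible with some basis $L$ of $V$ such that $E\setminus(E\cap L)$ is finite. Two generalized flags $\mathcal F,\mathcal G$ are $E$-commensurable if both are weakly compatible with $E$ and there are an inclusion-preserving bijection $\phi:\mathcal F\to\mathcal G$ and a finite-dimensional subspace $U\subset V$ with $F\subset\phi(F)+U$, $\phi(F)\subset F+U$, $\dim(F\cap U)=\dim(\phi(F)\cap U)$ for all $F\in\mathcal F$. If $V$ carries a nondegenerate symmetric or symplectic form, a generalized flag is isotropic if it consists of isotropic and coisotropic subspaces ($F$ is coisotropic if $F^\perp$ is isotropic) and is invariant under taking orthogonal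 complements. IND-VARIETIES OF GENERALIZED FLAGS. Let $E=\{e_n\}_{n\in\mathbb{Z}_{>0}}$ and let $\mathcal F$ be a generalized flag compatible with $E$. $\mathbf{Fl}(\mathcal F,E,V)$ is the set of all generalized flags in $V$ that are $E$-commensurable with $\mathcal F$. Its ind-variety structure is the following. Let $V'_n=\mathrm{Span}\{e_j:j\le n\}$, let $(m'_{n,1},\dots,m'_{n,k_n})$ be the type of the flag $\mathcal F\cap V'_n$ in $V'_n$, and let $W'_n=\mathrm{Span}\{e_{n+1}\}$, so $V'_{n+1}=V'_n\oplus W'_n$. Then $k_{n+1}\in\{k_n,k_n+1\}$, and there is a standard extension $i_n:Fl(m'_{n,1},\dots,m'_{n,k_n},V'_n)\hookrightarrow Fl(m'_{n+1,1},\dots,m'_{n+1,k_{n+1}},V'_{n+1})$, determined by the two types and by $W'_n$: for a suitable $i_0$, $0\le i_0\le k_n$, it sends $(T_1\subset\dots\subset T_{k_n})$ to $(T_1\subset\dots\subset T_{i_0}\subset T_{i_0+1}\oplus W'_n\subset\dots\subset T_{k_n}\oplus W'_n)$ if $k_{n+1}=k_n$, and to $(T_1\subset\dots\subset T_{i_0}\subset T_{i_0}\oplus W'_n\subset T_{i_0+1}\oplus W'_n\subset\dots\subset T_{k_n}\oplus W'_n)$ (with $T_0=0$) if $k_{n+1}=k_n+1$. $\mathbf{Fl}(\mathcal F,E,V)$ is naturally identified with the direct limit of the embeddings $i_n$. In the orthogonal and symplectic cases, $E$ is enumerated as $\{e_n,e^n\}_{n\in\mathbb{Z}_{>0}}$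 and is isotropic with $(e_n,e^n)=1$, or (symmetric form only) as $\{e_n,e_0,e^n\}_{n\in\mathbb{Z}_{>0}}$ with $e_n,e^n$ isotropic, $(e_n,e^n)=1$, $(e_0,e_n)=(e_0,e^n)=0$, $(e_0,e_0)=1$. For an isotropic generalized flag $\mathcal F$ compatible with $E$, $\mathbf{FlO}(\mathcal F,E,V)$, resp. $\mathbf{FlS}(\mathcal F,E,V)$, is the set of all isotropic generalized flags $E$-commensurable with $\mathcal F$. Set $V'_n=\mathrm{Span}\{e_j,e^j\}_{j\le n}$, or respectively $V'_n=\mathrm{Span}\{e_j,e_0,e^j\}_{j\le n}$; $\mathcal F\cap V'_n$ has an isotropic subflag of some type $(m'_{n,1},\dots,m'_{n,k_n})$, and there is a standard extension of $FlO(m'_{n,1},\dots,m'_{n,k_n},V'_n)$ into $FlO(m'_{n+1,1},\dots,m'_{n+1,k_{n+1}},V'_{n+1})$ (resp. the same with $FlS$), determined uniquely by the isotropic $1$-dimensional subspace $\mathrm{Span}\{e_{n+1}\}$. The ind-variety structure is that of the direct limit of these embeddings. CONSTRUCTION OF $E$ AND $\underline{\mathcal F}$. Given a chain of strict standard extensions $\varphi_N$ as in the claim, choose decompositions $V_{N+1}=V_N\oplus\widehat W_N$ (with $\widehat W_N=V_N^\perp$ in the orthogonal and symplectic cases), flags $W_{N,1}\subset\dots\subset W_{N,k_{N+1}}\subset\widehat W_N$ and surjective non-decreasing maps $\overline p_N:\{0,\dots,k_{N+1}+1\}\to\{0,\dots,k_N+1\}$ such that $\varphi_N(0\subset V_{m_{N,1}}\subset\dots\subset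 V_{m_{N,k_N}}\subset V_N)=(0\subset V_{(\overline p_N(1))}\oplus W_{N,1}\subset\dots\subset V_{(\overline p_N(k_{N+1}))}\oplus W_{N,k_{N+1}}\subset V_{N+1})$, where $V_{(0)}=0$, $V_{(i)}=V_{m_{N,i}}$, $V_{(k_N+1)}=V_N$ (such a choice always exists). Put $V=\varinjlim V_N$. Fix a flag $F_1=(0\subset V_{1,1}\subset\dots\subset V_{1,k_1}\subset V_1)$ in the first variety of the chain. Choose a basis $E=\{e_\alpha\}_{\alpha\in\mathbb{Z}_{>0}}$ of $V$ such that, for all subspaces $T$ of the form $V_{1,1},\dots,V_{1,k_1}$ and $W_{N,j}$, the set $T\cap E$ is a basis of $T$. Write $e_\alpha\sim e_{\tilde\alpha}$ if there exists $N_\alpha\in\mathbb{Z}_{>0}$ such that, for any $N\ge N_\alpha$, there is no space of the flag $\varphi_N\circ\varphi_{N-1}\circ\dots\circ\varphi_1(F_1)$ containing $e_\alpha$ but not $e_{\tilde\alpha}$, or vice versa. This is an equivalence relation; let $A$ be the set of equivalence classes $[e_\alpha]$. $A$ is linearly ordered: for $[e_\alpha]\ne[e_\beta]$ and $N\ge\max\{N_\alpha,N_\beta\}$, one has $[e_\alpha]\prec[e_\beta]$ if the smallest space of the flag $\varphi_N\circ\dots\circ\varphi_1(F_1)$ containing $e_\alpha$ is smaller than the smallest space of the same flag containing $e_\beta$. For $a\in A$ put $F'_a=\mathrm{Span}\{e_\beta:[e_\beta]\prec a\}$, $F''_a=\mathrm{Span}\{e_\beta:[e_\beta]\preccurlyeq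 a\}$. Then $\underline{\mathcal F}=\{F'_a,F''_a\}_{a\in A}$ is a generalized flag in $V$ compatible with $E$. In the orthogonal and symplectic cases (with $\psi_N$ in place of $\varphi_N$) a similar construction is used: $E$ is required to have the form $\{e_n,e_0,e^n\}_{n\in\mathbb{Z}_{>0}}$ if all $\dim V_N$ are odd, and $\{e_n,e^n\}_{n\in\mathbb{Z}_{>0}}$ if all $\dim V_N$ are even (in particular in the symplectic case), and is chosen by the same condition that all subspaces $V_{1,1},\dots,V_{1,k_1}$ and $W_{N,j}$ are generated by subsets of $E$. To define a linear order on $E$, one applies the procedure above to the vectors $e_n$, then sets $e^k\prec e^l\Leftrightarrow e_l\prec e_k$, and finally, whenever there is a vector $e_0$, puts $e_n\prec e_0\prec e^k$ for any $k,n\in\mathbb{Z}_{>0}$. The generalized flag $\underline{\mathcal F}$ determined by the same formulas for $F'_a,F''_a$ is isotropic.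
   Formalization: E must also generate all spaces of φ_N∘…∘φ_1(F_1); in the orthogonal/symplectic cases the order on E comes from flags completed by orthogonal complements (not always e_n≺e_0≺e^k); FlO keeps only flags in the fixed component; U_i may repeat and is nondegenerate only modulo ker ε_i. *)

(* Defs.v *)
From HB Require Import structures.
From Stdlib Require Import Relations.
From mathcomp Require Import all_boot all_order all_algebra.
From mathcomp Require Import sesquilinear.
From mathcomp Require Import all_classical reals.
From mathcomp Require Import complex.

Set Implicit Arguments.
Unset Strict Implicit.
Unset Printing Implicit Defensive.
Import GRing.Theory.
Local Open Scope classical_set_scope.
Local Open Scope ring_scope.

(* Sequences indexed by N, n >= 1 in the mathematics are indexed from 0 here: the
   chain starts at V_0, and [e n] stands for e_{n+1}. *)

(* ---- Subspaces of a possibly infinite-dimensional space, as sets ---- *)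

Section Subspaces.
Variables (K : fieldType) (V : lmodType K).
Implicit Types A B L X : set V.

Definition is_subspace A :=
  A 0 /\ forall (a : K) u v, A u -> A v -> A (a *: u + v).

Definition lin_span (S : set V) : set V := smallest is_subspace S.

Definition sum_sub A B : set V := [set u + v | u in A & v in B].

Definition lin_indep d (b : 'I_d -> V) :=
  forall c : 'I_d -> K, \sum_i c i *: b i = 0 -> forall i, c i = 0.

Definition is_frame d (b : 'I_d -> V) X := lin_indep b /\ lin_span (range b) = X.

Definition has_dim X d := exists b : 'I_d -> V, is_frame b X.

Definition dimn X : nat := xget 0%N (has_dim X).

Definition is_basis L X :=
  (forall d (b : 'I_d -> V), injective b -> (forall i, L (b i)) -> lin_indep b)
  /\ lin_span L = X.

(* [flag_term X s i] is V_(i) for the flag s = (V_1, ..., V_k) of X: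
   V_(0) = 0 and V_(k+1) = X. *)
Definition flag_term X (s : seq (set V)) (i : nat) : set V :=
  nth X ([set 0] :: s) i.

Definition is_flag X (ms : seq nat) (s : seq (set V)) :=
  [/\ size s = size ms,
      forall i, (i < size ms)%N ->
        is_subspace (nth set0 s i) /\ has_dim (nth set0 s i) (nth 0%N ms i) &
      forall i, (i <= size s)%N -> flag_term X s i `<=` flag_term X s i.+1].

End Subspaces.

(* 1 <= m_1 < ... < m_k < d *)
Definition flag_type (d : nat) (ms : seq nat) := sorted ltn (0%N :: rcons ms d).

(* ---- Varieties and ind-varieties ---- *)

(* A variety is handled through its underlying space with functions: the closed
   points, the Zariski-open sets and the regular functions on each of them.  A
   member of [regular U] is a total function of which only the restriction to U
   matters. *)
Record variety (K : fieldType) := Variety {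
  points :> Type;
  zopen : set (set points);
  regular : set points -> set (points -> K) }.

Section Varieties.
Variable K : fieldType.
Implicit Types X Y : variety K.

Definition is_morphism X Y (f : X -> Y) :=
  forall U, zopen U -> zopen (f @^-1` U) /\
    forall g, regular U g -> regular (f @^-1` U) (g \o f).

Definition closed_embedding X Y (f : X -> Y) :=
  [/\ injective f, is_morphism f, zopen (~` range f),
      forall U, zopen U -> exists2 U', zopen U' & U = f @^-1` U' &
      forall U g, zopen U -> regular U g -> forall x, U x ->
        exists U' h, [/\ zopen U', regular U' h, U' (f x) &
          forall y, U y -> U' (f y) -> g y = h (f y)]].

Definition zconnected X (A : set X) :=
  forall U U', zopen U -> zopen U' -> A `<=` U `|` U' ->
    A `&` U !=set0 -> A `&` U' !=set0 -> A `&` U `&` U' !=set0.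

Definition component X (x : X) : set X :=
  [set y | exists A, [/\ zconnected A, A x & A y]].

(* A presentation of an ind-variety as the union of an increasing sequence of
   varieties; [represents x p] says that the point x of the n-th variety is sent
   to the point p of the union.  The transition maps between the levels are then
   determined; that they are closed is part of the hypotheses on a chain of flag
   varieties, and plays no role in the notions of morphism and isomorphism. *)
Record ind_variety := IndVariety {
  ipoint :> Type;
  level : nat -> variety K;
  represents : forall n, level n -> ipoint -> Prop }.

Definition is_presentation (X : ind_variety) :=
  [/\ forall n (x : level X n), exists! p, represents x p,
      forall n (x y : level X n) p, represents x p -> represents y p -> x = y,
      forall p, exists n (x : level X n), represents x p &
      forall n, exists2 f : level X n -> level X n.+1, is_morphism f &
        forall x p, represents x p -> represents (f x) p].

Definition is_ind_morphism (X Y : ind_variety) (f : X -> Y) :=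
  forall n, exists m (g : level X n -> level Y m), is_morphism g /\
    forall x p, represents x p -> represents (g x) (f p).

Definition ind_isomorphic (X Y : ind_variety) :=
  [/\ is_presentation X, is_presentation Y &
      exists (f : X -> Y) (g : Y -> X),
        [/\ cancel f g, cancel g f, is_ind_morphism f & is_ind_morphism g]].

Section DirectLimit.
Variables (X : nat -> variety K) (f : forall n, X n -> X n.+1).

Inductive lim_step : relation {n & X n} :=
  LimStep n (x : X n) : lim_step (existT _ n x) (existT _ n.+1 (f x)).

Definition lim_class (p : {n & X n}) : set {n & X n} :=
  [set q | clos_refl_sym_trans _ lim_step p q].

Definition direct_limit : ind_variety :=
  @IndVariety {c | exists p, c = lim_class p} X
    (fun n x c => sval c (existT _ n x)).

End DirectLimit.

(* Polynomial functions on a vector space: the algebra generated by the linear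
   forms. *)
Inductive polyfun (M : lmodType K) : (M -> K) -> Prop :=
| PolyCst c : polyfun (fun=> c)
| PolyLin (l : {scalar M}) : polyfun l
| PolyAdd p q : polyfun p -> polyfun q -> polyfun (fun x => p x + q x)
| PolyMul p q : polyfun p -> polyfun q -> polyfun (fun x => p x * q x).

(* The flags of type ms in the d-dimensional space X that satisfy P.  A frame b
   of X is adapted to the flag (V_1, ..., V_k) when V_i is spanned by the first
   m_i vectors of b.  For P = setT the map (frame |-> flag) is the quotient
   GL_d -> GL_d/(parabolic), a Zariski-locally trivial bundle, so a set of flags
   is open, and a function on it regular, iff its pullback to the adapted frames
   is; for P closed this gives the reduced structure of the closed subvariety. *)
Section FlagVariety.
Variables (V : lmodType K) (d : nat) (X : set V) (ms : seq nat).
Variable P : set (seq (set V)).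

Definition adapted (b : {ffun 'I_d -> V}) (s : seq (set V)) :=
  is_frame b X /\
  s = [seq lin_span [set b i | i in [set i : 'I_d | (i < m)%N]] | m <- ms].

Definition flag_pt := {s : seq (set V) | is_flag X ms s /\ P s}.

Definition flag_zopen (U : set flag_pt) :=
  forall T b, U T -> adapted b (sval T) ->
    exists q, [/\ polyfun q, q b != 0 &
      forall T' b', adapted b' (sval T') -> q b' != 0 -> U T'].

Definition flag_regular (U : set flag_pt) (g : flag_pt -> K) :=
  forall T b, U T -> adapted b (sval T) ->
    exists p q, [/\ polyfun p, polyfun q, q b != 0 &
      forall T' b', U T' -> adapted b' (sval T') -> q b' != 0 ->
        g T' = p b' / q b'].

Definition flag_variety : variety K := Variety flag_zopen flag_regular.

End FlagVariety.

Definition Fl (V : vectType K) (ms : seq nat) : variety K :=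
  flag_variety (dim V) [set: V] ms setT.

End Varieties.

(* ---- Forms and isotropic flag varieties ---- *)

Inductive form_type := Symmetric | Alternating.

Section Forms.
Variables (K : fieldType) (V : lmodType K) (b : {biscalar V}).
Implicit Types A X : set V.

Definition form_of_type (ty : form_type) :=
  if ty is Symmetric then forall u v, b u v = b v u else forall u, b u u = 0.

Definition nondegenerate := forall u, (forall v, b u v = 0) -> u = 0.

Definition isotropic A := forall u v, A u -> A v -> b u v = 0.

Definition perp_in X A : set V := [set v | X v /\ forall u, A u -> b u v = 0].

Definition perp A := perp_in setT A.

(* The variety of isotropic subspaces of dimension [d/2] of X. *)
Definition max_isotropic (d : nat) X : variety K :=
  flag_variety d X [:: d./2] [set s : seq (set V) | forall A, A \in s -> isotropic A].

(* Isotropic flags; when m_k = d/2, the last space must belong to the given set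
   of maximal isotropic subspaces. *)
Definition isotropic_flag (d : nat) X (ms : seq nat)
    (C : set (max_isotropic d X)) : set (seq (set V)) :=
  [set s : seq (set V) | (forall A, A \in s -> isotropic A) /\
    ((last 0%N ms).*2 = d -> exists2 y, C y & sval y = [:: last [set 0] s])].

Definition isotropic_flag_variety d X ms C : variety K :=
  flag_variety d X ms (@isotropic_flag d X ms C).

(* The choice entering FlO (one fixed connected component); there is none in FlS. *)
Definition allowed_component (ty : form_type) d X (C : set (max_isotropic d X)) :=
  if ty is Symmetric then exists x, C = component x else C = setT.

End Forms.

Definition FlI (K : fieldType) (V : vectType K) (b : {biscalar V})
    (ms : seq nat) (C : set (max_isotropic b (dim V) setT)) : variety K :=
  @isotropic_flag_variety K V b (dim V) setT ms C.

(* ---- Strict standard extensions ---- *)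

(* Surjective non-decreasing maps {0, ..., k'+1} -> {0, ..., k+1}. *)
Definition ext_index (k' k : nat) (p : nat -> nat) :=
  [/\ forall i, (i <= k'.+1)%N -> (p i <= k.+1)%N,
      forall i j, (i <= j <= k'.+1)%N -> (p i <= p j)%N &
      forall j, (j <= k.+1)%N -> exists2 i, (i <= k'.+1)%N & p i = j].

Section StandardExtension.
Variables (K : fieldType) (V V' : vectType K).
Variables (ms ms' : seq nat) (P : set (seq (set V))) (P' : set (seq (set V'))).
Let FV := flag_variety (dim V) [set: V] ms P.
Let FV' := flag_variety (dim V') [set: V'] ms' P'.

(* Repetitions are allowed among the U_i, cf. the maps (T_1, T_2) |->
   (T_1 + W, T_2 + W).  [compat] collects the conditions on each pair
   (U_i, eps_i) coming from forms. *)
Definition standard_extension (compat : set V' -> (V' -> V) -> Prop)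
    (phi : FV -> FV') :=
  closed_embedding phi /\
  exists (U : nat -> set V') (eps : nat -> {linear V' -> V}) (p : nat -> nat),
    [/\ ext_index (size ms') (size ms) p,
        forall i, (1 <= i <= size ms')%N ->
          [/\ is_subspace (U i), U i <> [set 0], compat (U i) (eps i) &
              (exists2 u, U i u & eps i u <> 0) -> eps i @` U i = setT],
        forall i, (1 <= i < size ms')%N ->
          U i `<=` U i.+1 /\ forall u, U i u -> eps i.+1 u = eps i u &
        forall T : FV, sval (phi T) =
          [seq U i `&` eps i @^-1` flag_term setT (sval T) (p i)
             | i <- iota 1 (size ms')]].

(* phi (V_1, ..., V_k) = (V_(p 1) + W_1, ..., V_(p k') + W_k'), where
   V' = incl V + What is a direct sum and W_1, ..., W_k' is a flag in What. *)
Definition split_form (incl : {linear V -> V'}) (What : set V')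
    (W : nat -> set V') (p : nat -> nat) (phi : FV -> FV') :=
  [/\ injective incl,
      [/\ is_subspace What, sum_sub (range incl) What = setT &
          range incl `&` What = [set 0]],
      forall i, (1 <= i <= size ms')%N -> is_subspace (W i) /\ W i `<=` What,
      forall i, (1 <= i < size ms')%N -> W i `<=` W i.+1 &
      ext_index (size ms') (size ms) p /\
      forall T : FV, sval (phi T) =
        [seq sum_sub (incl @` flag_term setT (sval T) (p i)) (W i)
           | i <- iota 1 (size ms')]].

End StandardExtension.

(* The operator eps : U -> V is compatible with the forms.  Nondegeneracy of U is
   required modulo the kernel of eps, which compatibility makes orthogonal to U. *)
Definition form_compat (K : fieldType) (V V' : vectType K)
    (b : {biscalar V}) (b' : {biscalar V'}) (U : set V') (eps : V' -> V) :=
  [/\ forall u v, U u -> U v -> b' u v = b (eps u) (eps v),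
      isotropic b' (U `&` eps @^-1` [set 0]) &
      forall u, U u -> (forall v, U v -> b' u v = 0) -> eps u = 0].

(* ---- Generalized flags ---- *)

Section GeneralizedFlags.
Variables (K : fieldType) (V : lmodType K).
Implicit Types (F G : set (set V)) (E L : set V).

Definition successor F A B :=
  [/\ F A, F B, A `<` B & forall C, F C -> A `<` C -> ~ C `<` B].

Definition generalized_flag F :=
  [/\ forall A, F A -> is_subspace A,
      total_on F (fun A B => A `<=` B),
      forall A, F A -> exists B, successor F A B \/ successor F B A &
      [set v | v <> 0] =
        [set v | exists A B, successor F A B /\ (B `\` A) v]].

Definition compatible F L := forall A, F A -> is_basis (A `&` L) A.

Definition weakly_compatible F E := exists L,
  [/\ is_basis L setT, compatible F L & finite_set (E `\` (E `&` L))].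

Definition commensurable E F G :=
  [/\ generalized_flag F, generalized_flag G,
      weakly_compatible F E, weakly_compatible G E &
      exists (phi : set V -> set V) (U : set V),
        [/\ set_bij F G phi,
            forall A B, F A -> F B -> A `<=` B -> phi A `<=` phi B,
            is_subspace U /\ exists d, has_dim U d &
            forall A, F A ->
              [/\ A `<=` sum_sub (phi A) U, phi A `<=` sum_sub A U &
                  exists d, has_dim (A `&` U) d /\ has_dim (phi A `&` U) d]]].

Definition isotropic_gflag (b : {biscalar V}) F :=
  generalized_flag F /\
  forall A, F A ->
    [/\ isotropic b A \/ isotropic b (perp b A) & F (perp b A)].

(* The generalized flag {F'_a, F''_a} attached to E and a sequence of flags
   S 0, S 1, ..., each given as the set of its spaces. *)
Section LimitFlag.
Variables (S : nat -> set (set V)) (E : set V).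

Definition smallest_space (n : nat) (v : V) : set V :=
  \bigcap_(A in [set A | S n A /\ A v]) A.

Definition same_class (v w : V) := exists n0, forall n, (n0 <= n)%N ->
  forall A, S n A -> (A v <-> A w).

Definition class_lt (v w : V) := exists n0, forall n, (n0 <= n)%N ->
  smallest_space n v `<` smallest_space n w.

Definition limit_flag : set (set V) :=
  [set A | exists2 a, E a &
     A = lin_span [set v | E v /\ class_lt v a] \/
     A = lin_span [set v | E v /\ (class_lt v a \/ same_class v a)]].

End LimitFlag.

(* ---- Ind-variety structure on sets of generalized flags ---- *)

Definition lists (Q : set (set V)) (s : seq (set V)) :=
  (forall i j, (i < j < size s)%N -> nth set0 s i `<` nth set0 s j) /\
  forall A, Q A <-> exists2 i, (i < size s)%N & A = nth set0 s i.

Definition listing (Q : set (set V)) : seq (set V) := xget [::] (lists Q).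

Definition trace F (X : set V) (Q : set (set V)) : set (set V) :=
  [set A | Q A /\ exists2 H, F H & A = H `&` X].

Definition ext_same (W : set V) i (s : seq (set V)) :=
  take i s ++ [seq sum_sub A W | A <- drop i s].

(* For i = k + 1 the space added at the top is X itself; this is the case where
   some space of the generalized flag contains X but not W. *)
Definition ext_new (X W : set V) i (s : seq (set V)) :=
  take i (rcons s X) ++ [seq sum_sub A W | A <- drop i ([set 0] :: s)].

(* s' is the image of s under the standard extension of one of these two shapes
   that sends t to t' (which determines i). *)
Definition std_step (X W : set V) (t t' s s' : seq (set V)) :=
  exists i, (t' = ext_same W i t /\ s' = ext_same W i s) \/
            (t' = ext_new X W i t /\ s' = ext_new X W i s).

(* The flag s of X n corresponds to G: for all m >= n, the flag induced by G on
   X m is the image of s under the standard extensions attached to F. *)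
Definition corresponds (X : nat -> set V) (Q : nat -> set (set V))
    (W : nat -> set (set V)) F n (s : seq (set V)) G :=
  exists2 t : nat -> seq (set V), t n = s & forall m, (n <= m)%N ->
    lists (trace G (X m) (Q m)) (t m) /\
    exists2 w, W m w &
      std_step (X m) w (listing (trace F (X m) (Q m)))
        (listing (trace F (X m.+1) (Q m.+1))) (t m) (t m.+1).

(* ---- Fl(F, E, V) ---- *)

Section GFl.
Variables (F : set (set V)) (e : nat -> V).

Let X n := lin_span [set e j | j in `I_n].
Let Q n : set (set V) := [set A | A <> [set 0] /\ A <> X n].
Let ms n := [seq dimn A | A <- listing (trace F (X n) (Q n))].

Definition GFl : ind_variety K :=
  @IndVariety K {G | commensurable (range e) F G}
    (fun n => flag_variety n (X n) (ms n) setT)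
    (fun n s H =>
       corresponds X Q (fun m => [set lin_span [set e m]]) F n (sval s) (sval H)).

End GFl.

(* ---- FlO(F, E, V) and FlS(F, E, V) ---- *)

Definition witt_set (o : bool) (e e' : nat -> V) (e0 : V) : set V :=
  range e `|` range e' `|` (if o then [set e0] else set0).

(* o tells whether e_0 is present; e' n stands for e^{n+1}. *)
Definition witt_basis (b : {biscalar V}) (o : bool) (e e' : nat -> V) (e0 : V) :=
  [/\ is_basis (witt_set o e e' e0) setT,
      forall i j, b (e i) (e j) = 0 /\ b (e' i) (e' j) = 0,
      forall i j, b (e i) (e' j) = (i == j)%:R &
      o -> b e0 e0 = 1 /\ forall i, b e0 (e i) = 0 /\ b e0 (e' i) = 0].

Section GFlI.
Variables (ty : form_type) (b : {biscalar V}) (o : bool).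
Variables (F : set (set V)) (e e' : nat -> V) (e0 : V).

Let d n : nat := (n.*2 + o)%N.
Let X n := lin_span ([set e j | j in `I_n] `|` [set e' j | j in `I_n]
                   `|` (if o then [set e0] else set0)).
Let Q (n : nat) : set (set V) := [set A | A <> [set 0] /\ isotropic b A].
Let t n := listing (trace F (X n) (Q n)).
Let ms n := [seq dimn A | A <- t n].

(* In the symmetric case, the component of the space induced by F. *)
Let C n : set (max_isotropic b (d n) (X n)) :=
  if ty is Symmetric then
    [set y | exists2 x : max_isotropic b (d n) (X n),
       sval x = [:: last [set 0] (t n)] & component x y]
  else setT.

(* When F induces maximal isotropic subspaces of the even-dimensional X n, those
   induced by G must lie in the same connected components, in accordance with the
   convention defining the varieties FlO of which FlO(F, E, V) is the limit. *)
Definition same_component (G : set (set V)) :=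
  exists n0, forall n s, (n0 <= n)%N -> lists (trace G (X n) (Q n)) s ->
    (last 0%N (ms n)).*2 = d n ->
    exists2 y, @C n y & sval y = [:: last [set 0] s].

(* The isotropic line added at step m is spanned by e m or by e' m, whichever
   belongs to an isotropic space of F. *)
Definition GFlI : ind_variety K :=
  @IndVariety K
    {G | [/\ commensurable (witt_set o e e' e0) F G, isotropic_gflag b G &
             same_component G]}
    (fun n => isotropic_flag_variety (ms n) (@C n))
    (fun n s H =>
       corresponds X Q
         (fun m => [set w | w = lin_span [set e m] \/ w = lin_span [set e' m]])
         F n (sval s) (sval H)).

End GFlI.

End GeneralizedFlags.

(* V, with the maps in_N : V_N -> V, is the direct limit of the spaces V_N along
   the injections incl_N. *)
Definition is_direct_limit (K : fieldType) (V : nat -> vectType K)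
    (incl : forall N, {linear V N -> V N.+1})
    (L : lmodType K) (inL : forall N, {linear V N -> L}) :=
  [/\ forall N, injective (inL N),
      forall N u, inL N.+1 (incl N u) = inL N u &
      forall v, exists N u, v = inL N u].

(* ---- Chains of standard extensions, and the choices made for them ---- *)

Section Chains.
Variable K : fieldType.

Record fl_chain := FlChain {
  fcV : nat -> vectType K;
  fc_m : nat -> seq nat;
  fc_map : forall N, Fl (fcV N) (fc_m N) -> Fl (fcV N.+1) (fc_m N.+1);
  fc_type : forall N, flag_type (dim (fcV N)) (fc_m N);
  fc_dim : forall N, (dim (fcV N) < dim (fcV N.+1))%N;
  fc_std : forall N, standard_extension (fun _ _ => True) (@fc_map N) }.

Definition lim_Fl (c : fl_chain) : ind_variety K := direct_limit (@fc_map c).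

(* The image of F_1 under phi_{N-1} o ... o phi_0. *)
Fixpoint fl_orbit (c : fl_chain) (F1 : Fl (fcV c 0) (fc_m c 0)) (N : nat) :
    Fl (fcV c N) (fc_m c N) :=
  if N is N'.+1 then fc_map (fl_orbit F1 N') else F1.

Record fl_choices (c : fl_chain) := FlChoices {
  fd_incl : forall N, {linear fcV c N -> fcV c N.+1};
  fd_What : forall N, set (fcV c N.+1);
  fd_W : forall N, nat -> set (fcV c N.+1);
  fd_p : nat -> nat -> nat;
  fd_split : forall N,
    split_form (fd_incl N) (@fd_What N) (@fd_W N) (fd_p N) (@fc_map c N);
  fdV : lmodType K;
  fd_in : forall N, {linear fcV c N -> fdV};
  fd_lim : is_direct_limit fd_incl fd_in;
  fd_F1 : Fl (fcV c 0) (fc_m c 0);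
  fd_e : nat -> fdV;
  fd_inj : injective fd_e;
  fd_basis : is_basis (range fd_e) setT;
  fd_basis_V1 : forall i, (1 <= i <= size (fc_m c 0))%N ->
    let T := fd_in 0 @` flag_term setT (sval fd_F1) i in
    is_basis (T `&` range fd_e) T;
  fd_basis_W : forall N i, (1 <= i <= size (fc_m c N.+1))%N ->
    let T := fd_in N.+1 @` @fd_W N i in is_basis (T `&` range fd_e) T;
  (* Follows from the previous two conditions except when a space V_M itself
     occurs in the flags, i.e. fd_p M j = size (fc_m c M) + 1 for some
     j <= size (fc_m c M.+1); in that case e must be adapted to them as well. *)
  fd_basis_orbit : forall N i, (1 <= i <= size (fc_m c N))%N ->
    let T := fd_in N @` flag_term setT (sval (fl_orbit fd_F1 N)) i in
    is_basis (T `&` range fd_e) T }.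

Definition fl_limit_flag (c : fl_chain) (x : fl_choices c) : set (set (fdV x)) :=
  limit_flag
    (fun N => [set fd_in x N @` flag_term setT (sval (fl_orbit (fd_F1 x) N)) i
                 | i in [set i | (i <= (size (fc_m c N)).+1)%N]])
    (range (@fd_e c x)).

(* The orthogonal (ty = Symmetric) and symplectic (ty = Alternating) cases. *)

Record iso_chain (ty : form_type) := IsoChain {
  icV : nat -> vectType K;
  ic_form : forall N, {biscalar icV N};
  ic_m : nat -> seq nat;
  ic_comp : forall N, set (max_isotropic (ic_form N) (dim (icV N)) setT);
  ic_map : forall N, FlI (ic_m N) (@ic_comp N) -> FlI (ic_m N.+1) (@ic_comp N.+1);
  ic_odd : bool;
  ic_parity : forall N, odd (dim (icV N)) = ic_odd;
  ic_dim7 : ty = Symmetric -> forall N, (7 <= dim (icV N))%N;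
  ic_formP : forall N,
    form_of_type (ic_form N) ty /\ nondegenerate (ic_form N);
  ic_compP : forall N, allowed_component ty (@ic_comp N);
  ic_type : forall N, flag_type (dim (icV N)) (ic_m N) /\
    (last 0 (ic_m N) <= (dim (icV N))./2)%N;
  ic_dim : forall N, (dim (icV N) < dim (icV N.+1))%N;
  ic_std : forall N,
    standard_extension (form_compat (ic_form N) (ic_form N.+1)) (@ic_map N) }.

Definition lim_FlI ty (c : iso_chain ty) : ind_variety K :=
  direct_limit (@ic_map ty c).

Fixpoint iso_orbit ty (c : iso_chain ty)
    (F1 : FlI (ic_m c 0) (@ic_comp ty c 0)) (N : nat) :
    FlI (ic_m c N) (@ic_comp ty c N) :=
  if N is N'.+1 then ic_map (iso_orbit F1 N') else F1.

Record iso_choices ty (c : iso_chain ty) := IsoChoices {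
  id_incl : forall N, {linear icV c N -> icV c N.+1};
  id_isometry : forall N u v,
    ic_form c N.+1 (id_incl N u) (id_incl N v) = ic_form c N u v;
  id_W : forall N, nat -> set (icV c N.+1);
  id_p : nat -> nat -> nat;
  id_split : forall N,
    split_form (id_incl N) (perp (ic_form c N.+1) (range (id_incl N)))
      (@id_W N) (id_p N) (@ic_map ty c N);
  idV : lmodType K;
  id_in : forall N, {linear icV c N -> idV};
  id_lim : is_direct_limit id_incl id_in;
  id_form : {biscalar idV};
  id_formP : forall N u v,
    id_form (id_in N u) (id_in N v) = ic_form c N u v;
  id_F1 : FlI (ic_m c 0) (@ic_comp ty c 0);
  id_e : nat -> idV;
  id_e' : nat -> idV;
  id_e0 : idV;
  id_witt : witt_basis id_form (ic_odd c) id_e id_e' id_e0;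
  id_basis_V1 : forall i, (1 <= i <= size (ic_m c 0))%N ->
    let T := id_in 0 @` flag_term setT (sval id_F1) i in
    is_basis (T `&` witt_set (ic_odd c) id_e id_e' id_e0) T;
  id_basis_W : forall N i, (1 <= i <= size (ic_m c N.+1))%N ->
    let T := id_in N.+1 @` @id_W N i in
    is_basis (T `&` witt_set (ic_odd c) id_e id_e' id_e0) T }.

(* The classes are cut out by the isotropic flags completed with the orthogonal
   complements of their spaces.  On E this yields the order of the vectors e_n
   given by the isotropic flags, the reverse order on the e^n, and e_0 in between;
   basis vectors that no space separates stay in one class. *)
Definition iso_limit_flag ty (c : iso_chain ty) (x : iso_choices c) :
    set (set (idV x)) :=
  limit_flag
    (fun N => [set A | exists2 i, (i <= (size (ic_m c N)).+1)%N &
       let T := flag_term setT (sval (iso_orbit (id_F1 x) N)) i in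
       A = id_in x N @` T \/ A = id_in x N @` perp (ic_form c N) T])
    (witt_set (ic_odd c) (@id_e ty c x) (@id_e' ty c x) (id_e0 x)).

End Chains.

Arguments fd_e {K c} _ _.
Arguments id_e {K ty c} _ _.
Arguments id_e' {K ty c} _ _.
Arguments fl_limit_flag {K c} x _.
Arguments iso_limit_flag {K ty c} x _.

(* Main.v *)
From HB Require Import structures.
Require Import Defs.
From Stdlib Require Import Relations.
From mathcomp Require Import all_boot all_order all_algebra.
From mathcomp Require Import sesquilinear.
From mathcomp Require Import all_classical reals.
From mathcomp Require Import complex.

(** Both sides are exhausted by varieties of flags in finite-dimensional subspaces of V:
    the spaces V_N on the left, the spans X_n of the first basis vectors on the right.
    The isomorphism comes from attaching to every flag on either kind of subspace a
    generalized flag commensurable with F, the limit flag, in a way that does not depend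
    on the subspace at which the flag is read off.

    A stage of F is a finite-dimensional subspace Y with a complement C along which every
    space A of F splits ([is_stage]). A flag in Y of the type induced by F amounts to a
    monotone family of subspaces s A of Y with dim (s A) = dim (A `&` Y), and it defines
    the generalized flag of the spaces s A + A `&` C ([deform]). For Y = X_n this is
    commensurable with F ([deform_commensurable]), and every generalized flag
    commensurable with F arises in this way from all late enough X_n
    ([commensurable_deform]). On a larger stage Y' the same generalized flag is given by
    the spaces s A + A `&` C `&` Y' ([transfer], [transfer_deform]). Passing from s to
    this flag adds fixed subspaces to its terms; it lifts to an affine map between spaces
    of adapted frames, hence it is a morphism ([embedding_morphism]).

    For the X_n the transfers are the standard extensions that define the ind-variety of
    generalized flags ([std_step_exists]), and a flag on X_n corresponds to just one
    generalized flag because a step determines the next flag ([std_step_uniq]). The V_N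
    are stages too, the complement being the sum of the later complements of the chain:
    the spaces of F are those subspaces of V that bound a gap and whose traces on every
    V_N belong to the image of F_1 ([limit_flagE]). Here transfers are the given maps of
    the chain, since both add the same subspaces W_(N,i). As every V_N lies in some X_n
    and every X_n in some V_N, transfers in both directions yield mutually inverse
    ind-morphisms ([direct_limit_isomorphic]).

    In the presence of a form, stages are nondegenerate and the complements orthogonal. A
    flag now prescribes the isotropic spaces only, and the coisotropic ones follow by
    orthogonality ([iso_extend], [isotropic_deformation]). That F is isotropic and
    compatible with E results from orthogonality acting on the subspaces with the right
    traces ([perp_cut_flag], [iso_thread_spanned]). When maximal isotropic subspaces of
    an even-dimensional space occur, the transfers respect the chosen components because
    they are morphisms on those subspaces ([transfer_isotropic_flag]). *)

Set Implicit Arguments.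
Unset Strict Implicit.
Unset Printing Implicit Defensive.
Import GRing.Theory.
Local Open Scope classical_set_scope.
Local Open Scope ring_scope.

(** * Subspaces and spans *)

Lemma not_subset_exists (T : Type) (A B : set T) : ~ (A `<=` B) -> exists2 v, A v & ~ B v.
Proof. by move=> h; apply: contrapT => h'; apply: h => v Av; apply: contrapT => nv; apply: h'; exists v. Qed.

Section Subspaces.
Variables (K : fieldType) (V : lmodType K).
Implicit Types A B C L S X Y : set V.

Lemma subspace0 A : is_subspace A -> A 0.
Proof. by case. Qed.

Lemma subspaceD A u v : is_subspace A -> A u -> A v -> A (u + v).
Proof. by move=> [_ h] Au Av; rewrite -[u]scale1r; apply: h. Qed.

Lemma subspaceZ A a u : is_subspace A -> A u -> A (a *: u).
Proof. by move=> [h0 h] Au; rewrite -[_ *: u]addr0; apply: h. Qed.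

Lemma subspaceN A u : is_subspace A -> A u -> A (- u).
Proof. by move=> sA Au; rewrite -scaleN1r; apply: subspaceZ. Qed.

Lemma subspaceB A u v : is_subspace A -> A u -> A v -> A (u - v).
Proof. by move=> sA Au Av; apply: subspaceD => //; apply: subspaceN. Qed.

Lemma subspace_sum A (I : Type) (r : seq I) (F : I -> V) :
  is_subspace A -> (forall i, A (F i)) -> A (\sum_(i <- r) F i).
Proof.
move=> sA hF; elim: r => [|i r IH]; first by rewrite big_nil; apply: subspace0.
by rewrite big_cons; apply: subspaceD.
Qed.

Lemma subspace_addl A u v : is_subspace A -> A u -> A (u + v) -> A v.
Proof. by move=> sA Au Auv; rewrite -[v](addKr u) addrC; apply: subspaceB. Qed.

Lemma subspace_addr A u v : is_subspace A -> A v -> A (u + v) -> A u.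
Proof. by move=> sA Av; rewrite addrC; apply: subspace_addl. Qed.

Lemma subspace_set0 : is_subspace [set 0 : V].
Proof. by split=> // a u v -> ->; rewrite scaler0 addr0. Qed.

Lemma subspaceI A B : is_subspace A -> is_subspace B -> is_subspace (A `&` B).
Proof.
move=> [a0 hA] [b0 hB]; split=> // a u v [Au Bu] [Av Bv].
by split; [apply: hA|apply: hB].
Qed.

Lemma set0_sub A : is_subspace A -> [set 0] `<=` A.
Proof. by move=> sA _ ->; apply: subspace0. Qed.

Lemma subspace_span S : is_subspace (lin_span S).
Proof.
split=> [A [[A0 _] _] //|a u v hu hv A [[A0 hA] SA]].
by apply: (hA); [exact: (hu A (conj (conj A0 hA) SA))|exact: (hv A (conj (conj A0 hA) SA))].
Qed.

Lemma span_min A S : is_subspace A -> S `<=` A -> lin_span S `<=` A.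
Proof. by move=> sA SA u; apply. Qed.

Lemma sub_span S : S `<=` lin_span S.
Proof. by move=> u Su A [_]; apply. Qed.

Lemma span_mono S T : S `<=` T -> lin_span S `<=` lin_span T.
Proof.
by move=> ST; apply: span_min; [apply: subspace_span|apply: (subset_trans ST); apply: sub_span].
Qed.

Lemma subspace_sum_sub A B :
  is_subspace A -> is_subspace B -> is_subspace (sum_sub A B).
Proof.
move=> sA sB; split; first by exists 0; [exact: subspace0|exists 0; [exact: subspace0|rewrite addr0]].
move=> a _ _ [u Au [v Bv <-]] [u' Au' [v' Bv' <-]].
exists (a *: u + u'); first by apply: sA.2.
exists (a *: v + v'); first by apply: sB.2.
by rewrite scalerDr addrACA.
Qed.

Lemma sub_suml A B : is_subspace B -> A `<=` sum_sub A B.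
Proof. by move=> sB u Au; exists u => //; exists 0; [exact: subspace0|rewrite addr0]. Qed.

Lemma sub_sumr A B : is_subspace A -> B `<=` sum_sub A B.
Proof. by move=> sA u Au; exists 0; [exact: subspace0|exists u => //; rewrite add0r]. Qed.

Lemma sum_sub_min A B C :
  is_subspace C -> A `<=` C -> B `<=` C -> sum_sub A B `<=` C.
Proof. by move=> sC AC BC _ [u /AC Cu [v /BC Cv <-]]; apply: subspaceD. Qed.

Lemma sum_sub_mono A B A' B' :
  A `<=` A' -> B `<=` B' -> sum_sub A B `<=` sum_sub A' B'.
Proof. by move=> AA BB _ [u /AA Cu [v /BB Cv <-]]; exists u => //; exists v. Qed.

Lemma mem_sum_sub A B u v : A u -> B v -> sum_sub A B (u + v).
Proof. by move=> Au Bv; exists u => //; exists v. Qed.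

Lemma sum_subC A B : sum_sub A B = sum_sub B A.
Proof.
by apply/seteqP; split=> _ [u ? [v ? <-]]; rewrite addrC; apply: mem_sum_sub.
Qed.

Lemma sum_subA A B C : sum_sub A (sum_sub B C) = sum_sub (sum_sub A B) C.
Proof.
apply/seteqP; split=> [_ [u ? [_ [v ? [w ? <-]] <-]]|_ [_ [v ? [w ? <-]] [u ? <-]]].
  by rewrite addrA; do !apply: mem_sum_sub.
by rewrite -addrA; do !apply: mem_sum_sub.
Qed.

Lemma sum_sub0 A : sum_sub A [set 0] = A.
Proof.
apply/seteqP; split=> [_ [u Au [_ -> <-]]|u Au]; first by rewrite addr0.
by exists u => //; exists 0 => //; rewrite addr0.
Qed.

(** The modular law. *)
Lemma sum_subI A B C : is_subspace C -> A `<=` C ->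
  sum_sub A B `&` C = sum_sub A (B `&` C).
Proof.
move=> sC AC; apply/seteqP; split=> [_ [[u Au [v Bv <-]] Cuv]|_ [u Au [v [Bv Cv] <-]]].
  by apply: mem_sum_sub => //; split=> //; apply: subspace_addl Cuv => //; apply: AC.
by split; [apply: mem_sum_sub|apply: subspaceD => //; apply: AC].
Qed.

Lemma span_setU S T : lin_span (S `|` T) = sum_sub (lin_span S) (lin_span T).
Proof.
have sS := subspace_span S; have sT := subspace_span T.
apply/seteqP; split.
  apply: span_min; first exact: subspace_sum_sub.
  by move=> u [/sub_span|/sub_span] hu; [apply: sub_suml|apply: sub_sumr].
by apply: sum_sub_min; [apply: subspace_span|apply: span_mono|apply: span_mono] => u ?; [left|right].
Qed.

Lemma span_set0 : lin_span (@set0 V) = [set 0].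
Proof.
apply/seteqP; split; last by move=> _ ->; apply: subspace0; apply: subspace_span.
by apply: span_min => //; apply: subspace_set0.
Qed.

Lemma span_set1 (v : V) : lin_span [set v] = [set a *: v | a in [set: K]].
Proof.
apply/seteqP; split.
  apply: span_min; last by move=> _ ->; exists 1 => //; rewrite scale1r.
  split=> [|a _ _ [b _ <-] [c _ <-]]; first by exists 0 => //; rewrite scale0r.
  by exists (a * b + c) => //; rewrite scalerDl scalerA.
move=> _ [a _ <-]; apply: (subspaceZ a (subspace_span _)); exact: sub_span.
Qed.

End Subspaces.

Section LinearImages.
Variables (K : fieldType) (V W : lmodType K) (f : {linear V -> W}).

Lemma subspace_image A : is_subspace A -> is_subspace (f @` A).
Proof.
move=> [A0 hA]; split=> [|a _ _ [u Au <-] [v Av <-]]; first by exists 0 => //; rewrite linear0.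
by exists (a *: u + v); [apply: hA|rewrite linearP].
Qed.

Lemma subspace_preimage A : is_subspace A -> is_subspace (f @^-1` A).
Proof.
move=> [A0 hA]; split=> [|a u v Au Av] /=; first by rewrite linear0.
by rewrite linearP; apply: hA.
Qed.

Lemma image_span S : f @` lin_span S = lin_span (f @` S).
Proof.
apply/seteqP; split.
  move=> _ [u hu <-].
  have : lin_span S `<=` f @^-1` lin_span (f @` S).
    apply: span_min; first by apply: subspace_preimage; apply: subspace_span.
    by move=> v Sv; apply: sub_span; exists v.
  by apply.
apply: span_min; first by apply: subspace_image; apply: subspace_span.
by move=> _ [v Sv <-]; exists v => //; apply: sub_span.
Qed.

Lemma image_sum_sub A B : f @` sum_sub A B = sum_sub (f @` A) (f @` B).
Proof.
apply/seteqP; split=> [_ [_ [u Au [v Bv <-]] <-]|_ [_ [u Au <-] [_ [v Bv <-] <-]]].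
  by rewrite linearD; apply: mem_sum_sub; [exists u|exists v].
by rewrite -linearD; exists (u + v) => //; apply: mem_sum_sub.
Qed.

End LinearImages.

(** * Dimension *)

Section Dimension.
Variables (K : fieldType) (V : lmodType K).
Implicit Types (A B X Y : set V) (s t : seq V).

Definition sspan s : set V := lin_span [set` s].

Lemma subspace_sspan s : is_subspace (sspan s).
Proof. exact: subspace_span. Qed.

Lemma mem_sspan s v : v \in s -> sspan s v.
Proof. by move=> vs; apply: sub_span. Qed.

Lemma sspan_min A s : is_subspace A -> (forall v, v \in s -> A v) -> sspan s `<=` A.
Proof. exact: span_min. Qed.

Lemma sspan_mono s t : {subset s <= t} -> sspan s `<=` sspan t.
Proof. by move=> st; apply: span_mono => v /st. Qed.

Lemma eq_sspan s t : s =i t -> sspan s = sspan t.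
Proof. by move=> st; apply/seteqP; split; apply: sspan_mono => v; rewrite st. Qed.

Lemma sspan_nil : sspan [::] = [set 0].
Proof. by rewrite /sspan set_nil span_set0. Qed.

Lemma sspan_cat s t : sspan (s ++ t) = sum_sub (sspan s) (sspan t).
Proof.
rewrite -span_setU; congr lin_span; apply/seteqP.
by split=> v /=; rewrite mem_cat => /orP.
Qed.

Lemma sspan_cons v s : sspan (v :: s) = sum_sub (lin_span [set v]) (sspan s).
Proof.
rewrite -span_setU; congr lin_span; apply/seteqP.
split=> u /=; rewrite inE; first by move=> /orP [/eqP|]; [left|right].
by move=> [->|->]; rewrite ?eqxx ?orbT.
Qed.

Lemma sspan_consP v s u : sspan (v :: s) u <-> exists a, sspan s (u - a *: v).
Proof.
rewrite sspan_cons span_set1; split=> [[_ [a _ <-] [w sw <-]]|[a h]].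
  by exists a; rewrite addrC addKr.
by exists (a *: v); [exists a|exists (u - a *: v) => //; rewrite addrC subrK].
Qed.

(** Linear independence by peeling off one vector at a time, the form in which
    frames are extended. *)
Fixpoint indep s : Prop :=
  if s is v :: s' then indep s' /\ ~ sspan s' v else True.

Lemma indep_cat s t :
  indep (s ++ t) <-> [/\ indep s, indep t & sspan s `&` sspan t `<=` [set 0]].
Proof.
elim: s => [|v s IH] /=.
  by split=> [it|[]//]; split=> // u [+ _]; rewrite sspan_nil.
rewrite IH; split.
  move=> [[is_ it d] nv]; split=> //.
    by split=> // sv; apply: nv; rewrite sspan_cat; apply: sub_suml => //; apply: subspace_sspan.
  move=> u [/sspan_consP [a ha] tu]; case: (eqVneq a 0) ha => [->|a0 ha].
    by rewrite scale0r subr0 => su; apply: d.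
  case: nv; rewrite sspan_cat.
  have -> : v = a^-1 *: (- (u - a *: v) + u) by rewrite opprB subrK scalerA mulVf // scale1r.
  apply: (subspaceZ a^-1 (subspace_sum_sub (subspace_sspan _) (subspace_sspan _))).
  by apply: mem_sum_sub => //; apply: (subspaceN (subspace_sspan _)).
move=> [[is_ nv] it d]; split; last first.
  rewrite sspan_cat => -[a sa [b tb eab]].
  have : [set 0] b.
    apply: d; split=> //; rewrite sspan_cons -[b](addKr a) eab addrC.
    by apply: mem_sum_sub; [apply: sub_span|apply: (subspaceN (subspace_sspan _))].
  by move=> b0; move: eab; rewrite b0 addr0 => eab; rewrite -eab in nv.
split=> // u [su tu]; apply: d; split=> //.
by apply: sspan_mono su => w; rewrite inE => ->; rewrite orbT.
Qed.

Lemma indep_notin v s : indep (v :: s) -> v \notin s.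
Proof. by move=> [_ nv]; apply/negP => vs; apply: nv; apply: mem_sspan. Qed.

Lemma indep_uniq s : indep s -> uniq s.
Proof. by elim: s => //= v s IH h; rewrite (indep_notin h) IH //; case: h. Qed.

Lemma indep_filter p s : indep s -> indep (seq.filter p s).
Proof.
elim: s => //= v s IH [/IH is_ nv]; case: (p v) => //=; split=> // h; apply: nv.
by apply: sspan_mono h => w; rewrite mem_filter => /andP[].
Qed.

Lemma sspan_big s u : sspan s u <-> exists c : nat -> K, u = \sum_(i < size s) c i *: nth 0 s i.
Proof.
elim: s u => [|v s IH] u.
  rewrite sspan_nil; split=> [->|[c ->]]; last by rewrite big_ord0.
  by exists (fun=> 0); rewrite big_ord0.
rewrite sspan_consP; split=> [[a /IH [c e]]|[c ->]].
  exists (fun i => if i is j.+1 then c j else a); rewrite big_ord_recl /= -e.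
  by rewrite addrC subrK.
by exists (c 0%N); apply/IH; exists (fun i => c i.+1); rewrite big_ord_recl /= addrC addKr.
Qed.

Lemma indepP s : indep s <->
  forall c : nat -> K, \sum_(i < size s) c i *: nth 0 s i = 0 -> forall i, (i < size s)%N -> c i = 0.
Proof.
elim: s => [|v s IH] //; split.
  move=> [/IH is_ nv] c; rewrite /= big_ord_recl /= => e.
  have c0 : c 0%N = 0.
    apply/eqP/negP => /negP c0; apply: nv; apply/sspan_big.
    exists (fun i => - (c 0%N)^-1 * c i.+1).
    move/eqP: e; rewrite addr_eq0 => /eqP e.
    rewrite -[v](scalerK c0) e scalerN -scaleNr scaler_sumr.
    by apply: eq_bigr => i _; rewrite scalerA.
  case=> [//|i]; rewrite ltnS => hi; move: e; rewrite c0 scale0r add0r.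
  by move=> /(is_ (fun i => c i.+1)) ->.
move=> h; split.
  apply/IH => c e i hi; apply: (h (fun i => if i is j.+1 then c j else 0) _ i.+1) => //.
  by rewrite /= big_ord_recl /= scale0r add0r.
move=> /sspan_big [c e].
have := h (fun i => if i is j.+1 then c j else -1) _ 0%N isT.
rewrite /= big_ord_recl /= scaleN1r {1}e addNr => /(_ erefl) /eqP.
by rewrite oppr_eq0 oner_eq0.
Qed.

(** Otherwise the matrix of coefficients of s over t would have a nonzero left kernel,
    that is, a linear relation between the members of s. *)
Lemma indep_size_le s t : indep s -> (forall v, v \in s -> sspan t v) -> (size s <= size t)%N.
Proof.
move=> /indepP is_ st; rewrite leqNgt; apply/negP => lts.
have /choice [c hc] : forall i : nat, exists c : nat -> K,
    (i < size s)%N -> nth 0 s i = \sum_(j < size t) c j *: nth 0 t j.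
  move=> i; case: (ltnP i (size s)) => hi; last by exists (fun=> 0).
  by have /sspan_big [c e] := st _ (mem_nth 0 hi); exists c.
pose M : 'M[K]_(size s, size t) := \matrix_(i, j) c i j.
have : kermx M != 0.
  rewrite -mxrank_eq0 mxrank_ker -lt0n subn_gt0.
  by apply: leq_ltn_trans lts; apply: rank_leq_col.
move=> /rowV0Pn [r /sub_kermxP rM r0].
pose d i : K := if insub i is Some i' then r 0 i' else 0.
have dE (i : 'I_(size s)) : d i = r 0 i by rewrite /d valK.
case/eqP: r0; apply/rowP => i; rewrite mxE -dE; apply: is_ => //.
under eq_bigr => j _ do rewrite hc // dE scaler_sumr.
rewrite exchange_big big1 // => j _ /=.
under eq_bigr => k _ do rewrite scalerA.
rewrite -scaler_suml.
have := congr1 (fun N : 'M_(1, size t) => N 0 j) rM; rewrite !mxE.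
by under eq_bigr => k _ do rewrite mxE; move=> ->; rewrite scale0r.
Qed.

Lemma lin_indepP d (b : 'I_d -> V) : lin_indep b <-> indep [seq b i | i <- enum 'I_d].
Proof.
have E (c : nat -> K) : \sum_(i < size [seq b i | i <- enum 'I_d]) c i *: nth 0 [seq b i | i <- enum 'I_d] i
    = \sum_(i < d) c i *: b i.
  rewrite size_map size_enum_ord; apply: eq_bigr => i _.
  by rewrite (nth_map i) ?size_enum_ord // nth_ord_enum.
split=> [h|/indepP h].
  apply/indepP => c; rewrite E size_map size_enum_ord => e i hi.
  by have := h (fun i => c i) e (Ordinal hi).
move=> c e i.
pose c' i : K := if insub i is Some i' then c i' else 0.
have cE (j : 'I_d) : c' j = c j by rewrite /c' valK.
rewrite -cE; apply: h; last by rewrite size_map size_enum_ord.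
by rewrite E -[RHS]e; apply: eq_bigr => j _; rewrite cE.
Qed.

Lemma range_sspan d (b : 'I_d -> V) : lin_span (range b) = sspan [seq b i | i <- enum 'I_d].
Proof.
congr lin_span; apply/seteqP; split=> [_ [i _ <-]|v /= /mapP [i _ ->]].
  by apply: map_f; rewrite mem_enum.
by exists i.
Qed.

Lemma is_frameP d (b : 'I_d -> V) X :
  is_frame b X <-> indep [seq b i | i <- enum 'I_d] /\ sspan [seq b i | i <- enum 'I_d] = X.
Proof. by rewrite /is_frame lin_indepP range_sspan. Qed.

Lemma has_dimP X d : has_dim X d <-> exists s, [/\ size s = d, indep s & sspan s = X].
Proof.
split=> [[b /is_frameP [h1 h2]]|[s [<- h1 h2]]].
  by exists [seq b i | i <- enum 'I_d]; rewrite size_map size_enum_ord.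
exists (fun i : 'I_(size s) => nth 0 s i); apply/is_frameP.
suff -> : [seq (fun i : 'I_(size s) => nth 0 s i) i | i <- enum 'I_(size s)] = s by [].
by rewrite -[RHS](mkseq_nth 0) /mkseq -val_enum_ord -map_comp.
Qed.

Lemma has_dim_uniq X d d' : has_dim X d -> has_dim X d' -> d = d'.
Proof.
move=> /has_dimP [s [<- is_ hs]] /has_dimP [t [<- it ht]]; apply/eqP; rewrite eqn_leq.
by apply/andP; split; apply: indep_size_le => // v /mem_sspan; rewrite hs ht.
Qed.

Definition fdim X := exists d, has_dim X d.

Lemma has_dim_dimn X : fdim X -> has_dim X (dimn X).
Proof. exact: xgetPex. Qed.

Lemma dimnE X d : has_dim X d -> dimn X = d.
Proof. by move=> hd; apply: (has_dim_uniq _ hd); apply: has_dim_dimn; exists d. Qed.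

Lemma has_dim_subspace X d : has_dim X d -> is_subspace X.
Proof. by move=> /has_dimP [s [_ _ <-]]; apply: subspace_sspan. Qed.

Lemma fdim_subspace X : fdim X -> is_subspace X.
Proof. by move=> [d /has_dim_subspace]. Qed.

Lemma indep_sspan s : indep s -> has_dim (sspan s) (size s).
Proof. by move=> h; apply/has_dimP; exists s. Qed.

Lemma indep_le_dimn X s : fdim X -> indep s -> (forall v, v \in s -> X v) -> (size s <= dimn X)%N.
Proof.
move=> /has_dim_dimn /has_dimP [t [<- it ht]] is_ sX.
by apply: indep_size_le => // v /sX; rewrite ht.
Qed.

(** Vectors are added one at a time. The hypothesis bounds the length of independent
    sequences instead of a dimension, so that the lemma also produces the frames of
    subspaces not yet known to be finite-dimensional. *)
Lemma indep_extend A n s : is_subspace A ->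
    (forall t, indep t -> (forall v, v \in t -> A v) -> (size t <= n)%N) ->
    indep s -> (forall v, v \in s -> A v) ->
  exists t, indep (t ++ s) /\ sspan (t ++ s) = A.
Proof.
move=> sA hn; move: {2}(n - size s)%N (leqnn (n - size s)) => m.
elim: m s => [|m IH] s hm is_ sAs; case: (pselect (A `<=` sspan s)) => hA.
- by exists [::]; split=> //; apply/seteqP; split=> //; apply: sspan_min.
- have [v Av nv] := not_subset_exists hA.
  have vsA u : u \in v :: s -> A u by rewrite inE => /orP [/eqP ->|/sAs].
  have := hn (v :: s) (conj is_ nv) vsA.
  by move: hm; rewrite leqn0 subn_eq0 leqNgt /= => /negbTE ->.
- by exists [::]; split=> //; apply/seteqP; split=> //; apply: sspan_min.
have [v Av nv] := not_subset_exists hA.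
have vsA u : u \in v :: s -> A u by rewrite inE => /orP [/eqP ->|/sAs].
have lt := hn (v :: s) (conj is_ nv) vsA.
have [|//||t [it ht]] := IH (v :: s); last by exists (rcons t v); rewrite cat_rcons.
  by rewrite -ltnS; apply: leq_trans hm; rewrite /= subnS prednK // subn_gt0.
by [].
Qed.

Lemma frame_extend X s : fdim X -> indep s -> (forall v, v \in s -> X v) ->
  exists t, indep (t ++ s) /\ sspan (t ++ s) = X.
Proof.
move=> fX; apply: (indep_extend (fdim_subspace fX)) => t it tX.
exact: (indep_le_dimn fX).
Qed.

Lemma fdim_sub X A : fdim X -> is_subspace A -> A `<=` X -> fdim A.
Proof.
move=> fX sA AX.
have h t : indep t -> (forall v, v \in t -> A v) -> (size t <= dimn X)%N.
  by move=> it tA; apply: (indep_le_dimn fX) => // v /tA /AX.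
have [//|//|t] := @indep_extend A (dimn X) [::] sA h; rewrite cats0 => -[it <-]; exists (size t); exact: indep_sspan.
Qed.

Lemma frame_exists X : fdim X -> exists s, [/\ size s = dimn X, indep s & sspan s = X].
Proof. by move=> /has_dim_dimn /has_dimP. Qed.

Lemma dimn_sspan s : indep s -> dimn (sspan s) = size s.
Proof. by move=> /indep_sspan /dimnE. Qed.

Lemma dimn_sub A X : fdim X -> is_subspace A -> A `<=` X -> (dimn A <= dimn X)%N.
Proof.
move=> fX sA AX; have [s [<- is_ hs]] := frame_exists (fdim_sub fX sA AX).
by apply: indep_le_dimn => // v /mem_sspan; rewrite hs => /AX.
Qed.

Lemma dimn_sub_eq A X : fdim X -> is_subspace A -> A `<=` X -> (dimn X <= dimn A)%N -> A = X.
Proof.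
move=> fX sA AX; have [s [<- is_ hs]] := frame_exists (fdim_sub fX sA AX).
have sX v : v \in s -> X v by move=> /mem_sspan; rewrite hs => /AX.
have [t [it <-]] := frame_extend fX is_ sX.
rewrite dimn_sspan // size_cat -{2}(add0n (size s)) leq_add2r leqn0 => /eqP /size0nil ->.
by rewrite hs.
Qed.

Lemma has_dim_sum A B a b : has_dim A a -> has_dim B b -> A `&` B `<=` [set 0] ->
  has_dim (sum_sub A B) (a + b).
Proof.
move=> /has_dimP [s [<- is_ <-]] /has_dimP [t [<- it <-]] d.
by apply/has_dimP; exists (s ++ t); rewrite size_cat sspan_cat; split=> //; apply/indep_cat.
Qed.

Lemma dimn_sum_direct A B : fdim A -> fdim B -> A `&` B `<=` [set 0] ->
  dimn (sum_sub A B) = (dimn A + dimn B)%N.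
Proof. by move=> /has_dim_dimn hA /has_dim_dimn hB d; apply: dimnE; apply: has_dim_sum. Qed.

Lemma complement_exists X A : fdim X -> is_subspace A -> A `<=` X ->
  exists B, [/\ is_subspace B, A `&` B `<=` [set 0] & sum_sub A B = X].
Proof.
move=> fX sA AX; have [s [_ is_ hs]] := frame_exists (fdim_sub fX sA AX).
have sX v : v \in s -> X v by move=> /mem_sspan; rewrite hs => /AX.
have [t [/indep_cat [_ _ d] hX]] := frame_extend fX is_ sX.
exists (sspan t); split; first exact: subspace_sspan.
  by rewrite setIC -hs.
by rewrite -hX sspan_cat -hs sum_subC.
Qed.

Lemma fdim_sspan s : fdim (sspan s).
Proof.
elim: s => [|v s IH]; first by exists 0%N; apply: indep_sspan.
case: (pselect (sspan s v)) => hv; last first.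
  have [t [_ it ht]] := frame_exists IH.
  exists (size (v :: t)); have -> : sspan (v :: s) = sspan (v :: t).
    by rewrite !sspan_cons ht.
  by apply: indep_sspan; split=> //; rewrite ht.
suff -> : sspan (v :: s) = sspan s by [].
apply/seteqP; split; last by apply: sspan_mono => u us; rewrite inE us orbT.
apply: sspan_min; first exact: subspace_sspan.
by move=> u; rewrite inE => /orP [/eqP ->|/mem_sspan].
Qed.

Lemma dimn_sum A B : fdim A -> fdim B ->
  (dimn (sum_sub A B) + dimn (A `&` B) = dimn A + dimn B)%N.
Proof.
move=> fA fB; have sA := fdim_subspace fA; have sB := fdim_subspace fB.
have sI := subspaceI sA sB.
have [C [sC d eA]] := complement_exists fA sI (@subIsetl _ _ _).
have CA : C `<=` A by rewrite -eA; apply: sub_sumr.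
have fC := fdim_sub fA sC CA.
have -> : sum_sub A B = sum_sub C B.
  rewrite -{1}eA; apply/seteqP; split; last first.
    by apply: sum_sub_mono => //; rewrite eA.
  apply: sum_sub_min; [exact: subspace_sum_sub| |exact: sub_sumr].
  apply: sum_sub_min; [exact: subspace_sum_sub| |exact: sub_suml].
  by move=> u [_ Bu]; apply: sub_sumr.
rewrite dimn_sum_direct //; last by move=> u [Cu Bu]; apply: d; split=> //; split=> //; apply: CA.
have <- : (dimn (A `&` B) + dimn C = dimn A)%N.
  by rewrite -dimn_sum_direct ?eA //; apply: fdim_sub fA sI _.
by rewrite addnAC [(dimn C + _)%N]addnC.
Qed.

Lemma has_dim0 : has_dim [set 0 : V] 0.
Proof. by rewrite -sspan_nil; apply: (@indep_sspan [::]). Qed.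

Lemma dimn0 : dimn [set 0 : V] = 0%N.
Proof. exact: dimnE has_dim0. Qed.

Lemma dimn_eq0 A : fdim A -> dimn A = 0%N -> A = [set 0].
Proof. by move=> /frame_exists [s [<- _ <-]] /size0nil ->; rewrite sspan_nil. Qed.

Lemma chain_dimn_le A B : fdim A -> fdim B -> A `<=` B \/ B `<=` A ->
  (dimn A <= dimn B)%N -> A `<=` B.
Proof.
move=> fA fB [//|BA] h.
by rewrite (dimn_sub_eq fA (fdim_subspace fB) BA h).
Qed.

Lemma chain_dimn_eq A B : fdim A -> fdim B -> A `<=` B \/ B `<=` A ->
  dimn A = dimn B -> A = B.
Proof.
move=> fA fB h e; apply/seteqP; split; apply: chain_dimn_le => //; rewrite ?e //.
by case: h; [right|left].
Qed.

Lemma dimn_line (v : V) : v <> 0 -> has_dim (lin_span [set v]) 1.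
Proof.
move=> v0; have -> : lin_span [set v] = sspan [:: v] by rewrite sspan_cons sspan_nil sum_sub0.
by apply: (@indep_sspan [:: v]); split=> //; rewrite sspan_nil.
Qed.

(** The frame is built by climbing the chain, dimension after dimension, two members
    of the same dimension being equal. *)
Lemma adapted_frame_exists Y (C : set (set V)) : fdim Y ->
    (forall A, C A -> is_subspace A /\ A `<=` Y) -> total_on C (fun A B => A `<=` B) ->
  exists s, [/\ indep s, sspan s = Y &
    forall A, C A -> A = sspan [seq v <- s | `[< A v >]]].
Proof.
move=> fY CY tC; have sY := fdim_subspace fY.
have fC A : C A -> fdim A by move=> /CY [sA AY]; apply: fdim_sub AY.
have key r : exists s, [/\ indep s, sspan s `<=` Y,
    forall A, C A -> (dimn A <= r)%N -> A = sspan [seq v <- s | `[< A v >]] &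
    forall A, C A -> (r < dimn A)%N -> sspan s `<=` A].
  elim: r => [|r [s [is_ sYs h1 h2]]].
    exists [::]; split=> //; first by rewrite sspan_nil; apply: set0_sub.
      by move=> A CA; rewrite leqn0 => /eqP /(dimn_eq0 (fC _ CA)) ->; rewrite sspan_nil.
    by move=> A CA _; rewrite sspan_nil; apply: set0_sub; apply: fdim_subspace; apply: fC.
  case: (pselect (exists2 A0, C A0 & dimn A0 = r.+1)) => [[A0 CA0 dA0]|hn]; last first.
    exists s; split=> //.
      move=> A CA; rewrite leq_eqVlt => /orP [/eqP e|]; last by rewrite ltnS; apply: h1.
      by case: hn; exists A.
    by move=> A CA hA; apply: h2 => //; apply: ltnW.
  have sA0 v : v \in s -> A0 v by move=> /mem_sspan; apply: h2 => //; rewrite dA0.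
  have [t [it ht]] := frame_extend (fC _ CA0) is_ sA0.
  have tA0 v : v \in t ++ s -> A0 v by move=> /mem_sspan; rewrite ht.
  exists (t ++ s); split=> //; first by rewrite ht; apply: (CY _ CA0).2.
    move=> A CA; rewrite leq_eqVlt => /orP [/eqP e|].
      have -> : A = A0.
        by apply: chain_dimn_eq; rewrite ?e ?dA0; [apply: fC|apply: fC|apply: tC|].
      by rewrite -{1}ht; congr sspan; apply/esym/all_filterP/allP => v /tA0 /asboolP.
    rewrite ltnS => hA; apply/seteqP; split.
      rewrite {1}(h1 A CA hA); apply: sspan_mono => v; rewrite !mem_filter mem_cat.
      by move=> /andP [-> ->]; rewrite orbT.
    by apply: sspan_min; [apply: (CY _ CA).1|move=> v; rewrite mem_filter => /andP [/asboolP]].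
  move=> A CA hA; rewrite ht; apply: chain_dimn_le; [exact: fC|exact: fC|exact: tC|].
  by rewrite dA0; apply: ltnW.
have [s [is_ sYs h1 h2]] := key (dimn Y).
have sY' v : v \in s -> Y v by move=> /mem_sspan /sYs.
have [t [it ht]] := frame_extend fY is_ sY'.
exists (t ++ s); split=> // A CA; apply/seteqP; split.
  rewrite {1}(h1 A CA); last by apply: dimn_sub => //; case: (CY _ CA).
  apply: sspan_mono => v; rewrite !mem_filter mem_cat.
  by move=> /andP [-> ->]; rewrite orbT.
by apply: sspan_min; [apply: (CY _ CA).1|move=> v; rewrite mem_filter => /andP [/asboolP]].
Qed.

Lemma dimn_filter s A : indep s -> A = sspan [seq v <- s | `[< A v >]] ->
  dimn A = count (fun v => `[< A v >]) s.
Proof. by move=> is_ e; rewrite {1}e dimn_sspan ?size_filter //; apply: indep_filter. Qed.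

End Dimension.

Section DimensionImage.
Variables (K : fieldType) (V W : lmodType K) (f : {linear V -> W}).

Lemma image_sspan s : f @` sspan s = sspan (map f s).
Proof.
rewrite /sspan image_span; congr lin_span; apply/seteqP.
by split=> [_ [v vs <-]|_ /= /mapP [v vs ->]]; [apply: map_f|exists v].
Qed.

Lemma indep_image s : (forall u, sspan s u -> f u = 0 -> u = 0) -> indep s -> indep (map f s).
Proof.
elim: s => //= v s IH hf [is_ nv]; split.
  apply: IH => // u hu; apply: hf; apply: sspan_mono hu => w ws.
  by rewrite inE ws orbT.
rewrite -image_sspan => -[u su e]; apply: nv.
suff -> : v = u by [].
apply/eqP; rewrite -subr_eq0; apply/eqP; apply: hf; last by rewrite linearB e subrr.
apply: (subspaceB (subspace_sspan _)); [apply: mem_sspan; exact: mem_head|].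
by apply: sspan_mono su => w ws; rewrite inE ws orbT.
Qed.

Lemma has_dim_image A d : (forall u, A u -> f u = 0 -> u = 0) -> has_dim A d -> has_dim (f @` A) d.
Proof.
move=> hf /has_dimP [s [<- is_ e]]; apply/has_dimP; exists (map f s).
by rewrite size_map -image_sspan e; split=> //; apply: indep_image => //; rewrite e.
Qed.

Lemma dimn_image A : (forall u, A u -> f u = 0 -> u = 0) -> fdim A -> dimn (f @` A) = dimn A.
Proof. by move=> hf /has_dim_dimn h; apply: dimnE; apply: has_dim_image. Qed.

Lemma fdim_image A : fdim A -> fdim (f @` A).
Proof. by move=> /frame_exists [s [_ _ <-]]; rewrite image_sspan; apply: fdim_sspan. Qed.

End DimensionImage.

(** * Bases and the subspaces spanned by their parts *)

Section LinearPacking.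
Variables (K : fieldType) (V W : lmodType K).

Lemma linear_pack (g : V -> W) : linear g -> exists h : {linear V -> W}, h =1 g.
Proof.
move=> lg.
pose m := GRing.isLinear.Build K V W _ g lg.
by exists (HB.pack_for {linear V -> W} g m).
Qed.

End LinearPacking.

Section SpanFinite.
Variables (K : fieldType) (V : lmodType K).
Implicit Types (A B D L S : set V) (s : seq V).

Lemma span_finite S v : lin_span S v ->
  exists s, [/\ uniq s, forall u, u \in s -> S u & sspan s v].
Proof.
move=> Sv; suff: [set v | exists s, (forall u, u \in s -> S u) /\ sspan s v] v.
  move=> [s [sS sv]]; exists (undup s); split; first exact: undup_uniq.
    by move=> u; rewrite mem_undup; apply: sS.
  by rewrite (@eq_sspan _ _ _ s) // => u; rewrite mem_undup.
move: v Sv; apply: span_min; last first.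
  move=> u Su; exists [:: u]; split; first by move=> w; rewrite inE => /eqP ->.
  by apply: mem_sspan; apply: mem_head.
split; first by exists [::]; split=> //; rewrite sspan_nil.
move=> a u v [s [hs su]] [t [ht tv]]; exists (s ++ t); split.
  by move=> w; rewrite mem_cat => /orP [/hs|/ht].
rewrite sspan_cat; apply: mem_sum_sub => //.
exact: (subspaceZ a (subspace_sspan s)).
Qed.

Lemma is_basisP L A : is_basis L A <->
  (forall s, uniq s -> (forall u, u \in s -> L u) -> indep s) /\ lin_span L = A.
Proof.
split=> -[h1 h2]; split=> //.
  move=> s us sL; have := h1 (size s) (fun i => nth 0 s i).
  rewrite lin_indepP.
  have -> : [seq (fun i : 'I_(size s) => nth 0 s i) i | i <- enum 'I_(size s)] = s.
    by rewrite -[RHS](mkseq_nth 0) /mkseq -val_enum_ord -map_comp.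
  apply; last by move=> i; apply: sL; apply: mem_nth.
  by move=> i j /eqP; rewrite nth_uniq // => /eqP /val_inj.
move=> d b ib bL; apply/lin_indepP; apply: h1.
  by rewrite map_inj_uniq // enum_uniq.
by move=> u /mapP [i _ ->].
Qed.

End SpanFinite.

Section Bases.
Variables (K : fieldType) (V : lmodType K).
Implicit Types (A B D L S : set V) (s : seq V).

(** The graph of the map is the span of the prescribed pairs; it meets 0 x W trivially
    because E is independent. *)
Lemma linear_extension (E : set V) (W : lmodType K) (f : V -> W) : is_basis E setT ->
  exists g : {linear V -> W}, forall e, E e -> g e = f e.
Proof.
move=> /is_basisP [hE sE].
pose G : set (V * W)%type := lin_span [set (e, f e) | e in E].
have sG : is_subspace G := subspace_span _.
have G0 w : G (0, w) -> w = 0.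
  move=> /span_finite [s [us sS /sspan_big [c ec]]].
  have eS x : x \in s -> E x.1 /\ x.2 = f x.1 by move=> /sS [e Ee <-].
  have indS : indep (map fst s).
    apply: hE; last by move=> u /mapP [x /eS [? _] ->].
    rewrite map_inj_in_uniq // => -[x1 x2] [y1 y2] /eS [_ /= e1] /eS [_ /= e2] /= exy.
    by rewrite e1 e2 exy.
  have e1 := congr1 fst ec; have e2 := congr1 snd ec.
  rewrite /= (raddf_sum (GRing.Linear.clone _ _ _ _ (@fst V W) _)) /= in e1.
  rewrite /= (raddf_sum (GRing.Linear.clone _ _ _ _ (@snd V W) _)) /= in e2.
  rewrite e2 big1 // => i _.
  suff -> : c i = 0 by rewrite scale0r.
  apply: ((indepP _).1 indS) => //; last by rewrite size_map.
  rewrite size_map [RHS]e1; apply: eq_bigr => j _.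
  by rewrite (nth_map 0).
have Gex v : exists w, G (v, w).
  have : [set: V] v by [].
  rewrite -sE; move: v; apply: span_min => [|e Ee]; last by exists (f e); apply: sub_span; exists e.
  split; first by exists 0; apply: (subspace0 sG).
  by move=> a u v [w1 h1] [w2 h2]; exists (a *: w1 + w2); apply: (sG.2 a _ _ h1 h2).
have /choice [g hg] := Gex.
have gE v w : G (v, w) -> g v = w.
  move=> h; apply/eqP; rewrite -subr_eq0; apply/eqP/G0.
  by rewrite -(subrr v); apply: (subspaceB sG (hg v) h).
have lg : linear g.
  by move=> a u v; apply: gE; apply: (sG.2 a _ _ (hg u) (hg v)).
have [h hh] := linear_pack lg.
by exists h => e Ee; rewrite hh; apply: gE; apply: sub_span; exists e.
Qed.

Section FixedBasis.
Variables (E : set V) (bE : is_basis E setT).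

Lemma basis_indep s : uniq s -> (forall u, u \in s -> E u) -> indep s.
Proof. by case/is_basisP: bE => h _; apply: h. Qed.

Lemma basis_projection D : D `<=` E -> exists g : {linear V -> V},
  [/\ forall v, lin_span D v -> g v = v, forall v, lin_span (E `\` D) v -> g v = 0,
      forall v, lin_span D (g v) & forall v, lin_span (E `\` D) (v - g v)].
Proof.
move=> DE; have [g hg] := linear_extension (fun e => if `[< D e >] then e else 0) bE.
have g1 v : D v -> g v = v by move=> Dv; rewrite hg ?asboolT //; apply: DE.
have g0 v : (E `\` D) v -> g v = 0 by move=> [Ev nv]; rewrite hg // asboolF.
exists g; split.
- have sA : is_subspace [set v | g v = v].
    by split=> [|a u v /= hu hv] /=; rewrite ?linear0 // linearP hu hv.
  exact: (span_min sA).
- have sA : is_subspace [set v | g v = 0].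
    by split=> [|a u v /= hu hv] /=; rewrite ?linear0 // linearP hu hv scaler0 addr0.
  exact: (span_min sA).
- move=> v; have : [set: V] v by []. rewrite -bE.2; move: v.
  apply: (@span_min _ _ (g @^-1` lin_span D)).
    by apply: subspace_preimage; apply: subspace_span.
  move=> e Ee /=; case: (pselect (D e)) => h; first by rewrite g1 //; apply: sub_span.
  by rewrite g0 //; apply: (subspace0 (subspace_span _)).
- move=> v; have : [set: V] v by []. rewrite -bE.2; move: v.
  apply: (@span_min _ _ [set v | lin_span (E `\` D) (v - g v)]).
    have sS := subspace_span (E `\` D).
    split=> [|a u v /= hu hv] /=; first by rewrite linear0 subr0; apply: (subspace0 sS).
    rewrite linearP opprD addrACA -scalerBr; exact: sS.2.
  move=> e Ee /=; case: (pselect (D e)) => h.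
    by rewrite g1 // subrr; apply: (subspace0 (subspace_span _)).
  by rewrite g0 // subr0; apply: sub_span.
Qed.

Lemma span_basis_complement D : D `<=` E ->
  sum_sub (lin_span D) (lin_span (E `\` D)) = setT /\
  lin_span D `&` lin_span (E `\` D) `<=` [set 0].
Proof.
move=> DE; have [g [h1 h2 h3 h4]] := basis_projection DE; split.
  by apply/seteqP; split=> // v _; exists (g v) => //; exists (v - g v) => //; rewrite addrC subrK.
by move=> v [/h1 e /h2 e']; rewrite -e e'.
Qed.

Lemma span_basisI D D' : D `<=` E -> D' `<=` E ->
  lin_span D `&` lin_span D' = lin_span (D `&` D').
Proof.
move=> DE DE'; apply/seteqP; split; last first.
  by move=> v h; split; apply: span_mono h => u [].
move=> v [h h']; have [g [h1 h2 _ _]] := basis_projection DE'.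
suff : (g @^-1` lin_span (D `&` D')) v by rewrite /preimage /= h1.
move: v h {h'}; apply: span_min.
  by apply: subspace_preimage; apply: subspace_span.
move=> e De; rewrite /preimage /=; case: (pselect (D' e)) => He.
  by rewrite h1; [apply: sub_span|apply: sub_span].
rewrite h2; first exact: (subspace0 (subspace_span _)).
by apply: sub_span; split=> //; apply: DE.
Qed.

Lemma span_basis_mem D e : D `<=` E -> E e -> lin_span D e -> D e.
Proof.
move=> DE Ee De; apply: contrapT => nD.
have : [set 0] e.
  by apply: (span_basis_complement DE).2; split=> //; apply: sub_span.
move=> e0; have : indep [:: e] by apply: basis_indep => // u; rewrite inE => /eqP ->.
by rewrite /= => -[_]; rewrite sspan_nil.
Qed.

Definition spanned A := lin_span (A `&` E) = A.

Lemma spanned_subspace A : spanned A -> is_subspace A.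
Proof. by move=> <-; apply: subspace_span. Qed.

Lemma spanned_span D : D `<=` E -> spanned (lin_span D).
Proof.
move=> DE; rewrite /spanned; congr lin_span; apply/seteqP; split=> e.
  by move=> [h Ee]; apply: span_basis_mem.
by move=> De; split; [apply: sub_span|apply: DE].
Qed.

Lemma spannedI A B : spanned A -> spanned B -> spanned (A `&` B).
Proof.
move=> <- <-; rewrite span_basisI; [|exact: subIsetr|exact: subIsetr].
by apply: spanned_span => e [[]].
Qed.

Lemma spanned_sum A B : spanned A -> spanned B -> spanned (sum_sub A B).
Proof.
by move=> <- <-; rewrite -span_setU; apply: spanned_span => e [[]|[]].
Qed.

Lemma spanned0 : spanned [set 0].
Proof. by rewrite -span_set0; apply: spanned_span. Qed.

Lemma spannedT : spanned setT.
Proof. by rewrite /spanned setTI; case: bE. Qed.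

Lemma spanned_basis A : spanned A -> is_basis (A `&` E) A.
Proof.
by move=> hA; apply/is_basisP; split=> // s us h; apply: basis_indep => // u /h [].
Qed.

Lemma spanned_split A D : D `<=` E -> spanned A ->
  A = sum_sub (A `&` lin_span D) (A `&` lin_span (E `\` D)).
Proof.
move=> DE hA; have sA := spanned_subspace hA.
apply/seteqP; split; last by apply: sum_sub_min => // v [].
rewrite -{1}hA; apply: span_min.
  by apply: subspace_sum_sub; apply: subspaceI => //; apply: subspace_span.
move=> e [Ae Ee]; case: (pselect (D e)) => h.
  by apply: sub_suml; [apply: subspaceI => //; apply: subspace_span|split=> //; apply: sub_span].
by apply: sub_sumr; [apply: subspaceI => //; apply: subspace_span|split=> //; apply: sub_span].
Qed.

End FixedBasis.
End Bases.

(** * Stages and deformations of a generalized flag *)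

Section NatExtrema.
Implicit Types P : nat -> Prop.

Lemma nat_min P : (exists n, P n) -> exists n, P n /\ forall m, P m -> (n <= m)%N.
Proof.
move=> exP; have exp : exists n, `[< P n >] by case: exP => n Pn; exists n; apply/asboolP.
case: (ex_minnP exp) => n /asboolP Pn hn; exists n; split=> // m Pm.
by apply: hn; apply/asboolP.
Qed.

Lemma nat_max P d : (exists n, P n) -> (forall n, P n -> (n <= d)%N) ->
  exists n, P n /\ forall m, P m -> (m <= n)%N.
Proof.
move=> exP hd; have exp : exists n, `[< P n >] by case: exP => n Pn; exists n; apply/asboolP.
have hd' n : `[< P n >] -> (n <= d)%N by move=> /asboolP /hd.
case: (ex_maxnP exp hd') => n /asboolP Pn hn; exists n; split=> // m Pm.
by apply: hn; apply/asboolP.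
Qed.

End NatExtrema.

Section IndepPerm.
Variables (K : fieldType) (V : lmodType K).
Implicit Types (s t : seq V).

Lemma dimn_sspan_le s : (dimn (sspan s) <= size s)%N.
Proof.
have [t [<- it ht]] := frame_exists (fdim_sspan s).
by apply: indep_size_le => // v /mem_sspan; rewrite ht.
Qed.

Lemma indep_dimnP s : indep s <-> dimn (sspan s) = size s.
Proof.
split; first exact: dimn_sspan.
elim: s => //= v s IH e.
have nv : ~ sspan s v.
  move=> sv; have : sspan (v :: s) = sspan s.
    apply/seteqP; split; last by apply: sspan_mono => u us; rewrite inE us orbT.
    apply: sspan_min; first exact: subspace_sspan.
    by move=> u; rewrite inE => /orP [/eqP ->|/mem_sspan].
  by move=> e'; have := dimn_sspan_le s; rewrite -e' e ltnn.
split=> //; apply: IH; apply/eqP; rewrite eqn_leq dimn_sspan_le /=.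
have [t [et it ht]] := frame_exists (fdim_sspan s).
have e' : sspan (v :: s) = sspan (v :: t) by rewrite !sspan_cons ht.
rewrite -ltnS -e e' dimn_sspan /= ?et //.
by split=> //; rewrite ht.
Qed.

Lemma indep_perm s t : perm_eq s t -> indep s -> indep t.
Proof.
by move=> st; rewrite !indep_dimnP (perm_size st) (eq_sspan (perm_mem st)).
Qed.

Lemma indep_subset s t : indep s -> uniq t -> {subset t <= s} -> indep t.
Proof.
move=> is_ ut ts; have us := indep_uniq is_.
apply: (@indep_perm [seq x <- s | x \in t]); last exact: indep_filter.
apply: uniq_perm => //; first exact: filter_uniq.
move=> x; rewrite mem_filter; case: (boolP (x \in t)) => //= xt.
exact: ts.
Qed.

Lemma spanning_finite S s : (forall v, v \in s -> lin_span S v) ->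
  exists t, (forall v, v \in t -> S v) /\ forall v, v \in s -> sspan t v.
Proof.
elim: s => [|v s IH] h; first by exists [::].
have [|t [tS ts]] := IH; first by move=> u us; apply: h; rewrite inE us orbT.
have [r [_ rS rv]] := span_finite (h v (mem_head _ _)).
exists (r ++ t); split; first by move=> u; rewrite mem_cat => /orP [/rS|/tS].
move=> u; rewrite inE sspan_cat => /orP [/eqP ->|/ts ut].
  by apply: sub_suml => //; apply: subspace_sspan.
by apply: sub_sumr => //; apply: subspace_sspan.
Qed.

Lemma fdim_spanning S X : fdim X -> X `<=` lin_span S ->
  exists t, (forall v, v \in t -> S v) /\ X `<=` sspan t.
Proof.
move=> /frame_exists [s [_ is_ <-]] h.
have [|t [tS ts]] := @spanning_finite S s; first by move=> v /mem_sspan /h.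
by exists t; split=> //; apply: sspan_min => //; apply: subspace_sspan.
Qed.

End IndepPerm.

Section Stages.
Variables (K : fieldType) (V : lmodType K).
Implicit Types (A B C Y : set V) (F G : set (set V)) (s : set V -> set V).

Definition chain F := (forall A, F A -> is_subspace A) /\ total_on F (fun A B => A `<=` B).

(** A way of cutting F into a finite part, its traces on Y, and a part left unchanged,
    its traces on the complement C. *)
Definition is_stage F Y C :=
  [/\ fdim Y, is_subspace C, Y `&` C `<=` [set 0], sum_sub Y C = setT &
      forall A, F A -> A `<=` sum_sub (A `&` Y) (A `&` C)].

(** A flag in Y of the type of the flag induced by F. It is encoded as a function of
    the spaces of F, not as a list, because this function directly gives the bijection
    between F and the generalized flag that it defines. *)
Definition deformation F Y s :=
  (forall A, F A -> [/\ is_subspace (s A), s A `<=` Y & dimn (s A) = dimn (A `&` Y)]) /\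
  forall A B, F A -> F B -> A `<=` B -> s A `<=` s B.

(** The space that replaces A: changed inside Y, kept along C. *)
Definition deform C s A := sum_sub (s A) (A `&` C).

Lemma stage_sub F F' Y C : F' `<=` F -> is_stage F Y C -> is_stage F' Y C.
Proof. by move=> FF [h1 h2 h3 h4 h5]; split=> // A /FF; apply: h5. Qed.

Lemma deformation_sub F F' Y s : F' `<=` F -> deformation F Y s -> deformation F' Y s.
Proof.
by move=> FF [h1 h2]; split=> [A /FF /h1 //|A B /FF FA /FF FB]; apply: h2.
Qed.

Lemma chain_sub F F' : F' `<=` F -> chain F -> chain F'.
Proof. by move=> FF [h1 h2]; split=> [A /FF /h1 //|A B /FF FA /FF FB]; apply: h2. Qed.

Lemma gflag_chain F : generalized_flag F -> chain F.
Proof. by case. Qed.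

Lemma direct_uniq Y C u v u' v' : is_subspace Y -> is_subspace C -> Y `&` C `<=` [set 0] ->
  Y u -> C v -> Y u' -> C v' -> u + v = u' + v' -> u = u' /\ v = v'.
Proof.
move=> sY sC d Yu Cv Yu' Cv' e.
have e' : u - u' = v' - v.
  have -> : u = u' + v' - v by rewrite -e addrK.
  by rewrite -[u' + v' - v]addrA [u' + _]addrC addrK.
have : [set 0] (u - u').
  by apply: d; split; [apply: subspaceB|rewrite e'; apply: subspaceB].
move=> h; split; apply/eqP; first by rewrite -subr_eq0 h.
by rewrite eq_sym -subr_eq0 -e' h.
Qed.

Section Fixed.
Variables (F : set (set V)) (Y C : set V).
Hypotheses (cF : chain F) (st : is_stage F Y C).

Let fY : fdim Y. Proof. by case: st. Qed.
Let sC : is_subspace C. Proof. by case: st. Qed.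
Let dYC : Y `&` C `<=` [set 0]. Proof. by case: st. Qed.
Let sF A : F A -> is_subspace A. Proof. by case: cF => h _; apply: h. Qed.
Let sY : is_subspace Y := fdim_subspace fY.

Lemma trace_fdim A : F A -> fdim (A `&` Y).
Proof. by move=> FA; apply: (fdim_sub fY) => //; apply: subspaceI => //; apply: sF. Qed.

Lemma trace_chain A B : F A -> F B -> A `&` Y `<=` B `&` Y \/ B `&` Y `<=` A `&` Y.
Proof. by move=> FA FB; case: (cF.2 A B FA FB) => h; [left|right]; apply: setSI. Qed.

Variable (s : set V -> set V).
Hypothesis (ds : deformation F Y s).

Let ssub A : F A -> is_subspace (s A). Proof. by move=> FA; case: (ds.1 A FA). Qed.
Let sAY A : F A -> s A `<=` Y. Proof. by move=> FA; case: (ds.1 A FA). Qed.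
Let sdim A : F A -> dimn (s A) = dimn (A `&` Y). Proof. by move=> FA; case: (ds.1 A FA). Qed.

Lemma deformation_fdim A : F A -> fdim (s A).
Proof. by move=> FA; apply: (fdim_sub fY); [apply: ssub|apply: sAY]. Qed.

Lemma deformation_chain A B : F A -> F B -> s A `<=` s B \/ s B `<=` s A.
Proof. by move=> FA FB; case: (cF.2 A B FA FB) => h; [left|right]; apply: ds.2. Qed.

Lemma deformation_le A B : F A -> F B ->
  (dimn (A `&` Y) <= dimn (B `&` Y))%N -> s A `<=` s B.
Proof.
move=> FA FB h; apply: chain_dimn_le; rewrite ?sdim //; try exact: deformation_fdim.
exact: deformation_chain.
Qed.

Lemma deformation_eq A B : F A -> F B -> dimn (A `&` Y) = dimn (B `&` Y) -> s A = s B.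
Proof. by move=> FA FB h; apply/seteqP; split; apply: deformation_le; rewrite ?h. Qed.

Lemma trace_le A B : F A -> F B ->
  (dimn (A `&` Y) <= dimn (B `&` Y))%N -> A `&` Y `<=` B `&` Y.
Proof.
by move=> FA FB h; apply: chain_dimn_le => //; [exact: trace_fdim|exact: trace_fdim|exact: trace_chain].
Qed.

Lemma deform_subspace A : F A -> is_subspace (deform C s A).
Proof.
by move=> FA; apply: subspace_sum_sub; [apply: ssub|apply: subspaceI => //; apply: sF].
Qed.

Lemma deform_capY A : F A -> deform C s A `&` Y = s A.
Proof.
move=> FA; rewrite /deform sum_subI //; last exact: sAY.
suff -> : A `&` C `&` Y = [set 0] by rewrite sum_sub0.
apply/seteqP; split; first by move=> v [[_ Cv] Yv]; apply: dYC.
by apply: set0_sub; apply: subspaceI => //; apply: subspaceI => //; apply: sF.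
Qed.

Lemma deform_capC A : F A -> deform C s A `&` C = A `&` C.
Proof.
move=> FA; rewrite /deform sum_subC sum_subI //.
suff -> : s A `&` C = [set 0] by rewrite sum_sub0.
apply/seteqP; split; first by move=> v [/sAY Yv Cv]; apply: dYC; split=> //; apply: Yv.
by apply: set0_sub; apply: subspaceI => //; apply: ssub.
Qed.

Lemma deform_mono A B : F A -> F B -> A `<=` B -> deform C s A `<=` deform C s B.
Proof. by move=> FA FB AB; apply: sum_sub_mono; [apply: ds.2|apply: setSI]. Qed.

Lemma deform_reflect A B : F A -> F B -> deform C s A `<=` deform C s B -> A `<=` B.
Proof.
move=> FA FB h; case: (cF.2 A B FA FB) => // BA.
case: st => _ _ _ _ /(_ A FA) hA; apply: (subset_trans hA); apply: sum_sub_min; first exact: sF.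
  have sAB : s A `<=` s B by rewrite -!deform_capY //; apply: setSI.
  have hd : (dimn (A `&` Y) <= dimn (B `&` Y))%N.
    by rewrite -!sdim //; apply: dimn_sub => //; [exact: deformation_fdim|exact: ssub].
  by move=> v /(trace_le FA FB hd) [].
by rewrite -(deform_capC FA) => v [/h hv Cv]; have : (deform C s B `&` C) v by []; rewrite deform_capC // => -[].
Qed.

Lemma deform_inj A B : F A -> F B -> deform C s A = deform C s B -> A = B.
Proof. by move=> FA FB e; apply/seteqP; split; apply: deform_reflect; rewrite // e. Qed.

Lemma mem_deform A y c : F A -> Y y -> C c -> deform C s A (y + c) <-> s A y /\ A c.
Proof.
move=> FA Yy Cc; split=> [[a sa [b [Ab Cb] e]]|[sy Ac]].
  by have [<- <-] := direct_uniq sY sC dYC (sAY FA sa) Cb Yy Cc e.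
by exists y => //; exists c.
Qed.

End Fixed.

Section GeneralizedFlagDeformation.
Variables (F : set (set V)).
Hypothesis (gF : generalized_flag F).
Let cF := gflag_chain gF.

Lemma gflag_mem v : v <> 0 -> exists A B, [/\ successor F A B, B v & ~ A v].
Proof.
case: gF => _ _ _ h v0.
have : [set v | v <> 0] v by []. rewrite h => -[A [B [sAB [Bv nAv]]]].
by exists A, B.
Qed.

Lemma gflag_covers_seq (w : V) (t : seq V) : w <> 0 -> exists2 A, F A & forall v, v \in t -> A v.
Proof.
move=> w0; elim: t => [|v t [A FA hA]].
  by have [_ [B [[_ FB _ _] _ _]]] := gflag_mem w0; exists B.
case: (eqVneq v 0) => [->|/eqP v0].
  exists A => // u; rewrite inE => /orP [/eqP ->|/hA //].
  exact: (subspace0 (cF.1 _ FA)).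
have [_ [B [[_ FB _ _] Bv _]]] := gflag_mem v0.
case: (cF.2 A B FA FB) => h.
  by exists B => // u; rewrite inE => /orP [/eqP ->|/hA /h].
by exists A => // u; rewrite inE => /orP [/eqP ->|/hA //]; apply: h.
Qed.

Lemma gflag_covers (w : V) Y : w <> 0 -> fdim Y -> exists2 A, F A & Y `<=` A.
Proof.
move=> w0 /frame_exists [t [_ _ <-]]; have [A FA hA] := gflag_covers_seq t w0.
by exists A => //; apply: sspan_min => //; apply: cF.1.
Qed.

Lemma gflag_avoids (w : V) Y : w <> 0 -> fdim Y -> exists2 A, F A & A `&` Y = [set 0].
Proof.
move=> w0 fY; have sY := fdim_subspace fY.
have [n [[A FA dA] hn]] : exists n, (exists2 A, F A & dimn (A `&` Y) = n) /\
    forall m, (exists2 A, F A & dimn (A `&` Y) = m) -> (n <= m)%N.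
  apply: nat_min; have [A [_ [[FA _ _ _] _ _]]] := gflag_mem w0.
  by exists (dimn (A `&` Y)), A.
exists A => //; apply/seteqP; split; last by apply: set0_sub; apply: subspaceI => //; apply: cF.1.
move=> u [Au Yu]; apply: contrapT => u0.
have [B [_ [[FB _ _ _] _ nBu]]] := gflag_mem u0.
have BA : B `<=` A.
  by case: (cF.2 A B FA FB) => // h; case: nBu; apply: h.
have fA : fdim (A `&` Y) by apply: (fdim_sub fY) => //; apply: subspaceI => //; apply: cF.1.
have hd := hn _ (ex_intro2 _ _ B FB erefl); rewrite -dA in hd.
have sBY : is_subspace (B `&` Y) by apply: subspaceI => //; apply: cF.1.
have := dimn_sub_eq fA sBY (setSI BA) hd.
by move=> e; have : (A `&` Y) u by []; rewrite -e => -[].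
Qed.

Variables (Y C : set V) (s : set V -> set V).
Hypotheses (st : is_stage F Y C) (ds : deformation F Y s).

(* The spaces A with y in s A are those whose trace contains that of A0, the smallest of
   them, and a vector z is chosen in the gap of F just below A0. *)
Let deformation_test y : Y y -> y <> 0 -> exists z, z <> 0 /\ forall A, F A -> s A y <-> A z.
Proof.
move=> Yy y0; have fY : fdim Y by case: st.
have sY := fdim_subspace fY.
have [n [[A0 [FA0 sy] dA0] hn]] : exists n, (exists2 A, F A /\ s A y & dimn (A `&` Y) = n) /\
    forall m, (exists2 A, F A /\ s A y & dimn (A `&` Y) = m) -> (n <= m)%N.
  apply: nat_min; have [A FA YA] := gflag_covers y0 fY.
  exists (dimn (A `&` Y)), A => //; split=> //.
  have [sA sAY sd] := ds.1 A FA.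
  have e : A `&` Y = Y by apply/seteqP; split=> // v Yv; split=> //; apply: YA.
  by rewrite (@dimn_sub_eq _ _ (s A) Y fY sA sAY) // sd e.
have n0 : (0 < n)%N.
  rewrite lt0n; apply/eqP => n0; apply: y0.
  have [_ _ sd] := ds.1 A0 FA0.
  by have := dimn_eq0 (deformation_fdim st ds FA0); rewrite sd dA0 => /(_ n0) e; rewrite e in sy.
have [m [[[A1 FA1 dA1] ltm] hm]] : exists m, ((exists2 A, F A & dimn (A `&` Y) = m) /\ (m < n)%N) /\
    forall m', ((exists2 A, F A & dimn (A `&` Y) = m') /\ (m' < n)%N) -> (m' <= m)%N.
  apply: (@nat_max _ n); last by move=> m' [_ /ltnW].
  have [A FA eA] := gflag_avoids y0 fY.
  by exists 0%N; split=> //; exists A => //; rewrite eA dimn0.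
have [z [A0z Yz] nz] : exists2 z, (A0 `&` Y) z & ~ (A1 `&` Y) z.
  apply: not_subset_exists => h.
  have := dimn_sub (trace_fdim cF st FA1) (subspaceI (cF.1 _ FA0) sY) h.
  by rewrite dA0 dA1 leqNgt ltm.
exists z; split=> [z0|A FA].
  by apply: nz; rewrite z0; apply: (subspace0 (subspaceI (cF.1 _ FA1) sY)).
split=> [sAy|Az].
  have h : (dimn (A0 `&` Y) <= dimn (A `&` Y))%N.
    by rewrite dA0; apply: hn; exists A.
  by have [] := trace_le cF st FA0 FA h (conj A0z Yz).
apply: (deformation_le cF st ds FA0 FA) => //.
rewrite dA0 leqNgt; apply/negP => lt.
have h := hm _ (conj (ex_intro2 _ _ A FA erefl) lt).
by rewrite -dA1 in h; apply: nz; apply: (trace_le cF st FA FA1 h).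
Qed.

(** Condition (ii) of generalized flags says that each nonzero vector lies in the gap
    between two consecutive spaces. It carries over to the deformed flag because v can
    be traded for a vector z that lies in the same spaces before deformation. With
    v = y + c in Y + C, one takes c or a vector found for y, whichever lies in fewer
    spaces of F. *)
Lemma deform_test v : v <> 0 -> exists z, z <> 0 /\ forall A, F A -> deform C s A v <-> A z.
Proof.
move=> v0; have [fY sC dYC sYC _] := st.
have sY := fdim_subspace fY.
have : [set: V] v by []. rewrite -sYC => -[y Yy [c Cc e]].
have hm A : F A -> deform C s A v <-> s A y /\ A c.
  by move=> FA; rewrite -e; exact: (mem_deform st ds FA Yy Cc).
case: (pselect (y = 0)) => [y0|y0].
  exists c; split=> [c0|A FA]; first by apply: v0; rewrite -e y0 c0 addr0.
  rewrite hm //; split=> [[]//|Ac]; split=> //; rewrite y0; apply: subspace0.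
  by case: (ds.1 A FA).
have [z [z0 hz]] := deformation_test Yy y0.
case: (pselect (forall A, F A -> A z -> A c)) => h.
  exists z; split=> // A FA; rewrite hm // hz //; split=> [[]//|Az]; split=> //; exact: h.
have [A1 FA1 [zA1 nc]] : exists2 A, F A & A z /\ ~ A c.
  apply: contrapT => h'; apply: h => A FA Az; apply: contrapT => nc.
  by apply: h'; exists A.
have h' A : F A -> A c -> A z.
  move=> FA Ac; case: (cF.2 A A1 FA FA1) => AA; last exact: AA.
  by case: nc; apply: AA.
exists c; split=> [c0|A FA].
  by apply: nc; rewrite c0; apply: (subspace0 (cF.1 _ FA1)).
rewrite hm // hz //; split=> [[]//|Ac]; split=> //; exact: h'.
Qed.

Lemma deform_successor A B :
  successor F A B -> successor (deform C s @` F) (deform C s A) (deform C s B).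
Proof.
move=> [FA FB [AB nBA] h]; split; [by exists A|by exists B| |].
  split; first exact: (deform_mono ds).
  by move=> /(deform_reflect cF st ds FB FA).
move=> _ [D FD <-] [h1 h2] [h3 h4].
have AD := deform_reflect cF st ds FA FD h1.
have DB := deform_reflect cF st ds FD FB h3.
apply: (h D FD); split=> // h'.
  by apply: h2; apply: (deform_mono ds).
by apply: h4; apply: (deform_mono ds).
Qed.

Lemma deform_gflag : generalized_flag (deform C s @` F).
Proof.
split.
- by move=> _ [A FA <-]; apply: (deform_subspace cF st ds).
- move=> _ _ [A FA <-] [B FB <-].
  by case: (cF.2 A B FA FB) => h; [left|right]; apply: (deform_mono ds).
- move=> _ [A FA <-]; case: gF => _ _ /(_ A FA) [B [h|h]] _; exists (deform C s B).
    by left; apply: deform_successor.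
  by right; apply: deform_successor.
apply/seteqP; split=> v /=; last first.
  move=> [_ [_ [[[A FA <-] _ _ _] [_ nv]]]] v0; apply: nv; rewrite v0.
  exact: (subspace0 (deform_subspace cF st ds FA)).
move=> v0; have [z [z0 hz]] := deform_test v0.
have [A [B [sAB Bz nAz]]] := gflag_mem z0.
have [FA FB _ _] := sAB.
exists (deform C s A), (deform C s B); split; first exact: deform_successor.
by split; [apply/(hz _ FB)|move=> /(hz _ FA)].
Qed.

End GeneralizedFlagDeformation.
End Stages.

(** * Commensurability and deformations *)

Section Commensurability.
Variables (K : fieldType) (V : lmodType K) (E : set V).
Hypothesis bE : is_basis E setT.
Implicit Types (A B C D Y : set V) (F G : set (set V)) (s : set V -> set V).

Variable F : set (set V).
Hypotheses (gF : generalized_flag F) (spF : forall A, F A -> spanned E A).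
Let cF := gflag_chain gF.

Lemma basis_neq0 e : E e -> e <> 0.
Proof.
move=> Ee e0; have := basis_indep bE (s := [:: e]); rewrite /= sspan_nil.
by case=> // u; rewrite inE => /eqP ->.
Qed.

Lemma finite_span_fdim D : finite_set D -> fdim (lin_span D).
Proof. by move=> /finite_seqP [t ->]; apply: fdim_sspan. Qed.

Lemma basis_stage D : finite_set D -> D `<=` E -> is_stage F (lin_span D) (lin_span (E `\` D)).
Proof.
move=> fD DE; have [h1 h2] := span_basis_complement bE DE; split=> //.
- exact: finite_span_fdim.
- exact: subspace_span.
- by move=> A FA; rewrite -spanned_split //; apply: spF.
Qed.

Lemma compl_span A D : D `<=` E -> spanned E A ->
  A `&` lin_span (E `\` D) = lin_span (A `&` (E `\` D)).
Proof.
move=> DE sA; have h : spanned E (A `&` lin_span (E `\` D)).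
  by apply: spannedI => //; apply: spanned_span => // e [].
apply/seteqP; split; last first.
  apply: span_min.
    by apply: subspaceI; [apply: spanned_subspace sA|apply: subspace_span].
  by move=> e [Ae h']; split=> //; apply: sub_span.
rewrite -{1}h; apply: span_mono => e [[Ae he] Ee]; split=> //.
by apply: (span_basis_mem bE _ Ee he) => // u [].
Qed.

(** A basis of lin_span D adapted to the deformed flag, completed by the vectors of E
    outside D, is compatible with it; only finitely many vectors of E are lost. *)
Lemma deform_commensurable D s : finite_set D -> D `<=` E ->
  deformation F (lin_span D) s ->
  commensurable E F (deform (lin_span (E `\` D)) s @` F).
Proof.
move=> fD DE ds; have st := basis_stage fD DE.
set Y := lin_span D in ds st *; set C := lin_span (E `\` D) in st *.
have [fY sC dYC sYC _] := st; have sY := fdim_subspace fY.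
split=> //.
- exact: (deform_gflag gF st ds).
- exists E; split=> //; first by move=> A FA; apply: spanned_basis => //; apply: spF.
  by rewrite setIid setDv; apply: finite_set0.
- have [t [it ht hA]] : exists t, [/\ indep t, sspan t = Y &
      forall B, (s @` F) B -> B = sspan [seq v <- t | `[< B v >]]].
    apply: adapted_frame_exists => //.
      by move=> _ [A FA <-]; case: (ds.1 A FA).
    by move=> _ _ [A FA <-] [B FB <-]; apply: (deformation_chain cF ds).
  pose L : set V := [set` t] `|` (E `\` D).
  have bL : is_basis L setT.
    apply/is_basisP; split; last by rewrite /L span_setU -/(sspan t) ht.
    move=> r ur rL.
    apply: (@indep_perm _ _ ([seq v <- r | v \in t] ++ [seq v <- r | v \notin t])).
      by apply/permPl; apply: perm_filterC.
    apply/indep_cat; split.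
    + apply: (indep_subset it); first exact: filter_uniq.
      by move=> v; rewrite mem_filter => /andP [].
    + apply: (basis_indep bE); first exact: filter_uniq.
      move=> v; rewrite mem_filter => /andP [nt /rL [/= vt|[]//]].
      by rewrite vt in nt.
    + move=> v [h1 h2]; apply: dYC; split.
        rewrite -ht; move: v h1 {h2}; apply: sspan_mono => v.
        by rewrite mem_filter => /andP [].
      move: v h2 {h1}; apply: sspan_min => // v; rewrite mem_filter => /andP [nt /rL [/= vt|]].
        by rewrite vt in nt.
      exact: sub_span.
  exists L; split=> //.
    move=> _ [A FA <-]; apply: spanned_basis => //.
    have sd := deform_subspace cF st ds FA.
    apply/seteqP; split; first by apply: span_min => // v [].
    apply: sum_sub_min; first exact: subspace_span.
      rewrite {1}(hA (s A)); last by exists A.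
      apply: span_mono => v /=; rewrite mem_filter => /andP [/asboolP sv vt].
      split; last by left.
      apply: sub_suml => //; apply: subspaceI => //; exact: cF.1.
    rewrite compl_span //; last exact: spF.
    apply: span_mono => v [Av Ev]; split; last by right.
    apply: sub_sumr; first by case: (ds.1 A FA).
    by split=> //; apply: sub_span.
  apply: sub_finite_set fD => e [Ee nL]; apply: contrapT => nD; apply: nL.
  by split=> //; right.
exists (deform C s), Y; split.
- split; first by move=> A FA; exists A.
    by move=> A B /set_mem FA /set_mem FB; apply: (deform_inj cF st ds).
  by move=> _ [A FA <-]; exists A.
- by move=> A B FA FB; apply: (deform_mono ds).
- by split=> //; exact: fY.
- move=> A FA; have [sA sAY sd] := ds.1 A FA.
  have sAC : is_subspace (A `&` C) by apply: subspaceI => //; apply: cF.1.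
  split.
  + case: st => _ _ _ _ /(_ A FA) h; apply: (subset_trans h); rewrite sum_subC.
    by apply: sum_sub_mono; [apply: sub_sumr|move=> v []].
  + by rewrite sum_subC; apply: sum_sub_mono => // v [].
  + exists (dimn (A `&` Y)); rewrite (deform_capY cF st ds FA) -{2}sd.
    by split; apply: has_dim_dimn; [apply: (trace_fdim cF st)|apply: (deformation_fdim st ds)].
Qed.

Lemma finite_basis_stage (Dn : nat -> set V) (t : seq V) :
  (forall n, Dn n `<=` Dn n.+1) -> E `<=` \bigcup_n Dn n -> (forall v, v \in t -> E v) ->
  exists n, forall m, (n <= m)%N -> forall v, v \in t -> Dn m v.
Proof.
move=> inc ED; have inc' n m : (n <= m)%N -> Dn n `<=` Dn m.
  move=> /subnK <-; elim: (m - n)%N => [//|k IH]; exact: subset_trans (inc _).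
elim: t => [|v t IH] tE; first by exists 0%N.
have [|n hn] := IH; first by move=> u us; apply: tE; rewrite inE us orbT.
have [k _ Dk] := ED v (tE v (mem_head _ _)).
exists (maxn n k) => m; rewrite geq_max => /andP [nm km] u.
rewrite inE => /orP [/eqP ->|]; first exact: (inc' _ _ km).
exact: hn.
Qed.

(** Let the stage be large enough to contain U, the vectors of E missing from a basis L
    compatible with G, and those needed to write U in terms of L. The other vectors of E
    then belong to L, and such a vector lies in A iff it lies in phi A, since both
    spaces differ only within U. *)
Lemma commensurable_deform (Dn : nat -> set V) G :
  (forall n, Dn n `<=` Dn n.+1) -> E `<=` \bigcup_n Dn n ->
  (forall n, finite_set (Dn n) /\ Dn n `<=` E) -> commensurable E F G ->
  exists n0, forall n, (n0 <= n)%N -> exists s,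
    deformation F (lin_span (Dn n)) s /\ G = deform (lin_span (E `\` Dn n)) s @` F.
Proof.
move=> inc ED hD [_ gG _ [L [bL cL finL]] [phi [U [[bij1 bij2 bij3] mono [sU fU] hphi]]]].
have cG := gflag_chain gG.
have spL B : G B -> lin_span (B `&` L) = B by move=> GB; case: (cL B GB).
have Gphi A : F A -> G (phi A) by move=> FA; apply: bij1.
have [lu [luL Ulu]] : exists t, (forall v, v \in t -> L v) /\ U `<=` sspan t.
  by apply: fdim_spanning => //; rewrite bL.2.
have [eu [euE Ueu]] : exists t, (forall v, v \in t -> E v) /\ U `<=` sspan t.
  by apply: fdim_spanning => //; rewrite bE.2.
have [d hd] := (finite_seqP _).1 finL.
have [|n0 hn0] := @finite_basis_stage Dn (eu ++ [seq v <- lu | `[< E v >]] ++ d) inc ED.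
  move=> v; rewrite !mem_cat => /orP [/euE //|/orP [|vd]].
    by rewrite mem_filter => /andP [/asboolP].
  by have : [set` d] v by []; rewrite -hd => -[].
exists n0.
move=> n /hn0 {}hn0.
have [fD DE] := hD n; have st := basis_stage fD DE.
have [fX sC dXC sXC splitF] := st.
set X := lin_span (Dn n) in st fX dXC sXC splitF *.
set C := lin_span (E `\` Dn n) in st sC dXC sXC splitF *.
have sX := fdim_subspace fX.
have UX : U `<=` X.
  apply: (subset_trans Ueu); apply: span_mono => v vt; apply: hn0.
  by rewrite mem_cat vt.
have luD v : v \in lu -> E v -> Dn n v.
  move=> vl Ev; apply: hn0; rewrite !mem_cat mem_filter vl asboolT //= orbT //.
have ELD e : E e -> ~ Dn n e -> L e.
  move=> Ee nD; apply: contrapT => nL; apply: nD; apply: hn0.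
  suff : e \in d by rewrite !mem_cat => ->; rewrite !orbT.
  have : (E `\` (E `&` L)) e by split=> // -[].
  by rewrite hd.
have hC A : F A -> A `&` C `<=` phi A.
  move=> FA; have sphi := cG.1 _ (Gphi A FA).
  rewrite compl_span //; last exact: spF.
  apply: span_min => // e [Ae [Ee nD]].
  have [h _ _] := hphi A FA.
  have : lin_span ((phi A `&` L) `|` [set` lu]) e.
    rewrite span_setU spL; last exact: Gphi.
    by apply: (sum_sub_mono (@subset_refl _ _) Ulu); apply: h.
  move=> /(span_basis_mem bL _ (ELD e Ee nD)) [|[]//|/= el].
    by move=> v [[]//|/= /luL].
  by case: nD; apply: luD.
have splitG A : F A -> phi A = sum_sub (phi A `&` X) (A `&` C).
  move=> FA; have sphi := cG.1 _ (Gphi A FA).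
  have [_ h _] := hphi A FA.
  apply/seteqP; split; last exact: (sum_sub_min sphi (@subIsetl _ _ _) (hC A FA)).
  move=> v hv; have [a Aa [u Uu e]] := h v hv.
  have [a1 [A1 X1] [a2 [A2 C2] e2]] := splitF A FA a Aa.
  have h2 : phi A a2 by apply: (hC A FA).
  have e3 : v = (a1 + u) + a2 by rewrite -e -e2 addrAC.
  exists (a1 + u); last by exists a2 => //; rewrite e3.
  split; first by rewrite -(addrK a2 (a1 + u)) -e3; apply: (subspaceB sphi).
  by apply: (subspaceD sX) => //; apply: UX.
have dims A : F A -> dimn (phi A `&` X) = dimn (A `&` X).
  move=> FA; have sphi := cG.1 _ (Gphi A FA); have sA := cF.1 _ FA.
  have [h1 h2 [k [hk1 hk2]]] := hphi A FA.
  have f1 : fdim (phi A `&` X) by apply: (fdim_sub fX) => //; apply: subspaceI.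
  have f2 : fdim (A `&` X) by apply: (fdim_sub fX) => //; apply: subspaceI.
  have e : sum_sub (phi A `&` X) U = sum_sub (A `&` X) U.
    rewrite ![sum_sub (_ `&` X) _]sum_subC -!sum_subI //; congr (_ `&` X).
    rewrite ![sum_sub U _]sum_subC; apply/seteqP; split.
      exact: (sum_sub_min (subspace_sum_sub sA sU) h2 (sub_sumr sA)).
    exact: (sum_sub_min (subspace_sum_sub sphi sU) h1 (sub_sumr sphi)).
  have eI B : B `&` X `&` U = B `&` U.
    by apply/seteqP; split=> [v [[]]//|v [Bv Uv]]; split=> //; split=> //; apply: UX.
  have := dimn_sum f1 fU; rewrite e eI (dimnE hk2).
  have := dimn_sum f2 fU; rewrite eI (dimnE hk1) => -> /eqP.
  by rewrite eqn_add2r => /eqP.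
exists (fun A => phi A `&` X); split.
  split=> [A FA|A B FA FB AB]; last by apply: setSI; apply: mono.
  split=> //; last exact: dims.
  by apply: subspaceI => //; apply: cG.1; apply: Gphi.
apply/seteqP; split=> B.
  by move=> GB; have [A FA <-] := bij3 B GB; exists A => //; rewrite [RHS]splitG.
by move=> [A FA <-]; rewrite /deform -splitG //; apply: Gphi.
Qed.

End Commensurability.

(** * Flags of the type induced by a generalized flag *)

Section Lists.
Variables (K : fieldType) (V : lmodType K).
Implicit Types (A B : set V) (Q : set (set V)) (s t : seq (set V)).

Lemma lists_uniq Q s t : lists Q s -> lists Q t -> s = t.
Proof.
pose lt A B := `[< A `<` B >].
have lt_trans : transitive lt.
  move=> B A C /asboolP [AB nBA] /asboolP [BC nCB]; apply/asboolP; split.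
    exact: subset_trans BC.
  by move=> CA; apply: nBA; apply: subset_trans CA.
have lt_irr : irreflexive lt by move=> A; apply/negP => /asboolP [].
have srt r : (forall i j, (i < j < size r)%N -> nth set0 r i `<` nth set0 r j) -> sorted lt r.
  move=> h; rewrite (sorted_pairwise lt_trans); apply/(pairwiseP set0) => i j hi hj ij.
  by apply/asboolP; apply: h; rewrite ij.
have memr r A : A \in r <-> exists2 i, (i < size r)%N & A = nth set0 r i.
  split=> [/(nthP set0) [i hi <-]|[i hi ->]]; first by exists i.
  exact: mem_nth.
move=> [/srt ss hs] [/srt st ht].
apply: (irr_sorted_eq lt_trans lt_irr ss st) => A.
by apply/idP/idP => [/memr /hs /ht /memr|/memr /ht /hs /memr].
Qed.

Lemma listingE Q s : lists Q s -> listing Q = s.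
Proof. by move=> h; apply: (@lists_uniq Q) => //; apply: (xgetPex [::]); exists s. Qed.

End Lists.

Section TypedFlags.
Variables (K : fieldType) (V : lmodType K).
Implicit Types (A B C Y : set V) (F : set (set V)) (t : seq (set V)).

(** ms is the type of the flag induced by F in the d-dimensional space Y; the dimensions
    0 and d may or may not occur among the traces. *)
Definition typed F Y d ms :=
  [/\ has_dim Y d, path ltn 0%N ms, forall m, m \in ms -> (m <= d)%N,
      forall A, F A -> dimn (A `&` Y) \in 0%N :: rcons ms d &
      forall m, m \in ms -> exists2 A, F A & dimn (A `&` Y) = m].

(** The space of the flag t, completed by 0 and Y, that has the dimension of the trace
    of A. *)
Definition flag_fun Y d ms t A : set V :=
  flag_term Y t (index (dimn (A `&` Y)) (0%N :: rcons ms d)).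

Definition space_of_rank F Y m : set V := xget set0 [set A | F A /\ dimn (A `&` Y) = m].

Definition flag_list F Y ms (s : set V -> set V) : seq (set V) :=
  [seq s (space_of_rank F Y m) | m <- ms].

Lemma flag_term_dim Y d ms t i : has_dim Y d -> is_flag Y ms t ->
  has_dim (flag_term Y t i) (nth d (0%N :: ms) i).
Proof.
move=> hY [st h _]; case: i => [|i] /=; first exact: has_dim0.
rewrite /flag_term /=; case: (ltnP i (size ms)) => hi.
  have [_] := h i hi; rewrite (set_nth_default Y set0) ?st //.
  by rewrite (set_nth_default d 0%N).
by rewrite !nth_default ?st.
Qed.

Lemma flag_term_mono Y d ms t i j : has_dim Y d -> is_flag Y ms t -> (i <= j)%N ->
  flag_term Y t i `<=` flag_term Y t j.
Proof.
move=> hY ft /subnK <-; elim: (j - i)%N => [//|k IH]; rewrite addSn.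
apply: (subset_trans IH); case: ft => _ _ h.
case: (leqP (k + i) (size t)) => hk; first exact: h.
by rewrite /flag_term !nth_default // ltnW.
Qed.

Lemma flag_term_chain Y d ms t i j : has_dim Y d -> is_flag Y ms t ->
  flag_term Y t i `<=` flag_term Y t j \/ flag_term Y t j `<=` flag_term Y t i.
Proof.
by move=> hY ft; case: (leqP i j) => [|/ltnW] h; [left|right]; exact: (flag_term_mono hY ft h).
Qed.

Lemma flag_term_sub Y d ms t i : has_dim Y d -> is_flag Y ms t -> flag_term Y t i `<=` Y.
Proof.
move=> hY ft; apply: (@subset_trans _ (flag_term Y t (maxn i (size t).+1))).
  exact: (flag_term_mono hY ft (leq_maxl _ _)).
by rewrite /flag_term nth_default //= leq_maxr.
Qed.

Lemma nth_index_type d ms r : r \in 0%N :: rcons ms d ->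
  nth d (0%N :: ms) (index r (0%N :: rcons ms d)) = r.
Proof.
rewrite -rcons_cons => h; rewrite -[RHS](nth_index d h) nth_rcons.
case: ltnP => // h1; rewrite nth_default //.
by case: eqP.
Qed.

Lemma index_type d ms m : path ltn 0%N ms -> m \in ms ->
  index m (0%N :: rcons ms d) = (index m ms).+1.
Proof.
move=> pm mm; rewrite /=.
have /allP/(_ m mm) m0 := order_path_min ltn_trans pm.
by rewrite -[0%N == m]/(0 == m)%N eq_sym gtn_eqF // -cats1 index_cat mm.
Qed.

Lemma type_uniq ms : path ltn 0%N ms -> uniq ms.
Proof. by move=> /path_sorted; apply: (sorted_uniq ltn_trans ltnn). Qed.

Section Fixed.
Variables (F : set (set V)) (Y C : set V) (d : nat) (ms : seq nat).
Hypotheses (cF : chain F) (st : is_stage F Y C) (tF : typed F Y d ms).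

Let hY : has_dim Y d. Proof. by case: tF. Qed.
Let fY : fdim Y. Proof. by exists d. Qed.
Let pms : path ltn 0%N ms. Proof. by case: tF. Qed.

Lemma space_of_rankP m : m \in ms ->
  F (space_of_rank F Y m) /\ dimn (space_of_rank F Y m `&` Y) = m.
Proof.
move=> mm; case: tF => _ _ _ _ /(_ m mm) [A FA dA].
by apply: (xgetPex set0 (P := [set A | F A /\ dimn (A `&` Y) = m])); exists A.
Qed.

Lemma flag_fun_deformation t : is_flag Y ms t -> deformation F Y (flag_fun Y d ms t).
Proof.
move=> ft; have hd A : F A -> has_dim (flag_fun Y d ms t A) (dimn (A `&` Y)).
  move=> FA; case: tF => _ _ _ /(_ A FA) /nth_index_type e _.
  by rewrite -[X in has_dim _ X]e; apply: flag_term_dim.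
split=> [A FA|A B FA FB AB].
  split; first exact: has_dim_subspace (hd A FA).
    by apply: (flag_term_sub hY ft).
  exact: dimnE (hd A FA).
apply: chain_dimn_le; [by exists (dimn (A `&` Y)); apply: hd|by exists (dimn (B `&` Y)); apply: hd| |].
  by rewrite /flag_fun; apply: (flag_term_chain _ _ hY ft).
rewrite (dimnE (hd A FA)) (dimnE (hd B FB)); apply: dimn_sub; last exact: setSI.
  exact: (trace_fdim cF st).
by apply: subspaceI; [apply: cF.1|apply: fdim_subspace].
Qed.

Variables (s : set V -> set V).
Hypothesis (ds : deformation F Y s).

Lemma flag_list_is_flag : is_flag Y ms (flag_list F Y ms s).
Proof.
have key i : (i < size ms)%N -> exists2 A, A = space_of_rank F Y (nth 0%N ms i) &
    [/\ F A, is_subspace (s A), s A `<=` Y & has_dim (s A) (nth 0%N ms i)].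
  move=> hi; have [FA dA] := space_of_rankP (mem_nth 0%N hi).
  have [h1 h2 h3] := ds.1 _ FA.
  exists (space_of_rank F Y (nth 0%N ms i)) => //; split=> //.
  by rewrite -[X in has_dim _ X]dA -h3; apply: has_dim_dimn; apply: (deformation_fdim st ds).
split; first by rewrite size_map.
  by move=> i hi; rewrite (nth_map 0%N) //; have [B <- []] := key i hi.
move=> i; rewrite size_map => hi; rewrite /flag_term /flag_list.
case: i hi => [|i] hi /=.
  case: (ltnP 0 (size ms)) => h0; last by rewrite nth_default ?size_map //; apply: set0_sub; apply: fdim_subspace.
  by rewrite (nth_map 0%N) //; have [B <- [_ h _ _]] := key 0%N h0; apply: set0_sub.
rewrite (nth_map 0%N) //; case: (ltnP i.+1 (size ms)) => h1; last first.
  by rewrite [nth Y _ _]nth_default ?size_map //; have [B <- []] := key i hi.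
rewrite (nth_map 0%N) //.
have [F1 d1] := space_of_rankP (mem_nth 0%N hi).
have [F2 d2] := space_of_rankP (mem_nth 0%N h1).
apply: (deformation_le cF st ds F1 F2); rewrite d1 d2; apply: ltnW.
by have /(sortedP 0%N)/(_ i h1) := path_sorted pms.
Qed.

Lemma flag_fun_list A : F A -> flag_fun Y d ms (flag_list F Y ms s) A = s A.
Proof.
move=> FA; have [h1 h2 h3] := ds.1 A FA.
rewrite /flag_fun; case: tF => _ _ _ /(_ A FA) + _.
rewrite inE mem_rcons inE => /or3P [/eqP e|/eqP e|mm].
- rewrite e /= /flag_term /=; rewrite e in h3.
  by apply/esym; apply: dimn_eq0 => //; apply: (deformation_fdim st ds).
- case: (boolP (dimn (A `&` Y) \in 0%N :: ms)) => mm; last first.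
    rewrite -rcons_cons -cats1 index_cat (negbTE mm) /= e eqxx addn0.
    rewrite /flag_term nth_default /= ?size_map //.
    by apply/esym; apply: dimn_sub_eq; rewrite // h3 e (dimnE hY).
  have {mm} [e0|mm] : dimn (A `&` Y) = 0%N \/ dimn (A `&` Y) \in ms by move: mm; rewrite in_cons => /orP [/eqP|]; [left|right].
    rewrite e0 /= /flag_term /=; rewrite e0 in h3.
    by apply/esym; apply: dimn_eq0 => //; apply: (deformation_fdim st ds).
  rewrite index_type // /flag_term /= /flag_list (nth_map 0%N) ?index_mem // nth_index //.
  have [F1 d1] := space_of_rankP mm.
  exact: (deformation_eq cF st ds).
- rewrite index_type // /flag_term /= /flag_list (nth_map 0%N) ?index_mem // nth_index //.
  have [F1 d1] := space_of_rankP mm.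
  exact: (deformation_eq cF st ds).
Qed.

Lemma lists_flag_list (Q : set (set V)) :
  (forall B, Q B <-> exists A, [/\ F A, B = s A & dimn (A `&` Y) \in ms]) ->
  lists Q (flag_list F Y ms s).
Proof.
move=> hQ; split=> [i j|B].
  rewrite size_map => /andP [ij hj]; have hi := ltn_trans ij hj.
  rewrite /flag_list !(nth_map 0%N) //.
  have [F1 d1] := space_of_rankP (mem_nth 0%N hi).
  have [F2 d2] := space_of_rankP (mem_nth 0%N hj).
  have lt : (nth 0%N ms i < nth 0%N ms j)%N.
    have := path_sorted pms; rewrite (sorted_pairwise ltn_trans) => /(pairwiseP 0%N).
    exact.
  split; first by apply: (deformation_le cF st ds F1 F2); rewrite d1 d2 ltnW.
  move=> h; have [s1 _ e1] := ds.1 _ F1; have [s2 _ e2] := ds.1 _ F2.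
  have := dimn_sub (deformation_fdim st ds F1) s2 h.
  by rewrite e1 e2 d1 d2 leqNgt lt.
rewrite hQ size_map; split=> [[A [FA -> mm]]|[i hi ->]].
  exists (index (dimn (A `&` Y)) ms); first by rewrite index_mem.
  rewrite (nth_map 0%N) ?index_mem // nth_index //.
  have [F1 d1] := space_of_rankP mm.
  exact: (deformation_eq cF st ds).
rewrite (nth_map 0%N) //; have [F1 d1] := space_of_rankP (mem_nth 0%N hi).
by exists (space_of_rank F Y (nth 0%N ms i)); split=> //; rewrite d1 mem_nth.
Qed.

End Fixed.

Lemma flag_list_fun F Y d ms t : typed F Y d ms -> is_flag Y ms t ->
  flag_list F Y ms (flag_fun Y d ms t) = t.
Proof.
move=> tF ft; have [st _ _] := ft; have [hY pms _ _ _] := tF.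
apply: (@eq_from_nth _ set0); rewrite size_map // => i hi.
rewrite (nth_map 0%N) //; have mm := mem_nth 0%N hi.
have [_ d1] := space_of_rankP tF mm.
rewrite /flag_fun d1 index_type // /flag_term /= index_uniq ?type_uniq //.
by apply: set_nth_default; rewrite st.
Qed.

Lemma flag_list_eq F Y ms s s' : (forall m, m \in ms -> exists2 A, F A & dimn (A `&` Y) = m) ->
  (forall A, F A -> s A = s' A) -> flag_list F Y ms s = flag_list F Y ms s'.
Proof.
move=> h e; apply/eq_in_map => m mm; apply: e.
have [A FA dA] := h m mm.
by case: (xgetPex set0 (P := [set A | F A /\ dimn (A `&` Y) = m])); first by exists A.
Qed.

End TypedFlags.

Section Transfer.
Variables (K : fieldType) (V : lmodType K).
Implicit Types (A B : set V).
Variables (F : set (set V)) (Y C Y' C' : set V).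
Hypotheses (cF : chain F) (st : is_stage F Y C) (st' : is_stage F Y' C').
Hypotheses (YY' : Y `<=` Y') (CC' : forall A, F A -> Y `<=` A \/ A `&` C' `<=` C).
Variables (s : set V -> set V).
Hypothesis (ds : deformation F Y s).

(** The flag induced on the larger stage by the deformed generalized flag. *)
Definition transfer A := deform C s A `&` Y'.

Let sY' : is_subspace Y'. Proof. by case: st' => /fdim_subspace. Qed.
Let sC : is_subspace C. Proof. by case: st. Qed.
Let dYC : Y `&` C `<=` [set 0]. Proof. by case: st. Qed.

Let sACY A : F A -> is_subspace (A `&` C `&` Y').
Proof. by move=> FA; do ![apply: subspaceI => //]; apply: cF.1. Qed.

Lemma transferE A : F A -> transfer A = sum_sub (s A) (A `&` C `&` Y').
Proof.
move=> FA; apply: sum_subI => //; case: (ds.1 A FA) => _ h _.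
exact: subset_trans YY'.
Qed.

Let disj A : F A -> s A `&` (A `&` C `&` Y') `<=` [set 0].
Proof.
move=> FA v [sv [[_ Cv] _]]; apply: dYC; split=> //.
by case: (ds.1 A FA) => _ h _; apply: h.
Qed.

Lemma transfer_deformation : deformation F Y' transfer.
Proof.
have fY' : fdim Y' by case: st'.
split=> [A FA|A B FA FB AB]; last by apply: setSI; apply: (deform_mono ds).
have sA := cF.1 A FA; have [h1 h2 h3] := ds.1 A FA.
have fZ : fdim (A `&` C `&` Y') by apply: (fdim_sub fY'); [apply: sACY|move=> v []].
split; [by apply: subspaceI => //; apply: (deform_subspace cF st ds)|by move=> v []|].
rewrite transferE // dimn_sum_direct //; [|exact: (deformation_fdim st ds)|exact: disj].
rewrite h3 -dimn_sum_direct //; [|exact: (trace_fdim cF st)|]; last first.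
  by move=> v [[_ Yv] [[_ Cv] _]]; apply: dYC.
congr dimn; apply/seteqP; split.
  apply: sum_sub_min; first exact: subspaceI.
    by move=> v [Av /YY'].
  by move=> v [[]].
move=> v [Av Yv]; case: st => _ _ _ _ /(_ A FA v Av) [a [Aa Ya] [c [Ac Cc] e]].
exists a => //; exists c => //; split=> //.
by apply: (subspace_addl sY' (YY' Ya)); rewrite e.
Qed.

(** The generalized flag attached to a flag does not depend on the stage at which the
    flag is read off. The complements need only be nested on the spaces that do not
    contain Y, as the others are not changed. *)
Lemma transfer_deform A : F A -> deform C' transfer A = deform C s A.
Proof.
move=> FA; have sA := cF.1 A FA; have [h1 h2 h3] := ds.1 A FA.
have sC' : is_subspace C' by case: st'.
have hd := deform_subspace cF st ds FA.
case: (CC' FA) => [YA|AC].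
  have eA : deform C s A = A.
    rewrite /deform.
    have -> : s A = A `&` Y.
      apply: dimn_sub_eq => //; first exact: (trace_fdim cF st).
        by move=> v /[dup] /h2 Yv _; split=> //; apply: YA.
      by rewrite h3.
    apply/seteqP; split; first by apply: sum_sub_min => // v [].
    by case: st => _ _ _ _ /(_ A FA).
  rewrite {1}/deform /transfer eA; apply/seteqP; split.
    by apply: sum_sub_min => // v [].
  by case: st' => _ _ _ _ /(_ A FA).
have AC' : A `&` C' `<=` deform C s A.
  by move=> v Av; apply: sub_sumr => //; split; [case: Av|apply: AC].
apply/seteqP; split; first by apply: sum_sub_min => // v [].
apply: sum_sub_min.
- by apply: subspace_sum_sub; [apply: subspaceI|apply: subspaceI].
- move=> v sv; apply: sub_suml; first exact: subspaceI.
  split; last by apply: YY'; apply: h2.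
  by apply: sub_suml => //; apply: subspaceI.
move=> v [Av Cv]; case: st' => _ _ _ _ /(_ A FA v Av) [a [Aa Ya] [c [Ac Cc] e]].
exists a; last by exists c.
split=> //; apply: sub_sumr => //; split=> //.
by apply: (subspace_addr sC (AC _ (conj Ac Cc))); rewrite e.
Qed.

End Transfer.

(** * The two shapes of a step *)

Section Steps.
Variables (K : fieldType) (V : lmodType K).
Implicit Types (A B X W : set V) (Q : set (set V)) (t : seq (set V)).

Definition strictb A B := `[< A `<` B >].

Lemma lists_pairwise Q t : pairwise strictb t -> (forall A, Q A <-> A \in t) -> lists Q t.
Proof.
move=> /(pairwiseP set0) pt hQ; split=> [i j /andP [ij hj]|A].
  by apply/asboolP; apply: pt => //; apply: ltn_trans hj.
rewrite hQ; split=> [/(nthP set0) [i hi <-]|[i hi ->]]; first by exists i.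
exact: mem_nth.
Qed.

Definition add_if (b : bool) W A := if b then sum_sub A W else A.

Lemma ext_sameE X W i t : (i <= size t)%N ->
  ext_same W i t = [seq add_if (i < j)%N W (flag_term X t j) | j <- iota 1 (size t)].
Proof.
move=> hi; rewrite -[X in iota 1 X](subnKC hi) iotaD map_cat /ext_same.
congr (_ ++ _).
  apply: (@eq_from_nth _ X); first by rewrite size_map size_iota size_take_min (minn_idPl hi).
  move=> j; rewrite size_take_min (minn_idPl hi) => hj.
  by rewrite nth_take // (nth_map 0%N) ?size_iota // nth_iota // add1n ltnS leqNgt hj.
apply: (@eq_from_nth _ X); first by rewrite !size_map size_iota size_drop.
move=> j; rewrite size_map size_drop => hj.
rewrite (nth_map X) ?size_drop // nth_drop (nth_map 0%N) ?size_iota // nth_iota //.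
by rewrite add1n addSn ltnS leq_addr.
Qed.

Lemma ext_newE X W i t : (i <= (size t).+1)%N ->
  ext_new X W i t = [seq flag_term X t j | j <- iota 1 i] ++
    [seq sum_sub (flag_term X t j) W | j <- iota i ((size t).+1 - i)].
Proof.
move=> hi; rewrite /ext_new; congr (_ ++ _).
  apply: (@eq_from_nth _ X).
    by rewrite size_map size_iota size_take_min size_rcons (minn_idPl hi).
  move=> j; rewrite size_take_min size_rcons (minn_idPl hi) => hj.
  rewrite nth_take // (nth_map 0%N) ?size_iota // nth_iota // /flag_term add1n /=.
  by rewrite nth_rcons; case: ltnP => // h; rewrite if_same nth_default.
apply: (@eq_from_nth _ X); first by rewrite !size_map size_iota size_drop.
move=> j; rewrite size_map size_drop => hj.
by rewrite (nth_map X) ?size_drop // nth_drop (nth_map 0%N) ?size_iota // nth_iota.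
Qed.

Section Existence.
Variables (F : set (set V)) (X C : set V) (d : nat) (ms : seq nat).
Hypotheses (cF : chain F) (st : is_stage F X C) (tF : typed F X d ms).

Definition rank_index A := index (dimn (A `&` X)) (0%N :: rcons ms d).

Variables (c N : set V -> Prop).
Hypotheses (c_mono : forall A B, F A -> F B -> A `<=` B -> c A -> c B).
Hypotheses (bottom : exists2 A, F A & rank_index A = 0%N /\ ~ c A).
Hypotheses (top : forall A, F A -> rank_index A = (size ms).+1 ->
  exists2 A, F A & rank_index A = (size ms).+1 /\ c A).
Hypotheses (NP : forall A, F A -> N A <->
  ~ (rank_index A = 0%N /\ ~ c A) /\ ~ (rank_index A = (size ms).+1 /\ c A)).

Let hX : has_dim X d. Proof. by case: tF. Qed.
Let pms : path ltn 0%N ms. Proof. by case: tF. Qed.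
Let fX : fdim X. Proof. by exists d. Qed.

Let rank_le A : F A -> (rank_index A <= (size ms).+1)%N.
Proof.
move=> FA; case: tF => _ _ _ /(_ A FA) + _.
by rewrite -index_mem /rank_index /= size_rcons ltnS.
Qed.

Let rank_dim A : F A -> nth d (0%N :: ms) (rank_index A) = dimn (A `&` X).
Proof. by move=> FA; case: tF => _ _ _ /(_ A FA) /nth_index_type. Qed.

Let rank_lt A B : F A -> F B -> (rank_index A < rank_index B)%N ->
  (dimn (A `&` X) < dimn (B `&` X))%N.
Proof.
move=> FA FB lt; case: tF => _ _ msd h _.
have hs : sorted leq (0%N :: rcons ms d).
  rewrite /= rcons_path; apply/andP; split.
    by apply: sub_path pms => x y /ltnW.
  have : last 0%N ms \in 0%N :: ms by apply: mem_last.
  by rewrite inE => /orP [/eqP ->|/msd].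
rewrite ltn_neqAle; apply/andP; split.
  by apply: contraTneq lt => e; rewrite /rank_index e ltnn.
rewrite -(nth_index 0%N (h A FA)) -(nth_index 0%N (h B FB)).
apply: (sorted_leq_nth leq_trans leqnn 0%N hs); rewrite ?inE ?index_mem ?h //.
exact: ltnW.
Qed.

Let realized j : (1 <= j <= size ms)%N -> exists2 A, F A & rank_index A = j.
Proof.
case: j => // j /andP [_ hj]; have mm := mem_nth 0%N hj.
case: tF => _ _ _ _ /(_ _ mm) [A FA dA]; exists A => //.
by rewrite /rank_index dA index_type // index_uniq // type_uniq.
Qed.

(** The traces on the enlarged space are obtained by adding a line W to the spaces
    with c, so they depend on the pairs (rank index, c), which form a chain; that
    chain repeats at most one index, and this decides between the two shapes. *)
Lemma step_pattern : exists i (new : bool), forall t W, is_flag X ms t ->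
  is_subspace W -> X `&` W `<=` [set 0] -> W <> [set 0] ->
  lists [set B | exists A, [/\ F A, N A & B = add_if `[< c A >] W (flag_fun X d ms t A)]]
    (if new then ext_new X W i t else ext_same W i t).
Proof.
pose R j := exists2 A, F A & rank_index A = j.
have [j0 [[A0 FA0 [rA0 nc0]] hj0]] : exists j, (exists2 A, F A & rank_index A = j /\ ~ c A) /\
    forall j', (exists2 A, F A & rank_index A = j' /\ ~ c A) -> (j' <= j)%N.
  apply: (@nat_max _ (size ms).+1); first by case: bottom => A FA [rA nc]; exists 0%N, A.
  by move=> j [A FA [<- _]]; apply: rank_le.
have cge A : F A -> c A -> (j0 <= rank_index A)%N.
  move=> FA cA; rewrite leqNgt; apply/negP; rewrite -rA0 => lt.
  case: (cF.2 A A0 FA FA0) => h; first by apply: nc0; apply: c_mono cA.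
  have := rank_lt FA FA0 lt; rewrite ltnNge; case/negP.
  apply: dimn_sub; [exact: (trace_fdim cF st)| |exact: setSI].
  by apply: subspaceI; [apply: cF.1|apply: fdim_subspace].
have ncle A : F A -> ~ c A -> (rank_index A <= j0)%N.
  by move=> FA nc; apply: hj0; exists A.
have real0 j : (0 < j <= j0)%N -> exists2 A, F A & rank_index A = j /\ ~ c A.
  move=> /andP [j1]; rewrite leq_eqVlt => /orP [/eqP ->|lt]; first by exists A0.
  have [|A FA rA] := @realized j.
    by rewrite j1 -ltnS; apply: leq_trans lt _; rewrite -rA0; apply: rank_le.
  by exists A => //; split=> // cA; have := cge A FA cA; rewrite rA leqNgt lt.
have real1 j : (j0 < j <= size ms)%N -> exists2 A, F A & rank_index A = j /\ c A.
  move=> /andP [lt hj]; have [|A FA rA] := @realized j.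
    by rewrite hj andbT; apply: leq_trans lt.
  exists A => //; split=> //; apply: contrapT => nc.
  by have := ncle A FA nc; rewrite rA leqNgt lt.
pose isnew := exists2 A, F A & rank_index A = j0 /\ c A.
have j0le : (j0 <= (size ms).+1)%N by rewrite -rA0; apply: rank_le.
exists j0, `[< isnew >] => t W ft sW XW W0.
have szt : size t = size ms by case: ft.
have strict j j' : R j -> R j' -> (j < j')%N -> flag_term X t j `<` flag_term X t j'.
  move=> [A FA rA] [B FB rB] lt; split; first exact: (flag_term_mono hX ft (ltnW lt)).
  move=> /(dimn_sub _ _) h.
  have := rank_lt FA FB; rewrite rA rB => /(_ lt).
  rewrite -(rank_dim FA) -(rank_dim FB) rA rB ltnNge; case/negP.
  have d1 := flag_term_dim j hX ft; have d2 := flag_term_dim j' hX ft.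
  rewrite -(dimnE d1) -(dimnE d2); apply: h.
    by exists (nth d (0%N :: ms) j).
  exact: has_dim_subspace d2.
have ssub j : is_subspace (flag_term X t j) := has_dim_subspace (flag_term_dim j hX ft).
have sumX j : sum_sub (flag_term X t j) W `&` X = flag_term X t j.
  rewrite sum_subI; [|exact: fdim_subspace|exact: (flag_term_sub hX ft)].
  suff -> : W `&` X = [set 0] by rewrite sum_sub0.
  by apply/seteqP; split; [rewrite setIC|apply: set0_sub; apply: subspaceI => //; apply: fdim_subspace].
have strict01 j j' : (j <= j')%N -> flag_term X t j `<` sum_sub (flag_term X t j') W.
  move=> jj; split.
    apply: subset_trans (flag_term_mono hX ft jj) _; exact: sub_suml.
  move=> h; apply: W0; apply/seteqP; split; last exact: set0_sub.
  move=> w Ww; apply: XW; split=> //; apply: (flag_term_sub hX ft); apply: h.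
  exact: sub_sumr.
have strict11 j j' : R j -> R j' -> (j < j')%N ->
    sum_sub (flag_term X t j) W `<` sum_sub (flag_term X t j') W.
  move=> Rj Rj' lt; have [s1 s2] := strict j j' Rj Rj' lt; split.
    exact: sum_sub_mono.
  by move=> h; apply: s2; rewrite -sumX -(sumX j); apply: setSI.
have N1 A : F A -> c A -> (rank_index A <= size ms)%N -> N A.
  by move=> FA cA le; apply/(NP FA); split=> [[]//|[e _]]; move: le; rewrite e ltnn.
have N0 A : F A -> ~ c A -> (0 < rank_index A)%N -> N A.
  by move=> FA cA lt; apply/(NP FA); split=> [[e _]|[]//]; move: lt; rewrite e.
case: asboolP => new.
  rewrite ext_newE ?szt //; apply: lists_pairwise.
    rewrite pairwise_cat; apply/and3P; split.
    - apply/allrelP => _ _ /mapP [j + ->] /mapP [j' + ->].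
      rewrite !mem_iota add1n ltnS => /andP [_ h1] /andP [h2 _].
      by apply/asboolP; apply: strict01; apply: leq_trans h2.
    - rewrite pairwise_map; apply: (@sub_in_pairwise _ (mem (iota 1 j0)) ltn); last 2 first.
      + by apply/allP.
      + by rewrite -(sorted_pairwise ltn_trans); apply: iota_ltn_sorted.
      have hR j : j \in iota 1 j0 -> R j.
        by rewrite mem_iota add1n ltnS => /real0 [A FA []]; exists A.
      by move=> j j' /hR h /hR h' lt; apply/asboolP; exact: (strict j j' h h' lt).
    - rewrite pairwise_map; apply: (@sub_in_pairwise _ (mem (iota j0 ((size ms).+1 - j0))) ltn); last 2 first.
      + by apply/allP.
      + by rewrite -(sorted_pairwise ltn_trans); apply: iota_ltn_sorted.
      have hR j : j \in iota j0 ((size ms).+1 - j0) -> R j.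
        rewrite mem_iota subnKC // ltnS => /andP [h1 h2].
        move: h1; rewrite leq_eqVlt => /orP [/eqP <-|lt]; first by exists A0.
        by have [|A FA []] := real1 j; [rewrite lt|exists A].
      move=> j j' /hR h /hR h' lt; apply/asboolP; exact: strict11.
  move=> B; rewrite mem_cat; split.
    move=> [A [FA NA ->]]; have [n1 n2] := (NP FA).1 NA.
    rewrite /add_if /flag_fun -/(rank_index A); case: asboolP => cA; apply/orP.
      right; apply: map_f; rewrite mem_iota cge // subnKC //.
      by rewrite ltn_neqAle rank_le // andbT; apply/eqP => e; apply: n2.
    left; apply: map_f; rewrite mem_iota add1n ltnS ncle // andbT.
    by rewrite lt0n; apply/eqP => e; apply: n1.
  move=> /orP [/mapP [j hj ->]|/mapP [j hj ->]].
    move: hj; rewrite mem_iota add1n ltnS => hj; have [A FA [rA nc]] := real0 j hj.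
    exists A; split=> //; first by apply: N0; rewrite // rA; case/andP: hj.
    by rewrite asboolF // /add_if /flag_fun -/(rank_index A) rA.
  move: hj; rewrite mem_iota subnKC // ltnS => /andP [h1 h2].
  have [A FA [rA cA]] : exists2 A, F A & rank_index A = j /\ c A.
    move: h1; rewrite leq_eqVlt => /orP [/eqP <- //|lt].
    by apply: real1; rewrite lt.
  exists A; split=> //; first by apply: N1; rewrite // rA.
  by rewrite asboolT // /add_if /flag_fun -/(rank_index A) rA.
have j0k : (j0 <= size ms)%N.
  rewrite -ltnS ltn_neqAle j0le andbT; apply/eqP => e; apply: new.
  by have [|A FA []] := top FA0; rewrite ?rA0 // -e => h1 h2; exists A.
rewrite (@ext_sameE X) ?szt //; apply: lists_pairwise.
  rewrite pairwise_map; apply: (@sub_in_pairwise _ (mem (iota 1 (size ms))) ltn); last 2 first.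
  + by apply/allP.
  + by rewrite -(sorted_pairwise ltn_trans); apply: iota_ltn_sorted.
  have hR j : j \in iota 1 (size ms) -> R j.
    by rewrite mem_iota add1n ltnS => /realized.
  move=> j j' /hR h /hR h' lt; apply/asboolP; rewrite /add_if.
  case: (ltnP j0 j) => h1; first by rewrite (ltn_trans h1 lt); apply: strict11.
  by case: ifP => _; [apply: strict01; apply: ltnW|apply: strict].
move=> B; split.
  move=> [A [FA NA ->]]; have [n1 n2] := (NP FA).1 NA.
  rewrite /flag_fun -/(rank_index A); apply/mapP; exists (rank_index A).
    rewrite mem_iota add1n; case: (pselect (c A)) => cA.
      have le := cge A FA cA.
      have lt : (j0 < rank_index A)%N.
        by rewrite ltn_neqAle le andbT; apply/eqP => e; apply: new; exists A.
      rewrite (leq_ltn_trans _ lt) //= ltn_neqAle rank_le // andbT.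
      by apply/eqP => e; apply: n2.
    rewrite ltnS (leq_trans (ncle A FA cA)) // andbT lt0n.
    by apply/eqP => e; apply: n1.
  congr add_if; apply/asboolP/idP => [cA|].
    rewrite ltn_neqAle cge // andbT; apply/eqP => e; apply: new; by exists A.
  by move=> lt; apply: contrapT => nc; have := ncle A FA nc; rewrite leqNgt lt.
move=> /mapP [j]; rewrite mem_iota add1n ltnS => /andP [h1 h2] ->.
case: (ltnP j0 j) => h.
  have [|A FA [rA cA]] := real1 j; first by rewrite h.
  exists A; split=> //; first by apply: N1; rewrite // rA.
  by rewrite asboolT // /flag_fun -/(rank_index A) rA.
have [|A FA [rA nc]] := real0 j; first by rewrite h1.
exists A; split=> //; first by apply: N0; rewrite // rA.
by rewrite asboolF // /flag_fun -/(rank_index A) rA.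
Qed.

End Existence.

(** The shape and the position of a step can be read off from t and t': their lengths
    tell the shape, and the first space of t' outside X tells the position. That space
    contains the added line, which is therefore unique. *)
Lemma std_step_uniq X W W' t t' s s1 s2 : size s = size t ->
  is_subspace X -> is_subspace W -> is_subspace W' ->
  ~ (W `<=` X) -> ~ (W' `<=` X) ->
  (forall i, (i <= size t)%N -> is_subspace (flag_term X t i) /\ flag_term X t i `<=` X) ->
  (forall A, A \in t' -> W `<=` A -> W' `<=` A -> W = W') ->
  std_step X W t t' s s1 -> std_step X W' t t' s s2 -> s1 = s2.
Proof.
move=> sz sX sW sW' WX WX' tX hW.
have step_same (U : set V) i u : exists2 j, (j <= size u)%N & ext_same U i u = ext_same U j u /\ j = minn i (size u).
  exists (minn i (size u)); first exact: geq_minr.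
  split=> //; rewrite /ext_same; case: (leqP i (size u)) => // h.
  by rewrite !take_oversize ?drop_oversize // ltnW.
have step_new U i u : exists2 j, (j <= (size u).+1)%N & ext_new X U i u = ext_new X U j u /\ j = minn i (size u).+1.
  exists (minn i (size u).+1); first exact: geq_minr.
  split=> //; rewrite /ext_new; case: (leqP i (size u).+1) => // h.
  by rewrite !take_oversize ?drop_oversize ?size_rcons // ltnW.
have szsame (U : set V) i u : size (ext_same U i u) = size u.
  by rewrite /ext_same size_cat size_map -size_cat cat_take_drop.
have sznew U i u : size (ext_new X U i u) = (size u).+1.
  have [j hj [-> _]] := step_new U i u.
  by rewrite ext_newE // size_cat !size_map !size_iota subnKC.
(* A space to which a line outside X has been added is not contained in X. *)
have notX U j A : is_subspace U -> ~ (U `<=` X) -> (j <= size t)%N ->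
    sum_sub (flag_term X t j) U = A -> ~ (A `<=` X).
  move=> sU UX hj <- h; apply: UX; apply: subset_trans h.
  by apply: sub_sumr; case: (tX j hj).
have nth_same U i j : (i <= size t)%N -> (j < size t)%N ->
    nth X (ext_same U i t) j = add_if (i <= j)%N U (flag_term X t j.+1).
  by move=> hi hj; rewrite (@ext_sameE X) // (nth_map 0%N) ?size_iota // nth_iota // add1n ltnS.
have nth_new U i j : (i <= (size t).+1)%N -> (j <= size t)%N ->
    nth X (ext_new X U i t) j = if (j < i)%N then flag_term X t j.+1 else sum_sub (flag_term X t j) U.
  move=> hi hj; rewrite ext_newE // nth_cat size_map size_iota.
  case: ltnP => ji; first by rewrite (nth_map 0%N) ?size_iota // nth_iota // add1n.
  have lt : (j - i < (size t).+1 - i)%N by apply: ltn_sub2r; rewrite ltnS // (leq_trans ji).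
  by rewrite (nth_map 0%N) ?size_iota // nth_iota // subnKC.
move=> [i [[e1 ->]|[e1 ->]]] [i' [[e2 ->]|[e2 ->]]].
- have := e1; rewrite {}e2.
  have [j hj [-> ej]] := step_same W i t; have [j' hj' [-> ej']] := step_same W' i' t.
  have [k hk [-> ek]] := step_same W i s; have [k' hk' [-> ek']] := step_same W' i' s.
  move: hk hk' ek ek'; rewrite sz -ej -ej' => _ _ -> -> e.
  have ejj : j = j'.
    apply/eqP; rewrite eqn_leq; apply/andP; split; rewrite leqNgt; apply/negP => lt.
      have hjt := leq_trans lt hj.
      have := congr1 (fun u => nth X u j') e; rewrite !nth_same // leqnn leqNgt lt /= => e3.
      by apply: (notX W' j'.+1 _ sW' WX' hjt e3); case: (tX j'.+1 hjt).
    have hjt := leq_trans lt hj'.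
    have := congr1 (fun u => nth X u j) e; rewrite !nth_same // leqnn leqNgt lt /= => /esym e3.
    by apply: (notX W j.+1 _ sW WX hjt e3); case: (tX j.+1 hjt).
  rewrite -{}ejj in e *; case: (ltnP j (size t)) => hjt; last first.
    by rewrite /ext_same !drop_oversize ?sz //=.
  suff -> : W = W' by [].
  have := congr1 (fun u => nth X u j) e; rewrite !nth_same // leqnn /= => e3.
  apply: (hW (sum_sub (flag_term X t j.+1) W)).
  + rewrite e1; have [j1 _ [-> ej1]] := step_same W i t.
    have -> : sum_sub (flag_term X t j.+1) W = nth X (ext_same W j1 t) j.
      by rewrite ej1 -ej nth_same // leqnn.
    by apply: mem_nth; rewrite szsame.
  + by apply: sub_sumr; case: (tX j.+1 hjt).
  + by rewrite -e3; apply: sub_sumr; case: (tX j.+1 hjt).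
- have := congr1 size e1; rewrite e2 szsame sznew => /eqP.
  by rewrite -{2}[size t]addn0 -addn1 eqn_add2l.
- have := congr1 size e1; rewrite e2 szsame sznew => /eqP.
  by rewrite -{1}[size t]addn0 -addn1 eqn_add2l.
have := e1; rewrite {}e2.
have [j hj [-> ej]] := step_new W i t; have [j' hj' [-> ej']] := step_new W' i' t.
have [k hk [-> ek]] := step_new W i s; have [k' hk' [-> ek']] := step_new W' i' s.
move: hk hk' ek ek'; rewrite sz -ej -ej' => _ _ -> -> e.
have termX l : (l <= (size t).+1)%N -> flag_term X t l `<=` X.
  rewrite leq_eqVlt => /orP [/eqP ->|h]; last by case: (tX l h).
  by rewrite /flag_term nth_default.
have ejj : j = j'.
  apply/eqP; rewrite eqn_leq; apply/andP; split; rewrite leqNgt; apply/negP => lt.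
    have hjt : (j' <= size t)%N by rewrite -ltnS; apply: leq_trans hj.
    have := congr1 (fun u => nth X u j') e; rewrite !nth_new // ltnn lt => e3.
    by apply: (notX W' j' _ sW' WX' hjt e3); apply: termX.
  have hjt : (j <= size t)%N by rewrite -ltnS; apply: leq_trans hj'.
  have := congr1 (fun u => nth X u j) e; rewrite !nth_new // ltnn lt => /esym e3.
  by apply: (notX W j _ sW WX hjt e3); apply: termX.
rewrite -{}ejj in e *; case: (ltnP (size t) j) => hjt.
  have ejt : j = (size t).+1 by apply/eqP; rewrite eqn_leq hj.
  by rewrite /ext_new !drop_oversize /= ?sz ?ejt //=.
suff -> : W = W' by [].
have := congr1 (fun u => nth X u j) e; rewrite !nth_new // ltnn => e3.
apply: (hW (sum_sub (flag_term X t j) W)).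
+ rewrite e1; have [j1 _ [-> ej1]] := step_new W i t.
  have -> : sum_sub (flag_term X t j) W = nth X (ext_new X W j1 t) j.
    by rewrite ej1 -ej nth_new // ltnn.
  by apply: mem_nth; rewrite sznew ltnS.
+ by apply: sub_sumr; case: (tX j hjt).
+ by rewrite -e3; apply: sub_sumr; case: (tX j hjt).
Qed.

End Steps.

(** * Morphisms of flag varieties from affine maps of frames *)

Section AffineLifts.
Variables (K : fieldType) (V1 V2 : lmodType K) (d1 d2 : nat).
Implicit Types (b : {ffun 'I_d1 -> V1}).

Lemma polyfun_eq (M : lmodType K) (p q : M -> K) : p =1 q -> polyfun p -> polyfun q.
Proof. by move=> /funext ->. Qed.

Lemma polyfun_affine (M N : lmodType K) (g : {linear M -> N}) (c : N) (p : N -> K) :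
  polyfun p -> polyfun (fun x => p (g x + c)).
Proof.
elim=> {p} [a|l|p q _ hp _ hq|p q _ hp _ hq].
- exact: PolyCst.
- apply: (@polyfun_eq _ (fun x => (l \o g) x + l c)).
    by move=> x /=; rewrite linearD.
  by apply: PolyAdd; [exact: (PolyLin (GRing.Linear.clone _ _ _ _ (l \o g) _))|exact: PolyCst].
- exact: PolyAdd.
- exact: PolyMul.
Qed.

(** Topology and regular functions of a flag variety are defined on adapted frames, and
    polynomial functions pull back to polynomial functions along affine maps. *)
Lemma affine_lift_morphism (X1 : set V1) (X2 : set V2) ms1 ms2 P1 P2
    (f : flag_variety d1 X1 ms1 P1 -> flag_variety d2 X2 ms2 P2)
    (g : {linear {ffun 'I_d1 -> V1} -> {ffun 'I_d2 -> V2}}) (c : {ffun 'I_d2 -> V2}) :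
  (forall T b, adapted X1 ms1 b (sval T) -> adapted X2 ms2 (g b + c) (sval (f T))) ->
  is_morphism f.
Proof.
move=> hg U oU; split.
  move=> T b UT ab; have [q [pq q0 hq]] := oU _ _ UT (hg _ _ ab).
  exists (fun x => q (g x + c)); split=> //; first exact: polyfun_affine.
  by move=> T' b' ab' qb'; apply: (hq _ (g b' + c)) => //; apply: hg.
move=> r hr T b UT ab; have [p [q [pp pq q0 hq]]] := hr _ _ UT (hg _ _ ab).
exists (fun x => p (g x + c)), (fun x => q (g x + c)); split=> //; try exact: polyfun_affine.
by move=> T' b' UT' ab' qb'; apply: hq => //; apply: hg.
Qed.

End AffineLifts.

Section SortedLevels.
Variables (T : Type) (key : T -> nat).

Lemma take_count_sorted (p : pred T) (s : seq T) :
  sorted (fun x y => (key x <= key y)%N) s ->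
  (forall x y, (key x <= key y)%N -> p y -> p x) ->
  take (count p s) s = [seq x <- s | p x].
Proof.
move=> ss hp; elim: s ss => //= x s IH sx.
have ss : sorted (fun x y => (key x <= key y)%N) s by apply: path_sorted sx.
case: (boolP (p x)) => px /=; first by rewrite IH.
have tr : transitive (fun x y => (key x <= key y)%N) by move=> y z w; apply: leq_trans.
have h : all (predC p) s.
  have := order_path_min tr sx; apply: sub_all => y xy /=.
  by apply: contra px; apply: hp.
have hc : count p s = 0%N.
  by apply/eqP; rewrite -leqn0 leqNgt -has_count; rewrite all_predC in h.
have -> : [seq y <- s | p y] = [::] by apply/nilP; rewrite /nilp size_filter hc.
by rewrite hc.
Qed.

End SortedLevels.

Lemma count_ord_ltn n a : count (fun i : 'I_n => (i < a)%N) (enum 'I_n) = minn a n.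
Proof.
rewrite -(count_map val (fun i => (i < a)%N)) val_enum_ord.
elim: n => [|n IH]; first by rewrite minn0.
rewrite -addn1 iotaD count_cat IH /= add0n addn0 addn1.
case: (boolP (n < a)%N) => [hn|]; first by rewrite (minn_idPr (ltnW hn)) (minn_idPr hn) addn1.
by rewrite -leqNgt => hn; rewrite (minn_idPl hn) (minn_idPl (leqW hn)) addn0.
Qed.

Section Embedding.
Variables (K : fieldType) (V1 V2 : lmodType K) (h : {linear V1 -> V2}).
Variables (d1 d2 : nat) (X1 : set V1) (X2 : set V2) (ms1 ms2 : seq nat).
Variables (P1 : set (seq (set V1))) (P2 : set (seq (set V2))).

Lemma flag_term_adapted (b : {ffun 'I_d1 -> V1}) t i : adapted X1 ms1 b t ->
  flag_term X1 t i = lin_span [set b j | j in [set j : 'I_d1 | (j < nth d1 (0%N :: ms1) i)%N]].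
Proof.
move=> [[_ hX] ->]; case: i => [|i] /=.
  rewrite /flag_term /= -span_set0; congr lin_span; apply/seteqP.
  by split=> // v [j].
rewrite /flag_term /=; case: (ltnP i (size ms1)) => hi.
  by rewrite (nth_map 0%N) // (set_nth_default 0%N).
rewrite !nth_default ?size_map // -hX; congr lin_span; apply/seteqP.
by split=> [_ [j _ <-]|_ [j _ <-]]; exists j => //=; apply: ltn_ord.
Qed.

Hypothesis hinj : forall u, X1 u -> h u = 0 -> u = 0.
Variables (Z : nat -> set V2) (Zall : set V2) (ix : nat -> nat).
Hypotheses (fZ : fdim Zall) (dZ : h @` X1 `&` Zall `<=` [set 0])
  (sZ : sum_sub (h @` X1) Zall = X2).
Hypotheses (hX2 : has_dim X2 d2).
Hypotheses (sms2 : sorted leq ms2).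
Let alpha m := nth d1 (0%N :: ms1) (ix m).
Hypotheses (Zsub : forall m, m \in ms2 -> is_subspace (Z m) /\ Z m `<=` Zall)
  (Zmono : forall m m', m \in ms2 -> m' \in ms2 -> (m <= m')%N -> Z m `<=` Z m')
  (amono : forall m m', m \in ms2 -> m' \in ms2 -> (m <= m')%N -> (alpha m <= alpha m')%N)
  (ale : forall m, m \in ms2 -> (alpha m <= d1)%N)
  (adim : forall m, m \in ms2 -> (alpha m + dimn (Z m))%N = m).
Variables (f : flag_variety d1 X1 ms1 P1 -> flag_variety d2 X2 ms2 P2).
Hypothesis fE : forall T, sval (f T) =
  [seq sum_sub (h @` flag_term X1 (sval T) (ix m)) (Z m) | m <- ms2].

(** Adding fixed subspaces to the terms of a flag is a morphism: a frame adapted to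
    the image is obtained from one adapted to the flag by shuffling in the vectors of
    a frame adapted to the added spaces, in an order that does not depend on the flag. *)
Lemma embedding_morphism : is_morphism f.
Proof.
have [|hn] := pselect (exists (T : flag_variety d1 X1 ms1 P1) (b : {ffun 'I_d1 -> V1}),
    adapted X1 ms1 b (sval T)); last first.
  have [|g0 _] := @linear_pack K {ffun 'I_d1 -> V1} {ffun 'I_d2 -> V2} (fun=> 0).
    by move=> a u v; rewrite scaler0 addr0.
  apply: (affine_lift_morphism (g := g0) (c := 0)).
  by move=> T b ab; case: hn; exists T, b.
move=> [T0 [b0 [fb0 _]]].
have hX1 : has_dim X1 d1 by exists b0.
have [zs [iz ez hz]] : exists s, [/\ indep s, sspan s = Zall &
    forall A, [set Z m | m in [set` ms2]] A -> A = sspan [seq v <- s | `[< A v >]]].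
  apply: adapted_frame_exists => //.
    by move=> _ [m mm <-]; apply: Zsub.
  move=> _ _ [m mm <-] [m' mm' <-].
  by case: (leqP m m') => [|/ltnW] le; [left|right]; apply: Zmono.
pose lev m (x : 'I_d1 + V2) := match x with inl i => (i < alpha m)%N | inr z => `[< Z m z >] end.
pose key x := find (fun m => lev m x) ms2.
pose UL : seq ('I_d1 + V2) := [seq inl i | i <- enum 'I_d1] ++ [seq inr z | z <- zs].
pose SL := sort (fun x y => (key x <= key y)%N) UL.
have SUL : perm_eq SL UL by rewrite perm_sort.
have levmono m m' x : m \in ms2 -> m' \in ms2 -> (m <= m')%N -> lev m x -> lev m' x.
  move=> mm mm' le; case: x => [i|z] /=.
    by move=> lt; apply: leq_trans lt _; apply: amono.
  by move=> /asboolP hz'; apply/asboolP; apply: Zmono hz'.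
have levkey m x y : m \in ms2 -> (key x <= key y)%N -> lev m y -> lev m x.
  move=> mm le ly.
  have h1 : (key y <= index m ms2)%N.
    rewrite leqNgt; apply/negP => /(before_find 0%N).
    by rewrite nth_index // ly.
  have h2 : (key x < size ms2)%N.
    by apply: leq_ltn_trans (leq_trans le h1) _; rewrite index_mem.
  have h3 : lev (nth 0%N ms2 (key x)) x.
    by apply: (@nth_find _ 0%N (fun m => lev m x)); rewrite has_find.
  apply: levmono h3 => //; first exact: mem_nth.
  rewrite -[X in (_ <= X)%N](nth_index 0%N mm).
  apply: (sorted_leq_nth leq_trans leqnn 0%N sms2); rewrite ?inE ?index_mem //.
  exact: leq_trans h1.
have cntUL m : m \in ms2 -> count (lev m) UL = m.
  move=> mm; rewrite count_cat (count_map inl) (count_map inr) -[RHS](adim mm); congr (_ + _)%N.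
    by rewrite -[RHS](minn_idPl (ale mm)) -count_ord_ltn; apply: eq_count.
  by rewrite (dimn_filter iz) //; apply: hz; exists m.
have takeSL m : m \in ms2 -> take m SL = [seq x <- SL | lev m x].
  move=> mm; rewrite -(@take_count_sorted _ key (lev m)).
  - by rewrite (permP SUL) cntUL.
  - by apply: sort_sorted => x y; apply: leq_total.
  - by move=> x y; apply: levkey.
have szSL : size SL = d2.
  have := has_dim_image hinj hX1; have := has_dim_dimn fZ => hz1 hx1.
  have := has_dim_sum hx1 hz1 dZ; rewrite sZ => /has_dim_uniq /(_ hX2) <-.
  by rewrite (perm_size SUL) size_cat (size_map inl) (size_map inr) size_enum_ord -[in RHS]ez dimn_sspan.
pose ev (b : {ffun 'I_d1 -> V1}) (x : 'I_d1 + V2) := match x with inl i => h (b i) | inr z => z end.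
pose ev1 (b : {ffun 'I_d1 -> V1}) (x : 'I_d1 + V2) := match x with inl i => h (b i) | inr z => 0 end.
pose g b : {ffun 'I_d2 -> V2} := [ffun j : 'I_d2 => ev1 b (nth (inr 0) SL j)].
pose evc (x : 'I_d1 + V2) : V2 := match x with inl i => 0 | inr z => z end.
pose c : {ffun 'I_d2 -> V2} := [ffun j : 'I_d2 => evc (nth (inr 0) SL j)].
have [|gl hgl] := @linear_pack K _ _ g.
  move=> a u v; apply/ffunP => j; rewrite !ffunE /ev1.
  by case: (nth _ _ _) => [i|z]; [rewrite !ffunE linearP|rewrite scaler0 addr0].
apply: (affine_lift_morphism (g := gl) (c := c)) => T b ab.
have gE (j : 'I_d2) : (gl b + c) j = ev b (nth (inr 0) SL j).
  by rewrite hgl !ffunE /ev1 /evc /ev; case: (nth _ _ _) => [i|z]; rewrite ?addr0 ?add0r.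
have codE : [seq (gl b + c) j | j <- enum 'I_d2] = map (ev b) SL.
  rewrite (eq_map gE) (map_comp (fun j => ev b (nth (inr 0) SL j)) val) val_enum_ord -szSL.
  rewrite (map_comp (ev b) (nth (inr 0) SL)); congr map; exact: mkseq_nth.
have permE : perm_eq (map (ev b) SL) ([seq h (b i) | i <- enum 'I_d1] ++ zs).
  apply: (perm_trans (perm_map (ev b) SUL)).
  by rewrite map_cat -!map_comp (@eq_map _ _ (ev b \o inr) id) // map_id.
have [/is_frameP [ib hb] tE] := ab.
have hbE : sspan [seq h (b i) | i <- enum 'I_d1] = h @` X1.
  by rewrite -hb image_sspan -(map_comp h b).
split.
  apply/is_frameP; rewrite codE; split.
    apply: (indep_perm (s := [seq h (b i) | i <- enum 'I_d1] ++ zs)); first by rewrite perm_sym.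
    apply/indep_cat; split=> //; last by rewrite hbE ez.
    rewrite (map_comp h b); apply: indep_image => //; by rewrite hb.
  by rewrite (eq_sspan (perm_mem permE)) sspan_cat hbE ez sZ.
rewrite fE; apply/eq_in_map => m mm.
have -> : lin_span [set (gl b + c) i | i in [set i : 'I_d2 | (i < m)%N]] = sspan (map (ev b) (take m SL)).
  have md : (m <= size SL)%N.
    by rewrite -(cntUL _ mm) -(permP SUL) count_size.
  congr lin_span; apply/seteqP; split=> [_ [j /= jm <-]|v /= /mapP [x xS ->]].
    rewrite gE; apply: map_f; rewrite -(nth_take _ jm); apply: mem_nth.
    by rewrite size_take_min (minn_idPl md).
  have := xS; move=> /(nthP (inr 0)) [j]; rewrite size_take_min (minn_idPl md) => jm <-.
  have jd : (j < d2)%N by rewrite -szSL; apply: leq_trans md.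
  by exists (Ordinal jd) => //; rewrite gE /= nth_take.
rewrite takeSL // (@eq_sspan _ _ _ (map (ev b) [seq x <- UL | lev m x])); last first.
  by apply: perm_mem; apply: perm_map; apply: perm_filter.
rewrite filter_cat map_cat sspan_cat; congr sum_sub; last first.
  rewrite filter_map -map_comp (@eq_map _ _ (ev b \o inr) id) // map_id.
  by apply: hz; exists m.
rewrite (flag_term_adapted _ ab) image_span; congr lin_span; apply/seteqP; split.
  move=> _ [_ [j /= hj <-] <-] /=; rewrite filter_map -map_comp.
  by apply/mapP; exists j => //; rewrite mem_filter /= mem_enum hj.
move=> v /=; rewrite filter_map -map_comp => /mapP [j]; rewrite mem_filter => /andP [/= hj _] ->.
by exists (b j) => //; exists j.
Qed.

End Embedding.

(** * Comparison of ind-varieties, connected components *)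

Lemma sval_inj (T : Type) (P : T -> Prop) : injective (@proj1_sig T P).
Proof.
move=> [x hx] [y hy] /= exy; move: hx hy; rewrite exy => hx hy.
by congr exist; apply: Prop_irrelevance.
Qed.

Section Criterion.
Variables (K : fieldType) (X : nat -> variety K) (f : forall n, X n -> X n.+1).
Variables (Y : ind_variety K) (Z : Type) (val : Y -> Z).
Variables (Phi : forall n, X n -> Z) (Psi : forall m, level Y m -> Z).
Hypotheses (val_inj : injective val) (Phi_inj : forall n, injective (@Phi n))
  (Psi_inj : forall m, injective (@Psi m)).
Hypotheses (f_morph : forall n, is_morphism (@f n))
  (Phi_f : forall n x, @Phi n.+1 (f x) = Phi x).
Hypotheses (rep : forall m (x : level Y m) p, represents x p <-> val p = Psi x)
  (Psi_val : forall m (x : level Y m), exists p, val p = Psi x)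
  (val_Psi : forall p, exists m (x : level Y m), val p = Psi x).
Hypotheses (Y_step : forall m, exists2 g : level Y m -> level Y m.+1, is_morphism g &
    forall x, Psi (g x) = Psi x)
  (XY : forall n, exists m (g : X n -> level Y m), is_morphism g /\ forall x, Psi (g x) = Phi x)
  (YX : forall m, exists n (g : level Y m -> X n), is_morphism g /\ forall x, Phi (g x) = Psi x).

Let eqv := clos_refl_sym_trans _ (lim_step f).

Let Phi_eqv p q : eqv p q -> Phi (projT2 p) = Phi (projT2 q).
Proof.
by elim=> [_ _ [n x]| |p' q' _ ->|p' q' r _ -> _ ->] //=.
Qed.

Let push n (x : X n) m : (n <= m)%N -> exists y : X m, eqv (existT _ n x) (existT _ m y).
Proof.
elim: m => [|m IH]; first by rewrite leqn0 => /eqP e; subst n; exists x; apply: rst_refl.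
rewrite leq_eqVlt => /orP [/eqP e|/IH [y hy]]; first by subst n; exists x; apply: rst_refl.
by exists (f y); apply: rst_trans hy _; apply: rst_step.
Qed.

Let L := direct_limit f.

Let cls n (x : X n) : L := exist _ (lim_class f (existT _ n x)) (ex_intro _ _ erefl).

Let cls_eqv p q : eqv p q -> lim_class f p = lim_class f q.
Proof.
move=> h; apply/seteqP; split=> r hr; last exact: rst_trans hr.
by apply: rst_trans hr; apply: rst_sym.
Qed.

Let repL n (x : X n) (c : L) : @represents _ L n x c <-> c = cls x.
Proof.
split=> [|->]; last exact: rst_refl.
case: c => c [p ec] /= h; apply: sval_inj => /=.
by rewrite ec; apply: cls_eqv; rewrite ec in h.
Qed.

Let cls_surj (c : L) : exists n (x : X n), c = cls x.
Proof.
by case: c => c [[n x] ec]; exists n, x; apply: sval_inj.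
Qed.

Let cls_Phi n (x : X n) m (y : X m) : cls x = cls y <-> Phi x = Phi y.
Proof.
split=> [e|e].
  apply: (@Phi_eqv (existT _ n x) (existT _ m y)).
  have : sval (cls y) (existT _ m y) by apply: rst_refl.
  by rewrite -e.
have [x' hx] := push x (leq_maxl n m); have [y' hy] := push y (leq_maxr n m).
have exy : x' = y'.
  by apply: Phi_inj; rewrite -(Phi_eqv hx) -(Phi_eqv hy).
apply: sval_inj; apply: cls_eqv.
by apply: rst_trans hx _; apply: rst_sym; rewrite exy.
Qed.

(** Both ind-varieties are described by the same invariants: Phi and Psi take values in
    one type, that of generalized flags in the applications. Level maps in both
    directions that respect the invariants then assemble to mutually inverse
    morphisms. *)
Lemma direct_limit_isomorphic : ind_isomorphic (direct_limit f) Y.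
Proof.
have /choice [F hF] (c : L) : exists p : Y, forall n (x : X n), c = cls x -> val p = Phi x.
  have [n [x ec]] := cls_surj c; have [m [g [_ hg]]] := XY n.
  have [p hp] := Psi_val (g x); exists p => n' x'; rewrite ec hp hg.
  by move=> /cls_Phi.
have /choice [G hG] (p : Y) : exists c : L, forall n (x : X n), c = cls x -> val p = Phi x.
  have [m [y hy]] := val_Psi p; have [n [g [_ hg]]] := YX m.
  by exists (cls (g y)) => n' x' /cls_Phi <-; rewrite hg.
split.
- split.
  + move=> n x; exists (cls x); split; first by apply/(@repL n).
    by move=> c /(@repL n) ->.
  + move=> n x y c /(@repL n) e1 /(@repL n) e2; apply: Phi_inj.
    by apply/cls_Phi; rewrite -e1.
  + by move=> c; have [n [x ec]] := cls_surj c; exists n, x; apply/(@repL n).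
  + move=> n; exists (@f n) => // x c /(@repL n) ->; apply/(@repL n.+1).
    by apply/cls_Phi; rewrite Phi_f.
- split.
  + move=> m x; have [p hp] := Psi_val x; exists p; split; first exact/rep.
    by move=> q /rep hq; apply: val_inj; rewrite hp.
  + by move=> m x y p /rep e1 /rep e2; apply: Psi_inj; rewrite -e1.
  + by move=> p; have [m [x hx]] := val_Psi p; exists m, x; apply/rep.
  + move=> m; have [g mg hg] := Y_step m; exists g => // x p /rep hp.
    by apply/rep; rewrite hg.
exists F, G; split.
- move=> c; have [n [x ec]] := cls_surj c; have [m [y ey]] := cls_surj (G (F c)).
  by rewrite ey ec; apply/cls_Phi; rewrite -(hG _ _ _ ey) -(hF _ _ _ ec).
- move=> p; have [n [x ex]] := cls_surj (G p); apply: val_inj.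
  by rewrite (hF _ _ _ ex) (hG _ _ _ ex).
- move=> n; have [m [g [mg hg]]] := XY n; exists m, g; split=> // x c /(@repL n) ec.
  by apply/rep; rewrite hg (hF _ _ _ ec).
- move=> m; have [n [g [mg hg]]] := YX m; exists n, g; split=> // x p /rep hp.
  have [n' [x' ex]] := cls_surj (G p); apply/(@repL n); rewrite ex; apply/cls_Phi.
  by rewrite -(hG _ _ _ ex) hp hg.
Qed.

End Criterion.

Section Components.
Variables (K : fieldType).
Implicit Types X Y : variety K.

(** Morphisms are continuous and continuous images of connected sets are connected. *)
Lemma component_image X Y (f : X -> Y) x y : is_morphism f ->
  component x y -> component (f x) (f y).
Proof.
move=> mf [A [cA Ax Ay]]; exists (f @` A); split; [|by exists x|by exists y].
move=> U U' oU oU' AU [_ [[a Aa <-] Ua]] [_ [[a' Aa' <-] Ua']].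
have [|||w [[Aw Uw] Uw']] := cA (f @^-1` U) (f @^-1` U') (mf U oU).1 (mf U' oU').1.
- by move=> b Ab; apply: AU; exists b.
- by exists a.
- by exists a'.
by exists (f w); split=> //; split=> //; exists w.
Qed.

Lemma component_refl X (x : X) : component x x.
Proof.
exists [set x]; split=> // U U' _ _ xU [_ [-> Ux]] [_ [-> Ux']].
by exists x.
Qed.

Lemma component_sym X (x y : X) : component x y -> component y x.
Proof. by move=> [A [cA Ax Ay]]; exists A. Qed.

Lemma component_trans X (x y z : X) : component x y -> component y z -> component x z.
Proof.
move=> [A [cA Ax Ay]] [B [cB By Bz]]; exists (A `|` B); split; [|by left|by right].
move=> U U' oU oU' AU [a [Aa Ua]] [b [Bb Ub]].
have AsU : A `<=` U `|` U' by move=> w Aw; apply: AU; left.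
have BsU : B `<=` U `|` U' by move=> w Bw; apply: AU; right.
have hA : A `&` U !=set0 -> A `&` U' !=set0 -> (A `|` B) `&` U `&` U' !=set0.
  move=> h h'; have [w [[Aw Uw] Uw']] := cA U U' oU oU' AsU h h'.
  by exists w; split=> //; split=> //; left.
have hB : B `&` U !=set0 -> B `&` U' !=set0 -> (A `|` B) `&` U `&` U' !=set0.
  move=> h h'; have [w [[Aw Uw] Uw']] := cB U U' oU oU' BsU h h'.
  by exists w; split=> //; split=> //; right.
case: (AsU y Ay) => Uy.
  case: Bb => [Ab|Bb]; last by apply: hB; [exists y|exists b].
  case: Aa => [Aa|Ba]; first by apply: hA; [exists a|exists b].
  by apply: hA; [exists y|exists b].
case: Aa => [Aa|Ba]; last by apply: hB; [exists a|exists y].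
by apply: hA; [exists a|exists y].
Qed.

End Components.

(** * Transfer of flags between stages *)

Section FlagImage.
Variables (K : fieldType) (V W : lmodType K) (f : {linear V -> W}).

Definition flag_image (t : seq (set V)) : seq (set W) := [seq f @` A | A <- t].

Lemma image_set0 : f @` [set 0] = [set 0].
Proof. by rewrite image_set1 linear0. Qed.

Lemma flag_term_image X t i : flag_term (f @` X) (flag_image t) i = f @` flag_term X t i.
Proof.
have -> : flag_term (f @` X) (flag_image t) i = nth (f @` X) [seq f @` A | A <- [set 0] :: t] i.
  by rewrite /flag_term /= image_set0.
case: (ltnP i (size ([set 0] :: t))) => h; first by rewrite (nth_map X).
by rewrite nth_default ?size_map // /flag_term nth_default.
Qed.

Lemma is_flag_image X ms t : (forall u, X u -> f u = 0 -> u = 0) ->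
  (forall i, (i < size ms)%N -> nth set0 t i `<=` X) ->
  is_flag X ms t -> is_flag (f @` X) ms (flag_image t).
Proof.
move=> hf tX [st h1 h2]; split; first by rewrite size_map.
  move=> i hi; rewrite (nth_map set0) ?st //; have [s1 d1] := h1 i hi.
  split; first exact: subspace_image.
  by apply: has_dim_image d1 => u hu; apply: hf; apply: tX hu.
move=> i; rewrite size_map => hi; rewrite !flag_term_image.
by apply: image_subset; apply: h2.
Qed.

Lemma image_set_inj (A B : set V) : injective f -> f @` A = f @` B -> A = B.
Proof.
move=> fi e; apply/seteqP; split=> u hu.
  by have : (f @` B) (f u); [rewrite -e; exists u|move=> [v Bv /fi <-]].
by have : (f @` A) (f u); [rewrite e; exists u|move=> [v Bv /fi <-]].
Qed.

Lemma flag_image_inj : injective f -> injective flag_image.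
Proof. by move=> fi; apply: inj_map => A B; apply: image_set_inj. Qed.

End FlagImage.

Section FlagTransfer.
Variables (K : fieldType) (V : lmodType K).

(** A subspace Y of V identified with a subspace X0 of a space V0 by mutually inverse
    linear maps. The levels of a direct limit are flag varieties of abstract spaces V_N,
    those of the ind-variety of generalized flags are flag varieties of subspaces of V;
    this treats both alike. *)
Definition presents (V0 : lmodType K) (j : {linear V0 -> V}) (r : {linear V -> V0})
    (X0 : set V0) (Y : set V) :=
  [/\ injective j, is_subspace X0, j @` X0 = Y & forall v, Y v -> j (r v) = v].

Section Presentation.
Variables (V0 : lmodType K) (j : {linear V0 -> V}) (r : {linear V -> V0}).
Variables (X0 : set V0) (Y : set V).
Hypothesis (pY : presents j r X0 Y).

Lemma presents_retract u : X0 u -> r (j u) = u.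
Proof.
case: pY => ji _ eY h Xu; apply: ji; apply: h; rewrite -eY; by exists u.
Qed.

Lemma presents_inj v : Y v -> r v = 0 -> v = 0.
Proof. by case: pY => _ _ _ h Yv e; rewrite -(h v Yv) e linear0. Qed.

Lemma presents_image (A : set V) : A `<=` Y -> j @` (r @` A) = A.
Proof.
case: pY => _ _ _ h AY; apply/seteqP; split=> [_ [_ [v Av <-] <-]|v Av].
  by rewrite h //; apply: AY.
by exists (r v); [exists v|apply: h; apply: AY].
Qed.

Lemma presents_retract_image : r @` Y = X0.
Proof.
case: pY => _ _ eY _; apply/seteqP; split=> [_ [v + <-]|u Xu].
  by rewrite -eY => -[u Xu <-]; rewrite presents_retract.
by exists (j u); [rewrite -eY; exists u|rewrite presents_retract].
Qed.

Lemma presents_flag_image ms t d : has_dim X0 d -> is_flag X0 ms t -> is_flag Y ms (flag_image j t).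
Proof.
move=> hX ft; have [ji sX eY _] := pY; rewrite -eY; apply: is_flag_image => //.
  by move=> u _ e; apply: ji; rewrite e linear0.
move=> i hi; have [st _ _] := ft.
have := @flag_term_sub _ _ _ _ _ _ i.+1 hX ft; rewrite /flag_term /=.
by rewrite (set_nth_default X0) ?st.
Qed.

End Presentation.

Variables (V1 : lmodType K) (j1 : {linear V1 -> V}) (r1 : {linear V -> V1}).
Variables (X1 : set V1) (Y1 C1 : set V) (d1 : nat) (ms1 : seq nat).
Variables (V2 : lmodType K) (j2 : {linear V2 -> V}) (r2 : {linear V -> V2}).
Variables (X2 : set V2) (Y2 C2 : set V) (d2 : nat) (ms2 : seq nat).
Variables (F : set (set V)).
Hypotheses (cF : chain F) (p1 : presents j1 r1 X1 Y1) (p2 : presents j2 r2 X2 Y2).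
Hypotheses (hX1 : has_dim X1 d1) (hX2 : has_dim X2 d2).
Hypotheses (st1 : is_stage F Y1 C1) (st2 : is_stage F Y2 C2).
Hypotheses (t1 : typed F Y1 d1 ms1) (t2 : typed F Y2 d2 ms2).
Hypotheses (Y12 : Y1 `<=` Y2) (CC : forall A, F A -> Y1 `<=` A \/ A `&` C2 `<=` C1).

(** The flag t, moved to V, as a deformation of F. *)
Definition flag_def (V0 : lmodType K) (j : {linear V0 -> V}) Y d ms (t : seq (set V0)) :=
  flag_fun Y d ms (flag_image j t).

(** The flag on the second stage that defines the same generalized flag as t. *)
Definition transfer_flag (t : seq (set V1)) : seq (set V2) :=
  flag_image r2 (flag_list F Y2 ms2 (transfer C1 Y2 (flag_def j1 Y1 d1 ms1 t))).

Let flag_defP t : is_flag X1 ms1 t -> deformation F Y1 (flag_def j1 Y1 d1 ms1 t).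
Proof.
by move=> ft; apply: (flag_fun_deformation cF st1 t1); apply: (presents_flag_image p1 hX1).
Qed.

Let flag_list_sub t m : is_flag X1 ms1 t -> m \in ms2 ->
  transfer C1 Y2 (flag_def j1 Y1 d1 ms1 t) (space_of_rank F Y2 m) `<=` Y2.
Proof. by move=> ft mm v []. Qed.

Lemma transfer_flag_image t : is_flag X1 ms1 t ->
  flag_image j2 (transfer_flag t) = flag_list F Y2 ms2 (transfer C1 Y2 (flag_def j1 Y1 d1 ms1 t)).
Proof.
move=> ft; rewrite /transfer_flag /flag_image /flag_list -!map_comp.
by apply/eq_in_map => m mm /=; apply: (presents_image p2); apply: flag_list_sub.
Qed.

Lemma transfer_flag_is_flag t : is_flag X1 ms1 t -> is_flag X2 ms2 (transfer_flag t).
Proof.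
move=> ft; rewrite -(presents_retract_image p2); apply: is_flag_image.
- exact: (presents_inj p2).
- move=> i hi; rewrite (nth_map 0%N) //; apply: flag_list_sub => //; exact: mem_nth.
apply: (flag_list_is_flag cF st2 t2); apply: (transfer_deformation cF st1 st2) => //.
exact: flag_defP.
Qed.

Lemma transfer_flag_def t A : is_flag X1 ms1 t -> F A ->
  flag_def j2 Y2 d2 ms2 (transfer_flag t) A = transfer C1 Y2 (flag_def j1 Y1 d1 ms1 t) A.
Proof.
move=> ft FA; rewrite /flag_def transfer_flag_image //.
apply: (flag_fun_list cF st2 t2) => //; apply: (transfer_deformation cF st1 st2) => //.
exact: flag_defP.
Qed.

Lemma transfer_flag_deform t A : is_flag X1 ms1 t -> F A ->
  deform C2 (flag_def j2 Y2 d2 ms2 (transfer_flag t)) A = deform C1 (flag_def j1 Y1 d1 ms1 t) A.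
Proof.
move=> ft FA; rewrite {1}/deform transfer_flag_def //.
exact: (transfer_deform cF st1 st2 Y12 CC (flag_defP ft)).
Qed.

(** The transferred flag is obtained by adding the fixed subspaces A `&` C1 `&` Y2 to
    spaces of the given flag. *)
Lemma transfer_flag_morphism P1 P2
    (f : flag_variety d1 X1 ms1 P1 -> flag_variety d2 X2 ms2 P2) :
  (forall T, sval (f T) = transfer_flag (sval T)) -> is_morphism f.
Proof.
move=> fE; have [fY1 sC1 dYC sYC split1] := st1; have sY1 := fdim_subspace fY1.
have fY2 : fdim Y2 by case: st2. have sY2 := fdim_subspace fY2.
have [j1i sX1 eY1 jr1] := p1; have [j2i sX2 eY2 jr2] := p2.
have fm A : F A -> fdim (A `&` C1 `&` Y2).
  by move=> FA; apply: (fdim_sub fY2); [do ![apply: subspaceI => //]; apply: cF.1|move=> v []].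
have sm A : F A -> is_subspace (A `&` C1 `&` Y2) by move=> FA; apply: fdim_subspace; apply: fm.
pose B m := space_of_rank F Y2 m.
have FB m : m \in ms2 -> F (B m) by move=> mm; case: (space_of_rankP t2 mm).
have dB m : m \in ms2 -> dimn (B m `&` Y2) = m by move=> mm; case: (space_of_rankP t2 mm).
have Bmono m m' : m \in ms2 -> m' \in ms2 -> (m <= m')%N -> B m `<=` B m' \/ m = m'.
  move=> mm mm' le; case: (cF.2 _ _ (FB _ mm) (FB _ mm')) => h; first by left.
  right; apply/eqP; rewrite eqn_leq le -{1}(dB _ mm) -{1}(dB _ mm').
  by apply: dimn_sub; [apply: (trace_fdim cF st2); apply: FB|apply: subspaceI => //; apply: cF.1; apply: FB|apply: setSI].
have alphaE m : m \in ms2 ->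
    nth d1 (0%N :: ms1) (index (dimn (B m `&` Y1)) (0%N :: rcons ms1 d1)) = dimn (B m `&` Y1).
  by move=> mm; apply: nth_index_type; case: t1 => _ _ _ h _; apply: h; apply: FB.
have r2inj := presents_inj p2.
have hY1 : has_dim Y1 d1 by case: t1.
apply: (@embedding_morphism _ _ _ (GRing.Linear.clone _ _ _ _ (r2 \o j1) _) d1 d2 X1 X2 ms1 ms2 P1 P2
  _ (fun m => r2 @` (B m `&` C1 `&` Y2)) (r2 @` (C1 `&` Y2))
  (fun m => index (dimn (B m `&` Y1)) (0%N :: rcons ms1 d1))) => //=.
- move=> u Xu e; apply: j1i; rewrite linear0; apply: r2inj => //.
  by apply: Y12; rewrite -eY1; exists u.
- by apply: fdim_image; apply: (fdim_sub fY2); [apply: subspaceI|move=> v []].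
- move=> _ [[u Xu <-] [v [Cv Yv] e]].
  have Yu : Y1 (j1 u) by rewrite -eY1; exists u.
  have e' : j1 u = v.
    by rewrite -(jr2 v Yv) e /= jr2 //; apply: Y12.
  have : [set 0] (j1 u) by apply: dYC; split=> //; rewrite e'.
  by move=> /= ->; rewrite linear0.
- have -> : [set r2 (j1 x) | x in X1] = r2 @` Y1 by rewrite -eY1 image_comp.
  rewrite -image_sum_sub -(sum_subI _ sY2 Y12) sYC setTI; exact: (presents_retract_image p2).
- by case: t2 => _ /path_sorted h _ _ _; apply: sub_sorted h => x y /ltnW.
- by move=> m mm; split; [apply: subspace_image; apply: sm; apply: FB|apply: image_subset => v [[]]].
- move=> m m' mm mm' le; case: (Bmono m m' mm mm' le) => [h|-> //].
  by apply: image_subset => v [[/h]].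
- move=> m m' mm mm' le; rewrite !alphaE //; case: (Bmono m m' mm mm' le) => [h|-> //].
  by apply: dimn_sub; [apply: (trace_fdim cF st1); apply: FB|apply: subspaceI => //; apply: cF.1; apply: FB|apply: setSI].
- move=> m mm; rewrite alphaE // -(dimnE hY1); apply: dimn_sub => //.
  by apply: subspaceI => //; apply: cF.1; apply: FB.
- move=> m mm; rewrite alphaE // dimn_image; [|by move=> v [_ Yv]; apply: r2inj|exact: fm (FB _ mm)].
  have FBm := FB m mm; have sB := cF.1 _ FBm.
  rewrite -[RHS](dB _ mm) -dimn_sum_direct //.
  + congr dimn; apply/seteqP; split.
      apply: sum_sub_min; [exact: subspaceI| |by move=> v [[]]].
      by move=> v [Bv /Y12].
    move=> v [Bv Yv]; have [a [Ba Ya] [c [Bc Cc] e]] := split1 _ FBm v Bv.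
    exists a => //; exists c => //; split=> //.
    by apply: (subspace_addl sY2 (Y12 Ya)); rewrite e.
  + exact: (trace_fdim cF st1).
  + exact: fm.
  + by move=> v [[_ Yv] [[_ Cv] _]]; apply: dYC.
move=> T; rewrite fE /transfer_flag /flag_image /flag_list -map_comp.
apply/eq_in_map => m mm /=.
rewrite (transferE _ st2 Y12 (flag_defP (svalP T).1) (FB _ mm)) image_sum_sub; congr sum_sub.
by rewrite /flag_def /flag_fun -eY1 flag_term_image -image_comp.
Qed.

Lemma transfer_map_exists P1 P2 : (forall t, is_flag X1 ms1 t -> P1 t -> P2 (transfer_flag t)) ->
  exists2 f : flag_variety d1 X1 ms1 P1 -> flag_variety d2 X2 ms2 P2,
    is_morphism f & forall T, sval (f T) = transfer_flag (sval T).
Proof.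
move=> hP; pose f (T : flag_variety d1 X1 ms1 P1) : flag_variety d2 X2 ms2 P2 :=
  exist _ (transfer_flag (sval T))
    (conj (transfer_flag_is_flag (svalP T).1) (hP _ (svalP T).1 (svalP T).2)).
exists f => //; exact: transfer_flag_morphism.
Qed.

End FlagTransfer.

(** * Towers of chains and their limit flag *)

Section Threads.
Variables (K : fieldType) (V : lmodType K).
Implicit Types (A B H : set V) (v w : V).

(** What a chain of flags compatible with the inclusions Y N `<=` Y N.+1 amounts to: the
    spaces S N of the flag at level N, completed by 0 and Y N, are exactly the traces
    of the spaces at the next level. *)
Record tower (Y : nat -> set V) (S : nat -> set (set V)) : Prop := Tower {
  tower_fdim : forall N, fdim (Y N);
  tower_inc : forall N, Y N `<=` Y N.+1;
  tower_exhaust : forall v, exists N, Y N v;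
  tower_neq0 : forall N, Y N <> [set 0];
  tower_sub : forall N A, S N A -> is_subspace A /\ A `<=` Y N;
  tower_total : forall N, total_on (S N) (fun A B => A `<=` B);
  tower_0 : forall N, S N [set 0];
  tower_top : forall N, S N (Y N);
  tower_down : forall N A, S N.+1 A -> S N (A `&` Y N);
  tower_up : forall N A, S N A -> exists2 A', S N.+1 A' & A' `&` Y N = A }.

Record tower_splitting (Y : nat -> set V) (S : nat -> set (set V)) (D : nat -> set V) : Prop :=
  TowerSplitting {
  splitting_subspace : forall N, is_subspace (D N);
  splitting_disjoint : forall N, Y N `&` D N `<=` [set 0];
  splitting_sum : forall N, sum_sub (Y N) (D N) = Y N.+1;
  splitting_split : forall N A, S N.+1 A -> A `<=` sum_sub (A `&` Y N) (A `&` D N) }.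

Variables (Y : nat -> set V) (S : nat -> set (set V)).
Hypothesis tw : tower Y S.
Let fY := tower_fdim tw.
Let Yinc := @tower_inc _ _ tw.
Let Yall := tower_exhaust tw.
Let Y0 := tower_neq0 tw.
Let Ssub := @tower_sub _ _ tw.
Let Stot := tower_total tw.
Let S0 := tower_0 tw.
Let SY := tower_top tw.
Let Sdown := @tower_down _ _ tw.
Let Sup := @tower_up _ _ tw.

Lemma tower_mono N M : (N <= M)%N -> Y N `<=` Y M.
Proof.
move=> /subnK <-; elim: (M - N)%N => [//|k IH]; exact: (subset_trans IH (@Yinc _)).
Qed.

Lemma tower_common v w n : exists2 N, (n <= N)%N & Y N v /\ Y N w.
Proof.
have [a Ya] := Yall v; have [b Yb] := Yall w; exists (maxn n (maxn a b)); first exact: leq_maxl.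
split; first by apply: tower_mono Ya; rewrite !leq_max leqnn orbT.
by apply: tower_mono Yb; rewrite !leq_max leqnn !orbT.
Qed.

Lemma tower_contains A : fdim A -> exists N, A `<=` Y N.
Proof.
move=> /frame_exists [s [_ _ <-]].
suff [N hN] : exists N, forall v, v \in s -> Y N v.
  by exists N; apply: sspan_min => //; apply: fdim_subspace.
elim: s => [|v s [N hN]]; first by exists 0%N.
have [M le [Yv _]] := tower_common v v N; exists M => u.
by rewrite inE => /orP [/eqP ->//|/hN]; apply: tower_mono.
Qed.

Lemma trace_down N M A : (N <= M)%N -> S M A -> S N (A `&` Y N).
Proof.
move=> /subnK <-; elim: (M - N)%N A => [|k IH] A SA.
  by move: SA; rewrite add0n => SA; rewrite (setIidl (Ssub SA).2).
have -> : A `&` Y N = A `&` Y (k + N)%N `&` Y N.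
  apply/seteqP; split=> [v [Av Yv]|v [[]]//]; split=> //; split=> //.
  by apply: tower_mono Yv; apply: leq_addl.
by apply: IH; apply: Sdown.
Qed.

Lemma trace_up N M A : (N <= M)%N -> S N A -> exists2 A', S M A' & A' `&` Y N = A.
Proof.
move=> /subnK <-; elim: (M - N)%N => [|k IH] SA.
  by exists A => //; rewrite (setIidl (Ssub SA).2).
have [A' SA' eA] := IH SA; have [A'' SA'' eA'] := Sup SA'.
exists A'' => //; rewrite -eA -eA'; apply/seteqP; split=> [v [Av Yv]|v [[]]//].
by split=> //; split=> //; apply: tower_mono Yv; apply: leq_addl.
Qed.

(** A coherent choice of one space at each level, encoded by its union. *)
Definition thread H := forall N, S N (H `&` Y N).

Lemma thread_subspace H : thread H -> is_subspace H.
Proof.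
move=> tH; split; first by have [] := (subspace0 (Ssub (tH 0%N)).1).
move=> a u v Hu Hv; have [N _ [Yu Yv]] := tower_common u v 0.
by have [] := (Ssub (tH N)).1.2 a u v (conj Hu Yu) (conj Hv Yv).
Qed.

Lemma thread_total H H' : thread H -> thread H' -> H `<=` H' \/ H' `<=` H.
Proof.
move=> tH tH'; have [|h] := pselect (H `<=` H'); first by left.
have [v Hv nv] := not_subset_exists h; right=> w Hw.
have [N _ [Yv Yw]] := tower_common v w 0.
case: (Stot (tH N) (tH' N)) => hh; last by have [] := hh w (conj Hw Yw).
by case: nv; have [] := hh v (conj Hv Yv).
Qed.

(** The least thread that contains v, and the greatest one that avoids it. *)
Definition below v : set V :=
  [set w | forall N, Y N v -> Y N w -> forall A, S N A -> A v -> A w].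
Definition before v : set V := [set w | ~ below w v].

Lemma belowP N v w : Y N v -> Y N w ->
  below v w <-> forall A, S N A -> A v -> A w.
Proof.
move=> Yv Yw; split; first by move=> h; apply: h.
move=> h M Yv' Yw' A SA Av.
case: (leqP N M) => [le|/ltnW le].
  by have [] := h _ (trace_down le SA) (conj Av Yv).
have [A' SA' eA] := trace_up le SA.
have : (A' `&` Y M) v by rewrite eA.
by move=> [/(h _ SA') A'w _]; rewrite -eA.
Qed.

Lemma below_refl v : below v v.
Proof. by []. Qed.

Lemma thread_below H v : thread H -> H v -> below v `<=` H.
Proof.
move=> tH Hv w hw; have [N _ [Yv Yw]] := tower_common v w 0.
by have [] := (belowP Yv Yw).1 hw _ (tH N) (conj Hv Yv).
Qed.

Lemma thread_before H v : thread H -> ~ H v -> H `<=` before v.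
Proof. by move=> tH nv w Hw hv; apply: nv; apply: (thread_below tH Hw). Qed.

Let fS N A : S N A -> fdim A.
Proof. by move=> SA; have [sA AY] := Ssub SA; apply: fdim_sub AY. Qed.

Let below_trace N v : Y N v -> S N (below v `&` Y N).
Proof.
move=> Yv.
have [n [[A0 [SA0 A0v] dA0] hn]] : exists n, (exists2 A, S N A /\ A v & dimn A = n) /\
    forall m, (exists2 A, S N A /\ A v & dimn A = m) -> (n <= m)%N.
  by apply: nat_min; exists (dimn (Y N)), (Y N).
suff -> : below v `&` Y N = A0 by [].
apply/seteqP; split=> [w [hw Yw]|w A0w]; first exact: (belowP Yv Yw).1 hw _ SA0 A0v.
have Yw := (Ssub SA0).2 w A0w; split=> //; apply/(belowP Yv Yw) => A SA Av.
apply: (chain_dimn_le (fS SA0) (fS SA) (Stot SA0 SA)) A0w.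
by rewrite dA0; apply: hn; exists A.
Qed.

Lemma below_thread v : thread (below v).
Proof.
move=> N; have [M le [Yv _]] := tower_common v v N.
have -> : below v `&` Y N = below v `&` Y M `&` Y N.
  apply/seteqP; split=> [w [hw Yw]|w [[]]//]; split=> //; split=> //.
  exact: tower_mono Yw.
exact: trace_down le (below_trace Yv).
Qed.

Let before_trace N v : v <> 0 -> Y N v -> S N (before v `&` Y N).
Proof.
move=> v0 Yv.
have [n [[A0 [SA0 A0v] dA0] hn]] : exists n, (exists2 A, S N A /\ ~ A v & dimn A = n) /\
    forall m, (exists2 A, S N A /\ ~ A v & dimn A = m) -> (m <= n)%N.
  apply: (@nat_max _ (dimn (Y N))).
    by exists (dimn [set 0 : V]), [set 0].
  by move=> m [A [SA _] <-]; have [sA AY] := Ssub SA; apply: dimn_sub.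
suff -> : before v `&` Y N = A0 by [].
apply/seteqP; split=> [w [hw Yw]|w A0w].
  apply: contrapT => nw; apply: hw; apply/(belowP Yw Yv) => A SA Aw.
  apply: contrapT => nv; apply: nw.
  apply: (chain_dimn_le (fS SA) (fS SA0) (Stot SA SA0)) Aw.
  by rewrite dA0; apply: hn; exists A.
have Yw := (Ssub SA0).2 w A0w; split=> // /(belowP Yw Yv) h.
by apply: A0v; apply: h.
Qed.

Lemma before_thread v : v <> 0 -> thread (before v).
Proof.
move=> v0 N; have [M le [Yv _]] := tower_common v v N.
have -> : before v `&` Y N = before v `&` Y M `&` Y N.
  apply/seteqP; split=> [w [hw Yw]|w [[]]//]; split=> //; split=> //.
  exact: tower_mono Yw.
exact: trace_down le (before_trace v0 Yv).
Qed.

Lemma before_below v : v <> 0 -> before v `<` below v.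
Proof.
move=> v0; split; last by move=> h; have := h v (@below_refl v); apply; exact: below_refl.
case: (thread_total (before_thread v0) (@below_thread v)) => // h.
by have := h v (@below_refl v); case; apply: below_refl.
Qed.

(** Not all threads belong to the limit flag, only those bordering a gap: a generalized
    flag must have no element without neighbours. *)
Definition cut_flag : set (set V) :=
  [set A | exists2 v, v <> 0 & A = before v \/ A = below v].

Lemma cut_flag_thread A : cut_flag A -> thread A.
Proof. by move=> [v v0 [->|->]]; [apply: before_thread|apply: below_thread]. Qed.

Lemma cut_successor v : v <> 0 -> successor cut_flag (before v) (below v).
Proof.
move=> v0; split; [by exists v => //; left|by exists v => //; right|exact: before_below|].
move=> C /cut_flag_thread tC [h1 h2] [h3 h4].
case: (pselect (C v)) => Cv; first by apply: h4; apply: thread_below.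
by apply: h2; apply: thread_before.
Qed.

Lemma cut_gflag : generalized_flag cut_flag.
Proof.
split.
- by move=> A /cut_flag_thread /thread_subspace.
- by move=> A B /cut_flag_thread tA /cut_flag_thread tB; apply: thread_total.
- move=> _ [v v0 [->|->]]; [exists (below v); left|exists (before v); right]; exact: cut_successor.
apply/seteqP; split=> v /=.
  move=> v0; exists (before v), (below v); split; first exact: cut_successor.
  by split; [apply: below_refl|move=> h; apply: h; apply: below_refl].
move=> [A [B [[/cut_flag_thread tA _ _ _] [_ nv]]]] v0; apply: nv; rewrite v0.
exact: subspace0 (thread_subspace tA).
Qed.

(** Although not every thread is kept, no space of any level is lost: a nonzero A is the
    trace of the least thread through a vector of A outside the next smaller space, and
    0 is the trace of the greatest thread avoiding a vector of the smallest nonzero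
    space. *)
Lemma cut_trace N A : S N A -> exists2 H, cut_flag H & H `&` Y N = A.
Proof.
move=> SA; have [sA AY] := Ssub SA.
case: (pselect (A = [set 0])) => [A0|A0].
  have [n [[B [SB B0] dB] hn]] : exists n, (exists2 A, S N A /\ A <> [set 0] & dimn A = n) /\
      forall m, (exists2 A, S N A /\ A <> [set 0] & dimn A = m) -> (n <= m)%N.
    by apply: nat_min; exists (dimn (Y N)), (Y N).
  have [v Bv v0] : exists2 v, B v & v <> 0.
    have [sB _] := Ssub SB.
    apply: contrapT => h; apply: B0; apply/seteqP; split; last exact: set0_sub.
    by move=> v Bv; apply: contrapT => v0; apply: h; exists v.
  exists (before v); first by exists v => //; left.
  rewrite A0; have SC := before_thread v0 N.
  apply: contrapT => nz.
  have := hn _ (ex_intro2 _ _ _ (conj SC nz) erefl); rewrite -dB => le.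
  have h := chain_dimn_le (fS SB) (fS SC) (Stot SB SC) le.
  by have [hv _] := h v Bv; apply: hv; apply: below_refl.
have [n [[B [SB AB] dB] hn]] : exists n, (exists2 B, S N B /\ ~ (A `<=` B) & dimn B = n) /\
      forall m, (exists2 B, S N B /\ ~ (A `<=` B) & dimn B = m) -> (m <= n)%N.
  apply: (@nat_max _ (dimn (Y N))).
    exists (dimn [set 0 : V]), [set 0] => //; split=> // h; apply: A0.
    by apply/seteqP; split=> //; apply: set0_sub.
  by move=> m [B [SB _] <-]; have [sB BY] := Ssub SB; apply: dimn_sub.
have [v Av nv] := not_subset_exists AB.
have v0 : v <> 0 by move=> e; apply: nv; rewrite e; apply: subspace0 (Ssub SB).1.
exists (below v); first by exists v => //; right.
have Yv := AY v Av; apply/seteqP; split=> [w [hw Yw]|w Aw].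
  exact: (belowP Yv Yw).1 hw _ SA Av.
have Yw := AY w Aw; split=> //; apply/(belowP Yv Yw) => C SC Cv.
apply: contrapT => nw.
have AC : ~ (A `<=` C) by move=> h; apply: nw; apply: h.
apply: nv; apply: (chain_dimn_le (fS SC) (fS SB) (Stot SC SB)) Cv.
by rewrite dB; apply: hn; exists C.
Qed.

Section Basis.
Variable E : set V.
Hypotheses (bE : is_basis E setT) (spT : forall H, thread H -> spanned E H).

Let smallestE N v : Y N v -> smallest_space S N v = below v `&` Y N.
Proof.
move=> Yv; apply/seteqP; split=> w.
  move=> h; apply: (h (below v `&` Y N)); split; first exact: below_thread.
  by split=> //; apply: below_refl.
move=> [hw Yw] A [SA Av]; exact: (belowP Yv Yw).1 hw _ SA Av.
Qed.

Let class_ltE v a : class_lt S v a <-> before a v.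
Proof.
split=> [[n hn] hva|hva].
  have [N le [Yv Ya]] := tower_common v a n.
  have := hn N le; rewrite !smallestE // => -[_]; apply=> w [hw Yw]; split=> //.
  exact: (thread_below (@below_thread v) hva).
have [n _ [Yv Ya]] := tower_common v a 0.
exists n => N le; have Yv' := tower_mono le Yv; have Ya' := tower_mono le Ya.
rewrite !smallestE //; split.
  case: (thread_total (@below_thread v) (@below_thread a)) => h; first exact: setSI.
  by case: hva; apply: h; apply: below_refl.
by move=> h; apply: hva; have [] := h a (conj (@below_refl a) Ya').
Qed.

Let same_classE v a : same_class S v a <-> below a v /\ below v a.
Proof.
split=> [[n hn]|[h1 h2]].
  have [N le [Yv Ya]] := tower_common v a n.
  split; [apply/(belowP Ya Yv)|apply/(belowP Yv Ya)] => A SA h.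
    by apply/(hn N le A SA).
  by apply/(hn N le A SA).
have [n _ [Yv Ya]] := tower_common v a 0.
exists n => N le A SA; have Yv' := tower_mono le Yv; have Ya' := tower_mono le Ya.
by split; [apply: (belowP Yv' Ya').1 h2 _ SA|apply: (belowP Ya' Yv').1 h1 _ SA].
Qed.

Let lower_span a : a <> 0 -> lin_span [set v | E v /\ class_lt S v a] = before a.
Proof.
move=> a0; rewrite -[RHS](spT (before_thread a0)); congr lin_span; apply/seteqP.
by split=> v [h1 h2]; split=> //; apply/class_ltE.
Qed.

Let upper_span a : lin_span [set v | E v /\ (class_lt S v a \/ same_class S v a)] = below a.
Proof.
rewrite -[RHS](spT (@below_thread a)); congr lin_span; apply/seteqP; split=> v.
  move=> [Ev [/class_ltE hva|/same_classE []//]]; split=> //.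
  case: (thread_total (@below_thread v) (@below_thread a)) => h; first by apply: h; apply: below_refl.
  by case: hva; apply: h; apply: below_refl.
move=> [hv Ev]; split=> //.
case: (pselect (below v a)) => h; first by right; apply/same_classE.
by left; apply/class_ltE.
Qed.

(** For e in E the spaces F'_a and F''_a of the class a = [e] are the two threads around
    the gap of e. Every gap contains a vector of E, as threads are spanned by parts of
    E. *)
Lemma limit_flagE : limit_flag S E = cut_flag.
Proof.
apply/seteqP; split=> A.
  move=> [a Ea hA]; have a0 := basis_neq0 bE Ea; exists a => //.
  by move: hA; rewrite lower_span // upper_span.
move=> [v v0 hA].
have [a [Ea ba] na] : exists2 a, E a /\ below v a & ~ before v a.
  apply: contrapT => h; case: (before_below v0) => _; apply.
  rewrite -(spT (@below_thread v)); apply: span_min.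
    exact: thread_subspace (before_thread v0).
  move=> a [ba Ea]; apply: contrapT => na; apply: h; by exists a.
have a0 := basis_neq0 bE Ea.
have bav : below a v by apply: contrapT.
have e1 : below a = below v.
  by apply/seteqP; split; apply: thread_below => //; apply: below_thread.
have e2 : before a = before v.
  apply/seteqP; split=> w hw h; apply: hw.
    by apply: (thread_below (@below_thread w) h).
  by apply: (thread_below (@below_thread w) h).
by exists a => //; rewrite lower_span // upper_span e1 e2.
Qed.

End Basis.

Section Complements.
Variable D : nat -> set V.
Hypothesis sp : tower_splitting Y S D.
Let sD := splitting_subspace sp.
Let YD0 := @splitting_disjoint _ _ _ sp.
Let YD := splitting_sum sp.
Let SD := @splitting_split _ _ _ sp.

Fixpoint partial_compl N k : set V :=
  if k is k'.+1 then sum_sub (partial_compl N k') (D (N + k')) else [set 0].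

(** The sum of all D M with M >= N. *)
Definition tower_compl N : set V := \bigcup_k partial_compl N k.

Let sY N : is_subspace (Y N) := fdim_subspace (fY N).

Let sP N k : is_subspace (partial_compl N k).
Proof. by elim: k => [|k IH] /=; [apply: subspace_set0|apply: subspace_sum_sub]. Qed.

Let PY N k : partial_compl N k `<=` Y (N + k)%N.
Proof.
elim: k => [|k IH] /=; first by rewrite addn0; apply: set0_sub.
rewrite addnS -YD; exact: sum_sub_mono.
Qed.

Let Pmono N k l : (k <= l)%N -> partial_compl N k `<=` partial_compl N l.
Proof.
move=> /subnK <-; elim: (l - k)%N => [//|i IH]; rewrite addSn.
apply: (subset_trans IH); exact: sub_suml.
Qed.

Let dP N k : Y N `&` partial_compl N k `<=` [set 0].
Proof.
elim: k => [|k IH] /=; first by move=> v [].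
move=> v [Yv [c Pc [d Dd e]]].
have Yd : Y (N + k)%N d.
  have Yc := PY Pc; apply: (subspace_addl (sY _) Yc); rewrite e.
  by apply: tower_mono Yv; apply: leq_addr.
have d0 : d = 0 by apply: (YD0 (conj Yd Dd)).
by apply: IH; split=> //; rewrite -e d0 addr0.
Qed.

Let YP N k : sum_sub (Y N) (partial_compl N k) = Y (N + k)%N.
Proof.
elim: k => [|k IH] /=; first by rewrite sum_sub0 addn0.
by rewrite sum_subA IH YD addnS.
Qed.

Let splitP N k A : S (N + k)%N A -> A `<=` sum_sub (A `&` Y N) (A `&` partial_compl N k).
Proof.
elim: k A => [|k IH] A.
  rewrite addn0 => SA v Av; have [sA AY] := Ssub SA.
  by exists v; [split=> //; apply: AY|exists 0; [split=> //; apply: subspace0|rewrite addr0]].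
rewrite addnS => SA v Av; have [sA AY] := Ssub SA.
have [x [Ax Yx] [d [Ad Dd] e]] := SD SA Av.
have [a [[Aa _] Ya] [c [[Ac _] Pc] e']] := IH _ (Sdown SA) x (conj Ax Yx).
exists a => //; exists (c + d); last by rewrite addrA e'.
by split; [apply: subspaceD|apply: mem_sum_sub].
Qed.

Lemma tower_compl_subspace N : is_subspace (tower_compl N).
Proof.
split; first by exists 0%N.
move=> a u v [k _ hk] [l _ hl]; exists (maxn k l) => //.
apply: (sP N (maxn k l)).2; [apply: Pmono hk|apply: Pmono hl]; [exact: leq_maxl|exact: leq_maxr].
Qed.

Lemma tower_stage F N : (forall A, F A -> thread A) -> is_stage F (Y N) (tower_compl N).
Proof.
move=> FT; split=> //; first exact: tower_compl_subspace.
- by move=> v [Yv [k _ hk]]; apply: (@dP N k).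
- apply/seteqP; split=> // v _; have [M le [Yv _]] := tower_common v v N.
  move: Yv; rewrite -(subnKC le) -YP => -[y Yy [c Pc e]].
  by exists y => //; exists c => //; exists (M - N)%N.
move=> A /FT tA v Av; have [M le [Yv _]] := tower_common v v N.
have := tA M; rewrite -(subnKC le) => /splitP h.
have [|y [[Ay _] Yy] [c [[Ac _] Pc] e]] := h v; first by rewrite subnKC.
by exists y => //; exists c => //; split=> //; exists (M - N)%N.
Qed.

Lemma tower_compl_spanned (E : set V) H N : is_basis E setT ->
  (forall N A, S N.+1 A -> A = Y N.+1 \/ spanned E (A `&` D N)) ->
  thread H -> Y N `<=` H \/ spanned E (H `&` tower_compl N).
Proof.
move=> bE SDE tH; case: (pselect (Y N `<=` H)) => YH; [by left|right].
have sH := thread_subspace tH.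
have key k : spanned E (H `&` partial_compl N k).
  elim: k => [|k IH].
    have -> : H `&` partial_compl N 0 = [set 0]; last exact: spanned0.
    by apply/seteqP; split=> [v []//|]; apply: set0_sub; apply: subspaceI => //; apply: subspace_set0.
  have -> : H `&` partial_compl N k.+1 =
      sum_sub (H `&` partial_compl N k) (H `&` Y (N + k).+1 `&` D (N + k)).
    apply/seteqP; split=> [v [Hv [c Pc [d Dd e]]]|]; last first.
      apply: sum_sub_min; first by apply: subspaceI => //; apply: sP.
        by move=> v [Hv Pv]; split=> //; apply: (Pmono (leqnSn k)).
      move=> v [[Hv _] Dv]; split=> //; exact: (sub_sumr (sP N k)).
    have Yc := PY Pc.
    have Yv : Y (N + k).+1 v by rewrite -YD -e; apply: mem_sum_sub.
    have [x [[Hx _] Yx] [d' [[Hd' _] Dd'] e']] := SD (tH (N + k).+1) (conj Hv Yv).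
    have [exc edd] := direct_uniq (sY _) (sD _) (@YD0 _) Yx Dd' Yc Dd (etrans e' (esym e)).
    exists c; first by split=> //; rewrite -exc.
    by exists d => //; rewrite -edd; split=> //; split=> //; rewrite -YD; apply: sub_sumr.
  apply: spanned_sum => //.
  case: (SDE _ _ (tH (N + k).+1)) => // e; case: YH => v Yv.
  have : Y (N + k).+1 v by apply: tower_mono Yv; rewrite -addnS leq_addr.
  by rewrite -e => -[].
apply/seteqP; split.
  by apply: span_min => [|v []//]; apply: subspaceI => //; apply: tower_compl_subspace.
move=> v [Hv [k _ Pv]]; have : (H `&` partial_compl N k) v by [].
rewrite -(key k); apply: span_mono => e [[He Pe] Ee]; split=> //; split=> //.
by exists k.
Qed.

End Complements.

Lemma thread_spanned (E : set V) : is_basis E setT ->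
  (forall N A, S N A -> A = Y N \/ spanned E A) -> forall H, thread H -> spanned E H.
Proof.
move=> bE SE H tH; have sH := thread_subspace tH.
case: (pselect (exists N, ~ (Y N `<=` H))) => [[N0 nH]|hn]; last first.
  have -> : H = setT; last exact: spannedT.
  apply/seteqP; split=> // v _; have [N Yv] := Yall v; apply: contrapT => nv.
  by apply: hn; exists N => h; apply: nv; apply: h.
apply/seteqP; split; first by apply: span_min => // v [].
move=> v Hv; have [N le [Yv _]] := tower_common v v N0.
case: (SE N _ (tH N)) => [e|sp].
  case: nH => w Yw; have : Y N w by apply: tower_mono Yw.
  by rewrite -e => -[].
have : (H `&` Y N) v by []. rewrite -sp; apply: span_mono => e [[He _] Ee]; by split.
Qed.

End Threads.

(** * Steps of deformed flags *)

Section TraceTypes.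
Variables (K : fieldType) (V : lmodType K).
Implicit Types (A B C Y X : set V) (F : set (set V)).

Lemma trace_deformation F Y C : chain F -> is_stage F Y C -> deformation F Y (fun A => A `&` Y).
Proof.
move=> cF [fY _ _ _ _]; split=> [A FA|A B FA FB AB]; last exact: setSI.
by split=> //; apply: subspaceI; [apply: cF.1|apply: fdim_subspace].
Qed.

Definition trace_type F Y d (sel : pred nat) : seq nat :=
  [seq r <- iota 1 d | sel r && `[< exists2 A, F A & dimn (A `&` Y) = r >]].

Lemma mem_trace_type F Y d (sel : pred nat) r : r \in trace_type F Y d sel <->
  [/\ (0 < r <= d)%N, sel r & exists2 A, F A & dimn (A `&` Y) = r].
Proof.
rewrite mem_filter mem_iota add1n ltnS; split.
  by move=> /andP [/andP [h1 /asboolP h2] h3].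
by move=> [h1 h2 h3]; rewrite h1 h2 asboolT.
Qed.

Lemma trace_typed F Y C d (sel : pred nat) : chain F -> is_stage F Y C -> has_dim Y d ->
  (forall A, F A -> dimn (A `&` Y) != 0%N -> dimn (A `&` Y) != d -> sel (dimn (A `&` Y))) ->
  typed F Y d (trace_type F Y d sel).
Proof.
move=> cF st hY hsel; split=> //.
- rewrite (path_sortedE ltn_trans).
  apply/andP; split; first by apply/allP => m /mem_trace_type [/andP []].
  by apply: sorted_filter; [apply: ltn_trans|apply: iota_ltn_sorted].
- by move=> m /mem_trace_type [/andP []].
- move=> A FA; rewrite in_cons mem_rcons in_cons.
  case: eqVneq => //= h0; case: eqVneq => //= hd; apply/mem_trace_type; split.
  + rewrite lt0n h0 /= -(dimnE hY); apply: dimn_sub; [by exists d| |by move=> v []].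
    by apply: fdim_subspace; apply: (trace_fdim cF st).
  + exact: hsel.
  + by exists A.
by move=> m /mem_trace_type [].
Qed.

Lemma dimn_flag_list F Y C d ms s : is_stage F Y C -> typed F Y d ms -> deformation F Y s ->
  [seq dimn A | A <- flag_list F Y ms s] = ms.
Proof.
move=> st tF ds; rewrite /flag_list -map_comp -[RHS]map_id; apply/eq_in_map => m mm /=.
by have [FA dA] := space_of_rankP tF mm; case: (ds.1 _ FA) => _ _ ->.
Qed.

(** The traces on Y of the deformed generalized flag are the spaces of the flag, and they
    are told apart by their dimensions. *)
Lemma deform_flag_inj F Y C s s' : chain F -> is_stage F Y C ->
  deformation F Y s -> deformation F Y s' ->
  deform C s @` F = deform C s' @` F -> forall A, F A -> s A = s' A.
Proof.
move=> cF st ds ds' e A FA.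
have [B FB eB] : (deform C s' @` F) (deform C s A) by rewrite -e; exists A.
have h : s A = s' B by rewrite -(deform_capY cF st ds FA) -eB (deform_capY cF st ds' FB).
rewrite h; apply: (deformation_eq cF st ds' FB FA).
by have [_ _ <-] := ds'.1 B FB; have [_ _ <-] := ds.1 A FA; rewrite h.
Qed.

Lemma eq_deform_image F C s s' : (forall A, F A -> s A = s' A) ->
  deform C s @` F = deform C s' @` F.
Proof. by move=> h; apply: eq_imagel => A FA; rewrite /deform h. Qed.

End TraceTypes.

Section StepExistence.
Variables (K : fieldType) (V : lmodType K).
Implicit Types (A B : set V).
Variables (F : set (set V)) (X C X' C' : set V) (d d' : nat) (ms ms' : seq nat).
Hypotheses (cF : chain F) (st : is_stage F X C) (st' : is_stage F X' C').
Hypotheses (tF : typed F X d ms) (tF' : typed F X' d' ms').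
Hypotheses (XX' : X `<=` X').
Variables (W : set V) (c : set V -> Prop).
Hypotheses (hW : has_dim W 1) (XW : X `&` W `<=` [set 0]).
Hypotheses (cW : forall A, F A -> A `&` C `&` X' = if `[< c A >] then W else [set 0]).
Hypotheses (bottom : exists2 A, F A & dimn (A `&` X') = 0%N).
Hypotheses (top : forall A, F A -> rank_index X d ms A = (size ms).+1 ->
  exists2 A, F A & rank_index X d ms A = (size ms).+1 /\ c A).
Hypotheses (NP : forall A, F A -> dimn (A `&` X') \in ms' <->
  ~ (rank_index X d ms A = 0%N /\ ~ c A) /\ ~ (rank_index X d ms A = (size ms).+1 /\ c A)).
Variable (s : set V -> set V).
Hypothesis (ds : deformation F X s).

Let W0 : W <> [set 0].
Proof. by move=> e; have := has_dim_uniq hW; rewrite e => /(_ _ (has_dim0 V)). Qed.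

Let sW : is_subspace W := has_dim_subspace hW.

Let cP A : F A -> c A <-> W `<=` A `&` C `&` X'.
Proof.
move=> FA; rewrite cW //; case: asboolP => h; first by split=> // _; apply: subset_refl.
by split=> // h'; case: W0; apply/seteqP; split=> //; apply: set0_sub.
Qed.

Let step_lists r : deformation F X r ->
  lists [set B | exists A, [/\ F A, dimn (A `&` X') \in ms' &
                    B = add_if `[< c A >] W (flag_fun X d ms (flag_list F X ms r) A)]]
        (flag_list F X' ms' (transfer C X' r)).
Proof.
move=> dr; apply: (lists_flag_list cF st' tF').
  exact: (transfer_deformation cF st st' XX' dr).
move=> B; have key A : F A -> transfer C X' r A =
    add_if `[< c A >] W (flag_fun X d ms (flag_list F X ms r) A).
  move=> FA; rewrite (transferE _ st' XX' dr FA) (flag_fun_list cF st tF dr FA) cW // /add_if.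
  by case: ifP => // _; rewrite sum_sub0.
by split=> -[A [FA h1 h2]]; exists A; split=> //; rewrite ?h1 ?h2 ?key.
Qed.

(** The shape and the position given by [step_pattern] depend on F alone, so the same
    ones serve for the traces of F and for the deformed flag. *)
Lemma std_step_exists :
  std_step X W (flag_list F X ms (fun A => A `&` X)) (flag_list F X' ms' (fun A => A `&` X'))
    (flag_list F X ms s) (flag_list F X' ms' (transfer C X' s)).
Proof.
have dt := trace_deformation cF st; have dt' := trace_deformation cF st'.
have [_ pms h0 _ hr] := tF'; have [hX pm _ hm _] := tF.
have tE : flag_list F X' ms' (fun A => A `&` X') = flag_list F X' ms' (transfer C X' (fun A => A `&` X)).
  apply: flag_list_eq => // A FA; rewrite /transfer /deform; congr (_ `&` X').
  case: st => _ sC _ _ /(_ A FA) h; apply/seteqP; split=> //.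
  by apply: sum_sub_min; [apply: cF.1|move=> v []|move=> v []].
have [||||i [new hnew]] := @step_pattern K V F X C d ms cF st tF c
    (fun A => dimn (A `&` X') \in ms').
- move=> A B FA FB AB /(cP FA) h; apply/(cP FB); apply: (subset_trans h).
  by move=> v [[/AB Bv Cv] Xv].
- have [A FA dA] := bottom; exists A => //.
  have sA := cF.1 A FA; have A0 : A `&` X' = [set 0].
    exact: dimn_eq0 (trace_fdim cF st' FA) dA.
  have A0' : A `&` X = [set 0].
    apply/seteqP; split; first by move=> v [Av /XX' Xv]; rewrite -A0.
    by apply: set0_sub; apply: fdim_subspace; apply: (trace_fdim cF st).
  split; first by rewrite /rank_index A0' dimn0.
  move=> /(cP FA) h; apply: W0; apply/seteqP; split; last exact: set0_sub.
  by move=> v /h [[Av _] Xv]; rewrite -A0.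
- exact: top.
- exact: NP.
have E1 r : deformation F X r ->
    (if new then ext_new X W i (flag_list F X ms r) else ext_same W i (flag_list F X ms r)) =
    flag_list F X' ms' (transfer C X' r).
  move=> dr; apply: (lists_uniq _ (step_lists dr)); apply: hnew => //.
  exact: (flag_list_is_flag cF st tF dr).
exists i; rewrite tE -(E1 _ ds) -(E1 _ dt).
by case: (new) => /=; [right|left]; split.
Qed.

End StepExistence.

Section Uniqueness.
Variables (K : fieldType) (V : lmodType K).

Lemma std_steps_uniq (X : nat -> set V) (W : nat -> set (set V)) (l t t' : nat -> seq (set V)) n :
  (forall m, (n <= m)%N -> is_subspace (X m)) ->
  (forall m w, (n <= m)%N -> W m w -> is_subspace w /\ ~ (w `<=` X m)) ->
  (forall m i, (n <= m)%N -> (i <= size (l m))%N ->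
     is_subspace (flag_term (X m) (l m) i) /\ flag_term (X m) (l m) i `<=` X m) ->
  (forall m w w' A, (n <= m)%N -> W m w -> W m w' -> A \in l m.+1 -> w `<=` A -> w' `<=` A -> w = w') ->
  (forall m, (n <= m)%N -> exists2 w, W m w & std_step (X m) w (l m) (l m.+1) (t m) (t m.+1)) ->
  (forall m, (n <= m)%N -> exists2 w, W m w & std_step (X m) w (l m) (l m.+1) (t' m) (t' m.+1)) ->
  (forall m, (n <= m)%N -> size (t' m) = size (l m)) ->
  t n = t' n -> forall m, (n <= m)%N -> t m = t' m.
Proof.
move=> hX hW hl hu ht ht' hs e m /subnK <-; elim: (m - n)%N => [//|k IH].
have le : (n <= k + n)%N by apply: leq_addl.
have [w Ww sw] := ht _ le; have [w' Ww' sw'] := ht' _ le.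
have [s1 n1] := hW _ _ le Ww; have [s2 n2] := hW _ _ le Ww'.
rewrite -IH in sw'; apply: (std_step_uniq (etrans (congr1 size IH) (hs _ le)) (hX _ le) s1 s2 n1 n2 _ _ sw sw').
  by move=> i hi; apply: hl.
by move=> A hA; apply: (hu _ w w' A le Ww Ww' hA).
Qed.

End Uniqueness.

Section Retraction.
Variables (K : fieldType) (V0 V : lmodType K) (j : {linear V0 -> V}).

Lemma linear_retraction (C : set V) : injective j -> is_subspace C ->
  range j `&` C `<=` [set 0] -> sum_sub (range j) C = setT ->
  exists r : {linear V -> V0}, forall v, range j v -> j (r v) = v.
Proof.
move=> ji sC d e.
have /choice [g hg] v : exists u, C (v - j u).
  have : [set: V] v by []. rewrite -e => -[_ [u _ <-] [w Cw <-]].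
  by exists u; rewrite addrC addKr.
have gE v u : C (v - j u) -> g v = u.
  move=> h; apply: ji; apply/eqP; rewrite -subr_eq0; apply/eqP; apply: d; split.
    by exists (g v - u) => //; rewrite linearB.
  have -> : j (g v) - j u = (v - j u) - (v - j (g v)) by rewrite opprB [RHS]addrC addrA subrK.
  exact: subspaceB.
have lg : linear g.
  move=> a u v; apply: gE; rewrite linearP opprD addrACA -scalerBr; exact: sC.2.
have [r hr] := linear_pack lg; exists r => _ [u _ <-]; rewrite hr; congr (j _).
by apply: gE; rewrite subrr; apply: subspace0.
Qed.

End Retraction.

Section VectorTypes.
Variables (K : fieldType) (V : vectType K).

Lemma vect_has_dim : has_dim [set: V] (dim V).
Proof.
have e := vbasisP (fullv : {vspace V}).
rewrite -dimvf; exists (fun i => (vbasis (fullv : {vspace V}))`_i); split.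
  move=> c h i; have /freeP := basis_free e; apply=> //.
apply/seteqP; split=> // v _; rewrite (coord_vbasis (memvf v)).
apply: (subspace_sum _ (subspace_span _)) => i.
by apply: (subspaceZ _ (subspace_span _)); apply: sub_span; exists i.
Qed.

End VectorTypes.

(** * The presentation of Fl(F, E, V) *)

Section StageDimensions.
Variables (K : fieldType) (V : lmodType K).
Implicit Types (A : set V).

Lemma stage_trace_dim (F : set (set V)) (X C X' C' : set V) A : chain F ->
  is_stage F X C -> is_stage F X' C' -> X `<=` X' -> F A ->
  dimn (A `&` X') = (dimn (A `&` X) + dimn (A `&` C `&` X'))%N.
Proof.
move=> cF st st' XX' FA.
have [_ _ <-] := (transfer_deformation cF st st' XX' (trace_deformation cF st)).1 A FA.
rewrite (transferE _ st' XX' (trace_deformation cF st) FA) dimn_sum_direct //.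
- exact: (trace_fdim cF st).
- have [fX' _ _ _ _] := st'; have [_ sC _ _ _] := st; apply: (fdim_sub fX'); last by move=> v [].
  by do ![apply: subspaceI => //]; [apply: cF.1|apply: fdim_subspace].
by case: st => _ _ d _ _ v [[_ Xv] [[_ Cv] _]]; apply: d.
Qed.

Lemma rank_index0 F (X : set V) d ms A : typed F X d ms -> F A ->
  rank_index X d ms A = 0%N <-> dimn (A `&` X) = 0%N.
Proof.
move=> _ FA; rewrite /rank_index /=; case: eqP => // h; split=> // e; by case: h.
Qed.

Lemma rank_index_last F (X : set V) d ms A : typed F X d ms -> F A ->
  rank_index X d ms A = (size ms).+1 <-> dimn (A `&` X) \notin 0%N :: ms.
Proof.
move=> tF FA; rewrite /rank_index -rcons_cons -cats1 index_cat.
case: (boolP (dimn (A `&` X) \in 0%N :: ms)) => h; split=> //.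
  by move=> e; move: h; rewrite -index_mem e ltnn.
move=> _; case: tF => _ _ _ /(_ A FA) + _; rewrite -rcons_cons mem_rcons in_cons (negbTE h) orbF.
by move=> /eqP -> /=; rewrite eqxx addn0.
Qed.

End StageDimensions.

Section IdentityPresentation.
Variables (K : fieldType) (V : lmodType K).

Definition id_lin : {linear V -> V} := GRing.Linear.clone _ _ _ _ (@idfun V) _.

Lemma presents_id (X : set V) : is_subspace X -> presents id_lin id_lin X X.
Proof. by move=> sX; split=> //; rewrite /= image_id. Qed.

Lemma flag_image_id (t : seq (set V)) : flag_image id_lin t = t.
Proof. by rewrite /flag_image -[RHS]map_id; apply: eq_map => A /=; rewrite image_id. Qed.

End IdentityPresentation.

Section GFlPresentation.
Variables (K : fieldType) (V : lmodType K) (e : nat -> V) (F : set (set V)).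
Let E : set V := range e.
Hypotheses (einj : injective e) (bE : is_basis E setT).
Hypotheses (gF : generalized_flag F) (spF : forall A, F A -> spanned E A).
Let cF : chain F := gflag_chain gF.

Definition initial n : set V := [set e j | j in `I_n].
Definition initial_span n : set V := lin_span (initial n).
Definition initial_compl n : set V := lin_span (E `\` initial n).
Let X := initial_span.
Let C := initial_compl.
Let Q n : set (set V) := [set A | A <> [set 0] /\ A <> X n].
Definition initial_type n := [seq dimn A | A <- listing (trace F (X n) (Q n))].
Let ms := initial_type.

Lemma initial_finite n : finite_set (initial n).
Proof. by apply: finite_image; apply: finite_II. Qed.

Lemma initial_sub n : initial n `<=` E.
Proof. by move=> _ [j _ <-]; exists j. Qed.

Lemma initial_inc n m : (n <= m)%N -> initial n `<=` initial m.
Proof. by move=> le _ [j /= hj <-]; exists j => //=; apply: leq_trans le. Qed.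

Lemma initial_exhaust : E `<=` \bigcup_n initial n.
Proof. by move=> _ [j _ <-]; exists j.+1 => //; exists j => /=. Qed.

Lemma initial_has_dim n : has_dim (X n) n.
Proof.
have -> : X n = sspan (map e (iota 0 n)).
  congr lin_span; apply/seteqP; split=> [_ [j /= hj <-]|v /= /mapP [j]].
    by apply: map_f; rewrite mem_iota.
  by rewrite mem_iota => /andP [_ hj] ->; exists j.
rewrite -{2}(size_iota 0 n) -(size_map e); apply: indep_sspan.
apply: (basis_indep bE); first by rewrite map_inj_uniq ?iota_uniq.
by move=> v /mapP [j _ ->]; exists j.
Qed.

Let stX n : is_stage F (X n) (C n).
Proof. exact: (basis_stage bE spF (initial_finite n) (@initial_sub n)). Qed.
Definition initial_stage := stX.

Lemma initial_span_inc n m : (n <= m)%N -> X n `<=` X m.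
Proof. by move=> le; apply: span_mono; apply: initial_inc. Qed.

Lemma initial_compl_dec n m : (n <= m)%N -> C m `<=` C n.
Proof.
by move=> le; apply: span_mono => v [Ev nv]; split=> // hv; apply: nv; apply: initial_inc hv.
Qed.

Let e0 : e 0 <> 0.
Proof. by apply: (basis_neq0 bE); exists 0%N. Qed.

Let lists_trace0 n m0 s : typed F (X n) n m0 -> (forall r, r \in m0 -> (r < n)%N) ->
  deformation F (X n) s ->
  lists (trace (deform (C n) s @` F) (X n) (Q n)) (flag_list F (X n) m0 s).
Proof.
move=> ty0 lt0 ds; apply: (lists_flag_list cF (stX n) ty0 ds) => B; split.
  move=> [[B0 BX] [_ [A FA <-] eB]]; rewrite (deform_capY cF (stX n) ds FA) in eB.
  have [s1 s2 s3] := ds.1 A FA; exists A; split=> //.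
  case: ty0 => _ _ _ /(_ A FA) + _; rewrite inE mem_rcons inE => /or3P [/eqP d0|/eqP dn|//].
    by case: B0; rewrite eB; apply: dimn_eq0; [apply: (deformation_fdim (stX n) ds)|rewrite s3].
  case: BX; rewrite eB; apply: dimn_sub_eq => //; first by exists n; apply: initial_has_dim.
  by rewrite s3 dn (dimnE (initial_has_dim n)).
move=> [A [FA -> dA]]; have [s1 s2 s3] := ds.1 A FA.
have [_ pm _ _ _] := ty0; split; last by exists (deform (C n) s A); [exists A|rewrite (deform_capY cF (stX n) ds FA)].
split=> eA.
  have /allP/(_ _ dA) := order_path_min ltn_trans pm.
  by rewrite -s3 eA dimn0.
by have := lt0 _ dA; rewrite -s3 eA (dimnE (initial_has_dim n)) ltnn.
Qed.

Let deform_trace n : deform (C n) (fun A => A `&` X n) @` F = F.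
Proof.
apply/seteqP; split=> A.
  move=> [B FB <-]; suff -> : deform (C n) (fun A => A `&` X n) B = B by [].
  apply/seteqP; split; first by apply: sum_sub_min; [apply: cF.1|move=> v []|move=> v []].
  by case: (stX n) => _ _ _ _ /(_ B FB).
move=> FA; exists A => //.
apply/seteqP; split; first by apply: sum_sub_min; [apply: cF.1|move=> v []|move=> v []].
by case: (stX n) => _ _ _ _ /(_ A FA).
Qed.

Let msE n : ms n = trace_type F (X n) n (fun r => r < n)%N.
Proof.
set m0 := trace_type _ _ _ _.
have ty0 : typed F (X n) n m0.
  apply: (trace_typed cF (stX n) (initial_has_dim n)) => A FA _ hn.
  rewrite ltn_neqAle hn /= -[leqRHS](dimnE (initial_has_dim n)).
  apply: dimn_sub => //; first by exists n; apply: initial_has_dim.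
  by apply: fdim_subspace; apply: (trace_fdim cF (stX n)).
have dt := trace_deformation cF (stX n).
have lt0 r : r \in m0 -> (r < n)%N by move=> /mem_trace_type [].
have := lists_trace0 ty0 lt0 dt; rewrite deform_trace => /listingE eQ.
by rewrite /ms /initial_type eQ (dimn_flag_list (stX n) ty0 dt).
Qed.

Let ty n : typed F (X n) n (ms n).
Proof.
rewrite msE; apply: (trace_typed cF (stX n) (initial_has_dim n)) => A FA _ hn.
rewrite ltn_neqAle hn /= -[leqRHS](dimnE (initial_has_dim n)).
apply: dimn_sub => //; first by exists n; apply: initial_has_dim.
by apply: fdim_subspace; apply: (trace_fdim cF (stX n)).
Qed.
Definition initial_typed := ty.

Let ms_lt n r : r \in ms n -> (r < n)%N.
Proof. by rewrite msE => /mem_trace_type []. Qed.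

Let lists_trace n s : deformation F (X n) s ->
  lists (trace (deform (C n) s @` F) (X n) (Q n)) (flag_list F (X n) (ms n) s).
Proof. by apply: lists_trace0 => // r; apply: ms_lt. Qed.

Let listing_trace n : listing (trace F (X n) (Q n)) = flag_list F (X n) (ms n) (fun A => A `&` X n).
Proof.
by apply: listingE; have := lists_trace (trace_deformation cF (stX n)); rewrite deform_trace.
Qed.

Let W m := lin_span [set e m].

Let em_new m : (E `\` initial m) (e m).
Proof. by split; [exists m|move=> [j /= hj /einj ejm]; rewrite ejm ltnn in hj]. Qed.

Let XW m : X m `&` W m `<=` [set 0].
Proof.
have [_ _ d _ _] := stX m; move=> v [Xv Wv]; apply: d; split=> //.
by apply: span_mono Wv => _ ->; apply: em_new.
Qed.

Let hW m : has_dim (W m) 1.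
Proof. by apply: dimn_line; apply: (basis_neq0 bE); exists m. Qed.

Let cW m A : F A -> A `&` C m `&` X m.+1 = if `[< A (e m) >] then W m else [set 0].
Proof.
move=> FA; have sA := cF.1 A FA; rewrite -setIA.
have -> : C m `&` X m.+1 = W m.
  rewrite /C /initial_compl /X /initial_span (span_basisI bE) //; last exact: initial_sub.
  congr lin_span; apply/seteqP; split=> [_ [[[j _ <-] nj] [i /= hi /einj eij]]|_ ->].
    rewrite eij in hi; suff -> : j = m by [].
    apply/eqP; rewrite eqn_leq -ltnS hi leqNgt; apply/negP => lt; apply: nj; by exists j.
  by split; [apply: em_new|exists m => /=].
case: asboolP => h.
  by apply/setIidPr; apply: span_min => // _ ->.
apply/seteqP; split; last by apply: set0_sub; apply: subspaceI => //; apply: subspace_span.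
move=> v [Av]; rewrite /W span_set1 => -[a _ ev]; case: (eqVneq a 0) => [a0|a0].
  by rewrite -ev a0 scale0r.
case: h; rewrite -[e m](scalerK a0) ev; exact: subspaceZ.
Qed.

Let step m s : deformation F (X m) s ->
  std_step (X m) (W m) (listing (trace F (X m) (Q m))) (listing (trace F (X m.+1) (Q m.+1)))
    (flag_list F (X m) (ms m) s) (flag_list F (X m.+1) (ms m.+1) (transfer (C m) (X m.+1) s)).
Proof.
move=> ds; rewrite !listing_trace; case: m ds => [|m] ds.
  (* X 0 = 0 and X 1 is a line: there are no proper nonzero subspaces. *)
  have ms0 : ms 0 = [::] by case E0 : (ms 0) => [//|r l]; have := @ms_lt 0 r; rewrite E0 mem_head => /(_ isT).
  have ms1 : ms 1 = [::].
    case E1 : (ms 1) => [//|r l]; have h := @ms_lt 1 r; rewrite E1 mem_head in h.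
    have [_ pm _ _ _] := ty 1; rewrite E1 /= in pm; case/andP: pm => r0 _.
    by have := leq_trans r0 (h isT : (r <= 0)%N).
  by rewrite /flag_list ms0 ms1 /=; exists 0%N; left.
have inc : X m.+1 `<=` X m.+2 by apply: initial_span_inc.
have dW A : F A -> dimn (A `&` X m.+2) = (dimn (A `&` X m.+1) + `[< A (e m.+1) >])%N.
  move=> FA; rewrite (stage_trace_dim cF (stX m.+1) (stX m.+2) inc FA) cW //.
  by case: asboolP => h /=; [rewrite (dimnE (hW m.+1))|rewrite dimn0].
have dle A n : F A -> (dimn (A `&` X n) <= n)%N.
  move=> FA; rewrite -[leqRHS](dimnE (initial_has_dim n)); apply: dimn_sub => //; first by exists n; apply: initial_has_dim.
  by apply: fdim_subspace; apply: (trace_fdim cF (stX n)).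
have last_dim A : F A -> rank_index (X m.+1) m.+1 (ms m.+1) A = (size (ms m.+1)).+1 <-> dimn (A `&` X m.+1) = m.+1.
  move=> FA; rewrite (rank_index_last (ty m.+1) FA); split=> [h|->].
    case: (ty m.+1) => _ _ _ /(_ A FA) + _; rewrite -rcons_cons mem_rcons in_cons (negbTE h) orbF.
    by move=> /eqP.
  by rewrite inE /=; apply/negP => /ms_lt; rewrite ltnn.
apply: (std_step_exists cF (stX m.+1) (stX m.+2) (ty m.+1) (ty m.+2) inc (hW m.+1) (@XW m.+1)
  (c := fun A => A (e m.+1))) => //.
- exact: cW.
- have [A FA eA] := gflag_avoids gF e0 (ex_intro _ _ (initial_has_dim m.+2)).
  by exists A => //; rewrite eA dimn0.
- move=> _ _ _; have [A FA XA] := gflag_covers gF e0 (ex_intro _ _ (initial_has_dim m.+2)).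
  exists A => //; split.
    apply/(last_dim A FA); have -> : A `&` X m.+1 = X m.+1 by apply/setIidPr; apply: subset_trans XA.
    exact: dimnE (initial_has_dim _).
  by apply: XA; apply: sub_span; exists m.+1 => /=.
move=> A FA; rewrite (rank_index0 (ty m.+1) FA) (last_dim A FA).
have mem2 : dimn (A `&` X m.+2) \in ms m.+2 <-> (0 < dimn (A `&` X m.+2) < m.+2)%N.
  split=> [h|/andP [h1 h2]].
    rewrite (ms_lt h) andbT; have [_ pm _ _ _] := ty m.+2.
    by have /allP/(_ _ h) := order_path_min ltn_trans pm.
  case: (ty m.+2) => _ _ _ /(_ A FA) + _; rewrite in_cons mem_rcons in_cons.
  by rewrite gtn_eqF //= ltn_eqF.
rewrite mem2 dW //; have := dle A m.+1 FA; case: asboolP => h le; rewrite ?addn1 ?addn0.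
  split=> [/andP [_ lt]|[_ h2]]; first by split=> [[]//|[e1 _]]; rewrite e1 ltnn in lt.
  by rewrite /= ltnS ltn_neqAle le andbT; apply/eqP => e1; apply: h2.
split=> [/andP [lt _]|[h1 _]]; first by split=> [[e1 _]|[]//]; rewrite e1 in lt.
by rewrite ltnS le andbT lt0n; apply/eqP => e1; apply: h1.
Qed.

Let pX n : presents (id_lin V) (id_lin V) (X n) (X n).
Proof. by apply: presents_id; apply: subspace_span. Qed.

Definition initial_def n t := flag_def (id_lin V) (X n) n (ms n) t.
Let sg := initial_def.

Let sgE n t : sg n t = flag_fun (X n) n (ms n) t.
Proof. by rewrite /sg /initial_def /flag_def flag_image_id. Qed.

Let sg_def n t : is_flag (X n) (ms n) t -> deformation F (X n) (sg n t).
Proof. by move=> ft; rewrite sgE; apply: (flag_fun_deformation cF (stX n) (ty n)). Qed.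

Let CC n m A : (n <= m)%N -> F A -> X n `<=` A \/ A `&` C m `<=` C n.
Proof. by move=> le FA; right=> v [_ /(initial_compl_dec le)]. Qed.

Let G0 n t := deform (C n) (sg n t) @` F.

Let trans n t m := transfer (C n) (X m) (sg n t).

Let trans_def n t m : (n <= m)%N -> is_flag (X n) (ms n) t -> deformation F (X m) (trans n t m).
Proof.
move=> le ft.
exact: (transfer_deformation cF (stX n) (stX m) (initial_span_inc le) (sg_def ft)).
Qed.

Let trans_image n t m : (n <= m)%N -> is_flag (X n) (ms n) t ->
  deform (C m) (trans n t m) @` F = G0 n t.
Proof.
move=> le ft; apply: eq_imagel => A FA.
apply: (transfer_deform cF (stX n) (stX m) (initial_span_inc le) _ (sg_def ft) FA) => B FB.
exact: CC.
Qed.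

Let Wset m : set (set V) := [set lin_span [set e m]].

Let corresponds_G0 n t : is_flag (X n) (ms n) t -> corresponds X Q Wset F n t (G0 n t).
Proof.
move=> ft; exists (fun m => flag_list F (X m) (ms m) (trans n t m)).
  rewrite -[RHS](flag_list_fun (ty n) ft); apply: flag_list_eq; first by case: (ty n).
  by move=> A FA; rewrite /trans /transfer (deform_capY cF (stX n) (sg_def ft) FA) sgE.
move=> m le; split.
  by rewrite -(trans_image le ft); apply: lists_trace; apply: trans_def.
exists (W m) => //.
have := step (trans_def le ft).
rewrite (@flag_list_eq _ _ F _ _ (transfer (C m) (X m.+1) (trans n t m)) (trans n t m.+1)) //.
  by case: (ty m.+1).
move=> A FA; rewrite {1}/transfer /trans.
rewrite (transfer_deform cF (stX n) (stX m) (initial_span_inc le) _ (sg_def ft) FA) // => B FB.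
exact: CC.
Qed.

Let comm_deform G : commensurable E F G -> exists n0, forall n, (n0 <= n)%N -> exists s,
    deformation F (X n) s /\ G = deform (C n) s @` F.
Proof.
apply: (commensurable_deform bE gF spF) => [n||n].
- exact: initial_inc.
- exact: initial_exhaust.
- by split; [apply: initial_finite|apply: initial_sub].
Qed.

(* At a late stage G is the deformation given by the flag it induces there, and the
   intermediate steps determine this flag from t. *)
Let corresponds_uniq n t G : is_flag (X n) (ms n) t -> commensurable E F G ->
  corresponds X Q Wset F n t G -> G = G0 n t.
Proof.
move=> ft cG [u un hu]; have [u' un' hu'] := corresponds_G0 ft.
have [n0 hn0] := comm_deform cG.
have [s [ds eG]] := hn0 (maxn n n0) (leq_maxr _ _).
have le := leq_maxl n n0; set m := maxn n n0 in s ds eG le *.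
have dt k := trace_deformation cF (stX k).
have eu' k : (n <= k)%N -> u' k = flag_list F (X k) (ms k) (trans n t k).
  move=> lek; have [h _] := hu' k lek; rewrite -(trans_image lek ft) in h.
  by apply: (lists_uniq h); apply: lists_trace; apply: trans_def.
have euu : u m = u' m.
  apply: (@std_steps_uniq _ _ X Wset (fun k => listing (trace F (X k) (Q k))) u u' n) => //.
  - by move=> k _; apply: subspace_span.
  - move=> k w _ ->; split; first exact: subspace_span.
    move=> h; have := has_dim0 V; have -> : [set 0] = W k; last by move=> /(has_dim_uniq (hW k)).
    apply/seteqP; split; first by apply: set0_sub; apply: subspace_span.
    by move=> v Wv; apply: (@XW k); split=> //; apply: h.
  - move=> k i _ _; rewrite listing_trace.
    have fl := flag_list_is_flag cF (stX k) (ty k) (dt k).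
    split; first exact: has_dim_subspace (flag_term_dim i (initial_has_dim k) fl).
    exact: (flag_term_sub (initial_has_dim k) fl).
  - by move=> k w w' A _ -> ->.
  - by move=> k lek; case: (hu k lek).
  - by move=> k lek; case: (hu' k lek).
  - by move=> k lek; rewrite listing_trace (eu' k lek) !size_map.
  - by rewrite un un'.
have e1 : u m = flag_list F (X m) (ms m) s.
  by have [h _] := hu m le; rewrite eG in h; apply: (lists_uniq h); apply: lists_trace.
rewrite eG -(trans_image le ft); apply: eq_deform_image => A FA.
rewrite -(flag_fun_list cF (stX m) (ty m) ds FA) -e1 euu (eu' m le).
by rewrite (flag_fun_list cF (stX m) (ty m) (trans_def le ft) FA).
Qed.

Definition initial_gflag n t := G0 n t.

Lemma GFl_represents n (s : level (GFl F e) n) (H : GFl F e) :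
  represents s H <-> sval H = initial_gflag n (sval s).
Proof.
have ft : is_flag (X n) (ms n) (sval s) by case: (svalP s).
split=> [h|eH]; first exact: (corresponds_uniq ft (svalP H) h).
by rewrite /represents /= eH; apply: corresponds_G0.
Qed.

Lemma GFl_point n (s : level (GFl F e) n) : exists H : GFl F e, sval H = initial_gflag n (sval s).
Proof.
have ft : is_flag (X n) (ms n) (sval s) by case: (svalP s).
have h := deform_commensurable bE gF spF (initial_finite n) (@initial_sub n) (sg_def ft).
by exists (exist _ _ h).
Qed.

Lemma GFl_covered (H : GFl F e) : exists n (s : level (GFl F e) n), sval H = initial_gflag n (sval s).
Proof.
have [n hn] := comm_deform (svalP H); have [s [ds eH]] := hn n (leqnn n).
have ft := flag_list_is_flag cF (stX n) (ty n) ds.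
exists n, (exist _ (flag_list F (X n) (ms n) s) (conj ft I)) => /=.
rewrite eH; apply: eq_deform_image => A FA.
by rewrite sgE (flag_fun_list cF (stX n) (ty n) ds FA).
Qed.

Lemma GFl_inj n : injective (fun s : level (GFl F e) n => initial_gflag n (sval s)).
Proof.
move=> s s' /= h; apply: sval_inj.
have ft : is_flag (X n) (ms n) (sval s) by case: (svalP s).
have ft' : is_flag (X n) (ms n) (sval s') by case: (svalP s').
rewrite -(flag_list_fun (ty n) ft) -(flag_list_fun (ty n) ft').
apply: flag_list_eq; first by case: (ty n).
move=> A FA; rewrite -!sgE.
exact: (deform_flag_inj cF (stX n) (sg_def ft) (sg_def ft') h FA).
Qed.

Lemma GFl_step n : exists2 g : level (GFl F e) n -> level (GFl F e) n.+1, is_morphism g &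
  forall s, initial_gflag n.+1 (sval (g s)) = initial_gflag n (sval s).
Proof.
have [g mg hg] := transfer_map_exists cF (pX n) (pX n.+1) (initial_has_dim n)
  (initial_has_dim n.+1) (stX n) (stX n.+1) (ty n) (ty n.+1) (initial_span_inc (leqnSn n))
  (P1 := setT) (P2 := setT) (fun _ _ _ => I).
exists g => // s; rewrite hg; have ft : is_flag (X n) (ms n) (sval s) by case: (svalP s).
apply: eq_imagel => A FA.
by apply: (transfer_flag_deform cF (pX n) (pX n.+1) (initial_has_dim n) (stX n) (stX n.+1)
  (ty n) (ty n.+1) (initial_span_inc (leqnSn n)) _ ft FA) => B FB; apply: CC.
Qed.

End GFlPresentation.

(** * Chains of strict standard extensions *)

Section SplitForms.
Variables (K : fieldType) (V V' : vectType K) (ms ms' : seq nat).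
Variables (P : set (seq (set V))) (P' : set (seq (set V'))).
Variables (incl : {linear V -> V'}) (What : set V') (W : nat -> set V') (p : nat -> nat).
Variable (phi : flag_variety (dim V) [set: V] ms P -> flag_variety (dim V') [set: V'] ms' P').
Hypothesis sf : split_form incl What W p phi.

(** The summand W_i, with the values at 0 and k' + 1 that make the split form hold for
    the completed flags. *)
Definition split_part i : set V' :=
  if i is 0%N then [set 0] else if (i <= size ms')%N then W i else What.

Lemma split_index0 : p 0%N = 0%N.
Proof.
case: sf => _ _ _ _ [[_ h1 h2] _]; have [i hi e] := h2 0%N isT.
by apply/eqP; rewrite -leqn0 -[X in (_ <= X)%N]e; apply: h1; rewrite leq0n.
Qed.

Lemma split_index_last : p (size ms').+1 = (size ms).+1.
Proof.
case: sf => _ _ _ _ [[h0 h1 h2] _]; have [i hi e] := h2 (size ms).+1 (leqnn _).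
by apply/eqP; rewrite eqn_leq h0 //= -[X in (X <= _)%N]e; apply: h1; rewrite hi /=.
Qed.

Lemma split_part_sub i : is_subspace (split_part i) /\ split_part i `<=` What.
Proof.
case: sf => _ [sW _ _] hW _ _; rewrite /split_part; case: i => [|i].
  by split; [apply: subspace_set0|apply: set0_sub].
by case: ifP => h; [apply: hW|split].
Qed.

Lemma split_term T i : (i <= (size ms').+1)%N ->
  flag_term setT (sval (phi T)) i =
  sum_sub (incl @` flag_term setT (sval T) (p i)) (split_part i).
Proof.
case: sf => inj [sW e d] _ _ [_ hphi] hi.
rewrite /flag_term hphi; case: i hi => [|i] hi /=.
  by rewrite split_index0 /= image_set0 sum_sub0.
rewrite ltnS in hi; case: ltnP => h.
  by rewrite (nth_map 0%N) ?size_iota // nth_iota // add1n.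
have -> : i = size ms' by apply/eqP; rewrite eqn_leq hi.
rewrite nth_default ?size_map ?size_iota // split_index_last /=.
rewrite nth_default; last by case: (svalP T) => -[-> _ _].
by rewrite e.
Qed.

End SplitForms.

Section LinearCase.
Variables (K : fieldType) (c : fl_chain K) (x : fl_choices c).

Let V := fdV x.
Let inV N : {linear fcV c N -> V} := fd_in x N.
Let k N := size (fc_m c N).
Let d N := dim (fcV c N).
Let E : set V := range (fd_e x).
Let orbit N := fl_orbit (fd_F1 x) N.
Let Y N : set V := range (inV N).
Let S N : set (set V) :=
  [set inV N @` flag_term setT (sval (orbit N)) i | i in [set i | (i <= (k N).+1)%N]].
Let D N : set V := inV N.+1 @` @fd_What _ _ x N.
Let incl N : {linear fcV c N -> fcV c N.+1} := fd_incl x N.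
Let part N := split_part (fc_m c N.+1) (@fd_What _ _ x N) (@fd_W _ _ x N).

Let inVi N : injective (inV N). Proof. by case: (fd_lim x). Qed.
Let inVS N u : inV N.+1 (incl N u) = inV N u. Proof. by case: (fd_lim x). Qed.

Let bE : is_basis E setT := fd_basis x.

Let hV N : has_dim [set: fcV c N] (d N) := vect_has_dim _.

Let term_flag N (T : Fl (fcV c N) (fc_m c N)) : is_flag setT (fc_m c N) (sval T).
Proof. by case: (svalP T). Qed.

Let inV_has_dim N A n : has_dim A n -> has_dim (inV N @` A) n.
Proof. by apply: has_dim_image => u _ e; apply: (@inVi N); rewrite e linear0. Qed.

Let hY N : has_dim (Y N) (d N) := inV_has_dim (hV N).

Let fY N : fdim (Y N). Proof. by exists (d N). Qed.

Let type_path N : path ltn 0%N (fc_m c N) /\ forall m, m \in fc_m c N -> (m < d N)%N.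
Proof.
have := fc_type c N; rewrite /flag_type /= rcons_path => /andP [h1 h2]; split=> // m mm.
apply: leq_ltn_trans h2; have h1' : sorted leq (0%N :: fc_m c N).
  by apply: sub_path h1 => a b /ltnW.
have := mem_nth 0%N (_ : index m (0%N :: fc_m c N) < size (0%N :: fc_m c N))%N.
have mm' : m \in 0%N :: fc_m c N by rewrite inE mm orbT.
move=> _; rewrite -[X in (X <= _)%N](nth_index 0%N mm') (last_nth 0%N).
apply: (sorted_leq_nth leq_trans leqnn 0%N h1'); rewrite ?inE ?index_mem //.
by rewrite -ltnS index_mem.
Qed.

Let d_gt0 N : (0 < d N)%N.
Proof.
have := fc_type c N; rewrite /flag_type /= rcons_path => /andP [_].
exact: leq_ltn_trans.
Qed.

Let Yinc N : Y N `<=` Y N.+1.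
Proof. by move=> _ [u _ <-]; rewrite -inVS; exists (incl N u). Qed.

Let Yall v : exists N, Y N v.
Proof. by case: (fd_lim x) => _ _ /(_ v) [N [u ->]]; exists N, u. Qed.

Let Y0 N : Y N <> [set 0].
Proof.
move=> e; have := hY N; rewrite e => /has_dim_uniq /(_ (has_dim0 V)) e0.
by have := d_gt0 N; rewrite e0.
Qed.

Let sY N : is_subspace (Y N) := fdim_subspace (fY N).

Let Ssub N A : S N A -> is_subspace A /\ A `<=` Y N.
Proof.
move=> [i _ <-]; split; last by move=> _ [u _ <-]; exists u.
apply: subspace_image; apply: has_dim_subspace.
exact: (flag_term_dim i (hV N) (term_flag (orbit N))).
Qed.

Let Stot N : total_on (S N) (fun A B => A `<=` B).
Proof.
move=> _ _ [i _ <-] [j _ <-].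
by case: (flag_term_chain i j (hV N) (term_flag (orbit N))) => h; [left|right]; apply: image_subset.
Qed.

Let term_last N (T : Fl (fcV c N) (fc_m c N)) : flag_term setT (sval T) (k N).+1 = setT.
Proof. by rewrite /flag_term /= nth_default //; case: (term_flag T) => ->. Qed.

Let S0 N : S N [set 0].
Proof. by exists 0%N => //; rewrite /flag_term /= image_set0. Qed.

Let SY N : S N (Y N).
Proof. by exists (k N).+1 => /=; [exact: leqnn|rewrite term_last]. Qed.

Let sf N := fd_split x N.

Let term_succ N T i : (i <= (k N.+1).+1)%N ->
  inV N.+1 @` flag_term setT (sval (fc_map T)) i =
  sum_sub (inV N @` flag_term setT (sval T) (fd_p x N i)) (inV N.+1 @` @part N i).
Proof.
move=> hi; rewrite (split_term (sf N)) // image_sum_sub; congr sum_sub.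
by rewrite image_comp; apply: eq_imagel => u _ /=; apply: inVS.
Qed.

Let sD N : is_subspace (D N).
Proof. by apply: subspace_image; case: (sf N) => _ []. Qed.

Let YD0 N : Y N `&` D N `<=` [set 0].
Proof.
case: (sf N) => _ [_ _ e] _ _ _ v [[u _ <-] [w Ww]].
rewrite -(inVS u) => eqw; have ew := @inVi N.+1 _ _ eqw; have : (range (incl N) `&` @fd_What _ _ x N) w.
  by split=> //; exists u.
by rewrite e => w0; rewrite /= -ew w0 linear0.
Qed.

Let YD N : sum_sub (Y N) (D N) = Y N.+1.
Proof.
case: (sf N) => _ [_ e _] _ _ _; rewrite /Y -e image_sum_sub; congr sum_sub.
by rewrite image_comp; apply: eq_imagel => u _ /=; rewrite inVS.
Qed.

Let part_sub N i : is_subspace (inV N.+1 @` @part N i) /\ inV N.+1 @` @part N i `<=` D N.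
Proof.
have [h1 h2] := split_part_sub (sf N) i.
by split; [apply: subspace_image|apply: image_subset].
Qed.

Let sum_capY N A i : is_subspace A -> A `<=` Y N ->
  sum_sub A (inV N.+1 @` @part N i) `&` Y N = A.
Proof.
move=> sA AY; rewrite sum_subI //; suff -> : inV N.+1 @` @part N i `&` Y N = [set 0] by rewrite sum_sub0.
have [h1 h2] := part_sub N i; apply/seteqP; split; last by apply: set0_sub; apply: subspaceI.
by move=> v [/h2 Dv Yv]; exact: (@YD0 N v (conj Yv Dv)).
Qed.

Let sum_capD N A i : is_subspace A -> A `<=` Y N ->
  sum_sub A (inV N.+1 @` @part N i) `&` D N = inV N.+1 @` @part N i.
Proof.
have [h1 h2] := part_sub N i.
move=> sA AY; rewrite sum_subC sum_subI //; suff -> : A `&` D N = [set 0] by rewrite sum_sub0.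
apply/seteqP; split; last by apply: set0_sub; apply: subspaceI.
by move=> v [/AY Yv Dv]; exact: (@YD0 N v (conj Yv Dv)).
Qed.

Let term_image_sub N (T : Fl (fcV c N) (fc_m c N)) i : is_subspace (inV N @` flag_term setT (sval T) i) /\
  inV N @` flag_term setT (sval T) i `<=` Y N.
Proof.
split; last by move=> _ [u _ <-]; exists u.
apply: subspace_image; apply: has_dim_subspace; exact: (flag_term_dim i (hV N) (term_flag T)).
Qed.

Let p_le N i : (i <= (k N.+1).+1)%N -> (fd_p x N i <= (k N).+1)%N.
Proof. by case: (sf N) => _ _ _ _ [[h _ _] _]; apply: h. Qed.

Let Sdown N A : S N.+1 A -> S N (A `&` Y N).
Proof.
move=> [i hi <-]; rewrite term_succ //.
have [h1 h2] := term_image_sub (orbit N) (fd_p x N i).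
by rewrite sum_capY //; exists (fd_p x N i) => //; apply: p_le.
Qed.

Let Sup N A : S N A -> exists2 A', S N.+1 A' & A' `&` Y N = A.
Proof.
move=> [j hj <-]; case: (sf N) => _ _ _ _ [[_ _ /(_ j hj) [i hi e]] _].
exists (inV N.+1 @` flag_term setT (sval (orbit N.+1)) i); first by exists i.
have [h1 h2] := term_image_sub (orbit N) (fd_p x N i).
by rewrite term_succ // sum_capY // e.
Qed.

Let SD N A : S N.+1 A -> A `<=` sum_sub (A `&` Y N) (A `&` D N).
Proof.
move=> [i hi <-]; rewrite term_succ //.
have [h1 h2] := term_image_sub (orbit N) (fd_p x N i).
by rewrite sum_capY // sum_capD.
Qed.

Let spanned_of_basis A : is_basis (A `&` E) A -> spanned E A.
Proof. by case. Qed.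

Let tw : tower Y S.
Proof. by split. Qed.

Let tws : tower_splitting Y S D.
Proof. by split. Qed.

Let SE N A : S N A -> A = Y N \/ spanned E A.
Proof.
move=> [[|i] hi <-]; first by right; rewrite /flag_term /= image_set0; apply: spanned0.
move: hi; rewrite /= ltnS leq_eqVlt => /orP [/eqP ->|hi]; first by left; rewrite term_last.
by right; apply: spanned_of_basis; apply: (fd_basis_orbit x).
Qed.

Let SDE N A : S N.+1 A -> A = Y N.+1 \/ spanned E (A `&` D N).
Proof.
move=> [i hi <-]; have [h1 h2] := term_image_sub (orbit N) (fd_p x N i).
move: hi; rewrite /= leq_eqVlt => /orP [/eqP ->|hi]; first by left; rewrite term_last.
right; rewrite term_succ ?sum_capD //; last exact: ltnW.
rewrite ltnS in hi; rewrite /part /split_part; case: i hi {h1 h2} => [|i] hi.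
  by rewrite image_set0; apply: spanned0.
by rewrite hi; apply: spanned_of_basis; apply: (fd_basis_W x).
Qed.

Let thread := thread Y S.

Let spT H : thread H -> spanned E H.
Proof. exact: (thread_spanned tw bE SE). Qed.

Let F := fl_limit_flag x.

Let FE : F = cut_flag Y S.
Proof. exact: (limit_flagE tw bE spT). Qed.

Let gF : generalized_flag F.
Proof. by rewrite FE; apply: (cut_gflag tw). Qed.

Let cF : chain F := gflag_chain gF.

Let FT A : F A -> thread A.
Proof. by rewrite FE; apply: (cut_flag_thread tw). Qed.

Let spF A : F A -> spanned E A. Proof. by move=> /FT /spT. Qed.

Let C N := tower_compl D N.

Let stY N : is_stage F (Y N) (C N).
Proof. by exact: (tower_stage tw tws N FT). Qed.

Let dimFY N A : F A -> exists2 i, (i <= (k N).+1)%N &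
  A `&` Y N = inV N @` flag_term setT (sval (orbit N)) i.
Proof. by move=> /FT /(_ N) [i hi e]; exists i. Qed.

Let dim_term N (T : Fl (fcV c N) (fc_m c N)) i :
  dimn (inV N @` flag_term setT (sval T) i) = nth (d N) (0%N :: fc_m c N) i.
Proof.
by apply: dimnE; apply: inV_has_dim; exact: (flag_term_dim i (hV N) (term_flag T)).
Qed.

Let tyY N : typed F (Y N) (d N) (fc_m c N).
Proof.
have [h1 h2] := type_path N; split=> //; first by move=> m /h2 /ltnW.
  move=> A /(dimFY N) [i hi ->]; rewrite dim_term -rcons_cons.
  case: (ltnP i (size (0%N :: fc_m c N))) => h.
    by rewrite mem_rcons inE mem_nth ?orbT.
  by rewrite nth_default // mem_rcons mem_head.
move=> m mm; have hi : (index m (fc_m c N) < k N)%N by rewrite index_mem.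
have [|A FA e] := cut_trace tw (N := N)
    (A := inV N @` flag_term setT (sval (orbit N)) (index m (fc_m c N)).+1).
  by exists (index m (fc_m c N)).+1 => //=; rewrite ltnS ltnW.
exists A; first by rewrite FE.
by rewrite e dim_term /= (set_nth_default 0%N) // nth_index.
Qed.

Let sC N : is_subspace (C N) := tower_compl_subspace tws N.

Let retraction N : {r : {linear V -> fcV c N} | forall v, Y N v -> inV N (r v) = v}.
Proof.
have [_ _ h1 h2 _] := stY N.
by apply: cid; apply: linear_retraction h2 => //; apply: inVi.
Qed.

Let pY N : presents (inV N) (sval (retraction N)) setT (Y N).
Proof. by split=> //; [apply: inVi|apply: (svalP (retraction N))]. Qed.

Let X := initial_span (fd_e x).
Let Cx := initial_compl (fd_e x).

Let stX m : is_stage F (X m) (Cx m) := initial_stage bE spF m.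
Let tyX m := initial_typed (@fd_inj _ _ x) bE gF spF m.
Let pX m : presents (id_lin V) (id_lin V) (X m) (X m).
Proof. by apply: presents_id; apply: subspace_span. Qed.
Let hX m : has_dim (X m) m := initial_has_dim (@fd_inj _ _ x) bE m.

(* V N itself need not be spanned by a part of E, but it only matters for the spaces
   that do not contain it; those split along E. This is what nests the two kinds of
   complements. *)
Let spF2 N A : F A -> Y N `<=` A \/ spanned E (A `&` Y N) /\ spanned E (A `&` C N).
Proof.
move=> FA; case: (tower_compl_spanned tw tws N bE SDE (FT FA)) => h; first by left.
case: (SE (FT FA N)) => h'; last by right.
by left; rewrite -h' => v [].
Qed.

Let CC_YX N m A : Y N `<=` X m -> F A -> Y N `<=` A \/ A `&` Cx m `<=` C N.
Proof.
move=> YX FA; case: (spF2 N FA) => [|[s1 s2]]; first by left.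
right; rewrite /Cx /initial_compl (compl_span bE (@initial_sub _ _ _ m) (spF FA)).
apply: span_min; first exact: sC.
move=> v [Av [Ev nv]].
have : lin_span ((A `&` Y N `&` E) `|` (A `&` C N `&` E)) v.
  rewrite span_setU s1 s2; case: (stY N) => _ _ _ _ /(_ A FA); exact.
case/(span_basis_mem bE _ Ev); first by move=> u [[]|[]].
  move=> [[_ Yv] _]; case: nv.
  by apply: (span_basis_mem bE (@initial_sub _ _ _ m) Ev); apply: YX.
by move=> [[]].
Qed.

Let CC_XY N m A : X m `<=` Y N -> F A -> X m `<=` A \/ A `&` C N `<=` Cx m.
Proof.
move=> XY FA; case: (spF2 N FA) => [YA|[s1 s2]]; first by left; apply: subset_trans YA.
right; rewrite -s2; apply: span_mono => v [[Av Cv] Ev]; split=> // hv.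
apply: (basis_neq0 bE Ev); case: (stY N) => _ _ h _ _; apply: h; split=> //.
by apply: XY; apply: sub_span.
Qed.

Let C_dec N : C N.+1 `<=` C N.
Proof.
move=> v [l _ hl]; exists l.+1 => //; move: v hl.
elim: l => [|l IH] /=; first by move=> v ->; apply: (sub_suml (sD _)).
apply: sum_sub_mono; first exact: IH.
by rewrite addSn addnS.
Qed.

Let CC_YY N A : F A -> Y N `<=` A \/ A `&` C N.+1 `<=` C N.
Proof. by move=> _; right=> v [_ /C_dec]. Qed.

Let sg N (T : seq (set (fcV c N))) := flag_def (inV N) (Y N) (d N) (fc_m c N) T.

Let sg_def N (T : Fl (fcV c N) (fc_m c N)) : deformation F (Y N) (sg (sval T)).
Proof.
apply: (flag_fun_deformation cF (stY N) (tyY N)).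
exact: (presents_flag_image (pY N) (hV N) (term_flag T)).
Qed.

Let Phi N (T : Fl (fcV c N) (fc_m c N)) : set (set V) := deform (C N) (sg (sval T)) @` F.

Let Phi_inj N : injective (@Phi N).
Proof.
move=> T T' h; apply: sval_inj; apply: (flag_image_inj (@inVi N)).
have ft := presents_flag_image (pY N) (hV N) (term_flag T).
have ft' := presents_flag_image (pY N) (hV N) (term_flag T').
rewrite -(flag_list_fun (tyY N) ft) -(flag_list_fun (tyY N) ft').
apply: flag_list_eq; first by case: (tyY N).
exact: (deform_flag_inj cF (stY N) (sg_def T) (sg_def T') h).
Qed.

Let sgE N (T : Fl (fcV c N) (fc_m c N)) A : sg (sval T) A = inV N @` flag_term setT (sval T)
  (index (dimn (A `&` Y N)) (0%N :: rcons (fc_m c N) (d N))).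
Proof. by rewrite /sg /flag_def /flag_fun flag_term_image. Qed.

(* The chain map adds the same subspaces W_i as the transfer, so T and its image define
   the same generalized flag. *)
Let sg_succ N (T : Fl (fcV c N) (fc_m c N)) A : F A ->
  sg (sval (fc_map T)) A = transfer (C N) (Y N.+1) (sg (sval T)) A.
Proof.
move=> FA; rewrite (transferE _ (stY N.+1) (@Yinc N) (sg_def T) FA).
have [i hi eA] := dimFY N.+1 FA.
have eAN : A `&` Y N = inV N @` flag_term setT (sval (orbit N)) (fd_p x N i).
  have [h1 h2] := term_image_sub (orbit N) (fd_p x N i).
  rewrite -[RHS](sum_capY i h1 h2) -term_succ // -[fc_map _]/(orbit N.+1) -eA.
  by apply/seteqP; split=> [v [Av Yv]|v [[]]//]; split=> //; split=> //; apply: Yinc.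
have eCD : A `&` C N `&` Y N.+1 = inV N.+1 @` @part N i.
  have [h1 h2] := term_image_sub (orbit N) (fd_p x N i).
  rewrite -(sum_capD i h1 h2) -term_succ // -[fc_map _]/(orbit N.+1) -eA.
  have [_ _ dYC _ _] := stY N.
  have DC : D N `<=` C N.
    by move=> v Dv; exists 1%N => //=; rewrite addn0; apply: (sub_sumr (subspace_set0 V)).
  apply/seteqP; split=> v; last by move=> [[Av Yv] Dv]; split=> //; split=> //; apply: DC.
  move=> [[Av Cv] Yv]; split=> //; move: (Yv); rewrite -YD => -[y Yy [w Dw ev]].
  have y0 : y = 0.
    apply: dYC; split=> //; apply: (subspace_addr (sC N) (DC w Dw)); by rewrite ev.
  by rewrite -ev y0 add0r.
have [s1 _ e1] := (sg_def (fc_map T)).1 A FA.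
have [s2 _ e2] := (sg_def T).1 A FA.
rewrite eCD.
have -> : sg (sval T) A = inV N @` flag_term setT (sval T) (fd_p x N i).
  rewrite sgE; have [h1 h2] := term_image_sub T (fd_p x N i).
  apply: chain_dimn_eq.
  - by apply: (fdim_sub (fY N)); [case: (term_image_sub T (index (dimn (A `&` Y N)) (0%N :: rcons (fc_m c N) (d N))))|case: (term_image_sub T (index (dimn (A `&` Y N)) (0%N :: rcons (fc_m c N) (d N))))].
  - exact: (fdim_sub (fY N)).
  - case: (flag_term_chain (index (dimn (A `&` Y N)) (0%N :: rcons (fc_m c N) (d N))) (fd_p x N i) (hV N) (term_flag T)) => h; [left|right]; exact: image_subset.
  by rewrite -sgE e2 eAN !dim_term.
rewrite -term_succ //.
rewrite sgE; have [h1 h2] := term_image_sub (fc_map T) i.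
apply: chain_dimn_eq.
- by apply: (fdim_sub (fY N.+1)); [case: (term_image_sub (fc_map T) (index (dimn (A `&` Y N.+1)) (0%N :: rcons (fc_m c N.+1) (d N.+1))))|case: (term_image_sub (fc_map T) (index (dimn (A `&` Y N.+1)) (0%N :: rcons (fc_m c N.+1) (d N.+1))))].
- exact: (fdim_sub (fY N.+1)).
- case: (flag_term_chain (index (dimn (A `&` Y N.+1)) (0%N :: rcons (fc_m c N.+1) (d N.+1))) i (hV N.+1) (term_flag (fc_map T))) => h; [left|right]; exact: image_subset.
by rewrite -sgE e1 eA !dim_term.
Qed.

Let Phi_f N T : @Phi N.+1 (fc_map T) = @Phi N T.
Proof.
rewrite /Phi; transitivity (deform (C N.+1) (transfer (C N) (Y N.+1) (sg (sval T))) @` F).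
  by apply: eq_deform_image => A FA; apply: sg_succ.
apply: eq_imagel => A FA.
exact: (transfer_deform cF (stY N) (stY N.+1) (@Yinc N) (@CC_YY N) (sg_def T) FA).
Qed.

Let YinX N : exists m, Y N `<=` X m.
Proof.
have [|t [tE Yt]] := @fdim_spanning _ _ E (Y N) (fY N); first by rewrite bE.2.
have [m hm] := finite_basis_stage (fun n => initial_inc (leqnSn n)) (@initial_exhaust _ _ (fd_e x)) tE.
by exists m; apply: (subset_trans Yt); apply: span_mono => v; apply: hm.
Qed.

(** The levels of both sides are stages of F; the transfers between them in both
    directions do not change the generalized flag attached to a flag. *)
Theorem linear_case : ind_isomorphic (lim_Fl c) (GFl F (fd_e x)).
Proof.
apply: (@direct_limit_isomorphic K _ (@fc_map _ c) (GFl F (fd_e x)) (set (set V)) (fun H => sval H)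
  Phi (fun m s => @initial_gflag K _ (fd_e x) F m (sval s))).
- exact: sval_inj.
- exact: Phi_inj.
- exact: (GFl_inj (@fd_inj _ _ x) bE gF spF).
- by move=> N; case: (fc_std c N) => -[].
- exact: Phi_f.
- exact: (GFl_represents (@fd_inj _ _ x) bE gF spF).
- exact: (GFl_point (@fd_inj _ _ x) bE gF spF).
- exact: (GFl_covered (@fd_inj _ _ x) bE gF spF).
- exact: (GFl_step (@fd_inj _ _ x) bE gF spF).
- move=> N; have [m YX] := YinX N; exists m.
  have [g mg hg] := transfer_map_exists cF (pY N) (pX m) (hV N) (hX m) (stY N) (stX m) (tyY N) (tyX m) YX
    (P1 := setT) (P2 := setT) (fun _ _ _ => I).
  exists g; split=> // T; rewrite hg; apply: eq_imagel => A FA.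
  apply: (transfer_flag_deform cF (pY N) (pX m) (hV N) (stY N) (stX m) (tyY N) (tyX m) YX _ (term_flag T) FA).
  by move=> B FB; apply: CC_YX.
- move=> m; have [N XY] := tower_contains tw (ex_intro _ _ (hX m)); exists N.
  have [g mg hg] := transfer_map_exists cF (pX m) (pY N) (hX m) (hV N) (stX m) (stY N) (tyX m) (tyY N) XY
    (P1 := setT) (P2 := setT) (fun _ _ _ => I).
  exists g; split=> // s; have fs : is_flag (X m) (initial_type (fd_e x) F m) (sval s) by case: (svalP s).
  rewrite /Phi hg; apply: eq_imagel => A FA.
  apply: (transfer_flag_deform cF (pX m) (pY N) (hX m) (stX m) (stY N) (tyX m) (tyY N) XY _ fs FA).
  by move=> B FB; apply: CC_XY.
Qed.

End LinearCase.

(** * Orthogonality *)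

Section RankNullity.
Variables (K : fieldType) (V W : lmodType K) (f : {linear V -> W}).

Lemma rank_nullity (Y : set V) : fdim Y ->
  (dimn (Y `&` f @^-1` [set (0 : W)%R]) + dimn (f @` Y))%N = dimn Y.
Proof.
move=> fY; have sY := fdim_subspace fY.
have sN : is_subspace (Y `&` f @^-1` [set (0 : W)%R]).
  by apply: subspaceI => //; apply: subspace_preimage; apply: subspace_set0.
have [Z [sZ d e]] := complement_exists fY sN (@subIsetl _ _ _).
have ZY : Z `<=` Y by rewrite -e; apply: sub_sumr.
have -> : f @` Y = f @` Z.
  apply/seteqP; split; last exact: image_subset.
  by move=> _ [v + <-]; rewrite -e => -[n [_ /= fn] [z Zz <-]]; exists z => //; rewrite linearD fn add0r.
have fZ := fdim_sub fY sZ ZY.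
rewrite dimn_image //; last by move=> u Zu fu; apply: d; split=> //; split=> //; apply: ZY.
rewrite -[RHS](congr1 (@dimn _ _) e) dimn_sum_direct //.
exact: (fdim_sub fY sN).
Qed.

End RankNullity.

Section Forms.
Variables (K : fieldType) (V : lmodType K) (b : {biscalar V}).
Implicit Types (A B C X Y : set V).

Hypothesis b_refl : forall u v, b u v = 0 -> b v u = 0.

Lemma bDl u v w : b (u + v) w = b u w + b v w. Proof. exact: linearDl. Qed.
Lemma bDr u v w : b u (v + w) = b u v + b u w. Proof. exact: linearDr. Qed.
Lemma bZl a u v : b (a *: u) v = a * b u v. Proof. exact: linearZl_LR. Qed.
Lemma bZr a u v : b u (a *: v) = a * b u v. Proof. exact: linearZr_LR. Qed.
Lemma b0l v : b 0 v = 0. Proof. exact: linear0l. Qed.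
Lemma b0r v : b v 0 = 0. Proof. exact: linear0r. Qed.

Lemma perp_in_subspace X A : is_subspace X -> is_subspace (perp_in b X A).
Proof.
move=> sX; split; first by split; [exact: subspace0|move=> u _; apply: b0r].
move=> a u v [Xu hu] [Xv hv]; split; first exact: sX.2.
by move=> w Aw; rewrite bDr bZr hu // hv // mulr0 addr0.
Qed.

Lemma perp_subspace A : is_subspace (perp b A).
Proof. by apply: perp_in_subspace. Qed.

Lemma perp_inE X A : perp_in b X A = X `&` perp b A.
Proof. by apply/seteqP; split=> v [Xv]; [split|move=> [_ h]; split]. Qed.

Lemma perp_anti X A B : A `<=` B -> perp_in b X B `<=` perp_in b X A.
Proof. by move=> AB v [Xv h]; split=> // u Au; apply: h; apply: AB. Qed.

Lemma perp_span A : perp b (lin_span A) = perp b A.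
Proof.
apply/seteqP; split; first by apply: perp_anti; apply: sub_span.
move=> v [_ h]; split=> // u; move: u; apply: (@span_min _ _ [set u | b u v = 0]) => //.
by split=> [|a u w /= hu hw] /=; rewrite ?b0l // bDl bZl hu hw mulr0 addr0.
Qed.

Lemma isotropic_sub A B : A `<=` B -> isotropic b B -> isotropic b A.
Proof. by move=> AB h u v Au Av; apply: h; apply: AB. Qed.

Lemma isotropic_perp A : isotropic b A <-> A `<=` perp b A.
Proof. by split=> [h v Av|h u v Au Av]; [split=> // u Au; apply: h|have [_] := h v Av; apply]. Qed.

Lemma isotropic_sum A B : isotropic b A -> isotropic b B ->
  (forall u v, A u -> B v -> b u v = 0) -> isotropic b (sum_sub A B).
Proof.
move=> iA iB iAB _ _ [u Au [v Bv <-]] [u' Au' [v' Bv' <-]].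
by rewrite bDl !bDr (iA u u') // (iB v v') // (iAB u v') // (b_refl (iAB _ _ Au' Bv)) !addr0.
Qed.

Definition nondeg_on Y := forall u, Y u -> (forall v, Y v -> b u v = 0) -> u = 0.

Let pairing_row (s : seq V) : exists g : {linear V -> 'rV[K]_(size s)},
  forall v (i : 'I_(size s)), g v 0 i = b (nth 0 s i) v.
Proof.
have [|g hg] := @linear_pack K V _ (fun v => \row_(i < size s) b (nth 0 s i) v).
  by move=> a u v; apply/rowP => i; rewrite !mxE bDr bZr.
by exists g => v i; rewrite hg mxE.
Qed.

Let pairing_kernel (s : seq V) (g : {linear V -> 'rV[K]_(size s)}) v :
  (forall v (i : 'I_(size s)), g v 0 i = b (nth 0 s i) v) ->
  g v = 0 <-> perp b (sspan s) v.
Proof.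
move=> hg; rewrite perp_span; split=> [e|[_ h]].
  split=> // u /= /(nthP 0) [i hi <-].
  by have := hg v (Ordinal hi); rewrite e mxE.
by apply/rowP => i; rewrite hg mxE; apply: h => /=; apply: mem_nth.
Qed.

Let fdim_row n (A : set 'rV[K]_n) : is_subspace A -> fdim A /\ (dimn A <= n)%N.
Proof.
move=> sA; have h := @vect_has_dim K 'rV[K]_n.
have f : fdim [set: 'rV[K]_n] by exists (dim 'rV[K]_n).
split; first exact: fdim_sub f sA _.
by apply: leq_trans (dimn_sub f sA (@subsetT _ _)) _; rewrite (dimnE h) /dim /= mul1n.
Qed.

(* perp_in b Y A is the kernel of the pairing of Y with a frame of A. *)
Let perp_codim Y A : fdim Y -> fdim A -> (dimn Y <= dimn (perp_in b Y A) + dimn A)%N.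
Proof.
move=> fY fA; have [s [es is_ hs]] := frame_exists fA.
have [g hg] := pairing_row s; rewrite -(rank_nullity g fY).
have -> : Y `&` g @^-1` [set (0 : 'rV[K]_(size s))%R] = perp_in b Y A.
  rewrite perp_inE -hs; congr (Y `&` _); apply/seteqP.
  by split=> v /=; [move/(pairing_kernel _ hg)|move=> h; apply/(pairing_kernel _ hg)].
rewrite leq_add2l -es; apply: (fdim_row _).2.
by apply: subspace_image; apply: fdim_subspace.
Qed.

Lemma perp_dim Y A : fdim Y -> nondeg_on Y -> is_subspace A -> A `<=` Y ->
  (dimn (perp_in b Y A) + dimn A)%N = dimn Y.
Proof.
move=> fY nY sA AY; have fA := fdim_sub fY sA AY; have sY := fdim_subspace fY.
apply/eqP; rewrite eqn_leq perp_codim // andbT.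
have sP := perp_in_subspace A sY.
have PY : perp_in b Y A `<=` Y by move=> v [].
have fP := fdim_sub fY sP PY.
have [Z [sZ d e]] := complement_exists fY sP PY.
have ZY : Z `<=` Y by rewrite -e; apply: sub_sumr.
have fZ := fdim_sub fY sZ ZY.
have -> : dimn Y = (dimn (perp_in b Y A) + dimn Z)%N by rewrite -(dimn_sum_direct fP fZ d) e.
rewrite leq_add2l.
(* A pairs injectively with Z: a vector of A orthogonal to Z is orthogonal to Y. *)
have := perp_codim fA fZ; suff -> : perp_in b A Z = [set 0] by rewrite dimn0 add0n.
apply/seteqP; split; last by apply: set0_sub; apply: perp_in_subspace.
move=> v [Av hv]; apply: nY; first exact: AY.
move=> w; rewrite -e => -[p [_ hp] [z Zz <-]].
by rewrite bDr (hp v Av) add0r; apply: b_refl; apply: hv.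
Qed.

Lemma perp_perp Y A : fdim Y -> nondeg_on Y -> is_subspace A -> A `<=` Y ->
  perp_in b Y (perp_in b Y A) = A.
Proof.
move=> fY nY sA AY; have sY := fdim_subspace fY.
have sP := perp_in_subspace A sY; have PY : perp_in b Y A `<=` Y by move=> v [].
have sPP := perp_in_subspace (perp_in b Y A) sY.
apply/esym; apply: dimn_sub_eq => //.
- by apply: (fdim_sub fY) => // v [].
- by move=> v Av; split; [apply: AY|move=> u [_ h]; apply: b_refl; apply: h].
have h1 := perp_dim fY nY sA AY; have h2 := perp_dim fY nY sP PY.
by rewrite -(leq_add2l (dimn (perp_in b Y A))) h1 addnC h2.
Qed.

Lemma isotropic_dim Y A : fdim Y -> nondeg_on Y -> is_subspace A -> A `<=` Y ->
  isotropic b A -> ((dimn A).*2 <= dimn Y)%N.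
Proof.
move=> fY nY sA AY iA; rewrite -(perp_dim fY nY sA AY) -addnn leq_add2r.
have sY := fdim_subspace fY; apply: dimn_sub => //.
  by apply: (fdim_sub fY) (perp_in_subspace A sY) _ => v [].
by move=> v Av; split; [apply: AY|move=> u Au; apply: iA].
Qed.

End Forms.

Lemma form_of_type_refl (K : fieldType) (V : lmodType K) (b : {biscalar V}) ty :
  form_of_type b ty -> forall u v, b u v = 0 -> b v u = 0.
Proof.
case: ty => /= h u v e; first by rewrite h.
have := h (u + v); rewrite bDl !bDr !h e !add0r addr0.
by [].
Qed.

(** * Isotropic deformations *)

Section IsotropicDeformations.
Variables (K : fieldType) (V : lmodType K) (b : {biscalar V}).
Hypothesis b_refl : forall u v, b u v = 0 -> b v u = 0.
Implicit Types (A B C X Y : set V) (F G : set (set V)) (s : set V -> set V).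

Definition iso_part F : set (set V) := [set A | F A /\ isotropic b A].

(** The complement is the orthogonal one so that deforming F commutes with taking
    orthogonal complements. *)
Definition iso_stage F Y := is_stage F Y (perp b Y) /\ nondeg_on b Y.

Lemma iso_part_sub F : iso_part F `<=` F. Proof. by move=> A []. Qed.

Lemma stage_perp F Y C : is_stage F Y C -> nondeg_on b Y ->
  (forall y c, Y y -> C c -> b y c = 0) -> C = perp b Y.
Proof.
move=> [fY sC d e _] nY h; have sY := fdim_subspace fY.
apply/seteqP; split=> [c Cc|v [_ hv]]; first by split=> // y Yy; apply: h.
have : [set: V] v by []. rewrite -e => -[y Yy [c Cc ev]].
have y0 : y = 0.
  apply: nY => // w Yw; apply: b_refl.
  by have := hv w Yw; rewrite -ev bDr (h w c) // addr0.
by rewrite -ev y0 add0r.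
Qed.

Variable F : set (set V).
Hypotheses (gF : generalized_flag F) (FP : forall A, F A -> F (perp b A))
  (Fiso : forall A, F A -> isotropic b A \/ isotropic b (perp b A))
  (perpK : forall A, F A -> perp b (perp b A) = A).
Let cF := gflag_chain gF.
Let Fi := iso_part F.
Let cFi : chain Fi := chain_sub (@iso_part_sub F) cF.

Lemma coisotropic A : F A -> ~ isotropic b A -> Fi (perp b A) /\ perp b A `<=` A.
Proof.
move=> FA nA; case: (Fiso FA) => // iA; split; first by split=> //; apply: FP.
by rewrite -{2}(perpK FA); apply/isotropic_perp.
Qed.

Section Stage.
Variable Y : set V.
Hypothesis st : iso_stage F Y.
Let C := perp b Y.
Let stF : is_stage F Y C. Proof. by case: st. Qed.
Let stFi : is_stage Fi Y C := stage_sub (@iso_part_sub F) stF.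
Let nY : nondeg_on b Y. Proof. by case: st. Qed.
Let fY : fdim Y. Proof. by case: stF. Qed.
Let sY : is_subspace Y := fdim_subspace fY.
Let sC : is_subspace C := perp_subspace b Y.

Let YC y c : Y y -> C c -> b y c = 0. Proof. by move=> Yy [_]; apply. Qed.
Let CY y c : Y y -> C c -> b c y = 0. Proof. by move=> Yy Cc; apply: b_refl; apply: YC. Qed.

Lemma perp_trace A : F A -> perp b A `&` Y = perp_in b Y (A `&` Y).
Proof.
move=> FA; apply/seteqP; split=> [v [[_ h] Yv]|v [Yv h]].
  by split=> // u [Au _]; apply: h.
split=> //; split=> // u Au; case: stF => _ _ _ _ /(_ A FA u Au) [y [Ay Yy] [c [Ac Cc] <-]].
by rewrite bDl h // add0r; apply: CY.
Qed.

Let sAY A : F A -> is_subspace (A `&` Y).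
Proof. by move=> FA; apply: subspaceI => //; apply: cF.1. Qed.

Lemma perp_trace_dim A : F A -> (dimn (perp b A `&` Y) + dimn (A `&` Y))%N = dimn Y.
Proof. by move=> FA; rewrite perp_trace // (perp_dim b_refl fY nY) //; apply: sAY. Qed.

Lemma iso_trace_dim A : Fi A -> ((dimn (A `&` Y)).*2 <= dimn Y)%N.
Proof.
move=> [FA iA]; apply: (isotropic_dim b_refl fY nY) => //; first exact: sAY.
by apply: isotropic_sub iA => v [].
Qed.

(** A coisotropic space contains its orthogonal complement, and their traces have
    complementary dimensions; so if the trace is at most half of Y, the two traces
    coincide. *)
Lemma small_trace_iso A : F A -> ((dimn (A `&` Y)).*2 <= dimn Y)%N ->
  exists2 A', Fi A' & A' `&` Y = A `&` Y.
Proof.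
move=> FA hd; case: (pselect (isotropic b A)) => iA; first by exists A.
have [Fp pA] := coisotropic FA iA; exists (perp b A) => //.
apply: dimn_sub_eq; [exact: (trace_fdim cF stF)|exact: (sAY Fp.1)|exact: setSI|].
by have := perp_trace_dim FA; rewrite -(leq_add2r (dimn (A `&` Y))) addnn => ->.
Qed.

(** An isotropic flag prescribes the isotropic spaces only; the coisotropic ones follow
    by orthogonality. *)
Definition iso_extend s A : set V :=
  if `[< isotropic b A >] then s A else perp_in b Y (s (perp b A)).

Section Extension.
Variable s : set V -> set V.
Hypotheses (ds : deformation Fi Y s) (is_ : forall A, Fi A -> isotropic b (s A)).

Let s_iso A B u v : Fi A -> Fi B -> s A u -> s B v -> b u v = 0.
Proof.
move=> FA FB Au Bv; case: (deformation_chain cFi ds FA FB) => h.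
  by apply: (is_ FB) => //; apply: h.
by apply: (is_ FA) => //; apply: h.
Qed.

Let extend_iso A : Fi A -> iso_extend s A = s A.
Proof. by move=> [_ iA]; rewrite /iso_extend asboolT. Qed.

Let extend_coiso A : ~ isotropic b A -> iso_extend s A = perp_in b Y (s (perp b A)).
Proof. by move=> iA; rewrite /iso_extend asboolF. Qed.

Lemma iso_extend_deformation : deformation F Y (iso_extend s).
Proof.
split=> [A FA|A B FA FB AB].
  case: (pselect (isotropic b A)) => iA; first by rewrite extend_iso //; apply: ds.1.
  have [Fp pA] := coisotropic FA iA; have [h1 h2 h3] := ds.1 _ Fp.
  rewrite extend_coiso //; split; [exact: perp_in_subspace|by move=> v []|].
  apply/eqP; rewrite -(eqn_add2r (dimn (s (perp b A)))) (perp_dim b_refl fY nY) // h3.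
  by rewrite addnC perp_trace_dim.
case: (pselect (isotropic b B)) => iB.
  have iA : isotropic b A := isotropic_sub AB iB.
  by rewrite !extend_iso //; apply: ds.2.
have [FpB pB] := coisotropic FB iB.
case: (pselect (isotropic b A)) => iA; rewrite (extend_coiso iB).
  rewrite extend_iso // => v sv; split; first by have [_ h _] := ds.1 A (conj FA iA); apply: h.
  by move=> u su; apply: (s_iso FpB (conj FA iA)).
have [FpA pA] := coisotropic FA iA; rewrite extend_coiso //.
by apply: perp_anti; apply: ds.2 => //; apply: perp_anti.
Qed.

Lemma perp_iso_extend A : F A -> perp_in b Y (iso_extend s A) = iso_extend s (perp b A).
Proof.
move=> FA; case: (pselect (isotropic b A)) => iA; last first.
  have [FpA pA] := coisotropic FA iA; have [h1 h2 h3] := ds.1 _ FpA.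
  by rewrite (extend_coiso iA) extend_iso // (perp_perp b_refl fY nY).
have [h1 h2 h3] := ds.1 A (conj FA iA).
case: (pselect (isotropic b (perp b A))) => ipA; last first.
  by rewrite extend_iso // extend_coiso // perpK.
have eA : perp b A = A.
  by apply/seteqP; split; [rewrite -{2}(perpK FA)|]; apply/isotropic_perp.
rewrite eA extend_iso //; apply/esym; apply: dimn_sub_eq.
- by apply: (fdim_sub fY) (perp_in_subspace b _ sY) _ => v [].
- exact: h1.
- by move=> v sv; split; [apply: h2|move=> u su; apply: (s_iso (conj FA iA) (conj FA iA))].
rewrite -(leq_add2r (dimn (s A))) (perp_dim b_refl fY nY) // h3.
by rewrite -(perp_trace_dim FA) eA.
Qed.

Lemma perp_deform A : F A ->
  perp b (deform C (iso_extend s) A) = deform C (iso_extend s) (perp b A).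
Proof.
move=> FA; have de := iso_extend_deformation; have [h1 h2 _] := de.1 A FA.
have sAC : is_subspace (A `&` C) by apply: subspaceI => //; apply: cF.1.
have [_ _ _ e _] := stF.
rewrite {2}/deform -perp_iso_extend //; apply/seteqP; split.
  move=> v [_ hv]; have : [set: V] v by []. rewrite -e => -[y Yy [c Cc ev]].
  have hu u : A u -> C u -> b u c = 0.
    move=> Au Cu; have := hv u (sub_sumr h1 (conj Au Cu)).
    by rewrite -ev bDr (CY Yy Cu) add0r.
  exists y.
    split=> // u su; have := hv u (sub_suml sAC su).
    by rewrite -ev bDr (YC (h2 _ su) Cc) addr0.
  exists c => //; split=> //; split=> // u Au.
  case: stF => _ _ _ _ /(_ A FA u Au) [a [Aa Ya] [a' [Aa' Ca'] <-]].
  by rewrite bDl (YC Ya Cc) (hu a') // addr0.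
apply: sum_sub_min; first exact: perp_subspace.
  move=> y [Yy hy]; split=> // _ [u su [c [Ac Cc] <-]].
  by rewrite bDl hy // (CY Yy Cc) addr0.
move=> c [[_ hc] Cc]; split=> // _ [u su [a [Aa Ca] <-]].
by rewrite bDl (YC (h2 _ su) Cc) (hc a Aa) addr0.
Qed.

Lemma iso_deform A : Fi A -> isotropic b (deform C s A).
Proof.
move=> FiA; have [FA iA] := FiA; apply: (isotropic_sum b_refl); first exact: is_.
  by apply: isotropic_sub iA => v [].
by move=> u v su [_ Cv]; apply: YC => //; have [_ h _] := ds.1 A FiA; apply: h.
Qed.

Lemma iso_extend_gflag : isotropic_gflag b (deform C (iso_extend s) @` F).
Proof.
have de := iso_extend_deformation.
split; first exact: (deform_gflag gF stF de).
move=> _ [A FA <-]; rewrite perp_deform //; split; last by exists (perp b A) => //; apply: FP.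
case: (pselect (isotropic b A)) => iA.
  left; rewrite /deform extend_iso //; exact: iso_deform.
right; have [FpA _] := coisotropic FA iA.
rewrite /deform extend_iso //; exact: iso_deform.
Qed.

End Extension.

(** The orthogonal complement of a deformed space is again a deformed space; comparing
    dimensions tells which one. *)
Lemma isotropic_deformation s : deformation F Y s -> isotropic_gflag b (deform C s @` F) ->
  (forall A, Fi A -> isotropic b (s A)) /\ forall A, F A -> s A = iso_extend s A.
Proof.
move=> ds [gG hG]; have sA A : F A -> is_subspace (s A) by move=> FA; case: (ds.1 A FA).
have sY' A : F A -> s A `<=` Y by move=> FA; case: (ds.1 A FA).
have sd A : F A -> dimn (s A) = dimn (A `&` Y) by move=> FA; case: (ds.1 A FA).
have perps A : F A -> exists A', [/\ F A', perp b (deform C s A) = deform C s A' & s A' = perp_in b Y (s A)].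
  move=> FA; have [_ [A' FA' eA']] := hG _ (ex_intro2 _ _ A FA erefl).
  exists A'; split=> //; rewrite -(deform_capY cF stF ds FA') eA'.
  apply/seteqP; split=> v.
    move=> [[_ h] Yv]; split=> // u su; apply: h; apply: sub_suml su.
    by apply: subspaceI => //; apply: cF.1.
  move=> [Yv h]; split=> //; split=> // _ [u su [c [_ Cc] <-]].
  by rewrite bDl h // (CY Yv Cc) addr0.
split.
  move=> A [FA iA]; have [A' [FA' eA' es]] := perps A FA.
  have [i1|i1] := (hG _ (ex_intro2 _ _ A FA erefl)).1.
    by apply: isotropic_sub i1; apply: sub_suml; apply: subspaceI => //; apply: cF.1.
  have i2 : isotropic b (s A').
    rewrite eA' in i1; apply: isotropic_sub i1; apply: sub_suml; apply: subspaceI => //; exact: cF.1.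
  suff h : s A `<=` s A' by apply: isotropic_sub h i2.
  apply: (deformation_le cF stF ds FA FA'); rewrite -!sd //.
  rewrite es -(leq_add2r (dimn (s A))) (perp_dim b_refl fY nY) ?addnn; [|exact: sA|exact: sY'].
  by rewrite sd //; apply: iso_trace_dim.
move=> A FA; rewrite /iso_extend; case: asboolP => // iA.
have [FpA _] := coisotropic FA iA; have [A' [FA' _ es]] := perps _ FpA.1.
rewrite -es; apply: (deformation_eq cF stF ds FA FA'); rewrite -(sd A') // es.
apply/eqP; rewrite -(eqn_add2r (dimn (s (perp b A)))) (perp_dim b_refl fY nY); [|exact: sA FpA.1|exact: sY' FpA.1].
by rewrite sd; [rewrite addnC perp_trace_dim|case: FpA].
Qed.

End Stage.

Section TwoStages.
Variables (Y Y' : set V).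
Hypotheses (st : iso_stage F Y) (st' : iso_stage F Y') (YY' : Y `<=` Y').
Let C := perp b Y.
Let stF : is_stage F Y C. Proof. by case: st. Qed.
Let stF' : is_stage F Y' (perp b Y'). Proof. by case: st'. Qed.
Let stFi : is_stage Fi Y C := stage_sub (@iso_part_sub F) stF.
Let stFi' : is_stage Fi Y' (perp b Y') := stage_sub (@iso_part_sub F) stF'.

Lemma iso_compl A : F A -> Y `<=` A \/ A `&` perp b Y' `<=` perp b Y.
Proof. by move=> FA; right=> v [_]; apply: perp_anti. Qed.

Variable s : set V -> set V.
Hypotheses (ds : deformation Fi Y s) (is_ : forall A, Fi A -> isotropic b (s A)).

Lemma transfer_iso A : Fi A -> isotropic b (transfer C Y' s A).
Proof.
by move=> FA; apply: isotropic_sub (iso_deform ds is_ FA) => v [].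
Qed.

Lemma transfer_iso_extend A : F A ->
  iso_extend Y' (transfer C Y' s) A = transfer C Y' (iso_extend Y s) A.
Proof.
move=> FA; have dt := transfer_deformation cFi stFi stFi' YY' ds.
have de := iso_extend_deformation st ds is_.
have d1 := iso_extend_deformation st' dt transfer_iso.
have d2 := transfer_deformation cF stF stF' YY' de.
have [_ _ e1] := d1.1 A FA; have [_ _ e2] := d2.1 A FA.
case: (pselect (isotropic b A)) => iA.
  by rewrite /transfer /deform /iso_extend !asboolT.
have [FpA _] := coisotropic FA iA.
apply/esym; apply: dimn_sub_eq; [exact: (deformation_fdim stF' d1 FA)|by case: (d2.1 A FA)| |by rewrite e1 e2].
rewrite [iso_extend Y' _ A]/iso_extend asboolF //.
have -> : transfer C Y' (iso_extend Y s) A = perp b (deform C (iso_extend Y s) (perp b A)) `&` Y'.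
  by rewrite (perp_deform st ds is_) ?perpK //; apply: FP.
move=> v [[_ h] Yv]; split=> // u [hu _]; apply: h.
rewrite /deform /iso_extend asboolT //; by case: FpA.
Qed.

Lemma transfer_iso_gflag :
  deform (perp b Y') (iso_extend Y' (transfer C Y' s)) @` F = deform C (iso_extend Y s) @` F.
Proof.
have de := iso_extend_deformation st ds is_.
transitivity (deform (perp b Y') (transfer C Y' (iso_extend Y s)) @` F).
  by apply: eq_deform_image => A FA; apply: transfer_iso_extend.
apply: eq_imagel => A FA.
exact: (transfer_deform cF stF stF' YY' iso_compl de FA).
Qed.

End TwoStages.

Lemma iso_extend_eq Y s s' : (forall A, Fi A -> s A = s' A) ->
  forall A, F A -> iso_extend Y s A = iso_extend Y s' A.
Proof.
move=> h A FA; rewrite /iso_extend; case: asboolP => iA; first exact: h.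
by have [FpA _] := coisotropic FA iA; rewrite h.
Qed.

Lemma iso_gflag_inj Y s s' : iso_stage F Y ->
  deformation Fi Y s -> (forall A, Fi A -> isotropic b (s A)) ->
  deformation Fi Y s' -> (forall A, Fi A -> isotropic b (s' A)) ->
  deform (perp b Y) (iso_extend Y s) @` F = deform (perp b Y) (iso_extend Y s') @` F ->
  forall A, Fi A -> s A = s' A.
Proof.
move=> st ds is_ ds' is' e A FiA; have [FA iA] := FiA.
have h := deform_flag_inj cF st.1 (iso_extend_deformation st ds is_)
  (iso_extend_deformation st ds' is') e FA.
by move: h; rewrite /iso_extend asboolT.
Qed.

End IsotropicDeformations.

(** * Transfer of isotropic flags and components *)

Section MaximalIsotropic.
Variables (K : fieldType).

(** The condition on components entering the definition of isotropic flag varieties,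
    normalized by a reference flag with last space A0: the last space of a flag must lie
    in the component of A0. *)
Definition component_data (V : lmodType K) (b : {biscalar V}) ty d X (ms : seq nat)
    (Gam : set (max_isotropic b d X)) (A0 : set V) :=
  if ty is Symmetric then (last 0%N ms).*2 = d ->
    forall y0 : max_isotropic b d X, sval y0 = [:: A0] -> Gam = component y0
  else Gam = setT.

Lemma index_last_type d ms : path ltn 0%N ms ->
  index (last 0%N ms) (0%N :: rcons ms d) = size ms.
Proof.
move=> pm; rewrite -rcons_cons -cats1 index_cat mem_last.
have /sorted_uniq h : sorted ltn (0%N :: ms) := pm.
by rewrite (last_nth 0%N) index_uniq //; apply: h; [apply: ltn_trans|apply: ltnn].
Qed.

Lemma mem_type_le_last ms m : path ltn 0%N ms -> m \in 0%N :: ms -> (m <= last 0%N ms)%N.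
Proof.
move=> pm mm; have h : sorted leq (0%N :: ms) by apply: sub_path pm => a c /ltnW.
rewrite -[X in (X <= _)%N](nth_index 0%N mm) (last_nth 0%N).
apply: (sorted_leq_nth leq_trans leqnn 0%N h); rewrite ?inE ?index_mem //.
by rewrite -ltnS index_mem.
Qed.

Lemma flag_term_last (V : lmodType K) (X : set V) ms t : is_flag X ms t ->
  flag_term X t (size ms) = last [set 0] t.
Proof.
move=> [<- _ _]; rewrite /flag_term (last_nth [set 0]).
by apply: set_nth_default.
Qed.

Lemma max_isotropic_point (V : lmodType K) (b : {biscalar V}) d X ms t : has_dim X d ->
  is_flag X ms t -> (forall A, A \in t -> isotropic b A) -> (last 0%N ms).*2 = d ->
  exists z : max_isotropic b d X, sval z = [:: last [set 0] t].
Proof.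
move=> hX ft it hd; have [szt _ _] := ft.
have hl : has_dim (last [set 0] t) d./2.
  rewrite -(flag_term_last ft) -hd doubleK.
  have := flag_term_dim (size ms) hX ft.
  by rewrite (set_nth_default 0%N) // -last_nth.
have fl : is_flag X [:: d./2] [:: last [set 0] t].
  split=> //; first by case=> //= _; split=> //; apply: has_dim_subspace hl.
  case=> [_|[|//] _].
    by rewrite /flag_term /=; apply: set0_sub; apply: has_dim_subspace hl.
  rewrite /flag_term /= -(flag_term_last ft); exact: (flag_term_sub hX ft).
have il : [set s : seq (set V) | forall A, A \in s -> isotropic b A] [:: last [set 0] t].
  move=> A; rewrite inE => /eqP ->; case: (lastP t) it => [_|r B it] /=.
    by move=> u v -> _; rewrite b0l.
  by rewrite last_rcons; apply: it; rewrite mem_rcons mem_head.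
pose z : max_isotropic b d X := exist (fun s => is_flag X [:: d./2] s /\ [set s : seq (set V) | forall A, A \in s -> isotropic b A] s) _ (conj fl il).
by exists z.
Qed.

End MaximalIsotropic.

Section IsotropicTransfer.
Variables (K : fieldType) (V : lmodType K) (b : {biscalar V}).
Hypothesis b_refl : forall u v, b u v = 0 -> b v u = 0.
Variable F : set (set V).
Hypotheses (gF : generalized_flag F) (FP : forall A, F A -> F (perp b A))
  (Fiso : forall A, F A -> isotropic b A \/ isotropic b (perp b A))
  (perpK : forall A, F A -> perp b (perp b A) = A).
Let cF := gflag_chain gF.
Let Fi := iso_part b F.
Let cFi : chain Fi := chain_sub (@iso_part_sub _ _ _ F) cF.

Section IsotropicFlags.
Variables (V0 : lmodType K) (j : {linear V0 -> V}) (r : {linear V -> V0}).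
Variables (b0 : {biscalar V0}) (X0 : set V0) (Y : set V) (d : nat) (ms : seq nat).
Hypotheses (hb : forall u v, b (j u) (j v) = b0 u v) (pY : presents j r X0 Y).
Hypotheses (hX : has_dim X0 d) (st : iso_stage b F Y) (ty : typed Fi Y d ms).

Lemma isotropic_image A : isotropic b (j @` A) <-> isotropic b0 A.
Proof.
split=> h u v; first by move=> Au Av; rewrite -hb; apply: h; [exists u|exists v].
by move=> [u' Au' <-] [v' Av' <-]; rewrite hb; apply: h.
Qed.

Lemma isotropic_retract (A : set V) : A `<=` Y -> isotropic b A -> isotropic b0 (r @` A).
Proof. by move=> AY iA; apply/isotropic_image; rewrite (presents_image pY). Qed.

(** An isotropic trace equal to the whole nondegenerate space Y is 0. *)
Lemma iso_type_dim A : Fi A -> dimn (A `&` Y) \in 0%N :: ms.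
Proof.
move=> FA; have [hY _ _ h _] := ty; have := h A FA; rewrite -rcons_cons mem_rcons in_cons.
move=> /orP [/eqP e|//]; have := iso_trace_dim b_refl gF st FA.
rewrite (dimnE hY) e -addnn -{3}(addn0 d) leq_add2l leqn0 => /eqP ->.
by rewrite mem_head.
Qed.

Lemma iso_type_le m : m \in 0%N :: ms -> (m.*2 <= d)%N.
Proof.
rewrite in_cons => /orP [/eqP -> //|mm]; have [hY _ _ _ h] := ty; have [A FA <-] := h m mm.
by rewrite -(dimnE hY); apply: (iso_trace_dim b_refl gF st).
Qed.

Lemma flag_def_isotropic t A : is_flag X0 ms t -> (forall B, B \in t -> isotropic b0 B) ->
  Fi A -> isotropic b (flag_def j Y d ms t A).
Proof.
move=> ft it FA; have [szt _ _] := ft; have [_ _ eY _] := pY.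
rewrite /flag_def /flag_fun -eY flag_term_image eY; apply/isotropic_image.
have := iso_type_dim FA; rewrite in_cons => /orP [/eqP ->|mm].
  by rewrite /flag_term /= => u v -> _; rewrite b0l.
have [_ pm _ _ _] := ty; rewrite index_type // /flag_term /=.
by apply: it; apply: mem_nth; rewrite szt index_mem.
Qed.

Lemma flag_def_last t A : is_flag X0 ms t -> dimn (A `&` Y) = last 0%N ms ->
  flag_def j Y d ms t A = j @` last [set 0] t.
Proof.
move=> ft dA; have [_ pm _ _ _] := ty; have [_ _ eY _] := pY.
by rewrite /flag_def /flag_fun dA index_last_type // -eY flag_term_image (flag_term_last ft).
Qed.

Definition iso_gflag t : set (set V) := deform (perp b Y) (iso_extend b Y (flag_def j Y d ms t)) @` F.

Lemma iso_flag_deformation t : is_flag X0 ms t -> deformation Fi Y (flag_def j Y d ms t).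
Proof.
move=> ft; have stFi : is_stage Fi Y (perp b Y) := stage_sub (@iso_part_sub _ _ _ F) st.1.
exact: (flag_fun_deformation cFi stFi ty (presents_flag_image pY hX ft)).
Qed.

Lemma iso_gflag_flag_inj t t' : is_flag X0 ms t -> (forall B, B \in t -> isotropic b0 B) ->
  is_flag X0 ms t' -> (forall B, B \in t' -> isotropic b0 B) -> iso_gflag t = iso_gflag t' -> t = t'.
Proof.
move=> ft it ft' it' h; have [ji _ _ _] := pY; apply: (flag_image_inj ji).
have f1 := presents_flag_image pY hX ft; have f2 := presents_flag_image pY hX ft'.
rewrite -(flag_list_fun ty f1) -(flag_list_fun ty f2).
apply: flag_list_eq; first by case: ty.
apply: (iso_gflag_inj b_refl gF FP Fiso perpK st _ _ _ _ h); try exact: iso_flag_deformation.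
  by move=> A; apply: flag_def_isotropic.
by move=> A; apply: flag_def_isotropic.
Qed.

End IsotropicFlags.

Variables (V1 : lmodType K) (j1 : {linear V1 -> V}) (r1 : {linear V -> V1}).
Variables (b1 : {biscalar V1}) (X1 : set V1) (Y1 : set V) (d1 : nat) (ms1 : seq nat).
Variables (V2 : lmodType K) (j2 : {linear V2 -> V}) (r2 : {linear V -> V2}).
Variables (b2 : {biscalar V2}) (X2 : set V2) (Y2 : set V) (d2 : nat) (ms2 : seq nat).
Hypotheses (hb1 : forall u v, b (j1 u) (j1 v) = b1 u v) (hb2 : forall u v, b (j2 u) (j2 v) = b2 u v).
Hypotheses (p1 : presents j1 r1 X1 Y1) (p2 : presents j2 r2 X2 Y2).
Hypotheses (hX1 : has_dim X1 d1) (hX2 : has_dim X2 d2).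
Hypotheses (st1 : iso_stage b F Y1) (st2 : iso_stage b F Y2).
Hypotheses (t1 : typed Fi Y1 d1 ms1) (t2 : typed Fi Y2 d2 ms2).
Hypotheses (Y12 : Y1 `<=` Y2) (bottom : exists2 A, Fi A & dimn (A `&` Y2) = 0%N).

Let C1 := perp b Y1.
Let s1F : is_stage F Y1 C1. Proof. by case: st1. Qed.
Let s2F : is_stage F Y2 (perp b Y2). Proof. by case: st2. Qed.
Let s1 : is_stage Fi Y1 C1 := stage_sub (@iso_part_sub _ _ _ F) s1F.
Let s2 : is_stage Fi Y2 (perp b Y2) := stage_sub (@iso_part_sub _ _ _ F) s2F.
Let fY2 : fdim Y2. Proof. by case: s1F => [_ _ _ _ _]; case: s2F. Qed.
Let sY1 : is_subspace Y1. Proof. by case: s1F => /fdim_subspace. Qed.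
Let sY2 : is_subspace Y2 := fdim_subspace fY2.
Let hY1 : has_dim Y1 d1. Proof. by case: t1. Qed.
Let hY2 : has_dim Y2 d2. Proof. by case: t2. Qed.
Let nY2 : nondeg_on b Y2. Proof. by case: st2. Qed.

Let tr := transfer_flag j1 Y1 C1 d1 ms1 r2 Y2 ms2 Fi.

Lemma iso_transfer_isotropic t : is_flag X1 ms1 t -> (forall A, A \in t -> isotropic b1 A) ->
  forall A, A \in tr t -> isotropic b2 A.
Proof.
move=> ft it A /mapP [B /mapP [m mm ->] ->].
have [FB _] := space_of_rankP t2 mm.
apply: (isotropic_retract hb2 p2); first by move=> v [].
have ds := flag_fun_deformation cFi s1 t1 (presents_flag_image p1 hX1 ft).
apply: (transfer_iso b_refl ds _ FB) => D FD.
exact: (flag_def_isotropic hb1 p1 st1 t1 ft it FD).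
Qed.

(** The trace of A on Y2 splits into isotropic subspaces of Y1 and of its orthogonal
    complement in Y2; if it is of half dimension in Y2, so are they. *)
Lemma max_iso_descends A : Fi A -> (dimn (A `&` Y2)).*2 = d2 ->
  (dimn (A `&` Y1)).*2 = d1 /\ dimn (A `&` Y1) = last 0%N ms1.
Proof.
move=> FA hA; have [FA' iA] := FA.
have hsum := stage_trace_dim cF s1F s2F Y12 FA'.
set P := perp_in b Y2 Y1.
have fP : fdim P by apply: (fdim_sub fY2) (perp_in_subspace b _ sY2) _ => v [].
have dP : (dimn P + d1)%N = d2.
  by rewrite -(dimnE hY1) -(dimnE hY2); apply: perp_dim.
have nP : nondeg_on b P.
  move=> u [Yu hu] h; apply: nY2 => // v Yv.
  have [_ _ _ e _] := s1F; have : [set: V] v by []. rewrite -e => -[y Yy [c Cc ev]].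
  have Yc : Y2 c by apply: (subspace_addl sY2 (Y12 Yy)); rewrite ev.
  rewrite -ev bDr (b_refl (hu y Yy)) add0r; apply: h; split=> //.
  by case: Cc.
have h2 : ((dimn (A `&` C1 `&` Y2)).*2 <= dimn P)%N.
  apply: (isotropic_dim b_refl fP nP).
  - by apply: subspaceI => //; apply: subspaceI; [apply: cF.1|apply: (perp_subspace b Y1)].
  - by move=> v [[_ [_ Cv]] Yv]; split.
  - by apply: isotropic_sub iA => v [[]].
have h1 : ((dimn (A `&` Y1)).*2 <= d1)%N.
  by rewrite -(dimnE hY1); apply: (iso_trace_dim b_refl gF st1).
have e1 : (dimn (A `&` Y1)).*2 = d1.
  apply/eqP; rewrite eqn_leq h1 /= -(leq_add2l (dimn P)) dP -hA hsum doubleD addnC leq_add2r.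
  exact: h2.
split=> //; apply/eqP; rewrite eqn_leq; apply/andP; split.
  by apply: mem_type_le_last (iso_type_dim st1 t1 FA); case: t1.
by rewrite -leq_double e1; apply: (iso_type_le st1 t1); apply: mem_last.
Qed.

Let max_witness : exists2 A, Fi A & dimn (A `&` Y2) = last 0%N ms2.
Proof.
case: (lastP ms2) (t2) => [_|s m ty]; first exact: bottom.
rewrite last_rcons; case: ty => _ _ _ _; apply; by rewrite mem_rcons mem_head.
Qed.

Let singleton_typed (A : set V) (Y : set V) d : (0 < d./2)%N -> has_dim Y d ->
  dimn (A `&` Y) = d./2 -> typed [set A] Y d [:: d./2].
Proof.
move=> d0 hY dA; split=> //=; first by rewrite d0.
- by move=> m; rewrite inE => /eqP ->; rewrite -{2}(odd_double_half d) -addnn addnA leq_addl.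
- by move=> _ ->; rewrite dA !inE eqxx orbT.
by move=> m; rewrite inE => /eqP ->; exists A.
Qed.

Variable ty : form_type.
Variables (Gam1 : set (max_isotropic b1 d1 X1)) (Gam2 : set (max_isotropic b2 d2 X2)).
Variables (t01 : seq (set V1)) (t02 : seq (set V2)).
Hypotheses (f01 : is_flag X1 ms1 t01) (f02 : is_flag X2 ms2 t02).
Hypotheses (e01 : forall A, Fi A -> flag_def j1 Y1 d1 ms1 t01 A = A `&` Y1)
  (e02 : forall A, Fi A -> flag_def j2 Y2 d2 ms2 t02 A = A `&` Y2).
Hypotheses (cd1 : component_data ty ms1 Gam1 (last [set 0] t01))
  (cd2 : component_data ty ms2 Gam2 (last [set 0] t02)).

Let tr_last t A : is_flag X1 ms1 t -> Fi A -> dimn (A `&` Y2) = last 0%N ms2 ->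
  r2 @` transfer C1 Y2 (flag_def j1 Y1 d1 ms1 t) A = last [set 0] (tr t).
Proof.
move=> ft FA dA; rewrite -(transfer_flag_def cFi p1 p2 hX1 s1 s2 t1 t2 Y12 ft FA).
have ft2 := transfer_flag_is_flag cFi p1 p2 hX1 s1 s2 t1 t2 Y12 ft.
rewrite (flag_def_last p2 t2 ft2 dA).
have [_ sX eY _] := p2; rewrite -(flag_term_last ft2).
have h := flag_term_sub (i := size ms2) hX2 ft2.
apply/seteqP; split=> [_ [_ [u Au <-] <-]|u Au].
  by rewrite (presents_retract p2) //; apply: h.
by exists (j2 u); [exists u|rewrite (presents_retract p2) //; apply: h].
Qed.

Let tr_last0 A : Fi A -> dimn (A `&` Y2) = last 0%N ms2 ->
  r2 @` transfer C1 Y2 (flag_def j1 Y1 d1 ms1 t01) A = last [set 0] t02.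
Proof.
move=> FA dA; have -> : transfer C1 Y2 (flag_def j1 Y1 d1 ms1 t01) A = flag_def j2 Y2 d2 ms2 t02 A.
  rewrite e02 // /transfer /deform e01 //; congr (_ `&` Y2).
  have [_ _ _ _ /(_ A FA) h] := s1; apply/seteqP; split=> //.
  by apply: sum_sub_min; [apply: cFi.1|move=> v []|move=> v []].
rewrite (flag_def_last p2 t2 f02 dA).
have h := flag_term_sub (i := size ms2) hX2 f02; rewrite (flag_term_last f02) in h.
apply/seteqP; split=> [_ [_ [u Au <-] <-]|u Au].
  by rewrite (presents_retract p2) //; apply: h.
by exists (j2 u); [exists u|rewrite (presents_retract p2) //; apply: h].
Qed.

(** On the last spaces a transfer adds a fixed isotropic subspace. This is a morphism
    between varieties of maximal isotropic subspaces, so it maps connected components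
    into connected components, and it sends the reference point of the first stage to
    that of the second. *)
Lemma transfer_isotropic_flag t : is_flag X1 ms1 t ->
  isotropic_flag ms1 Gam1 t -> isotropic_flag ms2 Gam2 (tr t).
Proof.
move=> ft [it ct]; split; first exact: iso_transfer_isotropic.
move=> hmax; have ft2 := transfer_flag_is_flag cFi p1 p2 hX1 s1 s2 t1 t2 Y12 ft.
have [z2 ez2] := max_isotropic_point hX2 ft2 (iso_transfer_isotropic ft it) hmax.
exists z2 => //; have [A FA dA] := max_witness.
have dA2 : (dimn (A `&` Y2)).*2 = d2 by rewrite dA.
have [dA1 eA1] := max_iso_descends FA dA2.
move: cd1 cd2; rewrite /component_data; case: ty => [cs1 cs2|_ -> //].
have hmax1 : (last 0%N ms1).*2 = d1 by rewrite -eA1.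
have [y Gy ey] := ct hmax1.
have i01 B : B \in t01 -> isotropic b1 B.
  move=> Bt; apply/(isotropic_image hb1); move: Bt => /(nthP set0) [i hi <-].
  have [sz0 _ _] := f01; have [_ pm _ _ hr] := t1; rewrite sz0 in hi.
  have [D FD dD] := hr _ (mem_nth 0%N hi).
  have := e01 FD; rewrite /flag_def /flag_fun dD index_type ?mem_nth // index_uniq ?type_uniq //.
  have [_ _ eY _] := p1; rewrite -eY flag_term_image eY /flag_term /= (set_nth_default set0) ?sz0 // => ->.
  by apply: isotropic_sub FD.2 => v [].
have [x0 ex0] := max_isotropic_point hX1 f01 i01 hmax1.
have h0 := cs1 hmax1 x0 ex0.
case: (posnP d1./2) => d10.
  have d1E : d1 = 0%N.
    by move: hmax1 d10 => <-; rewrite doubleK => ->.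
  have ms0 : ms1 = [::].
    case E1 : (ms1) => [//|m l]; have [_ pm le _ _] := t1.
    rewrite E1 /= in pm; case/andP: pm => m0 _.
    by have := le m; rewrite E1 mem_head d1E => /(_ isT); rewrite leqNgt m0.
  have et : t = t01.
    have [sz _ _] := ft; have [sz0 _ _] := f01; rewrite ms0 in sz sz0.
    by rewrite (size0nil sz) (size0nil sz0).
  have ez : sval z2 = [:: last [set 0] t02].
    by rewrite ez2 -(tr_last ft FA dA) et (tr_last0 FA dA).
  by rewrite (cs2 hmax z2 ez); apply: component_refl.
have d20 : (0 < d2./2)%N.
  have le : (d1 <= d2)%N by rewrite -(dimnE hY1) -(dimnE hY2); apply: dimn_sub.
  exact: leq_trans d10 (half_leq le).
have dAh1 : dimn (A `&` Y1) = d1./2 by rewrite -dA1 doubleK.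
have dAh2 : dimn (A `&` Y2) = d2./2 by rewrite -dA2 doubleK.
have sA : [set A] `<=` Fi by move=> _ ->.
have cA : chain [set A] := chain_sub sA cFi.
have u1 : is_stage [set A] Y1 C1 := stage_sub sA s1.
have u2 : is_stage [set A] Y2 (perp b Y2) := stage_sub sA s2.
have tA1 := singleton_typed d10 hY1 dAh1; have tA2 := singleton_typed d20 hY2 dAh2.
pose trA := transfer_flag j1 Y1 C1 d1 [:: d1./2] r2 Y2 [:: d2./2] [set A].
have defA (z : max_isotropic b1 d1 X1) B : sval z = [:: B] ->
    flag_def j1 Y1 d1 [:: d1./2] (sval z) A = j1 @` B.
  move=> ez; have [_ _ eY _] := p1.
  rewrite /flag_def /flag_fun dAh1 -eY flag_term_image ez /= ltn_eqF //= ?eqxx.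
  by rewrite /flag_term.
have trAE : forall z : max_isotropic b1 d1 X1, trA (sval z) =
    [:: r2 @` transfer C1 Y2 (flag_def j1 Y1 d1 [:: d1./2] (sval z)) A].
  move=> z.
  rewrite /trA /transfer_flag /flag_list /= /flag_image /=.
  suff -> : space_of_rank [set A] Y2 d2./2 = A by [].
  by have [] := space_of_rankP tA2 (mem_head _ _).
have [f mf hf] : exists2 f : max_isotropic b1 d1 X1 -> max_isotropic b2 d2 X2,
    is_morphism f & forall z, sval (f z) = trA (sval z).
  apply: (transfer_map_exists cA p1 p2 hX1 hX2 u1 u2 tA1 tA2 Y12) => r fr ir B.
  rewrite /transfer_flag /flag_list /= /flag_image /= inE => /eqP ->.
  have -> : space_of_rank [set A] Y2 d2./2 = A.
    by have [] := space_of_rankP tA2 (mem_head _ _).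
  apply: (isotropic_retract hb2 p2); first by move=> v [].
  have dr := flag_fun_deformation cA u1 tA1 (presents_flag_image p1 hX1 fr).
  have := dr.1 A erefl; case=> _ h2 _.
  apply: (@isotropic_sub _ _ _ _ (deform C1 (flag_def j1 Y1 d1 [:: d1./2] r) A)); first by move=> v [].
  apply: (isotropic_sum b_refl).
  - have [_ _ eY _] := p1; rewrite /flag_def /flag_fun dAh1 -eY flag_term_image /= ltn_eqF //= ?eqxx.
    apply/(isotropic_image hb1); rewrite /flag_term /=; apply: ir.
    by apply: mem_nth; case: fr => ->.
  - by apply: isotropic_sub FA.2 => v [].
  - by move=> u v /h2 Yu [_ [_ Cv]]; apply: Cv.
have ex : sval (f x0) = [:: last [set 0] t02].
  rewrite hf trAE -(tr_last0 FA dA) /transfer /deform (defA _ _ ex0).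
  by rewrite (flag_def_last p1 t1 f01 eA1).
have fy : f y = z2.
  apply: sval_inj; rewrite hf trAE ez2 -(tr_last ft FA dA) /transfer /deform (defA _ _ ey).
  by rewrite (flag_def_last p1 t1 ft eA1).
rewrite (cs2 hmax _ ex) -fy; apply: component_image => //.
by rewrite -h0.
Qed.

(** All maps between levels are instances of this: those within one exhaustion of V and
    those from one exhaustion to another. *)
Lemma isotropic_transfer_map :
  exists2 f : isotropic_flag_variety ms1 Gam1 -> isotropic_flag_variety ms2 Gam2, is_morphism f &
    forall T, iso_gflag j2 Y2 d2 ms2 (sval (f T)) = iso_gflag j1 Y1 d1 ms1 (sval T).
Proof.
have [f mf hf] := transfer_map_exists cFi p1 p2 hX1 hX2 s1 s2 t1 t2 Y12 transfer_isotropic_flag.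
exists f => // T; rewrite hf; have [ft [it _]] := svalP T.
have dt := iso_flag_deformation p1 hX1 st1 t1 ft.
have di A : Fi A -> isotropic b (flag_def j1 Y1 d1 ms1 (sval T) A).
  exact: (flag_def_isotropic hb1 p1 st1 t1 ft it).
rewrite /iso_gflag -(transfer_iso_gflag b_refl gF FP Fiso perpK st1 st2 Y12 dt di).
apply: eq_deform_image; apply: (iso_extend_eq FP Fiso perpK) => A FA.
exact: (transfer_flag_def cFi p1 p2 hX1 s1 s2 t1 t2 Y12 ft FA).
Qed.

End IsotropicTransfer.

(** * Bases made of isotropic pairs *)

Section WittBases.
Variables (K : fieldType) (V : lmodType K) (b : {biscalar V}).
Variables (o : bool) (e e' : nat -> V) (e0 : V).
Hypothesis b_refl : forall u v, b u v = 0 -> b v u = 0.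
Hypothesis wb : witt_basis b o e e' e0.
Let E : set V := witt_set o e e' e0.

Definition witt_initial n : set V :=
  [set e j | j in `I_n] `|` [set e' j | j in `I_n] `|` (if o then [set e0] else set0).
Definition witt_span n : set V := lin_span (witt_initial n).
Let D := witt_initial.
Let X := witt_span.

Let bE : is_basis E setT. Proof. by case: wb. Qed.
Let bee i j : b (e i) (e j) = 0. Proof. by case: wb => _ /(_ i j) []. Qed.
Let bee' i j : b (e' i) (e' j) = 0. Proof. by case: wb => _ /(_ i j) []. Qed.
Let bp i j : b (e i) (e' j) = (i == j)%:R. Proof. by case: wb. Qed.
Let bp1 i : b (e i) (e' i) <> 0. Proof. by rewrite bp eqxx; apply/eqP; apply: oner_neq0. Qed.
Let bp2 i : b (e' i) (e i) <> 0. Proof. by move=> h; apply: (@bp1 i); apply: b_refl. Qed.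
Let bp' i j : b (e' i) (e j) <> 0 -> i = j.
Proof.
move=> h; apply/eqP; apply: contraT => ne; case: h; apply: b_refl.
by rewrite bp eq_sym (negbTE ne).
Qed.
Let b00 : o -> b e0 e0 <> 0.
Proof. by case: wb => _ _ _ h /h [-> _]; apply/eqP; apply: oner_neq0. Qed.
Let b0e i : o -> b e0 (e i) = 0 /\ b e0 (e' i) = 0.
Proof. by case: wb => _ _ _ h /h [_ /(_ i)]. Qed.
Let be0 i : o -> b (e i) e0 = 0 /\ b (e' i) e0 = 0.
Proof. by move=> /(b0e i) [h1 h2]; split; apply: b_refl. Qed.

Lemma witt_einj : injective e.
Proof. by move=> i j h; apply: esym; apply: bp'; rewrite h; apply: bp2. Qed.

Lemma witt_e'inj : injective e'.
Proof. by move=> i j h; apply: bp'; rewrite h; apply: bp2. Qed.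

Let initial_cases n v : D n v -> [\/ exists2 j, (j < n)%N & v = e j,
  exists2 j, (j < n)%N & v = e' j | o /\ v = e0].
Proof.
move=> [[[j hj <-]|[j hj <-]]|]; first by apply: Or31; exists j.
  by apply: Or32; exists j.
by case: (o) => //= ->; apply: Or33.
Qed.

Let E_cases v : E v -> [\/ exists j, v = e j, exists j, v = e' j | o /\ v = e0].
Proof.
move=> [[[j _ <-]|[j _ <-]]|]; first by apply: Or31; exists j.
  by apply: Or32; exists j.
by case: (o) => //= ->; apply: Or33.
Qed.

Let initial_e n j : (j < n)%N -> D n (e j). Proof. by move=> h; left; left; exists j. Qed.
Let initial_e' n j : (j < n)%N -> D n (e' j). Proof. by move=> h; left; right; exists j. Qed.
Let initial_e0 n : o -> D n e0. Proof. by move=> h; right; rewrite h. Qed.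

Lemma witt_initial_sub n : D n `<=` E.
Proof.
move=> v /initial_cases [[j _ ->]|[j _ ->]|[h ->]].
- by left; left; exists j.
- by left; right; exists j.
by right; rewrite h.
Qed.

Lemma witt_initial_inc n m : (n <= m)%N -> D n `<=` D m.
Proof.
move=> le v /initial_cases [[j hj ->]|[j hj ->]|[h ->]].
- by apply: initial_e; apply: leq_trans le.
- by apply: initial_e'; apply: leq_trans le.
exact: initial_e0.
Qed.

Lemma witt_initial_exhaust : E `<=` \bigcup_n D n.
Proof.
move=> v /E_cases [[j ->]|[j ->]|[h ->]].
- by exists j.+1 => //; apply: initial_e.
- by exists j.+1 => //; apply: initial_e'.
by exists 0%N => //; apply: initial_e0.
Qed.

Lemma witt_initial_finite n : finite_set (D n).
Proof.
rewrite /D /witt_initial !finite_setU; do !split; try by apply: finite_image; apply: finite_II.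
by case: ifP.
Qed.

Lemma witt_initial_succ n v : D n.+1 v -> D n v \/ v = e n \/ v = e' n.
Proof.
move=> /initial_cases [[j hj ->]|[j hj ->]|[h ->]]; last by left; apply: initial_e0.
  move: hj; rewrite ltnS leq_eqVlt => /orP [/eqP ->|hj]; first by right; left.
  by left; apply: initial_e.
move: hj; rewrite ltnS leq_eqVlt => /orP [/eqP ->|hj]; first by right; right.
by left; apply: initial_e'.
Qed.

Lemma witt_new n v : v = e n \/ v = e' n -> (E `\` D n) v /\ D n.+1 v.
Proof.
move=> h; split; last by case: h => ->; [apply: initial_e|apply: initial_e'].
split; first by case: h => ->; [left; left|left; right]; exists n.
case: h => -> /initial_cases [[j hj h]|[j hj h]|[h h']].
- by rewrite (witt_einj h) ltnn in hj.
- by apply: (@bp1 n); rewrite h bee'.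
- by apply: (@bp1 n); rewrite h'; case: (b0e n h).
- by apply: (@bp2 n); rewrite h bee.
- by rewrite (witt_e'inj h) ltnn in hj.
- by apply: (@bp2 n); rewrite h'; case: (b0e n h).
Qed.

(** The partner of e n is e' n and conversely, that of e0 is e0 itself. *)
Lemma witt_partner n v : D n v -> exists2 w, D n w &
  b w v <> 0 /\ forall u, E u -> b u v <> 0 -> u = w.
Proof.
move=> /initial_cases [[j hj ->]|[j hj ->]|[h ->]].
- exists (e' j); first exact: initial_e'.
  split=> // u /E_cases [[i ->]|[i ->]|[h ->]] //; first by move/bp' ->.
  by case: (b0e j h).
- exists (e j); first exact: initial_e.
  split=> // u /E_cases [[i ->]|[i ->]|[h ->]] //.
    by rewrite bp; case: eqVneq => [->|].
  by case: (b0e j h).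
exists e0; first exact: initial_e0.
split; first exact: b00.
by move=> u /E_cases [[i ->]|[i ->]|[_ ->]] //; case: (be0 i h).
Qed.

Lemma witt_orthogonal n u v : D n u -> (E `\` D n) v -> b u v = 0.
Proof.
move=> Du [Ev nv]; apply: b_refl; apply: contrapT => h; apply: nv.
by have [w Dw [_ hw]] := witt_partner Du; rewrite (hw v).
Qed.

Lemma witt_nondeg n : nondeg_on b (X n).
Proof.
move=> u Xu hu; have [l [_ lD lu]] := span_finite Xu.
have {}lu : sspan (undup l) u by move: lu; rewrite (@eq_sspan _ _ _ l) // => v; rewrite mem_undup.
have {}lD v : v \in undup l -> D n v by rewrite mem_undup; apply: lD.
elim: (undup l) u (undup_uniq l) lD lu hu {Xu} => [|v s IH] u; first by rewrite sspan_nil.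
move=> /= /andP [vs us] lD /sspan_consP [a su] hu.
have Dv := lD v (mem_head _ _).
have sD u' : u' \in s -> D n u' by move=> h; apply: lD; rewrite inE h orbT.
have [w Dw [hwv hw]] := witt_partner Dv.
have [v' Dv' [_ hv']] := witt_partner Dw.
have only u' : u' \in s -> b u' w = 0.
  move=> u's; apply: contrapT => h; have e1 := hv' u' (witt_initial_sub (sD _ u's)) h.
  have e2 : v = v' by apply: hv'; [apply: witt_initial_sub Dv|move=> /b_refl].
  by rewrite e2 -e1 u's in vs.
have h0 : b (u - a *: v) w = 0.
  apply: (sspan_min (A := [set u' | b u' w = 0])) su => //.
  by split=> [|c u1 u2 /= h1 h2] /=; rewrite ?b0l // bDl bZl h1 h2 mulr0 addr0.
have a0 : a = 0.
  have := hu w (sub_span Dw); rewrite -[u](subrK (a *: v)) bDl h0 add0r bZl => /eqP.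
  by rewrite mulf_eq0 => /orP [/eqP //|/eqP /b_refl].
move: su; rewrite a0 scale0r subr0 => su.
exact: IH.
Qed.

Lemma witt_span_dim n : has_dim (X n) (n.*2 + o)%N.
Proof.
pose s := map e (iota 0 n) ++ map e' (iota 0 n) ++ nseq o e0.
have hs v : v \in s <-> D n v.
  rewrite !mem_cat; split.
    case/or3P => [/mapP [j]|/mapP [j]|]; rewrite ?mem_iota.
    - by move=> /= hj ->; apply: initial_e.
    - by move=> /= hj ->; apply: initial_e'.
    by rewrite mem_nseq => /andP [h /eqP ->]; apply: initial_e0; case: (o) h.
  case/initial_cases => [[j hj ->]|[j hj ->]|[h ->]].
  - by rewrite map_f // mem_iota.
  - by rewrite orbC map_f ?orbT // mem_iota.
  by rewrite mem_nseq h eqxx !orbT.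
have us : uniq s.
  rewrite !cat_uniq !map_inj_uniq ?iota_uniq; [|exact: witt_e'inj|exact: witt_einj].
  rewrite /= has_cat negb_or -andbA; apply/and4P; split.
  - apply/hasPn => _ /mapP [j _ ->]; apply/negP => /mapP [i _ h].
    by apply: (@bp2 i); rewrite -h bee'.
  - apply/hasPn => v; rewrite mem_nseq => /andP [h /eqP ->]; apply/negP => /mapP [i _ h'].
    have ho : o by case: (o) h.
    by apply: (b00 ho); rewrite {2}h'; case: (b0e i ho).
  - apply/hasPn => v; rewrite mem_nseq => /andP [h /eqP ->]; apply/negP => /mapP [i _ h'].
    have ho : o by case: (o) h.
    by apply: (b00 ho); rewrite {2}h'; case: (b0e i ho).
  by case: (o).
have -> : X n = sspan s.
  by congr lin_span; apply/seteqP; split=> v /=; move=> /hs.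
have -> : (n.*2 + o)%N = size s.
  by rewrite !size_cat !size_map size_iota size_nseq addnA addnn.
apply: indep_sspan; apply: (basis_indep bE us) => v /hs; exact: witt_initial_sub.
Qed.

Lemma witt_span_inc n m : (n <= m)%N -> X n `<=` X m.
Proof. by move=> le; apply: span_mono; apply: witt_initial_inc. Qed.

Lemma witt_span_exhaust v : exists n, X n v.
Proof.
have : [set: V] v by []. rewrite -bE.2 => /span_finite [t [_ tE tv]].
have [n hn] := finite_basis_stage (fun n => witt_initial_inc (leqnSn n)) witt_initial_exhaust tE.
exists n; apply: sspan_min tv; first exact: subspace_span.
by move=> u ut; apply: sub_span; apply: hn.
Qed.

Lemma witt_perp n : lin_span (E `\` D n) = perp b (X n).
Proof.
have st0 : is_stage set0 (X n) (lin_span (E `\` D n)).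
  by apply: (basis_stage bE _ (@witt_initial_finite n) (@witt_initial_sub n)).
apply: (stage_perp b_refl st0 (@witt_nondeg n)) => u v Xu Cv.
have h w : D n w -> b w v = 0.
  move=> Dw; move: v Cv; apply: (@span_min _ _ [set v | b w v = 0]).
    by split=> [|c u1 u2 /= h1 h2] /=; rewrite ?b0r // bDr bZr h1 h2 mulr0 addr0.
  by move=> v hv; apply: (@witt_orthogonal n).
move: u Xu; apply: (@span_min _ _ [set u | b u v = 0]) => //.
by split=> [|c u1 u2 /= h1 h2] /=; rewrite ?b0l // bDl bZl h1 h2 mulr0 addr0.
Qed.

Variable F : set (set V).
Hypothesis spF : forall A, F A -> spanned E A.

Let stD n : is_stage F (X n) (lin_span (E `\` D n)).
Proof. exact: (basis_stage bE spF (@witt_initial_finite n) (@witt_initial_sub n)). Qed.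

Lemma witt_stage n : iso_stage b F (X n).
Proof. by split; [rewrite -witt_perp|apply: witt_nondeg]. Qed.

Lemma perp_perp_id : (forall A, F A -> F (perp b A)) -> forall A, F A -> perp b (perp b A) = A.
Proof.
move=> FP A FA.
have h n : perp b (perp b A) `&` X n = A `&` X n.
  have st := witt_stage n; have [[fX _ _ _ _] nX] := st.
  rewrite (perp_trace b_refl st (FP _ FA)) (perp_trace b_refl st FA) (perp_perp b_refl fX nX) //.
  by apply: subspaceI; [apply: spanned_subspace (spF FA)|apply: fdim_subspace].
apply/seteqP; split=> v hv; have [n Xv] := witt_span_exhaust v.
  by have : (perp b (perp b A) `&` X n) v by []; rewrite h => -[].
by have : (A `&` X n) v by []; rewrite -h => -[].
Qed.

(** A basis vector that occurs in a vector orthogonal to A is itself orthogonal to A,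
    because it is the only one to pair with its partner. *)
Lemma witt_perp_spanned A : spanned E A -> spanned E (perp b A).
Proof.
move=> sA; apply/seteqP; split.
  by apply: span_min; [apply: perp_subspace|move=> v []].
move=> v hv; have : [set: V] v by []. rewrite -bE.2 => /span_finite [l [_ lE lv]].
have {}lv : sspan (undup l) v by move: lv; rewrite (@eq_sspan _ _ _ l) // => u; rewrite mem_undup.
have {}lE u : u \in undup l -> E u by rewrite mem_undup; apply: lE.
elim: (undup l) v (undup_uniq l) lE lv hv => [|u s IH] v.
  by rewrite sspan_nil => _ _ -> _; apply: subspace0; apply: subspace_span.
move=> /= /andP [us ss] lE /sspan_consP [a sv] hv.
have sE u' : u' \in s -> E u' by move=> h; apply: lE; rewrite inE h orbT.
have Eu := lE u (mem_head _ _).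
case: (pselect (perp b A u)) => pu.
  rewrite -[v](subrK (a *: u)); apply: (subspaceD (subspace_span _)).
    apply: IH => //; apply: (subspaceB (perp_subspace b A)) => //.
    exact: (subspaceZ a (perp_subspace b A) pu).
  by apply: (subspaceZ a (subspace_span _)); apply: sub_span; split.
have [w [Aw Ew] bwu] : exists2 w, A w /\ E w & b w u <> 0.
  apply: contrapT => h; apply: pu; rewrite -sA perp_span; split=> // w [Aw Ew].
  by apply: contrapT => bwu; apply: h; exists w.
have [n _ Dw] := witt_initial_exhaust Ew.
have [u0 _ [_ hu0]] := witt_partner Dw.
have eu : u = u0 by apply: hu0 => // /b_refl.
have only u' : u' \in s -> b u' w = 0.
  move=> u's; apply: contrapT => h; have e1 := hu0 u' (sE _ u's) h.
  by rewrite eu -e1 u's in us.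
have h0 : b (v - a *: u) w = 0.
  apply: (sspan_min (A := [set u' | b u' w = 0])) sv => //.
  by split=> [|c u1 u2 /= h1 h2] /=; rewrite ?b0l // bDl bZl h1 h2 mulr0 addr0.
have a0 : a = 0.
  have := b_refl (hv.2 w Aw); rewrite -{1}[v](subrK (a *: u)) bDl h0 add0r bZl => /eqP.
  by rewrite mulf_eq0 => /orP [/eqP //|/eqP /b_refl].
move: sv; rewrite a0 scale0r subr0 => sv.
exact: IH.
Qed.

End WittBases.

(** * The presentations of FlO(F, E, V) and FlS(F, E, V) *)

Section GFlIPresentation.
Variables (K : fieldType) (V : lmodType K) (ty : form_type) (b : {biscalar V}).
Variables (o : bool) (e e' : nat -> V) (e0 : V) (F : set (set V)).
Let E : set V := witt_set o e e' e0.
Hypothesis b_refl : forall u v, b u v = 0 -> b v u = 0.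
Hypotheses (wb : witt_basis b o e e' e0) (iF : isotropic_gflag b F).
Hypothesis spF : forall A, F A -> spanned E A.

Let bE : is_basis E setT. Proof. by case: wb. Qed.
Let gF : generalized_flag F. Proof. by case: iF. Qed.
Let cF : chain F := gflag_chain gF.
Let FP A : F A -> F (perp b A). Proof. by case: iF => _ h /h []. Qed.
Let Fiso A : F A -> isotropic b A \/ isotropic b (perp b A). Proof. by case: iF => _ h /h []. Qed.
Let perpK A : F A -> perp b (perp b A) = A.
Proof. exact: (perp_perp_id b_refl wb spF FP). Qed.
Let Fi := iso_part b F.
Let cFi : chain Fi := chain_sub (@iso_part_sub _ _ _ F) cF.

Let D n := witt_initial o e e' e0 n.
Let X n := witt_span o e e' e0 n.
Let d n := (n.*2 + o)%N.
Let C n := perp b (X n).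
Let Q (n : nat) : set (set V) := [set A | A <> [set 0] /\ isotropic b A].
Definition witt_flag n := listing (trace F (X n) (Q n)).
Definition witt_type n := [seq dimn A | A <- witt_flag n].
Let t n := witt_flag n.
Let ms n := witt_type n.
Definition witt_component n : set (max_isotropic b (d n) (X n)) :=
  if ty is Symmetric then
    [set y | exists2 x : max_isotropic b (d n) (X n),
       sval x = [:: last [set 0] (t n)] & component x y]
  else setT.

Let st n : iso_stage b F (X n) := witt_stage b_refl wb spF n.
Let stF n : is_stage F (X n) (C n) := (st n).1.
Let stFi n : is_stage Fi (X n) (C n) := stage_sub (@iso_part_sub _ _ _ F) (stF n).
Let hX n : has_dim (X n) (d n) := witt_span_dim b_refl wb n.
Let fX n : fdim (X n). Proof. by exists (d n). Qed.
Let Xinc n m : (n <= m)%N -> X n `<=` X m. Proof. exact: witt_span_inc. Qed.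

Let lists_trace0 n m0 s : typed Fi (X n) (d n) m0 ->
  deformation Fi (X n) s -> (forall A, Fi A -> isotropic b (s A)) ->
  lists (trace (deform (C n) (iso_extend b (X n) s) @` F) (X n) (Q n)) (flag_list Fi (X n) m0 s).
Proof.
move=> ty0 ds is_; have de := iso_extend_deformation b_refl gF FP Fiso perpK (st n) ds is_.
have ext A : Fi A -> iso_extend b (X n) s A = s A by move=> [_ iA]; rewrite /iso_extend asboolT.
apply: (lists_flag_list cFi (stFi n) ty0 ds) => B; split.
  move=> [[B0 iB] [_ [A FA <-] eB]]; rewrite (deform_capY cF (stF n) de FA) in eB.
  have [s1 s2 s3] := de.1 A FA; rewrite -eB in s1 s2 s3.
  have le : ((dimn (A `&` X n)).*2 <= dimn (X n))%N.
    by rewrite -s3; apply: (isotropic_dim b_refl (fX n) (st n).2).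
  have [A' FA' eA'] := small_trace_iso b_refl gF FP Fiso perpK (st n) FA le.
  exists A'; split=> //.
    rewrite -(ext _ FA') eB; apply: (deformation_eq cF (stF n) de FA FA'.1); by rewrite eA'.
  have := iso_type_dim b_refl gF (st n) ty0 FA'; rewrite in_cons => /orP [/eqP d0|//].
  by case: B0; apply: dimn_eq0; [apply: fdim_sub (fX n) s1 s2|rewrite s3 -eA'].
move=> [A [FA -> dA]]; have [s1 s2 s3] := ds.1 A FA.
have [_ pm _ _ _] := ty0; split; last first.
  by exists (deform (C n) (iso_extend b (X n) s) A); [exists A => //; case: FA|rewrite (deform_capY cF (stF n) de FA.1) ext].
split=> [eA|]; last exact: is_.
have /allP/(_ _ dA) := order_path_min ltn_trans pm.
by rewrite -s3 eA dimn0.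
Qed.

Let tr_iso n A : Fi A -> isotropic b (A `&` X n).
Proof. by move=> [_ iA]; apply: isotropic_sub iA => v []. Qed.

Let trd n : deformation Fi (X n) (fun A => A `&` X n) := trace_deformation cFi (stFi n).

Let deform_trace n : deform (C n) (iso_extend b (X n) (fun A => A `&` X n)) @` F = F.
Proof.
have h A : F A -> deform (C n) (iso_extend b (X n) (fun A => A `&` X n)) A = A.
  move=> FA; have -> : deform (C n) (iso_extend b (X n) (fun A => A `&` X n)) A =
      deform (C n) (fun A => A `&` X n) A.
    rewrite /deform /iso_extend; case: asboolP => // iA.
    by rewrite -(perp_trace b_refl (st n) (FP FA)) perpK.
  apply/seteqP; split; first by apply: sum_sub_min; [apply: cF.1|move=> v []|move=> v []].
  by case: (stF n) => _ _ _ _ /(_ A FA).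
apply/seteqP; split=> A; first by move=> [B FB <-]; rewrite h.
by move=> FA; exists A => //; rewrite h.
Qed.

Let ty0 n : typed Fi (X n) (d n) (trace_type Fi (X n) (d n) xpredT).
Proof. exact: (trace_typed cFi (stFi n) (hX n)). Qed.

Let msE n : ms n = trace_type Fi (X n) (d n) xpredT.
Proof.
have := lists_trace0 (ty0 n) (trd n) (@tr_iso n); rewrite deform_trace => /listingE eQ.
by rewrite /ms /witt_type /witt_flag eQ (dimn_flag_list (stFi n) (ty0 n) (trd n)).
Qed.

Lemma witt_typed n : typed Fi (X n) (d n) (ms n).
Proof. by rewrite msE; apply: ty0. Qed.
Let tyn := witt_typed.

Let lists_trace n s : deformation Fi (X n) s -> (forall A, Fi A -> isotropic b (s A)) ->
  lists (trace (deform (C n) (iso_extend b (X n) s) @` F) (X n) (Q n)) (flag_list Fi (X n) (ms n) s).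
Proof. by apply: lists_trace0; apply: tyn. Qed.

Let listing_trace n : t n = flag_list Fi (X n) (ms n) (fun A => A `&` X n).
Proof.
by apply: listingE; have := lists_trace (trd n) (@tr_iso n); rewrite deform_trace.
Qed.

Lemma witt_bottom n : exists2 A, Fi A & dimn (A `&` X n) = 0%N.
Proof.
have ne0 : e 0%N <> 0 by apply: (basis_neq0 bE); left; left; exists 0%N.
have [A FA eA] := gflag_avoids gF ne0 (fX n).
have [|A' FA' eA'] := small_trace_iso b_refl gF FP Fiso perpK (st n) FA.
  by rewrite eA dimn0.
by exists A' => //; rewrite eA' eA dimn0.
Qed.

(* The vector of the pair (e m, e' m) that lies in isotropic spaces of F. *)
Let w m := if `[< exists2 A, Fi A & A (e' m) >] then e' m else e m.

Let not_both A m : isotropic b A -> A (e m) -> A (e' m) -> False.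
Proof.
move=> iA h h'; have := iA _ _ h h'; case: wb => _ _ -> _ /eqP; rewrite eqxx.
by apply/negP; apply: oner_neq0.
Qed.

Let iso_pair A m v : Fi A -> A v -> v = e m \/ v = e' m -> v = w m.
Proof.
move=> FA Av; rewrite /w; case: asboolP => [[B FB Be']|h] [|] ev //; last first.
  by case: h; exists A => //; rewrite -ev.
case: (cFi.2 A B FA FB) => h.
  case: (@not_both B m); [exact: FB.2|by rewrite -ev; apply: h|by []].
case: (@not_both A m); [exact: FA.2|by rewrite -ev|exact: h].
Qed.

Let wE m : w m = e m \/ w m = e' m.
Proof. by rewrite /w; case: ifP; [right|left]. Qed.

Let W m : set V := lin_span [set w m].

Let ww m : (E `\` D m) (w m) /\ D m.+1 (w m).
Proof. by apply: (witt_new b_refl wb); apply: wE. Qed.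

Let CE m : C m = lin_span (E `\` D m).
Proof. by apply: esym; exact: (witt_perp b_refl wb). Qed.

Let line_disjoint m v : v = e m \/ v = e' m -> X m `&` lin_span [set v] `<=` [set 0].
Proof.
move=> hv; have [_ _ dj _ _] := stF m; move=> u [Xu Wu]; apply: dj; split=> //.
rewrite CE; apply: span_mono Wu => _ ->; exact: (witt_new b_refl wb hv).1.
Qed.

Let hW m : has_dim (W m) 1.
Proof. by apply: dimn_line; apply: (basis_neq0 bE); case: (ww m) => -[]. Qed.

Let cW m A : Fi A -> A `&` C m `&` X m.+1 = if `[< A (w m) >] then W m else [set 0].
Proof.
move=> FA; have sA := cFi.1 A FA.
have -> : A `&` C m `&` X m.+1 = lin_span (A `&` [set v | v = e m \/ v = e' m]).
  rewrite CE -{1}(spF FA.1) (span_basisI bE); [|by move=> v []|by move=> v []].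
  rewrite (span_basisI bE); [|by move=> v [[]]|exact: witt_initial_sub].
  congr lin_span; apply/seteqP; split=> v.
    by move=> [[[Av Ev] [_ nv]] Dv]; split=> //; case: (witt_initial_succ Dv).
  by move=> [Av hv]; have [[Ev nv] Dv] := witt_new b_refl wb hv.
case: asboolP => h.
  congr lin_span; apply/seteqP; split=> [v [Av hv]|_ ->]; first exact: (iso_pair FA Av hv).
  by split=> //; apply: wE.
have -> : A `&` [set v | v = e m \/ v = e' m] = set0; last exact: span_set0.
by apply/seteqP; split=> // v [Av hv]; apply: h; rewrite -(iso_pair FA Av hv).
Qed.

Let step m s : deformation Fi (X m) s ->
  std_step (X m) (W m) (t m) (t m.+1)
    (flag_list Fi (X m) (ms m) s) (flag_list Fi (X m.+1) (ms m.+1) (transfer (C m) (X m.+1) s)).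
Proof.
move=> ds; rewrite !listing_trace.
have inc : X m `<=` X m.+1 by apply: Xinc.
have dW A : Fi A -> dimn (A `&` X m.+1) = (dimn (A `&` X m) + `[< A (w m) >])%N.
  move=> FA; rewrite (stage_trace_dim cFi (stFi m) (stFi m.+1) inc FA) cW //.
  by case: asboolP => h /=; [rewrite (dimnE (hW m))|rewrite dimn0].
have nolast A : Fi A -> rank_index (X m) (d m) (ms m) A <> (size (ms m)).+1.
  move=> FA /(rank_index_last (tyn m) FA); apply/negP; rewrite negbK.
  exact: (iso_type_dim b_refl gF (st m) (tyn m) FA).
apply: (std_step_exists cFi (stFi m) (stFi m.+1) (tyn m) (tyn m.+1) inc (hW m) _
  (c := fun A => A (w m))) => //.
- by apply: line_disjoint; apply: wE.
- exact: cW.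
- exact: witt_bottom.
- by move=> A FA /(nolast A FA).
move=> A FA; rewrite (rank_index0 (tyn m) FA).
have -> : dimn (A `&` X m.+1) \in ms m.+1 <-> dimn (A `&` X m.+1) <> 0%N.
  have := iso_type_dim b_refl gF (st m.+1) (tyn m.+1) FA; rewrite in_cons.
  split=> [h e1|/eqP h]; last by move/orP: H => [|//]; rewrite (negbTE h).
  have [_ pm _ _ _] := tyn m.+1.
  by have /allP/(_ _ h) := order_path_min ltn_trans pm; rewrite e1.
rewrite dW //; case: asboolP => h; rewrite ?addn1 ?addn0.
  by split=> // _; split=> [[]|[/(nolast A FA)]].
split=> [h1|[h1 _] e1]; last by apply: h1.
by split=> [[/h1]|[/(nolast A FA)]].
Qed.

Let id_b (u v : V) : b (id_lin V u) (id_lin V v) = b u v. Proof. by []. Qed.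

Let pX n : presents (id_lin V) (id_lin V) (X n) (X n).
Proof. by apply: presents_id; apply: subspace_span. Qed.

Definition witt_gflag n s := iso_gflag b F (id_lin V) (X n) (d n) (ms n) s.
Let G0 := witt_gflag.

Let sg n s := flag_def (id_lin V) (X n) (d n) (ms n) s.

Let sgE n s : sg n s = flag_fun (X n) (d n) (ms n) s.
Proof. by rewrite /sg /flag_def flag_image_id. Qed.

Let isoflag (s : seq (set V)) := forall A, A \in s -> isotropic b A.

Let sg_def n s : is_flag (X n) (ms n) s -> deformation Fi (X n) (sg n s).
Proof. exact: (iso_flag_deformation gF (pX n) (hX n) (st n) (tyn n)). Qed.

Let sg_iso n s : is_flag (X n) (ms n) s -> isoflag s -> forall A, Fi A -> isotropic b (sg n s A).
Proof. by move=> fs is_ A; apply: (flag_def_isotropic b_refl gF id_b (pX n) (st n) (tyn n) fs is_). Qed.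

Let trans n s m := transfer (C n) (X m) (sg n s).

Let trans_def n s m : (n <= m)%N -> is_flag (X n) (ms n) s -> deformation Fi (X m) (trans n s m).
Proof.
move=> le fs; exact: (transfer_deformation cFi (stFi n) (stFi m) (Xinc le) (sg_def fs)).
Qed.

Let trans_iso n s m : is_flag (X n) (ms n) s -> isoflag s ->
  forall A, Fi A -> isotropic b (trans n s m A).
Proof. by move=> fs is_ A FA; apply: (transfer_iso b_refl (sg_def fs) (sg_iso fs is_) FA). Qed.

Let trans_image n s m : (n <= m)%N -> is_flag (X n) (ms n) s -> isoflag s ->
  deform (C m) (iso_extend b (X m) (trans n s m)) @` F = G0 n s.
Proof.
move=> le fs is_.
exact: (transfer_iso_gflag b_refl gF FP Fiso perpK (st n) (st m) (Xinc le) (sg_def fs) (sg_iso fs is_)).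
Qed.

Let trans_list n s m : is_flag (X n) (ms n) s ->
  transfer_flag (id_lin V) (X n) (C n) (d n) (ms n) (id_lin V) (X m) (ms m) Fi s =
  flag_list Fi (X m) (ms m) (trans n s m).
Proof. by move=> fs; rewrite /transfer_flag flag_image_id. Qed.

Let Wset m : set (set V) := [set A | A = lin_span [set e m] \/ A = lin_span [set e' m]].

Let corresponds_G0 n s : is_flag (X n) (ms n) s -> isoflag s -> corresponds X Q Wset F n s (G0 n s).
Proof.
move=> fs is_; exists (fun m => flag_list Fi (X m) (ms m) (trans n s m)).
  rewrite -[RHS](flag_list_fun (tyn n) fs); apply: flag_list_eq; first by case: (tyn n).
  by move=> A FA; rewrite /trans /transfer (deform_capY cFi (stFi n) (sg_def fs) FA) sgE.
move=> m le; split.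
  by rewrite -(trans_image le fs is_); apply: lists_trace; [apply: trans_def|apply: trans_iso].
exists (W m); first by rewrite /W; case: (wE m) => ->; [left|right].
have := step (trans_def le fs).
rewrite (@flag_list_eq _ _ Fi _ _ (transfer (C m) (X m.+1) (trans n s m)) (trans n s m.+1)) //.
  by case: (tyn m.+1).
move=> A FA; rewrite {1}/transfer /trans.
rewrite (transfer_deform cFi (stFi n) (stFi m) (Xinc le) _ (sg_def fs) FA) // => B FB.
by right=> v [_]; apply: perp_anti; apply: Xinc.
Qed.

Let comm_deform G : commensurable E F G -> isotropic_gflag b G ->
  exists n0, forall n, (n0 <= n)%N -> exists s,
    [/\ deformation Fi (X n) s, forall A, Fi A -> isotropic b (s A) &
        G = deform (C n) (iso_extend b (X n) s) @` F].
Proof.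
move=> cG iG; have [n0 h0] := commensurable_deform bE gF spF
  (fun n => witt_initial_inc (leqnSn n)) (@witt_initial_exhaust _ _ o e e' e0)
  (fun n => conj (witt_initial_finite o e e' e0 n) (@witt_initial_sub _ _ o e e' e0 n)) cG.
exists n0 => n le; have [s [ds eG]] := h0 n le; exists s.
rewrite -/(X n) -CE in eG.
have [h1 h2] : (forall A, Fi A -> isotropic b (s A)) /\ forall A, F A -> s A = iso_extend b (X n) s A.
  by apply: (isotropic_deformation b_refl gF FP Fiso perpK (st n) ds); rewrite -eG.
split=> //; first exact: (deformation_sub (@iso_part_sub _ _ _ F) ds).
by rewrite eG; apply: eq_deform_image.
Qed.

Let line_new m v : v = e m \/ v = e' m -> is_subspace (lin_span [set v]) /\ ~ (lin_span [set v] `<=` X m).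
Proof.
move=> hv; split; first exact: subspace_span.
move=> h; have [[Ev _] _] := witt_new b_refl wb hv; apply: (basis_neq0 bE Ev).
have Wv : lin_span [set v] v by apply: sub_span.
by apply: (line_disjoint hv); split=> //; apply: h.
Qed.

(* Here the line added at a step is not prescribed, but an isotropic space of F cannot
   contain both e m and e' m, so the traces of F determine it. *)
Let corresponds_uniq n s G : is_flag (X n) (ms n) s -> isoflag s -> commensurable E F G ->
  isotropic_gflag b G -> corresponds X Q Wset F n s G -> G = G0 n s.
Proof.
move=> fs is_ cG iG [u un hu]; have [u' un' hu'] := corresponds_G0 fs is_.
have [n0 hn0] := comm_deform cG iG.
have [r [dr ir eG]] := hn0 (maxn n n0) (leq_maxr _ _).
have le := leq_maxl n n0; set m := maxn n n0 in r dr ir eG le *.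
have eu' k : (n <= k)%N -> u' k = flag_list Fi (X k) (ms k) (trans n s k).
  move=> lek; have [h _] := hu' k lek; rewrite -(trans_image lek fs is_) in h.
  by apply: (lists_uniq h); apply: lists_trace; [apply: trans_def|apply: trans_iso].
have euu : u m = u' m.
  apply: (@std_steps_uniq _ _ X Wset t u u' n) => //.
  - by move=> k _; apply: subspace_span.
  - by move=> k A _ [] ->; apply: line_new; [left|right].
  - move=> k i _ _; rewrite listing_trace.
    have fl := flag_list_is_flag cFi (stFi k) (tyn k) (trd k).
    split; first exact: has_dim_subspace (flag_term_dim i (hX k) fl).
    exact: (flag_term_sub (hX k) fl).
  - move=> k A A' B _ hA hA'; rewrite listing_trace => hB h h'.
    have iB : isotropic b B.
      by move: hB => /mapP [r' /(space_of_rankP (tyn k.+1)) [FB _] ->]; apply: tr_iso.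
    have mem v : lin_span [set v] `<=` B -> B v by apply; apply: sub_span.
    case: hA hA' h h' => -> [] -> // /mem h /mem h'; first by case: (not_both iB h h').
    by case: (not_both iB h' h).
  - by move=> k lek; case: (hu k lek).
  - by move=> k lek; case: (hu' k lek).
  - by move=> k lek; rewrite listing_trace (eu' k lek) !size_map.
  - by rewrite un un'.
have e1 : u m = flag_list Fi (X m) (ms m) r.
  by have [h _] := hu m le; rewrite eG in h; apply: (lists_uniq h); apply: lists_trace.
rewrite eG -(trans_image le fs is_); apply: eq_deform_image; apply: (iso_extend_eq FP Fiso perpK) => A FA.
rewrite -(flag_fun_list cFi (stFi m) (tyn m) dr FA) -e1 euu (eu' m le).
by rewrite (flag_fun_list cFi (stFi m) (tyn m) (trans_def le fs) FA).
Qed.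

Lemma witt_component_data n : component_data ty (ms n) (@witt_component n) (last [set 0] (t n)).
Proof.
rewrite /component_data /witt_component; case: ty => // _ y0 ey.
apply/seteqP; split=> y; last by move=> hy; exists y0.
by move=> [x0 ex]; rewrite (sval_inj (etrans ex (esym ey))).
Qed.

Lemma witt_flag_is_flag n : is_flag (X n) (ms n) (t n).
Proof. by rewrite listing_trace; apply: (flag_list_is_flag cFi (stFi n) (tyn n) (trd n)). Qed.

Lemma witt_flag_def n A : Fi A -> flag_def (id_lin V) (X n) (d n) (ms n) (t n) A = A `&` X n.
Proof.
by move=> FA; rewrite -/(sg n _) sgE listing_trace (flag_fun_list cFi (stFi n) (tyn n) (trd n) FA).
Qed.

Let Pt := GFlI ty b o F e e' e0.

Let pt_flag n (s : level Pt n) : is_flag (X n) (ms n) (sval s). Proof. by case: (svalP s). Qed.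
Let pt_iso n (s : level Pt n) : isoflag (sval s). Proof. by case: (svalP s) => _ []. Qed.

Lemma GFlI_represents n (s : level Pt n) (H : Pt) : represents s H <-> sval H = witt_gflag n (sval s).
Proof.
have fs := pt_flag s; have is_ : isoflag (sval s) := @pt_iso n s; have [cH iH _] := svalP H.
split=> [h|eH]; first exact: (corresponds_uniq fs is_ cH iH h).
by rewrite /represents /= eH; apply: corresponds_G0.
Qed.

Let transfer_level n m s : (n <= m)%N -> is_flag (X n) (ms n) s ->
  isotropic_flag (ms n) (@witt_component n) s ->
  isotropic_flag (ms m) (@witt_component m)
    (transfer_flag (id_lin V) (X n) (C n) (d n) (ms n) (id_lin V) (X m) (ms m) Fi s).
Proof.
move=> le; apply: (transfer_isotropic_flag b_refl gF id_b id_b (pX n) (pX m) (hX n) (hX m)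
  (st n) (st m) (tyn n) (tyn m) (Xinc le) (witt_bottom m) (witt_flag_is_flag n) (witt_flag_is_flag m)
  (@witt_flag_def n) (@witt_flag_def m) (witt_component_data n) (witt_component_data m)).
Qed.

Lemma GFlI_point n (s : level Pt n) : exists H : Pt, sval H = witt_gflag n (sval s).
Proof.
have fs := pt_flag s; have is_ : isoflag (sval s) := @pt_iso n s.
have h1 : commensurable E F (G0 n (sval s)).
  have h := deform_commensurable bE gF spF (witt_initial_finite o e e' e0 n) (@witt_initial_sub _ _ o e e' e0 n)
    (iso_extend_deformation b_refl gF FP Fiso perpK (st n) (sg_def fs) (sg_iso fs is_)).
  by rewrite -CE in h.
have h2 := iso_extend_gflag b_refl gF FP Fiso perpK (st n) (sg_def fs) (sg_iso fs is_).
have h3 : same_component ty b o F e e' e0 (G0 n (sval s)).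
  exists n => m u le hu hm.
  have [_ /(_ hm)] := transfer_level le fs (svalP s).2; rewrite trans_list //.
  rewrite -(trans_image le fs is_) in hu.
  by rewrite (lists_uniq hu (lists_trace (trans_def le fs) (@trans_iso _ _ _ fs is_))).
pose G_ok G := [/\ commensurable E F G, isotropic_gflag b G & same_component ty b o F e e' e0 G].
by exists (exist G_ok (G0 n (sval s)) (And3 h1 h2 h3)).
Qed.

Lemma GFlI_covered (H : Pt) : exists n (s : level Pt n), sval H = witt_gflag n (sval s).
Proof.
have [cH iH [n1 hn1]] := svalP H; have [n0 hn0] := comm_deform cH iH.
have [s [ds is_ eH]] := hn0 (maxn n0 n1) (leq_maxl _ _); have := hn1 (maxn n0 n1) _ (leq_maxr _ _).
set n := maxn n0 n1 in s ds is_ eH *; move=> hn.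
have fs := flag_list_is_flag cFi (stFi n) (tyn n) ds.
have hl : lists (trace (sval H) (X n) (Q n)) (flag_list Fi (X n) (ms n) s).
  by rewrite eH; apply: lists_trace.
have ps : isotropic_flag (ms n) (@witt_component n) (flag_list Fi (X n) (ms n) s).
  split; last exact: hn.
  by move=> A /mapP [r /(space_of_rankP (tyn n)) [FA _] ->]; apply: is_.
pose s_ok u := is_flag (X n) (ms n) u /\ isotropic_flag (ms n) (@witt_component n) u.
exists n, (exist s_ok _ (conj fs ps)) => /=.
rewrite eH /witt_gflag; apply: eq_deform_image; apply: (iso_extend_eq FP Fiso perpK) => A FA.
by rewrite -/(sg n _) sgE (flag_fun_list cFi (stFi n) (tyn n) ds FA).
Qed.

Lemma GFlI_inj n : injective (fun s : level Pt n => witt_gflag n (sval s)).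
Proof.
move=> s s' /= h; apply: sval_inj.
exact: (iso_gflag_flag_inj b_refl gF FP Fiso perpK id_b (pX n) (hX n) (st n) (tyn n)
  (pt_flag s) (@pt_iso n s) (pt_flag s') (@pt_iso n s') h).
Qed.

Lemma GFlI_step n : exists2 g : level Pt n -> level Pt n.+1, is_morphism g &
  forall s, witt_gflag n.+1 (sval (g s)) = witt_gflag n (sval s).
Proof.
exact: (isotropic_transfer_map b_refl gF FP Fiso perpK id_b id_b (pX n) (pX n.+1) (hX n) (hX n.+1)
  (st n) (st n.+1) (tyn n) (tyn n.+1) (Xinc (leqnSn n)) (witt_bottom n.+1) (witt_flag_is_flag n)
  (witt_flag_is_flag n.+1) (@witt_flag_def n) (@witt_flag_def n.+1)
  (witt_component_data n) (witt_component_data n.+1)).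
Qed.

End GFlIPresentation.

(** * Towers with a form *)

Section IsotropicTowers.
Variables (K : fieldType) (V : lmodType K) (b : {biscalar V}).
Hypothesis b_refl : forall u v, b u v = 0 -> b v u = 0.
Variables (Y : nat -> set V) (S : nat -> set (set V)) (D : nat -> set V).
Hypotheses (tw : tower Y S) (tws : tower_splitting Y S D).
Hypotheses (nY : forall N, nondeg_on b (Y N))
  (YD : forall N y w, Y N y -> D N w -> b y w = 0)
  (S_perp : forall N A, S N A -> S N (perp_in b (Y N) A))
  (S_iso : forall N A, S N A -> isotropic b A \/ isotropic b (perp_in b (Y N) A)).
Let T : set (set V) := thread Y S.
Let fY := tower_fdim tw.

Lemma iso_tower_compl N : tower_compl D N = perp b (Y N).
Proof.
have st := tower_stage tw tws N (F := set0) (fun A => False_ind _).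
apply: (stage_perp b_refl st (@nY N)) => y v Yy [k _].
elim: k v => [|k IH] v /=; first by move=> ->; rewrite b0r.
move=> [u hu [w Dw <-]]; rewrite bDr (IH _ hu) add0r; apply: (YD _ Dw).
by apply: (tower_mono tw) Yy; apply: leq_addr.
Qed.

Lemma thread_stage N : iso_stage b T (Y N).
Proof.
split; last exact: nY.
by rewrite -iso_tower_compl; apply: (tower_stage tw tws N (F := T)).
Qed.

Let perpT N H : T H -> perp b H `&` Y N = perp_in b (Y N) (H `&` Y N).
Proof. by move=> tH; apply: (perp_trace b_refl (thread_stage N) tH). Qed.

Lemma perp_thread H : T H -> T (perp b H).
Proof. by move=> tH N; rewrite perpT //; apply: S_perp; apply: tH. Qed.

Let thread_eq H H' : (forall N, H `&` Y N = H' `&` Y N) -> H = H'.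
Proof.
move=> h; apply/seteqP; split=> v hv; have [N Yv] := tower_exhaust tw v.
  by have : (H `&` Y N) v by []; rewrite h => -[].
by have : (H' `&` Y N) v by []; rewrite -h => -[].
Qed.

Lemma perp_perp_thread H : T H -> perp b (perp b H) = H.
Proof.
move=> tH; apply: thread_eq => N; rewrite (perpT _ (perp_thread tH)) (perpT _ tH).
by have [sA AY] := tower_sub tw (tH N); apply: (perp_perp b_refl (fY N) (@nY N)).
Qed.

(** Once the trace of H at some level is not isotropic, it is coisotropic at all later
    levels. *)
Lemma thread_isotropic H : T H -> isotropic b H \/ isotropic b (perp b H).
Proof.
move=> tH; case: (pselect (isotropic b H)) => [|nH]; [by left|right=> u v hu hv].
have [u0 [v0 [Hu0 Hv0 b0]]] : exists u0 v0, [/\ H u0, H v0 & b u0 v0 <> 0].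
  apply: contrapT => h; apply: nH => u0 v0 Hu0 Hv0; apply: contrapT => b0.
  by apply: h; exists u0, v0.
have [N _ [Yu0 Yv0]] := tower_common tw u0 v0 0.
have [M le [Yu Yv]] := tower_common tw u v N.
case: (S_iso (tH M)) => h.
  by case: b0; apply: h; split=> //; apply: (tower_mono tw le).
by rewrite -perpT // in h; apply: h.
Qed.

(** Orthogonality reverses the order of the threads, hence exchanges the pairs of
    consecutive ones. *)
Lemma perp_cut_flag A : cut_flag Y S A -> cut_flag Y S (perp b A).
Proof.
move=> [v v0 hA]; set B0 := before Y S v; set B1 := below Y S v.
have t0 : T B0 := before_thread tw v0; have t1 : T B1 := @below_thread _ _ _ _ tw v.
have [b01 b10] : B0 `<` B1 := before_below tw v0.
have [w w1 w0] : exists2 w, perp b B0 w & ~ perp b B1 w.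
  apply: not_subset_exists => h; apply: b10.
  by rewrite -(perp_perp_thread t0) -(perp_perp_thread t1); apply: perp_anti.
have wn0 : w <> 0 by move=> e; apply: w0; rewrite e; apply: subspace0; apply: perp_subspace.
have tb0 := before_thread tw wn0; have tb1 := @below_thread _ _ _ _ tw w.
have [c01 c10] := before_below tw wn0.
have h1 : below Y S w `<=` perp b B0 by apply: (thread_below tw (perp_thread t0)).
have h0 : perp b B1 `<=` before Y S w by apply: (thread_before tw (perp_thread t1)).
have dich H : T H -> H `<=` B0 \/ B1 `<=` H.
  move=> tH; case: (pselect (H v)) => Hv; first by right; apply: (thread_below tw tH).
  by left; apply: (thread_before tw tH).
have k0 : perp b (before Y S w) `<=` B1 by rewrite -(perp_perp_thread t1); apply: perp_anti.
have k1 : B0 `<=` perp b (below Y S w) by rewrite -{1}(perp_perp_thread t0); apply: perp_anti.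
have kk : ~ (perp b (before Y S w) `<=` perp b (below Y S w)).
  move=> h; apply: c10; rewrite -(perp_perp_thread tb0) -(perp_perp_thread tb1); exact: perp_anti.
have e0 : perp b B0 = below Y S w.
  rewrite -(perp_perp_thread tb1); congr perp; apply/seteqP; split=> //.
  case: (dich _ (perp_thread tb1)) => // h; case: kk; exact: subset_trans h.
have e1 : perp b B1 = before Y S w.
  rewrite -(perp_perp_thread tb0); congr perp; apply/seteqP; split=> //.
  case: (dich _ (perp_thread tb0)) => // h; case: kk; exact: subset_trans k1.
by exists w => //; case: hA => ->; [right|left].
Qed.

Lemma cut_isotropic_gflag : isotropic_gflag b (cut_flag Y S).
Proof.
split; first exact: cut_gflag tw.
move=> A FA; split; last exact: perp_cut_flag.
by apply: thread_isotropic; apply: (cut_flag_thread tw).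
Qed.

(** The spaces Y N need not be spanned by parts of the basis, hence neither the
    coisotropic spaces at level N; so only isotropic threads are treated directly, and
    the other ones are their orthogonal complements. *)
Lemma iso_thread_spanned o e e' e0 : witt_basis b o e e' e0 ->
  (forall N A, S N A -> isotropic b A -> spanned (witt_set o e e' e0) A) ->
  forall H, T H -> spanned (witt_set o e e' e0) H.
Proof.
move=> wb sp; set E := witt_set _ _ _ _.
have isp H : T H -> isotropic b H -> spanned E H.
  move=> tH iH; apply/seteqP; split.
    by apply: span_min; [apply: (thread_subspace tw tH)|move=> v []].
  move=> v Hv; have [N Yv] := tower_exhaust tw v.
  have h : isotropic b (H `&` Y N) by apply: isotropic_sub iH => u [].
  have : (H `&` Y N) v by []. rewrite -(sp N _ (tH N) h).
  by apply: span_mono => u [[]].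
move=> H tH; case: (thread_isotropic tH) => iH; first exact: isp.
rewrite -(perp_perp_thread tH); apply: (witt_perp_spanned b_refl wb).
by apply: isp => //; apply: perp_thread.
Qed.

End IsotropicTowers.

(** * Chains of isotropic standard extensions *)

Lemma allowed_component_data (K : fieldType) (V : lmodType K) (b : {biscalar V}) ty d X ms
    (Gam : set (max_isotropic b d X)) A : allowed_component ty Gam ->
  ((last 0%N ms).*2 = d -> exists2 y, Gam y & sval y = [:: A]) -> component_data ty ms Gam A.
Proof.
case: ty => //= -[z ->] hc hd y0 ey.
have [y hy ey'] := hc hd; have e : y = y0 by apply: sval_inj; rewrite ey' ey.
rewrite e in hy; apply/seteqP; split=> w hw; last exact: component_trans hy hw.
by apply: component_trans hw; apply: component_sym.
Qed.

Section IsotropicCase.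
Variables (K : fieldType) (ty : form_type) (c : iso_chain K ty) (x : iso_choices c).

Let V := idV x.
Let b : {biscalar V} := id_form x.
Let f N := ic_form c N.
Let inV N : {linear icV c N -> V} := id_in x N.
Let k N := size (ic_m c N).
Let d N := dim (icV c N).
Let o := ic_odd c.
Let E : set V := witt_set o (id_e x) (id_e' x) (id_e0 x).
Let orbit N := iso_orbit (id_F1 x) N.
Let Y N : set V := range (inV N).
Let S N : set (set V) := [set A | exists2 i, (i <= (k N).+1)%N &
  let T := flag_term setT (sval (orbit N)) i in
  A = inV N @` T \/ A = inV N @` perp (f N) T].
Let D N : set V := inV N.+1 @` perp (f N.+1) (range (id_incl x N)).
Let incl N : {linear icV c N -> icV c N.+1} := id_incl x N.
Let part N := split_part (ic_m c N.+1) (perp (f N.+1) (range (incl N))) (@id_W _ _ _ x N).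
Let sf N := id_split x N.

Let inVi N : injective (inV N). Proof. by case: (id_lim x). Qed.
Let inVS N u : inV N.+1 (incl N u) = inV N u. Proof. by case: (id_lim x). Qed.
Let bf N u v : b (inV N u) (inV N v) = f N u v. Proof. exact: id_formP. Qed.

Let wb : witt_basis b o (id_e x) (id_e' x) (id_e0 x) := id_witt x.
Let bE : is_basis E setT. Proof. by case: wb. Qed.

Let hV N : has_dim [set: icV c N] (d N) := vect_has_dim _.

Let term_flag N (T : FlI (ic_m c N) (@ic_comp _ _ c N)) : is_flag setT (ic_m c N) (sval T).
Proof. by case: (svalP T). Qed.

Let flag_iso N (T : FlI (ic_m c N) (@ic_comp _ _ c N)) A : A \in sval T -> isotropic (f N) A.
Proof. by case: (svalP T) => _ [h _] /h. Qed.

Let inV_has_dim N A n : has_dim A n -> has_dim (inV N @` A) n.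
Proof. by apply: has_dim_image => u _ e; apply: (@inVi N); rewrite e linear0. Qed.

Let hY N : has_dim (Y N) (d N) := inV_has_dim (hV N).
Let fY N : fdim (Y N). Proof. by exists (d N). Qed.
Let sY N : is_subspace (Y N) := fdim_subspace (fY N).

Let type_path N : path ltn 0%N (ic_m c N) /\ forall m, m \in ic_m c N -> (m <= d N)%N.
Proof.
have [+ _] := ic_type c N; rewrite /flag_type /= rcons_path => /andP [h1 h2]; split=> // m mm.
apply: leq_trans (ltnW h2); apply: (mem_type_le_last h1); by rewrite inE mm orbT.
Qed.

Let d_gt0 N : (0 < d N)%N.
Proof.
have [+ _] := ic_type c N; rewrite /flag_type /= rcons_path => /andP [_].
exact: leq_ltn_trans.
Qed.

Let Yinc N : Y N `<=` Y N.+1.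
Proof. by move=> _ [u _ <-]; rewrite -inVS; exists (incl N u). Qed.

Let Ymono N M : (N <= M)%N -> Y N `<=` Y M.
Proof. by move=> /subnK <-; elim: (M - N)%N => [//|n IH]; exact: (subset_trans IH (@Yinc _)). Qed.

Let Yall v : exists N, Y N v.
Proof. by case: (id_lim x) => _ _ /(_ v) [N [u ->]]; exists N, u. Qed.

Let Y0 N : Y N <> [set 0].
Proof.
move=> e; have := hY N; rewrite e => /has_dim_uniq /(_ (has_dim0 V)) e0.
by have := d_gt0 N; rewrite e0.
Qed.

Let f_refl N u v : f N u v = 0 -> f N v u = 0.
Proof. exact: (form_of_type_refl (ic_formP c N).1). Qed.

Let b_refl u v : b u v = 0 -> b v u = 0.
Proof.
have [N Yu] := Yall u; have [M Yv] := Yall v.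
have [u' _ <-] := Ymono (leq_maxl N M) Yu; have [v' _ <-] := Ymono (leq_maxr N M) Yv.
by rewrite !bf; apply: f_refl.
Qed.

Let nY N : nondeg_on b (Y N).
Proof.
move=> _ [u _ <-] h; have [_ nf] := ic_formP c N.
rewrite (nf u) ?linear0 // => v; rewrite -[LHS]bf; apply: h; by exists v.
Qed.

Let perp_image N A : inV N @` perp (f N) A = perp_in b (Y N) (inV N @` A).
Proof.
apply/seteqP; split=> [_ [u [_ hu] <-]|_ [[u _ <-] hu]].
  by split=> [|_ [w Aw <-]]; [exists u|rewrite bf; apply: hu].
by exists u => //; split=> // w Aw; rewrite -bf; apply: hu; exists w.
Qed.

Let tm N (T : FlI (ic_m c N) (@ic_comp _ _ c N)) i : set V := inV N @` flag_term setT (sval T) i.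
Let To N i := tm (orbit N) i.
Let Po N i := perp_in b (Y N) (To N i).

Let tm_sub N (T : FlI (ic_m c N) (@ic_comp _ _ c N)) i : is_subspace (tm T i) /\ tm T i `<=` Y N.
Proof.
split; last by move=> _ [u _ <-]; exists u.
apply: subspace_image; apply: has_dim_subspace; exact: (flag_term_dim i (hV N) (term_flag T)).
Qed.

Let tm_dim N (T : FlI (ic_m c N) (@ic_comp _ _ c N)) i : dimn (tm T i) = nth (d N) (0%N :: ic_m c N) i.
Proof. by apply: dimnE; apply: inV_has_dim; exact: (flag_term_dim i (hV N) (term_flag T)). Qed.

Let tm_chain N (T : FlI (ic_m c N) (@ic_comp _ _ c N)) i j : tm T i `<=` tm T j \/ tm T j `<=` tm T i.
Proof.
by case: (flag_term_chain i j (hV N) (term_flag T)) => h; [left|right]; apply: image_subset.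
Qed.

Let tm_last N (T : FlI (ic_m c N) (@ic_comp _ _ c N)) : tm T (k N).+1 = Y N.
Proof. by rewrite /tm /flag_term /= nth_default //; case: (term_flag T) => ->. Qed.

Let tm0 N (T : FlI (ic_m c N) (@ic_comp _ _ c N)) : tm T 0 = [set 0].
Proof. by rewrite /tm /flag_term /= image_set0. Qed.

Let tm_iso N (T : FlI (ic_m c N) (@ic_comp _ _ c N)) i : (i <= k N)%N -> isotropic b (tm T i).
Proof.
case: i => [_|i hi]; first by rewrite tm0 => u v -> _; rewrite b0l.
apply/(isotropic_image (@bf N)); apply: (@flag_iso N T); rewrite /flag_term /=.
by apply: mem_nth; case: (term_flag T) => ->.
Qed.

Let Po_top N : Po N (k N).+1 = [set 0].
Proof.
rewrite /Po /To tm_last; apply/seteqP; split.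
  by move=> v [Yv hv]; apply: (nY Yv) => w Yw; apply: b_refl; apply: hv.
by apply: set0_sub; apply: perp_in_subspace.
Qed.

Let Po_0 N : Po N 0 = Y N.
Proof.
rewrite /Po /To tm0; apply/seteqP; split=> [v []//|v Yv]; split=> // u ->.
exact: b0l.
Qed.

Let SE N A : S N A <-> exists2 i, (i <= k N)%N & A = To N i \/ A = Po N i.
Proof.
split=> [[i hi]|[i hi hA]]; last first.
  by exists i; [exact: leqW|rewrite /= perp_image; exact: hA].
rewrite /= perp_image -/(tm (orbit N) i) -/(To N i) -/(Po N i).
move: hi; rewrite leq_eqVlt => /orP [/eqP ->|hi]; last by exists i.
rewrite Po_top /To tm_last => hA; exists 0%N => //.
by rewrite /To tm0 Po_0; case: hA; [right|left].
Qed.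

Let Po_Po N i : perp_in b (Y N) (Po N i) = To N i.
Proof.
by have [h1 h2] := tm_sub (orbit N) i; apply: (perp_perp b_refl (fY N) (@nY N)).
Qed.

Let S_perp N A : S N A -> S N (perp_in b (Y N) A).
Proof.
move=> /SE [i hi hA]; apply/SE; exists i => //.
by case: hA => ->; [right|left; rewrite Po_Po].
Qed.

Let S_iso N A : S N A -> isotropic b A \/ isotropic b (perp_in b (Y N) A).
Proof.
move=> /SE [i hi [->|->]]; first by left; apply: tm_iso.
by right; rewrite Po_Po; apply: tm_iso.
Qed.

Let Ssub N A : S N A -> is_subspace A /\ A `<=` Y N.
Proof.
move=> /SE [i _ [->|->]]; first exact: tm_sub.
by split; [apply: perp_in_subspace|move=> v []].
Qed.

(* If P_i is isotropic then it lies in its orthogonal complement T_i, and T_i in P_i. *)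
Let S_iso_term N A : S N A -> isotropic b A -> exists2 i, (i <= k N)%N & A = To N i.
Proof.
move=> /SE [i hi [->|->]] iA; exists i => //.
have [_ hT] := tm_sub (orbit N) i.
apply/seteqP; split=> v.
  by move=> hv; rewrite -Po_Po; split; [case: hv|move=> u hu; apply: iA].
by move=> hv; split=> [|u hu]; [exact: (hT v hv)|exact: (tm_iso hi hu hv)].
Qed.

Let To_Po N i j : (i <= k N)%N -> (j <= k N)%N -> To N i `<=` Po N j.
Proof.
move=> hi hj v hv; split=> [|u hu]; first exact: ((tm_sub (orbit N) i).2 v hv).
case: (tm_chain (orbit N) i j) => h.
  exact: (tm_iso hj hu (h v hv)).
exact: (tm_iso hi (h u hu) hv).
Qed.

Let Stot N : total_on (S N) (fun A B => A `<=` B).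
Proof.
move=> _ _ /SE [i hi [->|->]] /SE [j hj [->|->]].
- exact: tm_chain.
- by left; apply: To_Po.
- by right; apply: To_Po.
by case: (tm_chain (orbit N) i j) => h; [right|left]; apply: perp_anti.
Qed.

Let DE N : D N = perp_in b (Y N.+1) (Y N).
Proof.
rewrite /D perp_image; congr perp_in; rewrite image_comp; apply: eq_imagel => u _ /=.
exact: inVS.
Qed.

Let sD N : is_subspace (D N). Proof. by rewrite DE; apply: perp_in_subspace. Qed.

Let YDo N y w : Y N y -> D N w -> b y w = 0.
Proof. by rewrite DE => Yy [_]; apply. Qed.

Let DYo N y w : Y N y -> D N w -> b w y = 0.
Proof. by move=> Yy Dw; apply: b_refl; apply: YDo Yy Dw. Qed.

Let YD0 N : Y N `&` D N `<=` [set 0].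
Proof. by move=> v [Yv Dv]; apply: (nY Yv) => u Yu; apply: DYo Yu Dv. Qed.

Let YD N : sum_sub (Y N) (D N) = Y N.+1.
Proof.
case: (sf N) => _ [_ e _] _ _ _; rewrite /Y -e image_sum_sub; congr sum_sub.
by rewrite image_comp; apply: eq_imagel => u _ /=; rewrite inVS.
Qed.

Let Wo N i : set V := inV N.+1 @` @part N i.

Let Wo_sub N i : is_subspace (Wo N i) /\ Wo N i `<=` D N.
Proof.
have [h1 h2] := split_part_sub (sf N) i.
by split; [apply: subspace_image|apply: image_subset].
Qed.

Let tm_succ N (T : FlI (ic_m c N) (@ic_comp _ _ c N)) i : (i <= (k N.+1).+1)%N ->
  tm (ic_map T) i = sum_sub (tm T (id_p x N i)) (Wo N i).
Proof.
move=> hi; rewrite /tm (split_term (sf N)) // image_sum_sub; congr sum_sub.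
by rewrite image_comp; apply: eq_imagel => u _ /=; apply: inVS.
Qed.

Let p_le N i : (i <= k N.+1)%N -> (id_p x N i <= k N)%N.
Proof.
move=> hi; case: (sf N) => _ _ _ _ [[h _ _] _]; have := h i (leqW hi).
rewrite leq_eqVlt => /orP [/eqP e|//]; case: (@Y0 N).
(* Otherwise an isotropic space would contain the nondegenerate space V N. *)
have hY' : Y N `<=` To N.+1 i.
  rewrite /To -[orbit N.+1]/(ic_map (orbit N)) tm_succ ?e ?tm_last; last exact: leqW.
  by apply: sub_suml; apply: (Wo_sub N i).1.
apply/seteqP; split; last exact: set0_sub.
by move=> v Yv; apply: (nY Yv) => w Yw; exact: (tm_iso hi (hY' _ Yv) (hY' _ Yw)).
Qed.

(* T_i + W_i has in V N.+1 the orthogonal complement P_i + R_i, with R_i the orthogonal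
   complement of W_i inside D N. *)
Let S_sum N A : S N.+1 A -> exists A0 B0, [/\ S N A0, is_subspace B0, B0 `<=` D N & A = sum_sub A0 B0].
Proof.
move=> /SE [i hi [->|->]].
  exists (To N (id_p x N i)), (Wo N i); have [h1 h2] := Wo_sub N i; split=> //.
    by apply/SE; exists (id_p x N i); [apply: p_le|left].
  by rewrite /To -[orbit N.+1]/(ic_map (orbit N)) tm_succ //; exact: leqW.
have [h1 h2] := Wo_sub N i; have [h3 h4] := tm_sub (orbit N) (id_p x N i).
exists (Po N (id_p x N i)), (perp_in b (D N) (Wo N i)); split.
- by apply/SE; exists (id_p x N i); [apply: p_le|right].
- exact: perp_in_subspace.
- by move=> v [].
have eT : To N.+1 i = sum_sub (To N (id_p x N i)) (Wo N i).
  by rewrite /To -[orbit N.+1]/(ic_map (orbit N)) tm_succ //; exact: leqW.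
rewrite /Po eT; apply/seteqP; split.
  move=> v [+ hv]; rewrite -YD => -[y Yy [w Dw ev]].
  exists y; first split=> // u hu.
    have := hv u (sub_suml h1 hu); rewrite -ev bDr (YDo (h4 _ hu) Dw) addr0 //.
  exists w => //; split=> // u hu.
  by have := hv u (sub_sumr h3 hu); rewrite -ev bDr (DYo Yy (h2 _ hu)) add0r.
apply: sum_sub_min; first exact: perp_in_subspace.
  move=> v [Yv hv]; split; first exact: Yinc.
  by move=> _ [u hu [w hw <-]]; rewrite bDl (hv _ hu) add0r; apply: DYo Yv _; apply: h2.
move=> v [Dv hv]; split; first by rewrite -YD; apply: sub_sumr.
by move=> _ [u hu [w hw <-]]; rewrite bDl (hv _ hw) addr0; apply: YDo Dv; apply: h4.
Qed.

Let sum_capY N A B : is_subspace A -> A `<=` Y N -> is_subspace B -> B `<=` D N ->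
  sum_sub A B `&` Y N = A.
Proof.
move=> sA AY sB BD; rewrite sum_subI //; suff -> : B `&` Y N = [set 0] by rewrite sum_sub0.
apply/seteqP; split; last by apply: set0_sub; apply: subspaceI.
by move=> v [/BD Dv Yv]; exact: (@YD0 N v (conj Yv Dv)).
Qed.

Let sum_capD N A B : is_subspace A -> A `<=` Y N -> is_subspace B -> B `<=` D N ->
  sum_sub A B `&` D N = B.
Proof.
move=> sA AY sB BD; rewrite sum_subC sum_subI //; suff -> : A `&` D N = [set 0] by rewrite sum_sub0.
apply/seteqP; split; last by apply: set0_sub; apply: subspaceI.
by move=> v [/AY Yv Dv]; exact: (@YD0 N v (conj Yv Dv)).
Qed.

Let Sdown N A : S N.+1 A -> S N (A `&` Y N).
Proof.
move=> /S_sum [A0 [B0 [SA0 sB BD ->]]]; have [sA AY] := Ssub SA0.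
by rewrite sum_capY.
Qed.

Let SD N A : S N.+1 A -> A `<=` sum_sub (A `&` Y N) (A `&` D N).
Proof.
move=> /S_sum [A0 [B0 [SA0 sB BD ->]]]; have [sA AY] := Ssub SA0.
by rewrite sum_capY // sum_capD.
Qed.

Let To_up N j : (j <= k N)%N -> exists2 i, (i <= k N.+1)%N & To N.+1 i `&` Y N = To N j.
Proof.
move=> hj; case: (sf N) => _ _ _ _ [[_ _ /(_ j (leqW hj)) [i hi e]] _]; exists i.
  move: hi; rewrite leq_eqVlt => /orP [/eqP ei|//].
  by move: hj; rewrite -e ei (split_index_last (sf N)) ltnn.
have [h1 h2] := tm_sub (orbit N) (id_p x N i); have [h3 h4] := Wo_sub N i.
by rewrite /To -[orbit N.+1]/(ic_map (orbit N)) tm_succ // sum_capY // e.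
Qed.

Let Sup N A : S N A -> exists2 A', S N.+1 A' & A' `&` Y N = A.
Proof.
move=> /SE [j hj hA]; have [i hi e] := To_up hj.
case: hA => ->; first by exists (To N.+1 i) => //; apply/SE; exists i => //; left.
exists (Po N.+1 i); first by apply/SE; exists i => //; right.
rewrite /Po -e; apply/seteqP; split=> [v [[_ hv] Yv]|v [Yv hv]].
  by split=> // u [hu _]; apply: hv.
split=> //; split=> [|u hu]; first exact: Yinc.
have SA : S N.+1 (To N.+1 i) by apply/SE; exists i => //; left.
have [y hy [w [_ Dw] <-]] := SD SA hu.
by rewrite bDl hv // add0r; apply: DYo Yv Dw.
Qed.

Let tw : tower Y S.
Proof.
split=> //.
- by move=> N; apply/SE; exists 0%N => //; left; rewrite /To tm0.
- by move=> N; apply/SE; exists 0%N => //; right; rewrite Po_0.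
Qed.

Let tws : tower_splitting Y S D.
Proof. by split. Qed.

Let To_spanned N i : (i <= k N)%N -> spanned E (To N i).
Proof.
elim: N i => [|N IH] [|i] hi; rewrite /To ?tm0; try exact: spanned0.
  by case: (@id_basis_V1 _ _ _ x i.+1 hi).
rewrite -[orbit N.+1]/(ic_map (orbit N)) tm_succ; last exact: leqW.
apply: (spanned_sum bE); first exact: (IH _ (p_le hi)).
rewrite /Wo /part /split_part hi.
by case: (@id_basis_W _ _ _ x N i.+1 hi).
Qed.

Let F := iso_limit_flag x.

Let spT H : thread Y S H -> spanned E H.
Proof.
apply: (iso_thread_spanned b_refl tw tws nY YDo S_perp S_iso wb).
by move=> N A SA iA; have [i hi ->] := S_iso_term SA iA; apply: To_spanned.
Qed.

Let FE : F = cut_flag Y S.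
Proof. exact: (limit_flagE tw bE spT). Qed.

Let iF : isotropic_gflag b F.
Proof. by rewrite FE; apply: (cut_isotropic_gflag b_refl tw tws nY YDo S_perp S_iso). Qed.

Let gF : generalized_flag F. Proof. by case: iF. Qed.
Let cF : chain F := gflag_chain gF.
Let FT A : F A -> thread Y S A. Proof. by rewrite FE; apply: (cut_flag_thread tw). Qed.
Let spF A : F A -> spanned E A. Proof. by move=> /FT /spT. Qed.
Let FP A : F A -> F (perp b A). Proof. by case: iF => _ h /h []. Qed.
Let Fiso A : F A -> isotropic b A \/ isotropic b (perp b A). Proof. by case: iF => _ h /h []. Qed.
Let perpK A : F A -> perp b (perp b A) = A.
Proof. by move=> /FT; apply: (perp_perp_thread b_refl tw tws nY YDo S_perp). Qed.
Let Fi := iso_part b F.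
Let cFi : chain Fi := chain_sub (@iso_part_sub _ _ _ F) cF.
Let C N := perp b (Y N).

Let stY N : iso_stage b F (Y N).
Proof.
have [h1 h2] := thread_stage b_refl tw tws nY YDo N.
by split=> //; apply: stage_sub h1; exact: FT.
Qed.
Let stYF N : is_stage F (Y N) (C N) := (stY N).1.
Let stYi N : is_stage Fi (Y N) (C N) := stage_sub (@iso_part_sub _ _ _ F) (stYF N).

Let trace_term N A : Fi A -> exists2 i, (i <= k N)%N & A `&` Y N = To N i.
Proof.
move=> [FA iA]; apply: S_iso_term; first exact: (FT FA N).
by apply: isotropic_sub iA => v [].
Qed.

Let term_trace N i : (i <= k N)%N -> exists2 A, Fi A & A `&` Y N = To N i.
Proof.
move=> hi; have [|A FA e] := cut_trace tw (N := N) (A := To N i).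
  by apply/SE; exists i => //; left.
rewrite -FE in FA; have [|A' FA' e'] := small_trace_iso b_refl gF FP Fiso perpK (stY N) FA.
  have [h1 h2] := tm_sub (orbit N) i.
  by rewrite e; apply: (isotropic_dim b_refl (fY N) (@nY N) h1 h2); apply: tm_iso.
by exists A' => //; rewrite e'.
Qed.

Let tyY N : typed Fi (Y N) (d N) (ic_m c N).
Proof.
have [h1 h2] := type_path N; split=> //.
  move=> A /(trace_term N) [i hi ->]; rewrite tm_dim -rcons_cons.
  by rewrite mem_rcons inE mem_nth ?orbT.
move=> m mm; have hi : (index m (ic_m c N) < k N)%N by rewrite index_mem.
have [A FA e] := term_trace hi; exists A => //.
by rewrite e tm_dim /= (set_nth_default 0%N) // nth_index.
Qed.

Let retraction N : {r : {linear V -> icV c N} | forall v, Y N v -> inV N (r v) = v}.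
Proof.
have [_ h0 h1 h2 _] := stYF N.
by apply: cid; apply: linear_retraction h2 => //; apply: inVi.
Qed.

Let pY N : presents (inV N) (sval (retraction N)) setT (Y N).
Proof. by split=> //; [apply: inVi|apply: (svalP (retraction N))]. Qed.

Let bottomY N : exists2 A, Fi A & dimn (A `&` Y N) = 0%N.
Proof. by have [A FA e] := term_trace (leq0n (k N)); exists A => //; rewrite e /To tm0 dimn0. Qed.

Let sg N (T : FlI (ic_m c N) (@ic_comp _ _ c N)) := flag_def (inV N) (Y N) (d N) (ic_m c N) (sval T).

Let sg_def N T : deformation Fi (Y N) (@sg N T).
Proof. exact: (iso_flag_deformation gF (pY N) (hV N) (stY N) (tyY N) (term_flag T)). Qed.

Let sg_iso N T A : Fi A -> isotropic b (@sg N T A).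
Proof.
exact: (flag_def_isotropic b_refl gF (@bf N) (pY N) (stY N) (tyY N) (term_flag T) (@flag_iso N T)).
Qed.

Let sgE N T A i : Fi A -> A `&` Y N = To N i -> @sg N T A = tm T i.
Proof.
move=> FA eA; have [h1 h2] := tm_sub T i; have [s1 s2 e1] := (sg_def T).1 A FA.
have eT : @sg N T A = tm T (index (dimn (A `&` Y N)) (0%N :: rcons (ic_m c N) (d N))).
  by rewrite /sg /flag_def /flag_fun flag_term_image.
apply: chain_dimn_eq.
- exact: (fdim_sub (fY N)).
- exact: (fdim_sub (fY N)).
- by rewrite eT; apply: tm_chain.
by rewrite e1 eA !tm_dim.
Qed.

Let sg_orbit N A : Fi A -> @sg N (orbit N) A = A `&` Y N.
Proof. by move=> FA; have [i hi e] := trace_term N FA; rewrite (sgE _ FA e) e. Qed.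

Let sg_succ N T A : Fi A -> @sg N.+1 (ic_map T) A = transfer (C N) (Y N.+1) (@sg N T) A.
Proof.
move=> FA; rewrite (transferE _ (stYi N.+1) (@Yinc N) (sg_def T) FA).
have [i hi eA] := trace_term N.+1 FA.
have [h1 h2] := tm_sub (orbit N) (id_p x N i); have [h3 h4] := Wo_sub N i.
have eA' : A `&` Y N.+1 = sum_sub (To N (id_p x N i)) (Wo N i).
  by rewrite eA /To -[orbit N.+1]/(ic_map (orbit N)) tm_succ //; exact: leqW.
have eAN : A `&` Y N = To N (id_p x N i).
  rewrite -[RHS](sum_capY h1 h2 h3 h4) -eA'.
  by apply/seteqP; split=> [v [Av Yv]|v [[]]//]; split=> //; split=> //; apply: Yinc.
have eCD : A `&` C N `&` Y N.+1 = Wo N i.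
  rewrite -[RHS](sum_capD h1 h2 h3 h4) -eA' DE.
  by apply/seteqP; split=> v; [move=> [[Av [_ hv]] Yv]|move=> [[Av Yv] [_ hv]]].
rewrite eCD (sgE _ FA eA) (sgE _ FA eAN); apply: tm_succ; exact: leqW.
Qed.

Let Phi N (T : FlI (ic_m c N) (@ic_comp _ _ c N)) : set (set V) :=
  iso_gflag b F (inV N) (Y N) (d N) (ic_m c N) (sval T).

Let Phi_inj N : injective (@Phi N).
Proof.
move=> T T' h; apply: sval_inj.
exact: (iso_gflag_flag_inj b_refl gF FP Fiso perpK (@bf N) (pY N) (hV N) (stY N) (tyY N)
  (term_flag T) (@flag_iso N T) (term_flag T') (@flag_iso N T') h).
Qed.

Let Phi_map N T : @Phi N.+1 (ic_map T) = @Phi N T.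
Proof.
rewrite /Phi /iso_gflag.
rewrite -(transfer_iso_gflag b_refl gF FP Fiso perpK (stY N) (stY N.+1) (@Yinc N) (sg_def T) (@sg_iso N T)).
apply: eq_deform_image; apply: (iso_extend_eq FP Fiso perpK) => A FA.
exact: sg_succ.
Qed.

Let component_Y N : component_data ty (ic_m c N) (@ic_comp _ _ c N) (last [set 0] (sval (orbit N))).
Proof. by apply: allowed_component_data; [apply: ic_compP|case: (svalP (orbit N)) => _ []]. Qed.

Let X m := witt_span o (id_e x) (id_e' x) (id_e0 x) m.
Let dX m := (m.*2 + o)%N.
Let stX m : iso_stage b F (X m) := witt_stage b_refl wb spF m.
Let tyX m : typed Fi (X m) (dX m) _ := witt_typed b_refl wb iF spF m.
Let pX m : presents (id_lin V) (id_lin V) (X m) (X m).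
Proof. by apply: presents_id; apply: subspace_span. Qed.
Let hX m : has_dim (X m) (dX m) := witt_span_dim b_refl wb m.
Let id_b (u v : V) : b (id_lin V u) (id_lin V v) = b u v. Proof. by []. Qed.

Let YinX N : exists m, Y N `<=` X m.
Proof.
have [|t [tE Yt]] := @fdim_spanning _ _ E (Y N) (fY N); first by rewrite bE.2.
have [m hm] := finite_basis_stage (fun n => witt_initial_inc (leqnSn n))
  (@witt_initial_exhaust _ _ o (id_e x) (id_e' x) (id_e0 x)) tE.
by exists m; apply: (subset_trans Yt); apply: span_mono => v; apply: hm.
Qed.

(** The levels of both sides are stages of F, and [isotropic_transfer_map] applies in
    both directions between them. *)
Theorem isotropic_case :
  ind_isomorphic (lim_FlI c) (GFlI ty b o F (id_e x) (id_e' x) (id_e0 x)).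
Proof.
apply: (@direct_limit_isomorphic K _ (@ic_map _ _ c) (GFlI ty b o F (id_e x) (id_e' x) (id_e0 x))
  (set (set V)) (fun H => sval H)
  Phi (fun m s => witt_gflag b o (id_e x) (id_e' x) (id_e0 x) F m (sval s))).
- exact: sval_inj.
- exact: Phi_inj.
- exact: (GFlI_inj b_refl wb iF spF).
- by move=> N; case: (ic_std c N) => -[].
- exact: Phi_map.
- exact: (GFlI_represents b_refl wb iF spF).
- exact: (GFlI_point b_refl wb iF spF).
- exact: (GFlI_covered b_refl wb iF spF).
- exact: (GFlI_step ty b_refl wb iF spF).
- move=> N; have [m YX] := YinX N; exists m.
  have [g mg hg] := isotropic_transfer_map b_refl gF FP Fiso perpK (@bf N) id_b (pY N) (pX m)
    (hV N) (hX m) (stY N) (stX m) (tyY N) (tyX m) YX (witt_bottom b_refl wb iF spF m)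
    (term_flag (orbit N)) (witt_flag_is_flag b_refl wb iF spF m)
    (@sg_orbit N) (@witt_flag_def _ _ _ _ _ _ _ _ b_refl wb iF spF m)
    (component_Y N) (witt_component_data ty b o (id_e x) (id_e' x) (id_e0 x) F m).
  by exists g.
move=> m; have [N XY] := tower_contains tw (ex_intro _ _ (hX m)); exists N.
have [g mg hg] := isotropic_transfer_map b_refl gF FP Fiso perpK id_b (@bf N) (pX m) (pY N)
  (hX m) (hV N) (stX m) (stY N) (tyX m) (tyY N) XY (bottomY N)
  (witt_flag_is_flag b_refl wb iF spF m) (term_flag (orbit N))
  (@witt_flag_def _ _ _ _ _ _ _ _ b_refl wb iF spF m) (@sg_orbit N)
  (witt_component_data ty b o (id_e x) (id_e' x) (id_e0 x) F m) (component_Y N).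
by exists g.
Qed.

End IsotropicCase.

(** * The isomorphisms *)

Theorem theorem5p3 (R : realType) :
  (forall (c : fl_chain (complex R)) (x : fl_choices c),
     ind_isomorphic (lim_Fl c) (GFl (fl_limit_flag x) (fd_e x)))
  /\
  (forall (c : iso_chain (complex R) Symmetric) (x : iso_choices c),
     ind_isomorphic (lim_FlI c)
       (GFlI Symmetric (id_form x) (ic_odd c) (iso_limit_flag x)
          (id_e x) (id_e' x) (id_e0 x)))
  /\
  (forall (c : iso_chain (complex R) Alternating) (x : iso_choices c),
     ind_isomorphic (lim_FlI c)
       (GFlI Alternating (id_form x) (ic_odd c) (iso_limit_flag x)
          (id_e x) (id_e' x) (id_e0 x))).
Proof. by split; [|split] => c x; [apply: linear_case|apply: isotropic_case|apply: isotropic_case]. Qed.
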